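(* Let $R$ be a rational function with $\deg R \geq 2$. Then the $C^*$-algebra $\mathcal{O}_R$ associated with $R$ is simple and purely infinite.
   Context: A rational function $R = P/Q$ ($P,Q$ relatively prime complex polynomials) is regarded as a map of the Riemann sphere $\hat{\mathbb{C}}$ to itself, and $\deg R = \max\{\deg P, \deg Q\}$. The Fatou set $F_R$ is the maximal open subset of $\hat{\mathbb{C}}$ on which the iterates $(R^n)_n$ are equicontinuous; the Julia set is $J_R = \hat{\mathbb{C}} \setminus F_R$. It satisfies $R(J_R) = J_R = R^{-1}(J_R)$ and is non-empty if $\deg R \ge 2$. The branch index $e(x) = e_R(x)$ at $x \in \hat{\mathbb{C}}$ is the integer $n\ge 1$ such that, in appropriate local charts, $R(z) = R(x) + c(z-x)^n + (\text{higher terms})$ with $c \neq 0$. Let $A = C(J_R)$, $\operatorname{graph} R|_{J_R} = \{(x,y) \in J_R\times J_R : y = R(x)\}$ and $X = C(\operatorname{graph} R|_{J_R})$. $X$ is a full Hilbert bimodule over $A$ with $(a\cdot f\cdot b)(x,y) = a(x)f(x,y)b(y)$ and right $A$-valued inner product $(f|g)_A(y) = \sum_{x \in R^{-1}(y)} e(x)\overline{f(x,y)}g(x,y)$; the left action is the faithful unital homomorphism $\phi : A \to L(X)$, $(\phi(a)f)(x,y)=a(x)f(x,y)$, where $L(X)$ denotes the adjointable operators and $K(X)\subset L(X)$ the closed span of the rank one operators $\theta_{\xi,\eta}(\zeta) = \xi(\eta|\zeta)_A$. $\mathcal{O}_R$ is the Cuntz-Pimsner algebra $\mathcal{O}_X$: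 with $I_X = \phi^{-1}(K(X))$, it is the universal $C^*$-algebra generated by $i(a)$ ($a \in A$, $i$ a $*$-homomorphism) and $S_\xi$ ($\xi \in X$, linear in $\xi$) satisfying $i(a)S_\xi = S_{\phi(a)\xi}$, $S_\xi i(a) = S_{\xi a}$, $S_\xi^* S_\eta = i((\xi|\eta)_A)$, and $i(a) = i_K(\phi(a))$ for $a \in I_X$, where $i_K : K(X)\to \mathcal{O}_X$ is the homomorphism with $i_K(\theta_{\xi,\eta}) = S_\xi S_\eta^*$. *)

(* Defs.v *)
From HB Require Import structures.
From mathcomp Require Import all_boot all_order all_algebra.
From mathcomp Require Import all_classical all_reals all_analysis.
From mathcomp Require Import complex.

Set Implicit Arguments.
Unset Strict Implicit.
Unset Printing Implicit Defensive.

Import Order.TTheory GRing.Theory Num.Theory.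
Import numFieldNormedType.Exports.

Local Open Scope classical_set_scope.
Local Open Scope ring_scope.

(* A C*-algebra over F, not assumed unital (so [1] and the ring structures of
   the library are not available).  Norms take their values in F itself, as
   usual in [normedModType F]. *)
HB.mixin Record isCStarAlgebra (F : numClosedFieldType) (A : Type)
    of CompleteNormedModule F A := {
  cmul : A -> A -> A ;
  cstar : A -> A ;
  cmulA : associative cmul ;
  cmulDl : forall x y z : A, cmul (x + y) z = cmul x z + cmul y z ;
  cmulDr : forall x y z : A, cmul x (y + z) = cmul x y + cmul x z ;
  cmulZl : forall (c : F) (x y : A), cmul (c *: x) y = c *: cmul x y ;
  cmulZr : forall (c : F) (x y : A), cmul x (c *: y) = c *: cmul x y ;
  cstarK : involutive cstar ;
  cstarD : forall x y : A, cstar (x + y) = cstar x + cstar y ;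
  cstarZ : forall (c : F) (x : A), cstar (c *: x) = c^* *: cstar x ;
  cstarM : forall x y : A, cstar (cmul x y) = cmul (cstar y) (cstar x) ;
  cnormM : forall x y : A, `|cmul x y| <= `|x| * `|y| ;
  cnorm_star : forall x : A, `|cmul (cstar x) x| = `|x| ^+ 2
}.

#[short(type = "cstarAlgType")]
HB.structure Definition CStarAlgebra (F : numClosedFieldType) :=
  { A of isCStarAlgebra F A & CompleteNormedModule F A }.

Section CStarAlgebraNotions.
Variables (F : numClosedFieldType) (A : cstarAlgType F).
Implicit Types (x y p : A) (D I H : set A).

Definition linear_subspace D :=
  D 0 /\ forall (c : F) x y, D x -> D y -> D (c *: x + y).

Definition closed_ideal I :=
  [/\ closed I, linear_subspace I &
      forall x y, I y -> I (cmul x y) /\ I (cmul y x)].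

Definition simple_cstar :=
  (exists x, x != 0) /\
  forall I, closed_ideal I -> I = [set 0] \/ I = setT.

Definition cstar_subalgebra D :=
  [/\ closed D, linear_subspace D,
      forall x y, D x -> D y -> D (cmul x y) &
      forall x, D x -> D (cstar x)].

Definition cpositive x := exists y, x = cmul (cstar y) y.

Definition cle x y := cpositive (y - x).

Definition hereditary D :=
  forall x y, cpositive x -> cle x y -> D y -> D x.

Definition projection p := cstar p = p /\ cmul p p = p.

(* Murray-von Neumann equivalent to a proper subprojection of itself *)
Definition infinite_projection p :=
  projection p /\
  exists v, [/\ cmul (cstar v) v = p,
                cle (cmul v (cstar v)) p &
                cmul v (cstar v) <> p].

Definition purely_infinite :=
  forall H, cstar_subalgebra H -> hereditary H -> H <> [set 0] ->
  exists2 p, H p & infinite_projection p.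

End CStarAlgebraNotions.

Section ContinuousFunctions.
Variables (T : topologicalType) (F : numClosedFieldType).
Local Notation CT := (continuousType T F).
Implicit Types f g : CT.

Lemma cts0 : continuous (fun _ : T => 0 : F).
Proof. by move=> x; exact: cvg_cst. Qed.

Lemma ctsN f : continuous (fun x : T => - f x).
Proof. by move=> x; apply: cvgN; exact: (@cts_fun _ _ f). Qed.

Lemma ctsD f g : continuous (fun x : T => f x + g x).
Proof. by move=> x; apply: cvgD; exact: cts_fun. Qed.

Lemma ctsM f g : continuous (fun x : T => f x * g x).
Proof. by move=> x; apply: cvgM; exact: cts_fun. Qed.

Lemma ctsZ (c : F) f : continuous (fun x : T => c * f x).
Proof. by move=> x; apply: cvgM; [exact: cvg_cst|exact: cts_fun]. Qed.

Lemma cts_conj f : continuous (fun x : T => (f x)^*).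
Proof.
move=> x; apply/cvgrPdist_lt => e e0.
have /cvgrPdist_lt/(_ e e0) := @cts_fun _ _ f x.
by apply: filterS => y; rewrite -rmorphB norm_conjC.
Qed.

Definition cf0 : CT := mkcts cts0.
Definition cfN f : CT := mkcts (@ctsN f).
Definition cfD f g : CT := mkcts (@ctsD f g).
Definition cfZ c f : CT := mkcts (@ctsZ c f).
Definition cfM f g : CT := mkcts (@ctsM f g).
Definition cfconj f : CT := mkcts (@cts_conj f).

Fact cfDA : associative cfD.
Proof. by move=> f g h; apply/continuousEP => x /=; exact: addrA. Qed.
Fact cfDC : commutative cfD.
Proof. by move=> f g; apply/continuousEP => x /=; exact: addrC. Qed.
Fact cf0D : left_id cf0 cfD.
Proof. by move=> f; apply/continuousEP => x /=; exact: add0r. Qed.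
Fact cfND : left_inverse cf0 cfN cfD.
Proof. by move=> f; apply/continuousEP => x /=; exact: addNr. Qed.

HB.instance Definition _ := GRing.isZmodule.Build CT cfDA cfDC cf0D cfND.

Fact cfZA a b f : cfZ a (cfZ b f) = cfZ (a * b) f.
Proof. by apply/continuousEP => x /=; exact: mulrA. Qed.
Fact cf1Z : left_id 1 cfZ.
Proof. by move=> f; apply/continuousEP => x /=; exact: mul1r. Qed.
Fact cfZDr : right_distributive cfZ +%R.
Proof. by move=> a f g; apply/continuousEP => x /=; exact: mulrDr. Qed.
Fact cfZDl f : {morph cfZ^~ f : a b / a + b}.
Proof. by move=> a b; apply/continuousEP => x /=; exact: mulrDl. Qed.

HB.instance Definition _ :=
  GRing.Zmodule_isLmodule.Build F CT cfZA cf1Z cfZDr cfZDl.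

(* [cts_of h] is h as an element of C(T); the value 0 for discontinuous h is
   junk. *)
Definition cts_of (h : T -> F) : CT :=
  if pselect (continuous h) is left hc then mkcts hc else cf0.

End ContinuousFunctions.

Section RationalDynamics.
Variable K : realType.

Definition Cplx : numClosedFieldType := K[i].

(* The Riemann sphere is C with a point [None] at infinity; stereographic
   projection onto the unit sphere of R^3 induces its topology and its
   uniform (chordal metric) structure. *)
Definition stereo (z : option Cplx) : K * K * K :=
  if z is Some w then
    let a := complex.Re w in
    let b := complex.Im w in
    let s := a ^+ 2 + b ^+ 2 in
    (2 * a / (1 + s), 2 * b / (1 + s), (s - 1) / (1 + s))
  else (0, 0, 1).

Definition sphere := initial_topology stereo.
HB.instance Definition _ := PseudoMetric.on sphere.

Variables P Q : {poly Cplx}.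

Definition rat_degree : nat := maxn (size P).-1 (size Q).-1.

(* The map of the sphere given by P / Q, for coprime P and Q; its value at
   infinity is read off the coefficients of degree [rat_degree]. *)
Definition rat_map (z : sphere) : sphere :=
  if z is Some w then
    if Q.[w] == 0 then None else Some (P.[w] / Q.[w])
  else
    if Q`_rat_degree == 0 then None
    else Some (P`_rat_degree / Q`_rat_degree).

(* Equicontinuity on U is a local property, so the union of all open sets
   with that property is the largest one. *)
Definition fatou_set : set sphere :=
  \bigcup_(U in [set U : set sphere | open U /\
     equicontinuous [set: nat] (fun n (z : U) => iter n rat_map (\val z))]) U.

Definition julia_set : set sphere := ~` fatou_set.

(* The standard chart centred at x: z - x, or 1/z when x is infinity.  Its
   values off the domain of the chart (which is a neighbourhood of x) are
   junk. *)
Definition chart (x z : sphere) : Cplx :=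
  match x, z with
  | Some a, Some w => w - a
  | None, Some w => w^-1
  | _, None => 0
  end.

Definition has_branch_index (x : sphere) (n : nat) : Prop :=
  (0 < n)%N /\
  exists2 c : Cplx, c != 0 & exists M : Cplx,
    \forall z \near x,
      `|chart (rat_map x) (rat_map z) - c * chart x z ^+ n|
        <= M * `|chart x z| ^+ n.+1.

Definition branch_index (x : sphere) : nat := xget 0%N (has_branch_index x).

Definition julia_graph : set (julia_set * julia_set) :=
  [set p | \val p.2 = rat_map (\val p.1)].

Definition gsrc (p : julia_graph) : julia_set := (\val p).1.
Definition gtgt (p : julia_graph) : julia_set := (\val p).2.

Lemma gsrc_continuous : continuous gsrc.
Proof.
move=> p; apply: (@continuous_comp _ _ _ (fun q : julia_graph => \val q) fst).
  exact: initial_continuous.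
exact: cvg_fst.
Qed.

Lemma gtgt_continuous : continuous gtgt.
Proof.
move=> p; apply: (@continuous_comp _ _ _ (fun q : julia_graph => \val q) snd).
  exact: initial_continuous.
exact: cvg_snd.
Qed.

Local Notation coefA := (continuousType julia_set Cplx).
Local Notation bimodX := (continuousType julia_graph Cplx).

Implicit Types (a b : coefA) (f g h : bimodX) (T : bimodX -> bimodX).

Definition lact a f : bimodX := cfM (a \o mkcts gsrc_continuous) f.
Definition ract f a : bimodX := cfM f (a \o mkcts gtgt_continuous).

(* The sum ranges over the points (x, y) of the graph with y fixed, i.e. over
   the finite set of x in the Julia set with R(x) = y; it is continuous in
   y because of the weights [branch_index]. *)
Definition inner f g : coefA :=
  cts_of (fun y : julia_set =>
    \sum_(p \in [set p | gtgt p = y])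
      ((branch_index (\val (gsrc p)))%:R * (f p)^* * g p)).

Definition supnorm a : K :=
  sup (range (fun y => complex.Re (`|a y| : Cplx))).

Definition module_norm f : K := Num.sqrt (supnorm (inner f f)).

Definition is_adjoint T T' := forall f g, inner (T f) g = inner f (T' g).

Definition adjointable T := exists T', is_adjoint T T'.

Definition theta f g : bimodX -> bimodX := fun h => ract f (inner g h).

Definition finite_rank T :=
  exists (n : nat) (c : 'I_n -> Cplx) (f g : 'I_n -> bimodX),
    T = (fun h => \sum_(k < n) c k *: theta (f k) (g k) h).

(* the closure, for the operator norm, of [finite_rank] in [adjointable] *)
Definition compact_op T :=
  adjointable T /\
  forall e : K, 0 < e ->
    exists2 T', finite_rank T' &
      forall f, module_norm (T f - T' f) <= e * module_norm f.

Definition covariance_ideal : set coefA := [set a | compact_op (lact a)].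

(* [iK] restricts to a *-homomorphism on K(X) with theta f g |-> S f (S g)^*;
   its values off K(X) are irrelevant. *)
Definition is_iK (B : cstarAlgType Cplx) (S : bimodX -> B)
    (iK : (bimodX -> bimodX) -> B) :=
  [/\ forall (c : Cplx) T T', compact_op T -> compact_op T' ->
        iK (fun f => c *: T f + T' f) = c *: iK T + iK T',
      forall T T', compact_op T -> compact_op T' ->
        iK (fun f => T (T' f)) = cmul (iK T) (iK T'),
      forall T T', compact_op T -> is_adjoint T T' ->
        iK T' = cstar (iK T) &
      forall f g, iK (theta f g) = cmul (S f) (cstar (S g))].

Record cuntz_pimsner_rep (B : cstarAlgType Cplx) := CuntzPimsnerRep {
  rep_i : {linear coefA -> B} ;
  rep_S : {linear bimodX -> B} ;
  rep_iM : forall a b, rep_i (cfM a b) = cmul (rep_i a) (rep_i b) ;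
  rep_iconj : forall a, rep_i (cfconj a) = cstar (rep_i a) ;
  rep_lact : forall a f, cmul (rep_i a) (rep_S f) = rep_S (lact a f) ;
  rep_ract : forall f a, cmul (rep_S f) (rep_i a) = rep_S (ract f a) ;
  rep_inner : forall f g,
    cmul (cstar (rep_S f)) (rep_S g) = rep_i (inner f g) ;
  rep_covariant : exists2 iK, is_iK rep_S iK &
    forall a, covariance_ideal a -> rep_i a = iK (lact a)
}.

Definition generating (B : cstarAlgType Cplx) (r : cuntz_pimsner_rep B) :=
  forall D : set B, cstar_subalgebra D ->
    (forall a, D (rep_i r a)) -> (forall f, D (rep_S r f)) -> D = setT.

Definition is_cuntz_pimsner_algebra (O : cstarAlgType Cplx) :=
  exists r : cuntz_pimsner_rep O,
    generating r /\
    forall (B : cstarAlgType Cplx) (r' : cuntz_pimsner_rep B),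
      exists psi : {linear O -> B},
        [/\ forall x y, psi (cmul x y) = cmul (psi x) (psi y),
            forall x, psi (cstar x) = cstar (psi x),
            forall a, psi (rep_i r a) = rep_i r' a &
            forall f, psi (rep_S r f) = rep_S r' f].

End RationalDynamics.

(* Main.v *)
(* Identify C(graph R) with C(J) through x |-> (x, R x) and put S = S_1.  Then
   S_f = i(f) S, S i(a) = i(a o R) S and S^* i(a) S = i(L a), where L is the
   transfer operator weighted by the branch index.  An element of
   i(A) + K(X) + ... + K(X^n) acts on functions on J, and its norm is the norm of
   this action: off the branch points covariance lowers n, and near a branch
   point one tests on the difference of two nearby preimages of one value.
   Averaging over the gauge action, a nonzero h is close to a combination of
   words i(a) S^p S^*q i(b) with a Fourier coefficient bounded away from 0.
   Compression by a bump near a non-periodic point kills the other coefficients,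
   and since every open set meeting J is mapped onto J by some iterate of R, the
   remaining function can be turned into 1: for every h != 0 there is z with
   z^* h^* h z = 1.  This gives simplicity and pure infiniteness.

   That iterates of open sets meeting J cover J is proved without Montel's
   theorem: if R^n avoids three separated moving targets near a point, the
   logarithms of the corresponding pairings with the homogeneous lift F^n are
   harmonic, two of the three normalized limits cannot drop below the Green
   function of F at once, so the Green function is harmonic there and the iterates
   are equicontinuous.

   Finally O_R is not zero because it acts on l^2(J), by multiplication operators
   and (S xi)(x) = sqrt(e(x)) xi(R x). *)

From HB Require Import structures.
From mathcomp Require Import all_boot all_order all_algebra finmap.
From mathcomp Require Import all_classical all_reals all_analysis.
From mathcomp Require Import complex ring lra zify cyclic separable cyclotomic.
Require Import Defs.

Set Implicit Arguments.
Unset Strict Implicit.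
Unset Printing Implicit Defensive.

Import Order.TTheory GRing.Theory Num.Theory.
Import numFieldNormedType.Exports.

Local Open Scope classical_set_scope.
Local Open Scope ring_scope.

(** * C*-algebras *)

(** Since [O] is known only through its universal property, norm estimates rest on two devices. The
    core is made to act on all functions on the fibres of [R^n], continuous or not, so that point
    masses are admissible test vectors. And an estimate with a wasteful constant is proved for all
    powers [2^k] of a self-adjoint element, after which taking roots removes the constant. A Fourier
    coefficient of an element of [O] is never formed. It is read off from approximating sums of
    words, and what is used is a lower bound that holds for arbitrarily good approximations;
    therefore the [z] that turns an approximation into 1 must be bounded in terms of that lower
    bound alone. On the dynamical side every compactness argument, from continuity of roots to the
    moving targets, is a limit along an ultrafilter. What makes such limits harmonic is that [d^-n]
    times the logarithm of a zero-free polynomial of degree at most [d^n] has power series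
    coefficients bounded independently of [n]. The records [dynamics] and [covrep] contain all that
    the two halves exchange. *)

Section KNorm.
Variables (K : realType) (V : normedZmodType (Cplx K)).
Implicit Types x y : V.

(* Norms take values in [Cplx K], whose order is partial; [nm] is the same
   norm read in K. *)
Definition nm x : K := complex.Re (`|x| : Cplx K).

Lemma nmE x : `|x| = (nm x)%:C%C :> Cplx K.
Proof. by rewrite /nm RRe_real ?ger0_real. Qed.

Lemma le_nm x (r : K) : (`|x| <= r%:C%C :> Cplx K) = (nm x <= r).
Proof. by rewrite nmE lecR. Qed.

Lemma lt_nm x (r : K) : (`|x| < r%:C%C :> Cplx K) = (nm x < r).
Proof. by rewrite nmE ltcR. Qed.

Lemma nm_ge0 x : 0 <= nm x.
Proof. by rewrite -lecR -nmE normr_ge0. Qed.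

Lemma nmD x y : nm (x + y) <= nm x + nm y.
Proof. by rewrite -lecR rmorphD /= -!nmE ler_normD. Qed.

Lemma nmN x : nm (- x) = nm x.
Proof. by rewrite /nm normrN. Qed.

Lemma nmBC x y : nm (x - y) = nm (y - x).
Proof. by rewrite -nmN opprB. Qed.

Lemma nmB x y : nm (x - y) <= nm x + nm y.
Proof. by rewrite -(nmN y); exact: nmD. Qed.

Lemma nm_dist x y z : nm (x - z) <= nm (x - y) + nm (y - z).
Proof. by apply: le_trans (nmD _ _); rewrite addrA subrK. Qed.

Lemma nm0 : nm 0 = 0.
Proof. by rewrite /nm normr0. Qed.

Lemma nm_eq0 x : (nm x == 0) = (x == 0).
Proof. by rewrite -(normr_eq0 x) nmE -(inj_eq (@complexI K)). Qed.

Lemma nm_gt0 x : (0 < nm x) = (x != 0).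
Proof. by rewrite lt_def nm_eq0 nm_ge0 andbT. Qed.

Lemma nm_eq (x y : V) : (forall e, 0 < e -> nm (x - y) <= e) -> x = y.
Proof.
move=> h; apply/eqP; rewrite -subr_eq0 -nm_eq0 eq_le nm_ge0 andbT.
by apply/ler_addgt0Pr => e e0; rewrite add0r; exact: h.
Qed.

Lemma nm_sum (I : Type) (r : seq I) (P : pred I) (f : I -> V) :
  nm (\sum_(i <- r | P i) f i) <= \sum_(i <- r | P i) nm (f i).
Proof.
elim/big_rec2: _ => [|i y1 y2 _ h]; first by rewrite nm0.
by apply: le_trans (nmD _ _) _; rewrite lerD2l.
Qed.

Lemma nm_ler_dist x y : nm x - nm y <= nm (x - y).
Proof. by rewrite lerBlDr; apply: le_trans (nmD _ _); rewrite subrK. Qed.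

End KNorm.

Section KNormC.
Variable K : realType.
Local Notation C := (Cplx K).
Implicit Types x y : C.

Lemma nmM x y : nm (x * y) = nm x * nm y.
Proof. by apply: (@complexI K); rewrite rmorphM /= -!nmE normrM. Qed.

Lemma nm1 : nm (1 : C) = 1.
Proof. by rewrite /nm normr1. Qed.

Lemma nmX x n : nm (x ^+ n) = nm x ^+ n.
Proof. by apply: (@complexI K); rewrite rmorphXn /= -!nmE normrX. Qed.

Lemma nmV x : nm x^-1 = (nm x)^-1.
Proof. by apply: (@complexI K); rewrite fmorphV /= -!nmE normfV. Qed.

Lemma nm_conj x : nm x^* = nm x.
Proof. by rewrite /nm norm_conjC. Qed.

Lemma nm_real (r : K) : nm (r%:C%C : C) = `|r|.
Proof. by rewrite /nm normc_def /= expr0n /= addr0 sqrtr_sqr. Qed.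

Lemma nm_nat n : nm (n%:R : C) = n%:R.
Proof.
rewrite -[n%:R in LHS](_ : n%:R%:C%C = _) ?nm_real ?ger0_norm //.
by rewrite rmorph_nat.
Qed.

Lemma nm_prod (I : Type) (r : seq I) (P : pred I) (f : I -> C) :
  nm (\prod_(i <- r | P i) f i) = \prod_(i <- r | P i) nm (f i).
Proof. by rewrite (big_morph _ nmM nm1). Qed.

Lemma conjM_nm x : x^* * x = ((nm x) ^+ 2)%:C%C.
Proof. by rewrite mulrC -normCK rmorphXn /= -nmE. Qed.

Lemma conj_real (r : K) : (r%:C%C : C)^* = r%:C%C.
Proof. exact: conjc_real. Qed.

Lemma nm_norm x : nm (`|x| : C) = nm x.
Proof. by rewrite /nm normr_id. Qed.

Lemma norm_le_nm x y : `|x| <= y -> nm x <= nm y.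
Proof.
move=> xy; have y0 : 0 <= y by apply: le_trans xy.
by rewrite -lecR -!nmE (ger0_norm y0).
Qed.

Lemma re_le_nm x : complex.Re x <= nm x.
Proof.
rewrite -lecR -nmE; apply: le_trans (normc_ge_Re x).
by rewrite lecR ler_norm.
Qed.

Lemma im_le_nm x : complex.Im x <= nm x.
Proof.
case: x => a b; rewrite /nm normc_def /=.
by rewrite (le_trans (ler_norm _)) // -sqrtr_sqr ler_wsqrtr // lerDr sqr_ge0.
Qed.

Lemma abs_re_le x : `|complex.Re x| <= nm x.
Proof.
rewrite ler_norml re_le_nm andbT lerNl -(nmN x).
by apply: le_trans (re_le_nm _); case: x.
Qed.

Lemma nm_sq x : nm x ^+ 2 = complex.Re x ^+ 2 + complex.Im x ^+ 2.
Proof.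
case: x => a b; rewrite /nm normc_def /= sqr_sqrtr //.
by rewrite addr_ge0 ?sqr_ge0.
Qed.

End KNormC.

Section KNormMod.
Variables (K : realType) (V : normedModType (Cplx K)).

Lemma nmZ (c : Cplx K) (x : V) : nm (c *: x) = nm c * nm x.
Proof. by apply: (@complexI K); rewrite rmorphM /= -!nmE normrZ. Qed.

Lemma nbhs_nm (x : V) (U : set V) :
  nbhs x U <-> exists2 e : K, 0 < e & forall y, nm (x - y) < e -> U y.
Proof.
split=> [/nbhs_normP[e /= e0 h]|[e e0 h]].
- exists (complex.Re e).
    by rewrite -ltcR RRe_real // gtr0_real.
  move=> y xy; apply: h => /=; rewrite /ball_ /= nmE.
  by rewrite -(RRe_real (gtr0_real e0)) ltcR.
- apply/nbhs_normP; exists e%:C%C => /=; first by rewrite ltcR.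
  by move=> y /=; rewrite nmE ltcR; exact: h.
Qed.

End KNormMod.

Lemma geometric_small (K : realType) (c q e : K) :
  0 <= q -> q < 1 -> 0 < e -> exists N, forall n, (N <= n)%N -> c * q ^+ n < e.
Proof.
move=> q0 q1 e0.
have : (fun n => c * q ^+ n) @ \oo --> c * 0.
  by apply: cvgM; [exact: cvg_cst | apply: cvg_expr; rewrite ger0_norm].
rewrite mulr0 => /cvgrPdist_lt/(_ e e0)[N _ h].
exists N => n nN; have := h n nN => /=; rewrite sub0r normrN.
exact: le_lt_trans (ler_norm _).
Qed.

Section Complete.
Variables (K : realType) (V : completeNormedModType (Cplx K)).

Lemma cauchy_nm (u : nat -> V) :
  (forall e : K, 0 < e ->
     exists N, forall n m, (N <= n)%N -> (N <= m)%N -> nm (u n - u m) < e) ->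
  exists l, forall e : K, 0 < e ->
    exists N, forall n, (N <= n)%N -> nm (l - u n) < e.
Proof.
move=> h.
have cu : cauchy (u @ \oo).
  apply/cauchy_ballP => e e0.
  have e0' : 0 < complex.Re e by rewrite -ltcR RRe_real // gtr0_real.
  have [N hN] := h _ e0'.
  pose A := [set y | exists2 n, (N <= n)%N & y = u n].
  have nA : nbhs (u @ \oo) A by exists N => // n nN; exists n.
  exists (A, A) => // -[x y] /= [[n nN ->] [m mN ->]].
  rewrite -ball_normE /= nmE -(RRe_real (gtr0_real e0)) ltcR.
  exact: hN.
have /cvg_ex[l lu] : cvg (u @ \oo) by exact: cauchy_cvg.
exists l => e e0; have /cvgrPdist_lt := lu.
move=> /(_ e%:C%C); rewrite ltcR => /(_ e0)[N _ hN].
by exists N => n nN; rewrite -lt_nm; exact: hN.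
Qed.

Lemma geometric_cvg (u : nat -> V) (c q : K) : 0 <= q -> q < 1 ->
  (forall n, nm (u n.+1 - u n) <= c * q ^+ n) ->
  exists l, forall e : K, 0 < e ->
    exists N, forall n, (N <= n)%N -> nm (l - u n) < e.
Proof.
move=> q0 q1 h.
have c0 : 0 <= c by have := h 0%N; rewrite expr0 mulr1; exact: le_trans (nm_ge0 _).
have h2 n k : nm (u (n + k)%N - u n) <= c / (1 - q) * q ^+ n.
  (* The exact geometric partial sum, rather than its bound, makes the induction on [k] close. *)
  have : nm (u (n + k)%N - u n) <= c / (1 - q) * (q ^+ n - q ^+ (n + k)).
    elim: k => [|k ih]; first by rewrite addn0 !subrr nm0 mulr0.
    apply: le_trans (nm_dist _ (u (n + k)%N) _) _.
    rewrite addnS; apply: le_trans (lerD (h _) ih) _.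
    by rewrite exprS le_eqVlt; apply/orP; left; apply/eqP; field; lra.
  move/le_trans; apply; rewrite ler_wpM2l ?divr_ge0 //; first lra.
  by rewrite gerBl exprn_ge0.
apply: cauchy_nm => e e0.
have [N hN] := @geometric_small K (c / (1 - q)) q (e / 2) q0 q1 ltac:(lra).
exists N => n m nN mN.
have hx k : (N <= k)%N -> nm (u k - u N) < e / 2.
  move=> Nk; have := h2 N (k - N)%N; rewrite subnKC // => /le_lt_trans; apply.
  exact: hN.
apply: le_lt_trans (nm_dist _ (u N) _) _.
by rewrite (nmBC (u N)); have := hx _ nN; have := hx _ mN; lra.
Qed.

End Complete.

Local Notation "x ** y" := (cmul x y) (at level 40, left associativity).
Local Notation "x ^s" := (cstar x) (at level 2, format "x ^s").

Section CStarBasics.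
Variables (K : realType) (O : cstarAlgType (Cplx K)).
Implicit Types x y z : O.

Lemma cmul0l x : 0 ** x = 0.
Proof. by rewrite -(scale0r 0) cmulZl !scale0r. Qed.
Lemma cmul0r x : x ** 0 = 0.
Proof. by rewrite -(scale0r 0) cmulZr !scale0r. Qed.
Lemma cmulNl x y : (- x) ** y = - (x ** y).
Proof. by rewrite -scaleN1r cmulZl scaleN1r. Qed.
Lemma cmulNr x y : x ** (- y) = - (x ** y).
Proof. by rewrite -scaleN1r cmulZr scaleN1r. Qed.
Lemma cmulBl x y z : (x - y) ** z = x ** z - y ** z.
Proof. by rewrite cmulDl cmulNl. Qed.
Lemma cmulBr x y z : z ** (x - y) = z ** x - z ** y.
Proof. by rewrite cmulDr cmulNr. Qed.
Lemma cstar0 : (0 : O)^s = 0.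
Proof. by rewrite -(scale0r 0) cstarZ rmorph0 !scale0r. Qed.
Lemma cstarN x : (- x)^s = - x^s.
Proof. by rewrite -scaleN1r cstarZ rmorphN1 scaleN1r. Qed.
Lemma cstarB x y : (x - y)^s = x^s - y^s.
Proof. by rewrite cstarD cstarN. Qed.

Lemma cmul_suml (I : Type) (r : seq I) (P : pred I) (f : I -> O) y :
  (\sum_(i <- r | P i) f i) ** y = \sum_(i <- r | P i) f i ** y.
Proof.
by rewrite (big_morph (fun x => x ** y) (fun a b => cmulDl a b y) (cmul0l y)).
Qed.
Lemma cmul_sumr (I : Type) (r : seq I) (P : pred I) (f : I -> O) y :
  y ** (\sum_(i <- r | P i) f i) = \sum_(i <- r | P i) y ** f i.
Proof. by rewrite (big_morph (cmul y) (fun a b => cmulDr y a b) (cmul0r y)). Qed.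
Lemma cstar_sum (I : Type) (r : seq I) (P : pred I) (f : I -> O) :
  (\sum_(i <- r | P i) f i)^s = \sum_(i <- r | P i) (f i)^s.
Proof. by rewrite (big_morph cstar (@cstarD _ O) cstar0). Qed.

Lemma nm_cmul x y : nm (x ** y) <= nm x * nm y.
Proof. by rewrite -le_nm rmorphM /= -!nmE cnormM. Qed.

Lemma nm_cstar2 x : nm (x^s ** x) = nm x ^+ 2.
Proof. by apply: (@complexI K); rewrite rmorphXn /= -!nmE cnorm_star. Qed.

Lemma nm_cstar x : nm x^s = nm x.
Proof.
suff h y : nm y <= nm y^s by apply/eqP; rewrite eq_le -{2}(cstarK x) !h.
have [->|y0] := eqVneq (nm y) 0; first exact: nm_ge0.
have yp : 0 < nm y by rewrite lt_def y0 nm_ge0.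
by rewrite -(ler_pM2r yp) -expr2 -nm_cstar2 nm_cmul.
Qed.

(** The C*-identity makes squaring exact on self-adjoint elements. Together with [pow_trick] this
    does the work of the spectral radius formula. *)
Lemma nm_sa2 x n : x^s = x -> nm (iter n (fun y => y ** y) x) = nm x ^+ (2 ^ n).
Proof.
move=> sx; have hs k : (iter k (fun y => y ** y) x)^s = iter k (fun y => y ** y) x.
  by elim: k => //= k ih; rewrite cstarM ih.
elim: n => [|n ih]; first by rewrite expr1.
by rewrite /= -{1}(hs n) nm_cstar2 ih expnSr exprM.
Qed.

End CStarBasics.

Section Unital.
Variables (K : realType) (O : cstarAlgType (Cplx K)) (e : O).
Hypotheses (e1l : forall x : O, e ** x = x) (e1r : forall x : O, x ** e = x).
Implicit Types x y z : O.

Lemma cstar_unit : e^s = e.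
Proof. by rewrite -[LHS]e1l -{1}(cstarK e) -cstarM e1l cstarK. Qed.

(** Only an upper bound: the zero algebra is not excluded at this point. *)
Lemma nm_unit : nm e <= 1.
Proof.
have h : nm e ^+ 2 = nm e by rewrite -nm_cstar2 cstar_unit e1l.
have := nm_ge0 e; nra.
Qed.

Lemma nm_isometry x : x^s ** x = e -> nm x <= 1.
Proof.
by move=> h; rewrite -(@ler_pXn2r _ 2) ?nnegrE ?nm_ge0 // -nm_cstar2 h expr1n nm_unit.
Qed.

(** The Neumann series, summed by the recursion [u_{n+1} = e + s u_n], whose increments have norm at
    most [|s|^{n+1}]. *)
Lemma neumann s : nm s < 1 -> exists v, v ** (e - s) = e /\ (e - s) ** v = e.
Proof.
move=> s1; pose u n := iter n (fun v => e + s ** v) e.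
have comm n : u n ** s = s ** u n.
  by elim: n => [|n ih]; rewrite /= ?e1l ?e1r // cmulDl cmulDr e1l e1r -cmulA ih.
have [] := @geometric_cvg K O u (nm s) (nm s) (nm_ge0 s) s1.
  elim=> [|n ih]; first by rewrite expr0 mulr1 /= addrC addKr e1r.
  rewrite /= opprD addrACA subrr add0r -cmulBr.
  apply: le_trans (nm_cmul _ _) _; rewrite exprS.
  by rewrite mulrA [_ * nm s]mulrC -mulrA ler_wpM2l ?nm_ge0.
move=> v hv; exists v; split; apply: nm_eq => d d0.
- have [N hN] := hv (d / 4) ltac:(lra).
  have -> : v ** (e - s) - e = (v - u N) ** (e - s) + (u N - u N.+1).
    by rewrite /= cmulBl (cmulBr _ _ (u N)) e1r comm opprB opprD !addrA subrK addrAC addrK.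
  have h1 := hN N (leqnn _); have h2 := hN N.+1 (leqnSn _).
  apply: le_trans (nmD _ _) _.
  have h3 : nm ((v - u N) ** (e - s)) <= nm (v - u N) * 2.
    apply: le_trans (nm_cmul _ _) _; rewrite ler_wpM2l ?nm_ge0 //.
    by apply: le_trans (nmB _ _) _; have := nm_unit; lra.
  have := nm_dist (u N) v (u N.+1); rewrite (nmBC (u N) v); lra.
- have [N hN] := hv (d / 4) ltac:(lra).
  have -> : (e - s) ** v - e = (e - s) ** (v - u N) + (u N - u N.+1).
    by rewrite /= cmulBr (cmulBl _ _ (u N)) e1l opprB opprD !addrA subrK addrAC addrK.
  have h1 := hN N (leqnn _); have h2 := hN N.+1 (leqnSn _).
  apply: le_trans (nmD _ _) _.
  have h3 : nm ((e - s) ** (v - u N)) <= 2 * nm (v - u N).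
    apply: le_trans (nm_cmul _ _) _; rewrite ler_wpM2r ?nm_ge0 //.
    by apply: le_trans (nmB _ _) _; have := nm_unit; lra.
  have := nm_dist (u N) v (u N.+1); rewrite (nmBC (u N) v); lra.
Qed.

(** The equation [(e - s)^2 = e - t] is the fixed point equation [s = (t + s^2) / 2]. The limit of
    the iteration from 0 inherits self-adjointness and commutes with whatever commutes with [t]. *)
Lemma sqrt_unit_sub t : t^s = t -> nm t < 1 ->
  exists s, [/\ s^s = s, nm s < 1, (e - s) ** (e - s) = e - t &
    forall x, x ** t = t ** x -> x ** s = s ** x].
Proof.
move=> st t1; pose f s := 2^-1 *: (t + s ** s); pose u n := iter n f 0.
have [r [r0 r1 hr]] : exists r : K, [/\ 0 <= r, r < 1 & nm t + r ^+ 2 <= 2 * r].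
  (* The smaller root of [r^2 - 2 r + |t| = 0]: the ball of radius [r < 1] is invariant under [f],
     and [f] is [r]-Lipschitz on it. *)
  exists (1 - Num.sqrt (1 - nm t)).
  have h0 := sqrtr_ge0 (1 - nm t).
  have h1 := @sqr_sqrtr _ (1 - nm t) ltac:(lra).
  have t0 := nm_ge0 t; have hp : 0 < Num.sqrt (1 - nm t) by rewrite sqrtr_gt0; lra.
  split; [nra | lra | nra].
have n2 : nm (2^-1 : Cplx K) = 2^-1 by rewrite nmV nm_nat.
have ur n : nm (u n) <= r.
  elim: n => [|n ih] /=; first by rewrite nm0.
  rewrite nmZ n2; have := nmD t (u n ** u n); have := nm_cmul (u n) (u n).
  have := nm_ge0 (u n); rewrite -/(u n); nra.
have step x y : nm x <= r -> nm y <= r -> nm (f x - f y) <= r * nm (x - y).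
  move=> xr yr; rewrite /f -scalerBr opprD addrACA subrr add0r nmZ n2.
  have -> : x ** x - y ** y = x ** (x - y) + (x - y) ** y.
    by rewrite cmulBr cmulBl addrA subrK.
  have := nmD (x ** (x - y)) ((x - y) ** y).
  have := nm_cmul x (x - y); have := nm_cmul (x - y) y.
  have := nm_ge0 (x - y); nra.
have [] := @geometric_cvg K O u (nm (u 1%N)) r r0 r1.
  elim=> [|n ih]; first by rewrite /= subr0 expr0 mulr1.
  apply: le_trans (step (u n.+1) (u n) (ur _) (ur _)) _.
  by rewrite exprS mulrCA ler_wpM2l.
move=> s hs.
have sr : nm s <= r.
  apply/ler_addgt0Pr => d d0; have [N hN] := hs d d0.
  have := nm_ler_dist s (u N); have := hN N (leqnn _); have := ur N; lra.
have fs : f s = s.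
  apply: nm_eq => d d0; have [N hN] := hs (d / 2) ltac:(lra).
  have h1 := hN N (leqnn _); have h2 := hN N.+1 (leqnSn _).
  have := nm_dist (f s) (u N.+1) s; have := step s (u N) sr (ur N).
  rewrite (nmBC (u N.+1)) -/(f (u N)) -[f (u N)]/(u N.+1).
  have := nm_ge0 (s - u N); nra.
exists s; split.
- apply: nm_eq => d d0; have [N hN] := hs (d / 2) ltac:(lra).
  have su n : (u n)^s = u n.
    elim: n => [|n ih]; first by rewrite cstar0.
    by rewrite /= cstarZ cstarD cstarM st ih fmorphV rmorph_nat.
  have := nm_dist s^s (u N) s; rewrite -{1}(su N) -cstarB nm_cstar (nmBC (u N)).
  have := hN N (leqnn _); lra.
- lra.
- have -> : t = 2 *: s - s ** s.
    by rewrite -{1}fs /f scalerA divff ?pnatr_eq0 // scale1r addrK.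
  rewrite cmulBl !cmulBr e1l e1r e1l scaler_nat mulr2n !opprB !opprD.
  by rewrite -addrA; congr (_ + _); rewrite addrCA.
- move=> x xt; apply: nm_eq => d d0.
  have p0 : 0 < nm x + 1 by have := nm_ge0 x; lra.
  have [N hN] := hs (d / (2 * (nm x + 1))) ltac:(by rewrite divr_gt0 // mulr_gt0).
  have xu n : x ** u n = u n ** x.
    elim: n => [|n ih]; first by rewrite cmul0l cmul0r.
    by rewrite /= cmulZl cmulZr cmulDl cmulDr xt cmulA ih -cmulA ih cmulA.
  have -> : x ** s - s ** x = x ** (s - u N) - (s - u N) ** x.
    by rewrite cmulBr cmulBl opprB xu addrA subrK.
  have := nmB (x ** (s - u N)) ((s - u N) ** x).
  have := nm_cmul x (s - u N); have := nm_cmul (s - u N) x.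
  have := hN N (leqnn _); rewrite ltr_pdivlMr; last by rewrite mulr_gt0.
  have := nm_ge0 (s - u N); nra.
Qed.

End Unital.

(** * Homomorphisms are contractive *)

Section Hom.
Variables (K : realType) (O B : cstarAlgType (Cplx K)) (e : O).
Hypotheses (e1l : forall x : O, e ** x = x) (e1r : forall x : O, x ** e = x).
Variable psi : O -> B.
Hypotheses (psiD : forall x y, psi (x + y) = psi x + psi y)
  (psiZ : forall c x, psi (c *: x) = c *: psi x)
  (psiM : forall x y, psi (x ** y) = psi x ** psi y)
  (psis : forall x, psi x^s = (psi x)^s).

(* x = Re(u) for the unitary u = x + i sqrt(1 - x^2). *)
Lemma hom_contractive_sa x : x^s = x -> nm x < 1 -> nm (psi x) <= 1.
Proof.
move=> sx x1.
have [] := @sqrt_unit_sub K O e e1l e1r (x ** x).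
- by rewrite cstarM sx.
- by rewrite -{1}sx nm_cstar2; have := nm_ge0 x; nra.
move=> s [ss s1 hs cs]; have xs : x ** s = s ** x by apply: cs; rewrite cmulA.
pose y := e - s; have sy : y^s = y by rewrite cstarB ss (cstar_unit e1l).
have xy : x ** y = y ** x by rewrite cmulBr cmulBl e1l e1r xs.
have ii : ('i : Cplx K) * 'i = -1 by rewrite -expr2 sqrCi.
have hu (w : Cplx K) : w * w = -1 -> w^* = - w ->
    (x + w *: y)^s ** (x + w *: y) = e.
  move=> ww wc; rewrite cstarD cstarZ sx sy wc cmulDl !cmulDr !(cmulZl, cmulZr).
  rewrite hs xy scalerA mulNr ww opprK scale1r scaleNr addrA addrAC.
  by rewrite addrAC addrK addrC subrK.
have pe : nm (psi e) <= 1.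
  have h : nm (psi e) ^+ 2 = nm (psi e).
    by rewrite -nm_cstar2 -psis -psiM (cstar_unit e1l) e1l.
  have := nm_ge0 (psi e); nra.
have hp (w : Cplx K) : w * w = -1 -> w^* = - w -> nm (psi (x + w *: y)) <= 1.
  move=> ww wc; rewrite -(@ler_pXn2r _ 2) ?nnegrE ?nm_ge0 // -nm_cstar2.
  by rewrite -psis -psiM hu // expr1n.
have h1 := hp 'i ii (conjCi _).
have h2 := hp (- 'i) ltac:(by rewrite mulrNN) ltac:(by rewrite rmorphN /= [X in - X](conjCi (Cplx K))).
have -> : psi x = 2^-1 *: (psi (x + 'i *: y) + psi (x + (- 'i) *: y)).
  rewrite -psiD addrACA scaleNr subrr addr0.
  rewrite (_ : x + x = 2 *: x); last by rewrite scaler_nat mulr2n.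
  rewrite psiZ scalerA.
  by rewrite mulVf ?pnatr_eq0 // scale1r.
rewrite nmZ nmV nm_nat; have := nmD (psi (x + 'i *: y)) (psi (x + (- 'i) *: y)); lra.
Qed.

(** The universal property produces homomorphisms with no continuity attached. Contractivity is
    automatic, and it is what makes averages over the gauge action norm-decreasing. *)
Lemma hom_contractive x : nm (psi x) <= nm x.
Proof.
have sa y : y^s = y -> nm (psi y) <= nm y.
  move=> sy; apply/ler_addgt0Pr => d d0.
  have p0 : 0 < nm y + d by have := nm_ge0 y; lra.
  pose c : Cplx K := ((nm y + d)^-1)%:C%C.
  have nc : nm c = (nm y + d)^-1 by rewrite nm_real ger0_norm // invr_ge0 ltW.
  have := @hom_contractive_sa (c *: y); rewrite cstarZ sy nmZ nc psiZ nmZ nc.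
  rewrite (_ : c^* = c); last by rewrite /c; exact: conjc_real.
  rewrite [_ * nm y]mulrC ltr_pdivrMr // mul1r [_ * nm _]mulrC ler_pdivrMr // mul1r.
  apply => //; lra.
rewrite -(@ler_pXn2r _ 2) ?nnegrE ?nm_ge0 // -!nm_cstar2 -psis -psiM.
by apply: sa; rewrite cstarM cstarK.
Qed.

End Hom.

(** * Roots of unity and orthogonality of characters *)

Section RootsOfUnity.
Variable K : realType.
Local Notation C := (Cplx K).

Lemma prim_root_exists N : (0 < N)%N -> exists w : C, N.-primitive_root w.
Proof.
move=> N0; have [rs hrs] := closed_field_poly_normal ('X^N - 1 : {poly C}).
have pE : 'X^N - 1 = \prod_(z <- rs) ('X - z%:P) :> {poly C}.
  by rewrite hrs (monicP (monic_Xn_sub_1 _ N0)) scale1r.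
have sz : size rs = N by have := size_Xn_sub_1 C N0; rewrite pE size_prod_XsubC => -[].
have urs : uniq rs.
  by rewrite -separable_prod_XsubC -pE separable_Xn_sub_1 // pnatr_eq0 -lt0n.
have ars : all N.-unity_root rs.
  by apply/allP => z zrs; rewrite /root_of_unity pE root_prod_XsubC.
have := @has_prim_root C N rs N0 ars urs; rewrite sz => /(_ (leqnn N)) /hasP[w _ pw].
by exists w.
Qed.

Lemma prim_norm N (w : C) : N.-primitive_root w -> `|w| = 1.
Proof.
move=> h; apply/eqP; rewrite -(pexpr_eq1 (prim_order_gt0 h)) //.
by rewrite -normrX (prim_expr_order h) normr1.
Qed.

(** The condition on [k] rules out the nonzero multiples of [N], at which the sum would be [N] as
    well. *)
Lemma sum_prim N (w : C) (k : int) : N.-primitive_root w -> (`|k| < N)%N ->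
  \sum_(t < N) (w ^ k) ^+ t = if k == 0 then N%:R else 0.
Proof.
move=> pw kN; case: eqP => [->|/eqP k0].
  by rewrite expr0z; under eq_bigr do rewrite expr1n; rewrite sumr_const card_ord.
have w0 : w != 0 by rewrite -normr_eq0 (prim_norm pw) oner_eq0.
have wk : w ^ k != 1.
  apply/negP => /eqP wk1; have : w ^+ `|k| = 1.
    have [->//|wn] : w ^+ `|k| = w ^ k \/ w ^+ `|k| = (w ^ k)^-1.
      by case: k {kN k0 wk1} => n; [left | right; rewrite NegzE -exprnN invrK].
    by rewrite wn wk1 invr1.
  move/eqP; rewrite -(prim_order_dvd pw) gtnNdvd // absz_gt0 //.
have h : (w ^ k - 1) * \sum_(t < N) (w ^ k) ^+ t = 0.
  rewrite -subrX1 exprnP exprzAC -exprnP (prim_expr_order pw) exp1rz.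
  exact: subrr.
by move/eqP: h; rewrite mulf_eq0 subr_eq0 (negbTE wk) => /eqP.
Qed.

End RootsOfUnity.

(** * The covariance relations *)

(** The coefficient ring is left open because the operator is applied both to complex functions and
    to real ones, the latter being squares of moduli. *)
Definition tr (T : eqType) (fib : T -> seq T) (e : T -> nat) {F : pzRingType}
    (g : T -> F) (y : T) : F :=
  \sum_(x <- fib y) (e x)%:R * g x.

Section Transfer.
Variables (T : eqType) (R : T -> T) (fib : T -> seq T) (e : T -> nat).
Hypothesis mem_fib : forall x y, (x \in fib y) = (R x == y).
Variable F : pzRingType.
Implicit Types (g h : T -> F) (y : T).
Local Notation tr := (tr fib e).

Lemma tr_ext g h : (forall x, g x = h x) -> tr g =1 tr h.
Proof. by move=> gh y; apply: eq_bigr => x _; rewrite gh. Qed.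

Lemma tr_local g h y : (forall x, R x = y -> g x = h x) -> tr g y = tr h y.
Proof.
move=> gh; apply: eq_big_seq => x; rewrite mem_fib => /eqP xy.
by rewrite gh.
Qed.

Lemma iter_tr_local n g h y : (forall x, iter n R x = y -> g x = h x) ->
  iter n tr g y = iter n tr h y.
Proof.
elim: n g h y => [|n ih] g h y gh; first by rewrite /= gh.
rewrite /= ; apply: tr_local => x xy; apply: ih => z zx.
by apply: gh; rewrite /= zx.
Qed.

Lemma iter_tr_ext n g h : (forall x, g x = h x) -> iter n tr g =1 iter n tr h.
Proof. by elim: n => //= n ih gh y; apply: tr_ext => x; exact: ih. Qed.

Lemma trD g h y : tr (fun x => g x + h x) y = tr g y + tr h y.
Proof. by rewrite /tr -big_split; apply: eq_bigr => x _; rewrite mulrDr. Qed.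

Lemma iter_trD n g h y :
  iter n tr (fun x => g x + h x) y = iter n tr g y + iter n tr h y.
Proof.
elim: n y => //= n ih y; rewrite -trD; apply: tr_ext => x; exact: ih.
Qed.

(** [h (iter n R x)] is constant on the fibre over [y] and leaves the sum. For functions this is the
    relation between [S^n], its adjoint and composition with [R^n]. *)
Lemma tr_al n g h y : iter n tr (fun x => h (iter n R x) * g x) y = h y * iter n tr g y.
Proof.
elim: n g h y => [|n ih] g h y //; rewrite [in LHS]/= [in RHS]/=.
have -> : tr (iter n tr (fun x => h (iter n.+1 R x) * g x)) y =
    tr (fun x => h (R x) * iter n tr g x) y.
  by apply: tr_ext => x; rewrite -(ih g (h \o R)).
rewrite /tr mulr_sumr; apply: eq_big_seq => x; rewrite mem_fib => /eqP ->.
by rewrite mulrA -(commr_nat (h y)) -mulrA.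
Qed.

End Transfer.

(* What the C*-algebraic argument uses of a rational function on its Julia set;
   [bri] is the branch index and [tr fib bri] the transfer operator. *)
Record dynamics (K : realType) (T : topologicalType) := Dynamics {
  dmap : T -> T ;
  dmap_cts : continuous dmap ;
  fib : T -> seq T ;
  fib_uniq : forall y, uniq (fib y) ;
  mem_fib : forall x y, (x \in fib y) = (dmap x == y) ;
  bri : T -> nat ;
  bri_gt0 : forall x, (0 < bri x)%N ;
  deg : nat ;
  deg_ge2 : (2 <= deg)%N ;
  sum_bri : forall y, (\sum_(x <- fib y) bri x)%N = deg ;
  tr_cts : forall a : continuousType T (Cplx K),
    continuous (tr fib bri (a : T -> Cplx K)) ;
  T_haus : hausdorff_space T ;
  T_inh : T ;
  cts_bdd : forall a : continuousType T (Cplx K),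
    exists M : K, forall x, nm (a x) <= M ;
  dyn_bump : forall (x : T) (U : set T), nbhs x U -> exists v : continuousType T (Cplx K),
    [/\ forall z, 0 <= v z <= 1, forall z, ~ U z -> v z = 0 &
        \forall z \near x, v z = 1] ;
  crit : seq T ;
  critP : forall x, bri x != 1%N -> x \in crit ;
  crit_pair : forall (x : T) (U : set T), bri x != 1%N -> nbhs x U ->
    exists x1 x2, [/\ U x1, U x2, x1 != x2, dmap x1 = dmap x2 &
      bri x1 = 1%N /\ bri x2 = 1%N] ;
  dmap_ninj : exists x1 x2, x1 != x2 /\ dmap x1 = dmap x2 ;
  dmap_exact : forall (x : T) (U : set T), nbhs x U ->
    exists n, forall y, exists2 z, U z & iter n dmap z = y
}.

Arguments tr_cts {K T} d a.

(** * Continuous functions, composition with [R] and the transfer operator *)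

Section CA.
Variables (K : realType) (T : topologicalType).
Local Notation A := (continuousType T (Cplx K)).

Definition cf1 : A := mkcts (fun x => @cst_continuous T (Cplx K) 1 x).

Lemma ctsP (f : T -> Cplx K) : continuous f <->
  forall x (d : K), 0 < d -> \forall y \near x, nm (f x - f y) < d.
Proof.
split=> [h x d d0|h x].
- have /cvgrPdist_lt/(_ d%:C%C) := h x; rewrite ltcR => /(_ d0).
  by apply: filterS => y; rewrite lt_nm.
- apply/cvgrPdist_lt => d d0.
  have dR : d = (complex.Re d)%:C%C by rewrite RRe_real // gtr0_real.
  rewrite dR ltcR in d0; have := h x _ d0.
  by apply: filterS => y; rewrite dR lt_nm.
Qed.

Lemma nm_cts (a : A) : continuous (fun x => nm (a x)).
Proof.
move=> x; apply/cvgrPdist_lt => d d0.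
have /ctsP/(_ x d d0) := @cts_fun _ _ a.
apply: filterS => y; apply: le_lt_trans; rewrite ler_norml.
by rewrite nm_ler_dist andbT lerNl opprB nmBC nm_ler_dist.
Qed.

Lemma rc_cts (h : T -> K) : continuous h -> continuous (fun x => (h x)%:C%C : Cplx K).
Proof.
move=> hc; apply/ctsP => x d d0; have /cvgrPdist_lt/(_ d d0) := hc x.
by apply: filterS => y; rewrite -rmorphB nm_real.
Qed.

Definition rcf (h : T -> K) (hc : continuous h) : A := mkcts (rc_cts hc).

Lemma rcfE h (hc : continuous h) x : rcf hc x = (h x)%:C%C. Proof. by []. Qed.

Lemma cf1E x : cf1 x = 1. Proof. by []. Qed.
Lemma cfME (a b : A) x : cfM a b x = a x * b x. Proof. by []. Qed.
Lemma cfDE (a b : A) x : (a + b) x = a x + b x. Proof. by []. Qed.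
Lemma cfZE (c : Cplx K) (a : A) x : (c *: a) x = c * a x. Proof. by []. Qed.
Lemma cfconjE (a : A) x : cfconj a x = (a x)^*. Proof. by []. Qed.

Variable D : dynamics K T.

Definition al (a : A) : A := a \o mkcts (@dmap_cts K T D).
Definition trA (a : A) : A := mkcts (tr_cts D a).

Lemma alE a x : al a x = a (dmap D x).
Proof. by []. Qed.

Lemma trAE a x : trA a x = tr (fib D) (bri D) a x.
Proof. by []. Qed.

Definition cfE := (cf1E, cfME, cfDE, cfZE, cfconjE, alE, trAE).

End CA.

(* The relations of the Cuntz-Pimsner algebra in terms of S = S_1, using
   S_f = i(f) S; [ci_cov] is covariance for functions vanishing near the branch
   points, and a sum over p of i(p.1) S S^* i(p.2) is a finite rank operator. *)
Record covrep (K : realType) (T : topologicalType) (D : dynamics K T)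
    (O : cstarAlgType (Cplx K)) := CovRep {
  ci : {linear continuousType T (Cplx K) -> O} ;
  cS : O ;
  ciM : forall a b, ci (cfM a b) = ci a ** ci b ;
  ci_conj : forall a, ci (cfconj a) = (ci a)^s ;
  ci1_S : ci (cf1 K T) ** cS = cS ;
  cS_ci : forall a, cS ** ci a = ci (al D a) ** cS ;
  cS_tr : forall a, cS^s ** ci a ** cS = ci (trA D a) ;
  ci_cov : forall a : continuousType T (Cplx K),
    (forall x : T, bri D x != 1%N -> \forall z \near x, a z = 0) ->
    exists s : seq (continuousType T (Cplx K) * continuousType T (Cplx K)),
      ci a = \sum_(p <- s) ci p.1 ** cS ** cS^s ** ci p.2 /\
      forall (xi : T -> Cplx K) x, a x * xi x =
        \sum_(p <- s) p.1 x *
          tr (fib D) (bri D) (fun z => p.2 z * xi z) (dmap D x) ;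
  ci_gen : forall E : set O, cstar_subalgebra E ->
    (forall a, E (ci a)) -> E cS -> E = setT ;
  ci_gauge : forall w : Cplx K, `|w| = 1 -> exists g : {linear O -> O},
    [/\ forall x y, g (x ** y) = g x ** g y, forall x, g x^s = (g x)^s,
        forall a, g (ci a) = ci a & g cS = w *: cS] ;
  ci_neq0 : exists x : O, x != 0
}.

(** * The core and its action on functions *)

Section Core.
Variables (K : realType) (T : topologicalType) (D : dynamics K T).
Variables (O : cstarAlgType (Cplx K)) (r : covrep D O).
Local Notation C := (Cplx K).
Local Notation A := (continuousType T C).
Local Notation i := (ci r).
Local Notation S := (cS r).
Local Notation R := (dmap D).
Local Notation e := (bri D).
Local Notation Fn := (T -> C).
Local Notation L := (tr (fib D) e).
Local Notation one := (i (cf1 K T)).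
Implicit Types (a f g : A) (x y z : T) (xi eta : Fn) (Th : Fn -> Fn).

Lemma ci_ext a (b : A) : (forall x, a x = b x) -> i a = i b.
Proof. by move=> h; congr (i _); apply/continuousEP. Qed.

Lemma one_S : S ** one = S.
Proof. by rewrite cS_ci -[in RHS]ci1_S; congr (_ ** _); apply: ci_ext. Qed.

Lemma cS_one : S^s ** one = S^s.
Proof.
rewrite -[in RHS]ci1_S cstarM -ci_conj; congr (_ ** _); apply: ci_ext => x.
by rewrite !cfE rmorph1.
Qed.

(** The elements fixed by [one] on both sides form a C*-subalgebra containing the generators. *)
Lemma unit_l (x0 : O) : one ** x0 = x0.
Proof.
pose E := (fun x : O => one ** x = x /\ x ** one = x).
suff ET : E = setT by have [] : E x0 by rewrite ET.
have c1 : one^s = one by rewrite -ci_conj; apply: ci_ext => x; rewrite !cfE rmorph1.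
apply: (@ci_gen _ _ _ _ r); last 2 first.
- by move=> a; split; rewrite -ciM; apply: ci_ext => x; rewrite !cfE (mul1r, mulr1).
- by split; [exact: ci1_S | exact: one_S].
have n1 : 0 < nm one + 1 by have := nm_ge0 one; lra.
split.
- move=> x cx.
  have ap : forall d : K, 0 < d -> exists2 y, (one ** y = y /\ y ** one = y) & nm (x - y) < d.
    move=> d d0; have [|y [Dy xy]] := cx [set y | nm (x - y) < d].
      by apply/nbhs_nm; exists d.
    by exists y.
  split; apply: nm_eq => d d0;
    have [y [y1 y2] xy] := ap (d / (nm one + 1)) ltac:(by rewrite divr_gt0).
  + have -> : one ** x - x = one ** (x - y) - (x - y).
      by rewrite cmulBr y1 opprB addrA subrK.
    apply: le_trans (nmB _ _) _; have := nm_cmul one (x - y).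
    move: xy; rewrite ltr_pdivlMr // ; have := nm_ge0 (x - y); nra.
  + have -> : x ** one - x = (x - y) ** one - (x - y).
      by rewrite cmulBl y2 opprB addrA subrK.
    apply: le_trans (nmB _ _) _; have := nm_cmul (x - y) one.
    move: xy; rewrite ltr_pdivlMr // ; have := nm_ge0 (x - y); nra.
- split; first by rewrite /E cmul0l cmul0r.
  move=> c x y [x1 x2] [y1 y2].
  by rewrite /E cmulDl cmulDr cmulZl cmulZr x1 x2 y1 y2.
- by move=> x y [x1 x2] [y1 y2]; split; [rewrite cmulA x1 | rewrite -cmulA y2].
- move=> x [x1 x2]; split; first by rewrite -{1}c1 -cstarM x2.
  by rewrite -{1}c1 -cstarM x1.
Qed.

Lemma one_star : one^s = one.
Proof. exact: cstar_unit unit_l. Qed.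

Lemma unit_r (x0 : O) : x0 ** one = x0.
Proof. by rewrite -[LHS]cstarK cstarM one_star unit_l cstarK. Qed.

Lemma SsS : S^s ** S = (deg D)%:R *: one.
Proof.
rewrite -[X in X ** S]cS_one cS_tr -linearZ; apply: ci_ext => x; rewrite !cfE.
rewrite /tr mulr1 -(sum_bri D x) natr_sum; apply: eq_bigr => y _.
by rewrite mulr1.
Qed.

(** The function [b = |a|^2] is the mean of the two unitary functions [b + i sqrt(1 - b^2)] and
    [b - i sqrt(1 - b^2)]; the square root is taken pointwise, and the C*-identity passes from [b]
    to [a]. *)
Lemma nm_ci_le1 a : (forall x, nm (a x) <= 1) -> nm (i a) <= 1.
Proof.
move=> a1; have [b bE bi] : exists2 b : A, forall x, b x = (nm (a x) ^+ 2)%:C%C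
    & i b = (i a)^s ** i a.
  exists (cfM (cfconj a) a); last by rewrite ciM ci_conj.
  by move=> x; rewrite !cfE conjM_nm.
have cc : continuous (fun x => Num.sqrt (1 - nm (a x) ^+ 2 ^+ 2)).
  move=> x.
  apply: (@continuous_comp _ _ _ (fun x => nm (a x))
    (fun t : K => Num.sqrt (1 - t ^+ 2 ^+ 2))); first exact: nm_cts.
  apply: (@continuous_comp _ _ _ (fun t : K => 1 - t ^+ 2 ^+ 2) Num.sqrt);
    last exact: sqrt_continuous.
  apply: cvgB; first exact: cvg_cst.
  by apply: (@continuous_comp _ _ _ (fun t : K => t ^+ 2) (fun t : K => t ^+ 2));
    exact: exprn_continuous.
have [c cE] : exists c : A, forall x, c x = (Num.sqrt (1 - nm (a x) ^+ 2 ^+ 2))%:C%C.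
  by exists (rcf cc).
have ii : ('i : C) * 'i = -1 by rewrite -expr2 sqrCi.
have hu (w : C) : w * w = -1 -> w^* = - w -> nm (i (b + w *: c)) <= 1.
  move=> ww wc; apply: (nm_isometry unit_l); rewrite -ci_conj -ciM; apply: ci_ext => x.
  rewrite !cfE bE cE rmorphD rmorphM /= wc !conj_real.
  set t := nm (a x) ^+ 2; set u := Num.sqrt _.
  have hu : u ^+ 2 = 1 - t ^+ 2.
    rewrite sqr_sqrtr // subr_ge0 -exprM exprn_ile1 ?nm_ge0 //.
    have -> : (t%:C%C + - w * u%:C%C) * (t%:C%C + w * u%:C%C) =
      t%:C%C ^+ 2 - (w * w) * u%:C%C ^+ 2 :> C by ring.
  rewrite ww mulNr mul1r opprK -!rmorphXn /= hu -rmorphD /=.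
  by rewrite addrC subrK.
have h1 := hu 'i ii (conjCi _).
have h2 := hu (- 'i) ltac:(by rewrite mulrNN) ltac:(by rewrite rmorphN /= [X in - X](conjCi C)).
have hb : nm (i b) <= 1.
  have -> : i b = 2^-1 *: (i (b + 'i *: c) + i (b + (- 'i) *: c)).
    rewrite -linearD addrACA scaleNr subrr addr0.
    rewrite (_ : b + b = 2 *: b); last by rewrite scaler_nat mulr2n.
    by rewrite linearZ scalerA mulVf ?pnatr_eq0 // scale1r.
  rewrite nmZ nmV nm_nat; have := nmD (i (b + 'i *: c)) (i (b + (- 'i) *: c)); lra.
by rewrite -(@ler_pXn2r _ 2) ?nnegrE ?nm_ge0 // -nm_cstar2 -bi expr1n.
Qed.

Lemma nm_ci a (M : K) : 0 <= M -> (forall x, nm (a x) <= M) -> nm (i a) <= M.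
Proof.
move=> M0 aM; apply/ler_addgt0Pr => d d0.
have p0 : 0 < M + d by lra.
pose c : C := ((M + d)^-1)%:C%C.
have nc : nm c = (M + d)^-1 by rewrite nm_real ger0_norm // invr_ge0 ltW.
have := @nm_ci_le1 (c *: a); rewrite linearZ nmZ nc mulrC ler_pdivrMr // mul1r.
apply=> x; rewrite !cfE nmM nc mulrC ler_pdivrMr // mul1r.
by apply: le_trans (aM x) _; lra.
Qed.

Lemma trn n (g h : Fn) y :
  iter n L (fun x => h (iter n R x) * g x) y = h y * iter n L g y.
Proof. exact: (tr_al (bri D) (mem_fib D)). Qed.

Lemma tr1 (g h : Fn) y : L (fun x => h (R x) * g x) y = h y * L g y.
Proof. exact: (trn 1). Qed.

Lemma tr_conj (g : Fn) y : (L g y)^* = L (fun x => (g x)^*) y.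
Proof.
by rewrite /tr rmorph_sum; apply: eq_bigr => x _; rewrite rmorphM rmorph_nat.
Qed.

(** The inner product of the [n]-th tensor power of the bimodule, identified with functions on [T]
    through the orbit of the first coordinate. Arbitrary functions are allowed, so that point masses
    can serve as test vectors. *)
Definition ip n xi eta : Fn := iter n L (fun x => (xi x)^* * eta x).
Definition sq n xi : T -> K := iter n (tr (fib D) e) (fun x => nm (xi x) ^+ 2).
(** The bound is asked at each base point [y] separately, so that it can be tested on vectors living
    on a single fibre of [R^n]. *)
Definition bd n Th (c : K) := forall xi y, sq n (Th xi) y <= c ^+ 2 * sq n xi y.
Definition adj n Th Th' := forall xi eta y, ip n (Th xi) eta y = ip n xi (Th' eta) y.
Definition lin Th := forall (c : C) xi eta x,
  Th (fun z => c * xi z + eta z) x = c * Th xi x + Th eta x.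

Lemma ip_sq n xi y : ip n xi xi y = (sq n xi y)%:C%C.
Proof.
rewrite /ip /sq; under [LHS]iter_tr_ext => x do rewrite conjM_nm.
elim: n y => //= n ih y; rewrite rmorph_sum; apply: eq_bigr => x _.
by rewrite ih rmorphM rmorph_nat.
Qed.

Lemma le_iter_tr n (g h : T -> K) y : (forall x, iter n R x = y -> g x <= h x) ->
  iter n (tr (fib D) e) g y <= iter n (tr (fib D) e) h y.
Proof.
elim: n g h y => [|n ih] g h y gh; first exact: gh.
rewrite /= /tr !big_seq; apply: ler_sum => x; rewrite mem_fib => /eqP xy.
rewrite ler_wpM2l ?ler0n //; apply: ih => z zx; apply: gh; by rewrite /= zx.
Qed.

Lemma sq_ge0 n xi y : 0 <= sq n xi y.
Proof.
apply: le_trans (_ : iter n (tr (fib D) e) (fun=> 0) y <= _).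
  elim: n y => //= n ih y; rewrite sumr_ge0 // => x _.
  by rewrite mulr_ge0 ?ler0n.
by apply: le_iter_tr => x _; rewrite exprn_ge0 ?nm_ge0.
Qed.

Lemma ip_conj n xi eta y : (ip n xi eta y)^* = ip n eta xi y.
Proof.
rewrite /ip; transitivity (iter n L (fun x => ((xi x)^* * eta x)^*) y); last first.
  by apply: iter_tr_ext => x; rewrite rmorphM /= conjCK mulrC.
elim: n y => //= n ih y; rewrite rmorph_sum; apply: eq_bigr => x _.
by rewrite rmorphM rmorph_nat /= ih.
Qed.

Lemma ipDr n xi c eta eta' y :
  ip n xi (fun x => c * eta x + eta' x) y = c * ip n xi eta y + ip n xi eta' y.
Proof.
rewrite /ip; under iter_tr_ext => x do rewrite mulrDr mulrCA.
by rewrite iter_trD (trn n _ (fun=> c)).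
Qed.

Lemma ipDl n xi c eta eta' y :
  ip n (fun x => c * eta x + eta' x) xi y = c^* * ip n eta xi y + ip n eta' xi y.
Proof. by rewrite -ip_conj ipDr rmorphD rmorphM /= !ip_conj. Qed.

Lemma CS n xi eta y : nm (ip n xi eta y) ^+ 2 <= sq n xi y * sq n eta y.
Proof.
(* Positivity of [sq n] at [xi - s z^* eta] with [z = ip n xi eta y]; the phase of [z] is built into
   the coefficient so that [s] may stay real. *)
have h (s : K) : 0 <= sq n xi y - 2 * s * nm (ip n xi eta y) ^+ 2
    + s ^+ 2 * nm (ip n xi eta y) ^+ 2 * sq n eta y.
  set z := ip n xi eta y; pose c : C := - s%:C%C * z^*.
  have := sq_ge0 n (fun x => c * eta x + xi x) y.
  rewrite -lecR -ip_sq ipDr !ipDl !ip_sq -(ip_conj n xi eta) -/z.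
  rewrite /c rmorphM rmorphN /= conj_real conjCK.
  have -> : - s%:C%C * z^* * (- s%:C%C * z * (sq n eta y)%:C%C + z) +
     (- s%:C%C * z * z^* + (sq n xi y)%:C%C) =
     (sq n xi y)%:C%C - 2 * s%:C%C * (z^* * z) + s%:C%C ^+ 2 * (z^* * z) * (sq n eta y)%:C%C :> C.
    by ring.
  rewrite conjM_nm -(rmorph_nat (real_complex K)) -!rmorphXn -!rmorphM -rmorphB -rmorphD.
  by rewrite lecR.
have q0 := sq_ge0 n eta y; have p0 := sq_ge0 n xi y.
set z2 := nm _ ^+ 2 in h *; have z0 : 0 <= z2 by rewrite exprn_ge0 ?nm_ge0.
have [qz|qp] := eqVneq (sq n eta y) 0.
  rewrite qz mulr0; rewrite leNgt; apply/negP => zp.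
  (* When [sq n eta y = 0] the expression is affine in [s], and this value makes it negative. *)
  have := h ((sq n xi y + 1) / z2); rewrite qz mulr0 addr0.
  have -> : 2 * ((sq n xi y + 1) / z2) * z2 = 2 * (sq n xi y + 1) by field; rewrite gt_eqF.
  lra.
have {}qp : 0 < sq n eta y by rewrite lt_def qp.
have := h (sq n eta y)^-1.
have -> : sq n xi y - 2 * (sq n eta y)^-1 * z2 + (sq n eta y)^-1 ^+ 2 * z2 * sq n eta y
   = (sq n xi y * sq n eta y - z2) / sq n eta y by field; rewrite gt_eqF.
by rewrite pmulr_lge0 ?invr_gt0 // subr_ge0.
Qed.

Lemma adj_bd n Th Th' c : 0 <= c -> adj n Th Th' -> bd n Th c -> bd n Th' c.
Proof.
move=> c0 ad hb eta y; set q := sq n (Th' eta) y.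
have q0 : 0 <= q := sq_ge0 _ _ _.
have : q ^+ 2 <= c ^+ 2 * q * sq n eta y.
  have -> : q ^+ 2 = nm (ip n (Th (Th' eta)) eta y) ^+ 2.
    by rewrite ad ip_sq nm_real ger0_norm.
  by apply: le_trans (CS _ _ _ _) _; rewrite ler_wpM2r ?sq_ge0.
have := sq_ge0 n eta y; set p := sq n eta y => p0 h.
have [->|qn] := eqVneq q 0; first by rewrite mulr_ge0 ?exprn_ge0.
have qp : 0 < q by rewrite lt_def qn.
by rewrite -(ler_pM2r qp) -expr2 mulrAC.
Qed.

Lemma bd_comp n Th Th' c c' : 0 <= c -> bd n Th c -> bd n Th' c' ->
  bd n (fun xi => Th (Th' xi)) (c * c').
Proof.
move=> c0 h h' xi y; apply: le_trans (h _ _) _.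
by rewrite exprMn -[leRHS]mulrA; exact: (ler_wpM2l (exprn_ge0 2 c0) (h' xi y)).
Qed.

(** The span of the elements [i f S b S^* i g] with [b] in [P]. Each one acts by the transfer of
    [g xi], then [b] one level down, then pullback along [R] with weight [f]. Sums grow term by
    term, so that proofs go by induction on their length. *)
Inductive KS (P : O -> (Fn -> Fn) -> Prop) : O -> (Fn -> Fn) -> Prop :=
| KS0 b Th : b = 0 -> (forall xi x, Th xi x = 0) -> KS P b Th
| KSD f g b Th b2 Th2 b3 Th3 : P b Th -> KS P b2 Th2 ->
    b3 = i f ** S ** b ** S^s ** i g + b2 ->
    (forall xi x, Th3 xi x =
       f x * Th (L (fun z => g z * xi z)) (R x) + Th2 xi x) ->
    KS P b3 Th3.

(* [Core n] relates the elements of i(A) + K(X) + ... + K(X^n) to their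
   action on X^n, extended from C(T) to all functions T -> C. *)
Fixpoint Core n (b : O) (Th : Fn -> Fn) : Prop :=
  if n is n'.+1 then
    exists a b2 Th2, [/\ KS (Core n') b2 Th2, b = i a + b2 &
      forall xi x, Th xi x = a x * xi x + Th2 xi x]
  else exists a, b = i a /\ forall xi x, Th xi x = a x * xi x.

Section KSLemmas.
Variable P : O -> (Fn -> Fn) -> Prop.

Lemma KS_eq b Th Th' : KS P b Th -> (forall xi x, Th' xi x = Th xi x) -> KS P b Th'.
Proof.
case=> [b0 Th0 b0E h|f g b1 Th1 b2 Th2 b3 Th3 P1 K2 b3E h] e'.
  by apply: KS0 => // xi x; rewrite e'.
by apply: (KSD P1 K2 b3E) => xi x; rewrite e'.
Qed.

Lemma KS_add b Th b' Th' : KS P b Th -> KS P b' Th' ->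
  KS P (b + b') (fun xi x => Th xi x + Th' xi x).
Proof.
move=> h h'; elim: h => [b0 Th0 -> h0|f g b1 Th1 b2 Th2 b3 Th3 P1 _ ih -> h3].
  by rewrite add0r; apply: KS_eq h' _ => xi x; rewrite h0 add0r.
by apply: (KSD P1 ih); rewrite ?addrA // => xi x; rewrite h3 addrA.
Qed.

Lemma KS_il f b Th : KS P b Th -> KS P (i f ** b) (fun xi x => f x * Th xi x).
Proof.
elim=> [b0 Th0 -> h0|f0 g b1 Th1 b2 Th2 b3 Th3 P1 _ ih -> h3].
  by apply: KS0; rewrite ?cmul0r // => xi x; rewrite h0 mulr0.
apply: (@KSD P (cfM f f0) g _ _ _ _ _ _ P1 ih).
  by rewrite cmulDr ciM !cmulA.
by move=> xi x; rewrite h3 cfE mulrDr mulrA.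
Qed.

Lemma KS_ir g b Th : KS P b Th ->
  KS P (b ** i g) (fun xi => Th (fun z => g z * xi z)).
Proof.
elim=> [b0 Th0 -> h0|f g0 b1 Th1 b2 Th2 b3 Th3 P1 _ ih -> h3].
  by apply: KS0; rewrite ?cmul0l // => xi x; rewrite h0.
apply: (@KSD P f (cfM g0 g) _ _ _ _ _ _ P1 ih).
  by rewrite cmulDl ciM !cmulA.
move=> xi x; rewrite h3; congr (_ * Th1 (L _) _ + _).
by apply/funext => z; rewrite cfE mulrA.
Qed.

Lemma KS_lin b Th : (forall b Th, P b Th -> lin Th) -> KS P b Th -> lin Th.
Proof.
move=> Pl; elim=> [b0 Th0 _ h0|f g b1 Th1 b2 Th2 b3 Th3 P1 _ ih _ h3] c xi eta x.
  by rewrite !h0 mulr0 addr0.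
rewrite !h3 ih.
have -> : L (fun z => g z * (c * xi z + eta z)) =
    fun z => c * L (fun z => g z * xi z) z + L (fun z => g z * eta z) z.
  apply/funext => z; rewrite /tr mulr_sumr -big_split; apply: eq_bigr => u _ /=.
  by ring.
by rewrite (Pl _ _ P1); ring.
Qed.

(** The product of [f S b S^* g] and [f' S b' S^* g'] is [f S (b L(g f') b') S^* g']; the second
    hypothesis on [P] is closure under this middle product. *)
Lemma KS_mul b Th b' Th' : (forall b Th, P b Th -> lin Th) ->
  (forall b Th b' Th' f, P b Th -> P b' Th' ->
     P (b ** i f ** b') (fun xi => Th (fun x => f x * Th' xi x))) ->
  KS P b Th -> KS P b' Th' -> KS P (b ** b') (fun xi => Th (Th' xi)).
Proof.
move=> Pl Pm h h'; have Kl := KS_lin Pl.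
elim: h => [b0 Th0 -> h0|f g b1 Th1 b2 Th2 b3 Th3 P1 K2 ih -> h3].
  by apply: KS0; rewrite ?cmul0l // => xi x; rewrite h0.
rewrite cmulDl.
apply: (KS_eq (Th := fun xi x => f x * Th1 (L (fun z => g z * Th' xi z)) (R x) +
  Th2 (Th' xi) x)) => [|xi x]; last by rewrite h3.
apply: KS_add ih; elim: h' => [b0 Th0 -> h0|f' g' b1' Th1' b2' Th2' b3' Th3' P1' _ ih' -> h3'].
  apply: KS0; rewrite ?cmul0r // => xi x.
  have -> : (fun z => g z * Th0 xi z) = fun z => 0 * 0 + 0.
    by apply/funext => z; rewrite h0 mulr0 mulr0 addr0.
  (* The zero function in the form [-1 * xi + eta] with both functions zero, so that [lin] gives
     [Th1 0 = - Th1 0 + Th1 0]. *)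
  have lz : L (fun z => 0 * 0 + 0) = fun z => (-1) * (0 : C) + 0.
    apply/funext => z; rewrite /tr big1 => [|u _]; by rewrite !(mulr0, addr0).
  rewrite lz (Pl _ _ P1 (-1) (fun=> 0) (fun=> 0)) mulN1r addNr; exact: mulr0.
apply: (@KSD P f g' _ _ _ _ _ _ (Pm _ _ _ _ (trA D (cfM g f')) P1 P1') ih').
  by rewrite cmulDr -cS_tr ciM !cmulA.
move=> xi x; rewrite -mulrDr; congr (_ * _).
rewrite -[X in _ = X + _]mul1r -(Pl _ _ P1); congr (Th1 _ _).
apply/funext => z; rewrite mul1r !cfE mulrC -tr1 -trD.
by apply: tr_ext => u; rewrite !cfE h3' mulrDr /=; ring.
Qed.

(** Pairing [f * (phi o R)] with [eta] at level [n + 1] is pairing [phi] with [L(f^* eta)] at level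
    [n]. Hence the adjoint exchanges [f] and [g], and the level rises by one. *)
Lemma KS_star n b Th :
  (forall b Th, P b Th -> exists Th', P b^s Th' /\ adj n Th Th') ->
  KS P b Th -> exists Th', KS P b^s Th' /\ adj n.+1 Th Th'.
Proof.
move=> Ps; elim=> [b0 Th0 -> h0|f g b1 Th1 b2 Th2 b3 Th3 P1 K2 [Th2' [K2' a2]] -> h3].
  exists (fun xi x => 0); split; first by apply: KS0; rewrite ?cstar0.
  move=> xi eta y; rewrite /ip; apply: iter_tr_ext => x.
  by rewrite h0 mulr0 rmorph0 mul0r.
have [Th1' [P1' a1]] := Ps _ _ P1.
exists (fun xi x => (g x)^* * Th1' (L (fun z => (f z)^* * xi z)) (R x) + Th2' xi x).
split.
  apply: (@KSD P (cfconj g) (cfconj f) _ _ _ _ _ _ P1' K2') => //.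
  by rewrite cstarD !cstarM cstarK -!ci_conj !cmulA.
move=> xi eta y.
set t1 := (fun x => f x * Th1 (L (fun z => g z * xi z)) (R x)).
set t2 := (fun x => (g x)^* * Th1' (L (fun z => (f z)^* * eta z)) (R x)).
have -> : ip n.+1 (Th3 xi) eta y = ip n.+1 t1 eta y + ip n.+1 (Th2 xi) eta y.
  rewrite -[X in X + _]mul1r -[X in X * _](rmorph1 (Num.conj : C -> C)) -ipDl.
  by congr (ip _ _ _ _); apply/funext => x; rewrite h3 mul1r.
have -> : ip n.+1 xi (fun x => t2 x + Th2' eta x) y = ip n.+1 xi t2 y + ip n.+1 xi (Th2' eta) y.
  rewrite -[X in X + _]mul1r -ipDr.
  by congr (ip _ _ _ _); apply/funext => x; rewrite mul1r.
rewrite a2; congr (_ + _).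
transitivity (ip n (Th1 (L (fun z => g z * xi z))) (L (fun z => (f z)^* * eta z)) y).
  rewrite /ip iterSr; apply: iter_tr_ext => z.
  rewrite -(tr1 _ (fun z => (Th1 _ z)^*)); apply: tr_ext => x.
  by rewrite /t1 rmorphM /=; ring.
rewrite a1 /ip iterSr; apply: iter_tr_ext => z.
rewrite mulrC tr_conj -tr1; apply: tr_ext => x.
by rewrite /t2 rmorphM /=; ring.
Qed.

End KSLemmas.

Lemma Core_eq n b Th Th' : Core n b Th -> (forall xi x, Th' xi x = Th xi x) ->
  Core n b Th'.
Proof.
case: n => [|n] /= [a].
  by move=> [-> h] h'; exists a; split => // xi x; rewrite h' h.
by move=> [b2 [Th2 [h1 h2 h3]]] h'; exists a, b2, Th2; split => // xi x; rewrite h' h3.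
Qed.

Lemma Core_i n a : Core n (i a) (fun xi x => a x * xi x).
Proof.
case: n => [|n]; first by exists a.
exists a, 0, (fun xi x => 0); split; [exact: KS0 | by rewrite addr0|].
by move=> xi x; rewrite addr0.
Qed.

Lemma Core_lin n b Th : Core n b Th -> lin Th.
Proof.
elim: n b Th => [|n ih] b Th /= [a].
  by move=> [_ h] c xi eta x; rewrite !h; ring.
move=> [b2 [Th2 [h1 _ h3]]] c xi eta x; rewrite !h3 (KS_lin _ h1) //.
by ring.
Qed.

Lemma KS_Core n b Th : KS (Core n) b Th -> Core n.+1 b Th.
Proof.
move=> h; exists 0, b, Th; split => //; first by rewrite linear0 add0r.
by move=> xi x; rewrite [X in X * _](_ : _ = 0) // mul0r add0r.
Qed.

Lemma Core_add n b Th b' Th' : Core n b Th -> Core n b' Th' ->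
  Core n (b + b') (fun xi x => Th xi x + Th' xi x).
Proof.
case: n => [|n] /= [a].
  move=> [-> h] [a' [-> h']]; exists (a + a'); split; first by rewrite linearD.
  by move=> xi x; rewrite h h' cfE mulrDl.
move=> [b2 [Th2 [h1 -> h3]]] [a' [b2' [Th2' [h1' -> h3']]]].
exists (a + a'), (b2 + b2'), (fun xi x => Th2 xi x + Th2' xi x); split.
- exact: KS_add.
- by rewrite linearD addrACA.
- by move=> xi x; rewrite h3 h3' cfE mulrDl addrACA.
Qed.

Lemma Core_mul n b Th b' Th' : Core n b Th -> Core n b' Th' ->
  Core n (b ** b') (fun xi => Th (Th' xi)).
Proof.
elim: n b Th b' Th' => [|n ih] b Th b' Th' /= [a].
  move=> [-> h] [a' [-> h']]; exists (cfM a a'); split; first by rewrite ciM.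
  by move=> xi x; rewrite h h' cfE mulrA.
move=> [b2 [Th2 [h1 -> h3]]] [a' [b2' [Th2' [h1' -> h3']]]].
have Pm b0 Th0 b0' Th0' f : Core n b0 Th0 -> Core n b0' Th0' ->
    Core n (b0 ** i f ** b0') (fun xi => Th0 (fun x => f x * Th0' xi x)).
  by move=> c0 c0'; rewrite -cmulA; exact: (ih _ _ _ _ c0 (ih _ _ _ _ (Core_i n f) c0')).
exists (cfM a a'), (i a ** b2' + (b2 ** i a' + b2 ** b2')),
  (fun xi x => a x * Th2' xi x + (Th2 (fun z => a' z * xi z) x + Th2 (Th2' xi) x)).
split.
- apply: KS_add; first exact: KS_il.
  apply: KS_add; first exact: KS_ir.
  apply: KS_mul => //; exact: Core_lin.
- by rewrite cmulDl !cmulDr ciM !addrA.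
- move=> xi x; rewrite h3 h3' cfE mulrDr mulrA -!addrA; congr (_ + (_ + _)).
  rewrite -[X in X + _]mul1r -(KS_lin (@Core_lin n) h1); congr (Th2 _ _).
  by apply/funext => z; rewrite h3' mul1r.
Qed.

Lemma Core_star n b Th : Core n b Th -> exists Th', Core n b^s Th' /\ adj n Th Th'.
Proof.
elim: n b Th => [|n ih] b Th /= [a].
  move=> [-> h]; exists (fun xi x => (a x)^* * xi x); split.
    by exists (cfconj a); rewrite ci_conj.
  by move=> xi eta y; rewrite /ip /= h rmorphM /=; ring.
move=> [b2 [Th2 [h1 -> h3]]].
have [Th2' [h1' a2]] := KS_star ih h1.
exists (fun xi x => (a x)^* * xi x + Th2' xi x); split.
  by exists (cfconj a), b2^s, Th2'; split; rewrite // cstarD ci_conj.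
move=> xi eta y.
have -> : Th xi = (fun x => 1 * (a x * xi x) + Th2 xi x).
  by apply/funext => x; rewrite h3 mul1r.
have -> : (fun x => (a x)^* * eta x + Th2' eta x) =
    (fun x => 1 * ((a x)^* * eta x) + Th2' eta x).
  by apply/funext => x; rewrite mul1r.
rewrite ipDl ipDr rmorph1 !mul1r a2; congr (_ + _); apply: iter_tr_ext => x.
by rewrite rmorphM /=; ring.
Qed.

Lemma sq_succ n xi y :
  sq n.+1 xi y = iter n (tr (fib D) e) (tr (fib D) e (fun x => nm (xi x) ^+ 2)) y.
Proof. by rewrite /sq iterSr. Qed.

Lemma iter_trZ n (c : K) (g : T -> K) y :
  iter n (tr (fib D) e) (fun x => c * g x) y = c * iter n (tr (fib D) e) g y.
Proof. exact: (tr_al (bri D) (mem_fib D) n g (fun=> c)). Qed.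

Lemma bd_mulf n a (M : K) : 0 <= M -> (forall x, nm (a x) <= M) ->
  bd n (fun xi x => a x * xi x) M.
Proof.
move=> M0 aM xi y; rewrite /sq -iter_trZ; apply: le_iter_tr => x _.
by rewrite nmM exprMn ler_wpM2r ?exprn_ge0 ?nm_ge0 // lerXn2r ?nnegrE ?nm_ge0.
Qed.

(** The factor 2 comes from [(a + b)^2 <= 2 (a^2 + b^2)]. A constant of this kind is harmless, since
    [pow_trick] removes it in the end. *)
Lemma bd_add n Th Th' c c' : bd n Th c -> bd n Th' c' ->
  bd n (fun xi x => Th xi x + Th' xi x) (2 * (`|c| + `|c'|)).
Proof.
move=> h h' xi y.
have : sq n (fun x => Th xi x + Th' xi x) y <= 2 * (sq n (Th xi) y + sq n (Th' xi) y).
  rewrite /sq -iter_trD -iter_trZ; apply: le_iter_tr => x _.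
  have := nmD (Th xi x) (Th' xi x); have := nm_ge0 (Th xi x + Th' xi x).
  have := sqr_ge0 (nm (Th xi x) - nm (Th' xi x)); nra.
move/le_trans; apply.
have := h xi y; have := h' xi y; have s0 := sq_ge0 n xi y.
have -> : (2 * (`|c| + `|c'|)) ^+ 2 = 4 * `|c| ^+ 2 + 4 * `|c'| ^+ 2 + 8 * (`|c| * `|c'|) by ring.
have : 0 <= `|c| * `|c'| by rewrite mulr_ge0.
rewrite -!normrX !(ger0_norm (sqr_ge0 _)); move: (c ^+ 2) (c' ^+ 2) (_ * _) => u v w.
have : 0 <= w -> 0 <= w * sq n xi y by move=> ?; rewrite mulr_ge0.
have : 0 <= sq n (Th xi) y by exact: sq_ge0.
have : 0 <= sq n (Th' xi) y by exact: sq_ge0.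
move=> ? ? wp /wp ? ? ?; rewrite !mulrDl; lra.
Qed.

(* Cauchy-Schwarz on each fibre. *)
Lemma bd_trf n g (M : K) xi y : 0 <= M -> (forall x, nm (g x) <= M) ->
  sq n (L (fun z => g z * xi z)) y <= M ^+ 2 * (deg D)%:R * sq n.+1 xi y.
Proof.
move=> M0 gM; rewrite sq_succ /sq -iter_trZ; apply: le_iter_tr => x _.
have -> : L (fun z => g z * xi z) x = ip 1 (fun z => (g z)^*) xi x.
  by apply: tr_ext => z; rewrite conjCK.
apply: le_trans (CS _ _ _ _) _; rewrite /sq /= ler_wpM2r //.
  exact: (sq_ge0 1).
rewrite -(sum_bri D x) natr_sum mulr_sumr; apply: ler_sum => z _.
by rewrite mulrC ler_wpM2r ?ler0n // nm_conj lerXn2r ?nnegrE ?nm_ge0.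
Qed.

Lemma bd_alf n f (M : K) (eta : Fn) y : 0 <= M -> (forall x, nm (f x) <= M) ->
  sq n.+1 (fun x => f x * eta (R x)) y <= M ^+ 2 * (deg D)%:R * sq n eta y.
Proof.
move=> M0 fM; rewrite sq_succ /sq -iter_trZ; apply: le_iter_tr => x _.
apply: le_trans (_ : tr (fib D) e (fun z => nm (eta (R z)) ^+ 2 * M ^+ 2) x <= _).
  apply: ler_sum => z _; rewrite ler_wpM2l ?ler0n // nmM exprMn mulrC.
  by rewrite ler_wpM2l ?exprn_ge0 ?nm_ge0 // lerXn2r ?nnegrE ?nm_ge0.
have -> : tr (fib D) e (fun z => nm (eta (R z)) ^+ 2 * M ^+ 2) x =
    nm (eta x) ^+ 2 * tr (fib D) e (fun=> M ^+ 2) x.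
  exact: (tr_al (bri D) (mem_fib D) 1 (fun=> M ^+ 2) (fun z => nm (eta z) ^+ 2) x).
rewrite mulrC.
rewrite ler_wpM2r ?exprn_ge0 ?nm_ge0 // /tr -mulr_suml mulrC.
by rewrite -(sum_bri D x) natr_sum.
Qed.

Lemma cts_bdd_ge0 a : exists2 M : K, 0 <= M & forall x, nm (a x) <= M.
Proof.
have [M h] := cts_bdd D a; exists M => //.
exact: le_trans (nm_ge0 (a (T_inh D))) (h _).
Qed.

Lemma bd_KSterm n f g Th c : 0 <= c -> bd n Th c -> exists2 c', 0 <= c' &
  bd n.+1 (fun xi x => f x * Th (L (fun z => g z * xi z)) (R x)) c'.
Proof.
move=> c0 h; have [Mf f0 fM] := cts_bdd_ge0 f; have [Mg g0 gM] := cts_bdd_ge0 g.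
have d0 : 0 <= (deg D)%:R :> K by rewrite ler0n.
exists (Mf * Mg * c * (deg D)%:R); first by rewrite !mulr_ge0.
move=> xi y; apply: le_trans (bd_alf n (Th (L (fun z => g z * xi z))) y f0 fM) _.
have h1 := h (L (fun z => g z * xi z)) y.
have h2 := bd_trf n xi y g0 gM.
have -> : (Mf * Mg * c * (deg D)%:R) ^+ 2 * sq n.+1 xi y =
  Mf ^+ 2 * (deg D)%:R * (c ^+ 2 * (Mg ^+ 2 * (deg D)%:R * sq n.+1 xi y)) by ring.
rewrite ler_wpM2l ?mulr_ge0 ?exprn_ge0 //; apply: le_trans h1 _.
by rewrite ler_wpM2l ?exprn_ge0.
Qed.

Lemma Core_bdd n b Th : Core n b Th -> exists2 c, 0 <= c & bd n Th c.
Proof.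
have bde m Th0 Th1 c : bd m Th0 c -> (forall xi x, Th1 xi x = Th0 xi x) -> bd m Th1 c.
  by move=> h e' xi y; rewrite (_ : Th1 xi = Th0 xi) //; apply/funext => x.
elim: n b Th => [|n ih] b Th /= [a].
  move=> [_ h]; have [M M0 aM] := cts_bdd_ge0 a; exists M => //.
  exact: bde (bd_mulf _ M0 aM) h.
move=> [b2 [Th2 [h1 _ h3]]].
suff [c c0 hc] : exists2 c, 0 <= c & bd n.+1 Th2 c.
  have [M M0 aM] := cts_bdd_ge0 a; exists (2 * (`|M| + `|c|)).
    by rewrite mulr_ge0 // addr_ge0.
  exact: bde (bd_add (bd_mulf _ M0 aM) hc) h3.
elim: h1 => [b0 Th0 _ h0|f g b1 Th1 b3 Th3 b4 Th4 P1 _ [c c0 hc] _ h4].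
  exists 0 => // xi y; rewrite (_ : Th0 xi = fun=> 0); last exact/funext.
  rewrite /sq -iter_trZ; apply: le_iter_tr => x _.
  by rewrite nm0 !expr0n mul0r.
have [c1 c10 hc1] := ih _ _ P1.
have [c2 c20 hc2] := bd_KSterm f g c10 hc1.
exists (2 * (`|c2| + `|c|)); first by rewrite mulr_ge0 // addr_ge0.
exact: bde (bd_add hc2 hc) h4.
Qed.

End Core.

(** A constant [M] independent of [k] disappears on taking roots of order [2^k]. *)
Lemma pow_trick (K : realType) (x c M : K) : 0 <= x -> 0 <= c ->
  (forall k, x ^+ (2 ^ k) <= M * c ^+ (2 ^ k)) -> x <= c.
Proof.
move=> x0 c0 h; rewrite leNgt; apply/negP => cx.
have [cz|cn] := eqVneq c 0.
  have := h 0%N; rewrite cz !expr1 mulr0; lra.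
have cp : 0 < c by rewrite lt_def cn.
have q1 : c / x < 1 by rewrite ltr_pdivrMr ?mul1r //; lra.
have q0 : 0 <= c / x by rewrite divr_ge0.
have [N hN] := @geometric_small K M (c / x) 1 q0 q1 ltr01.
have N2 : (N <= 2 ^ N)%N by rewrite ltnW // ltn_expl.
have xp : 0 < x by lra.
have := hN _ N2; rewrite expr_div_n mulrA ltr_pdivrMr ?exprn_gt0 // mul1r.
by rewrite ltNge h.
Qed.

(** * The norm of a core element is the norm of its action *)

Section NormCore.
Variables (K : realType) (T : topologicalType) (D : dynamics K T).
Variables (O : cstarAlgType (Cplx K)) (r : covrep D O).
Local Notation C := (Cplx K).
Local Notation A := (continuousType T C).
Local Notation i := (ci r).
Local Notation S := (cS r).
Local Notation R := (dmap D).
Local Notation e := (bri D).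
Local Notation Fn := (T -> C).
Local Notation L := (tr (fib D) e).
Local Notation one := (i (cf1 K T)).
Local Notation KS := (KS r).
Local Notation Core := (Core r).
Implicit Types (a f g : A) (x y z : T) (xi eta : Fn) (Th : Fn -> Fn).

Lemma bump_seq (s : seq T) (U : set T) : (forall x, x \in s -> nbhs x U) ->
  exists v : A, [/\ forall z, 0 <= v z <= 1, forall z, ~ U z -> v z = 0 &
    forall x, x \in s -> \forall z \near x, v z = 1].
Proof.
elim: s => [|x s ih] sU.
  exists (0 : A); split => // z; rewrite [_ z](_ : _ = 0) //.
  by rewrite lexx ler01.
have [v [v1 v2 v3]] := ih (fun x' xs => sU x' (@mem_behead _ (x :: s) x' xs)).
have [w [w1 w2 w3]] := dyn_bump D (sU x (mem_head _ _)).
pose u : A := v + w + (-1) *: cfM v w.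
have uE z : u z = 1 - (1 - v z) * (1 - w z) by rewrite /u !cfE; ring.
exists u; split.
- move=> z; rewrite uE; have /andP[a1 a2] := v1 z; have /andP[b1 b2] := w1 z.
  rewrite subr_ge0 gerBl mulr_ge0 ?subr_ge0 // andbT.
  by rewrite mulr_ile1 ?subr_ge0 // gerBl.
- by move=> z Uz; rewrite uE v2 // w2 // !subr0 mulr1 subrr.
- move=> x'; rewrite in_cons => /orP[/eqP ->|x's].
    by apply: filterS w3 => z wz; rewrite uE wz subrr mulr0 subr0.
  by apply: filterS (v3 _ x's) => z vz; rewrite uE vz subrr mul0r subr0.
Qed.

Lemma tr_delta (F : pzRingType) (v : F) x z :
  tr (fib D) e (fun u => if u == x then v else 0) z =
  if R x == z then (e x)%:R * v else 0.
Proof.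
rewrite /tr; case: ifPn => xz.
  rewrite (bigD1_seq x) ?mem_fib //=; last exact: fib_uniq.
  by rewrite eqxx big1 ?addr0 // => u /negbTE ->; rewrite mulr0.
apply: big1_seq => u /andP[_]; rewrite mem_fib => uz; case: eqP => [ux|]; last by rewrite mulr0.
by rewrite -ux uz in xz.
Qed.

Lemma iter_delta_gt0 n x (v : K) : 0 < v ->
  0 < iter n (tr (fib D) e) (fun u => if u == x then v else 0) (iter n R x).
Proof.
move=> v0; elim: n => [|n ih] /=; first by rewrite eqxx.
set g := iter n (tr (fib D) e) _ in ih *.
have g0 u : 0 <= g u.
  apply: le_trans (_ : 0 * g u <= _); first by rewrite mul0r.
  rewrite /g -iter_trZ; apply: le_iter_tr => w _.
  by rewrite mul0r; case: ifP => // _; exact: ltW.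
apply: lt_le_trans (_ : (e (iter n R x))%:R * g (iter n R x) <= _).
  by rewrite mulr_gt0 ?ltr0n ?bri_gt0.
rewrite /tr (bigD1_seq (iter n R x)) ?mem_fib //=; last exact: fib_uniq.
by rewrite lerDl sumr_ge0 // => u _; rewrite mulr_ge0 ?ler0n.
Qed.

Definition dl x : Fn := fun u => if u == x then 1 else 0.

Lemma nm_dl x u : nm (dl x u) ^+ 2 = if u == x then 1 else 0 :> K.
Proof. by rewrite /dl; case: eqP => _; rewrite ?nm1 ?nm0 ?expr1n ?expr0n. Qed.

Lemma lin_Z Th (c : C) xi x : lin Th -> Th (fun z => c * xi z) x = c * Th xi x.
Proof.
move=> l; have -> : (fun z => c * xi z) = fun z => (c - 1) * xi z + xi z.
  by apply/funext => z; ring.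
by rewrite l; ring.
Qed.

(** The point mass at [x] has positive weight over [R^n x], and comparing this single coordinate
    bounds the diagonal matrix entry. *)
Lemma bd_dl n Th (c : K) x : 0 <= c -> bd D n Th c -> nm (Th (dl x) x) <= c.
Proof.
move=> c0 h; rewrite -(@ler_pXn2r _ 2) ?nnegrE ?nm_ge0 //.
have := h (dl x) (iter n R x); rewrite /sq.
under [X in _ <= _ * X]iter_tr_ext do rewrite nm_dl.
have w0 := @iter_delta_gt0 n x 1 ltr01; move=> h1.
rewrite -(ler_pM2r w0); apply: le_trans h1; rewrite -iter_trZ.
apply: le_iter_tr => u _; case: eqP => [->|_]; first by rewrite mulr1.
by rewrite mulr0 exprn_ge0 ?nm_ge0.
Qed.

Definition pdl x x' : Fn := fun u => dl x u - dl x' u.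

(** The transfer of [g * pdl x x'] is [g x - g x'] times the point mass at [R x], and [g] varies
    little near [xc]. On differences of nearby points with one value the compact part is therefore
    negligible, and only a multiplication operator is seen. *)
Lemma KS_pair n b Th (xc : T) (d : K) : KS (Core n) b Th -> 0 < d ->
  exists2 U : set T, nbhs xc U & forall x x', U x -> U x' -> x != x' -> R x = R x' ->
    e x = 1%N -> e x' = 1%N -> nm (Th (pdl x x') x) <= d /\ nm (Th (pdl x x') x') <= d.
Proof.
move=> h; elim: h d => [b0 Th0 _ h0|f g b1 Th1 b2 Th2 b3 Th3 P1 _ ih _ h3] d d0.
  by exists setT => [|x x' *]; [exact: filterT | rewrite !h0 nm0; split; exact: ltW].
have [U nU hU] := ih (d / 2) ltac:(lra).
have [c c0 hc] := Core_bdd P1.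
have [M M0 fM] := cts_bdd_ge0 D f.
have q0 : 0 < M * c + 1 by have := mulr_ge0 M0 c0; lra.
(* Both [g x] and [g x'] are this close to [g xc]; after multiplication by [f] and by an entry of
   [Th1], bounded by [M] and [c], at most [d / 2] is left. *)
have /ctsP/(_ xc (d / (4 * (M * c + 1)))) := @cts_fun _ _ g.
rewrite divr_gt0 ?mulr_gt0 // => /(_ isT) ng.
exists (U `&` [set z | nm (g xc - g z) < d / (4 * (M * c + 1))]); first exact: filterI.
move=> x x' [Ux /= gx] [Ux' /= gx'] nx Rx ex ex'.
have [h1 h2] := hU x x' Ux Ux' nx Rx ex ex'.
have key0 z : R z = R x -> Th3 (pdl x x') z =
    f z * ((g x - g x') * Th1 (dl (R x)) (R x)) + Th2 (pdl x x') z.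
  move=> Rz; rewrite h3 Rz; congr (_ * _ + _).
  rewrite -(lin_Z _ _ _ (Core_lin P1)); congr (Th1 _ _); apply/funext => w.
  have -> : (fun z => g z * pdl x x' z) = (fun z => (if z == x then g x else 0) +
      (if z == x' then - g x' else 0)).
    apply/funext => u; rewrite /pdl /dl; case: (eqVneq u x) => [->|_].
      by rewrite (negbTE nx) subr0 mulr1 addr0.
    by case: eqP => [->|_]; ring.
  rewrite trD !tr_delta ex ex' -Rx !mul1r /dl eq_sym.
  by case: eqP => _; rewrite ?mulr1 ?mulr0 ?addr0.
have key z : nm (f z * ((g x - g x') * Th1 (dl (R x)) (R x))) <= d / 2.
  have k1 := bd_dl (R x) c0 hc; have k2 := fM z.
  have k3 : nm (g x - g x') <= d / (2 * (M * c + 1)).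
    apply: le_trans (nm_dist _ (g xc) _) _; rewrite (nmBC (g x)).
    have -> : d / (2 * (M * c + 1)) = d / (4 * (M * c + 1)) + d / (4 * (M * c + 1)).
      by field; rewrite gt_eqF.
    by rewrite lerD // ltW.
  rewrite !nmM; apply: le_trans (_ : M * (d / (2 * (M * c + 1)) * c) <= _).
    by rewrite !ler_pM ?mulr_ge0 ?nm_ge0.
  have -> : M * (d / (2 * (M * c + 1)) * c) = d / 2 * ((M * c) / (M * c + 1)).
    by field; rewrite gt_eqF.
  rewrite ler_piMr //; first lra.
  by rewrite ler_pdivrMr // mul1r; lra.
rewrite (key0 x) // (key0 x') //.
split; apply: le_trans (nmD _ _) _.
- by have := key x; lra.
- by have := key x'; lra.
Qed.

(** The test vector is [pdl x x'] for two nearby preimages of one value close to [xc]: by [KS_pair]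
    its image is [a] times itself up to [d] at both points. *)
Lemma Core_crit n b a b2 Th2 Th (c : K) (xc : T) : 0 <= c -> KS (Core n) b2 Th2 ->
  b = i a + b2 -> (forall xi x, Th xi x = a x * xi x + Th2 xi x) ->
  bd D n.+1 Th c -> e xc != 1%N -> nm (a xc) <= c.
Proof.
move=> c0 hK _ hTh hbd ec; apply/ler_addgt0Pr => d' d'0; pose d := d' / 2.
have d0 : 0 < d by rewrite /d; lra.
have [U nU hU] := KS_pair xc hK d0.
have /ctsP/(_ xc d d0) na := @cts_fun _ _ a.
have nU2 : nbhs xc (U `&` [set z | nm (a xc - a z) < d]) by exact: filterI.
have [x [x' [[Ux /= ax] [Ux' /= ax'] nx Rx [ex ex']]]] := crit_pair ec nU2.
have [h1 h2] := hU x x' Ux Ux' nx Rx ex ex'.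
rewrite (_ : d' = 2 * d); last by rewrite /d; field.
rewrite leNgt; apply/negP => big.
have px : pdl x x' x = 1 by rewrite /pdl /dl eqxx (negbTE nx) subr0.
have px' : pdl x x' x' = -1 by rewrite /pdl /dl eqxx eq_sym (negbTE nx) sub0r.
have low z (s : C) : nm (a xc - a z) < d -> nm s = 1 -> nm (Th2 (pdl x x') z) <= d ->
    c < nm (a z * s + Th2 (pdl x x') z).
  move=> az s1 th; have k1 := nm_ler_dist (a z * s) (- Th2 (pdl x x') z).
  rewrite opprK nmM s1 mulr1 nmN in k1.
  have := nm_ler_dist (a xc) (a z); lra.
have l1 : c < nm (Th (pdl x x') x).
  by rewrite hTh px; apply: low => //; exact: nm1.
have l2 : c < nm (Th (pdl x x') x').
  by rewrite hTh px'; apply: low => //; rewrite nmN nm1.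
(* If [c] is exceeded at both points, the square norm of the image exceeds [2 c^2 w], where [w] is
   the weight of [R x]; the test vector has square norm exactly [2 w]. *)
have := hbd (pdl x x') (iter n.+1 R x); rewrite iterSr.
set w := iter n (tr (fib D) e) (fun u => if u == R x then 1 else 0) (iter n R (R x)) : K.
have w0 : 0 < w := @iter_delta_gt0 n (R x) 1 ltr01.
have -> : sq D n.+1 (pdl x x') (iter n R (R x)) = 2 * w.
  rewrite sq_succ /w -iter_trZ; apply: iter_tr_ext => z.
  have -> : (fun x0 => nm (pdl x x' x0) ^+ 2) = fun u => (if u == x then 1 else 0) +
      (if u == x' then 1 else 0) : K.
    apply/funext => u; rewrite -!nm_dl /pdl /dl; case: (eqVneq u x) => [->|_].
      by rewrite (negbTE nx) subr0 nm0 expr0n addr0.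
    by rewrite sub0r nmN nm0 expr0n add0r.
  rewrite trD !tr_delta ex ex' -Rx eq_sym.
  by case: eqP => _; ring.
suff : (nm (Th (pdl x x') x) ^+ 2 + nm (Th (pdl x x') x') ^+ 2) * w <=
    sq D n.+1 (Th (pdl x x')) (iter n R (R x)).
  move=> k1 k2; have := le_trans k1 k2.
  rewrite mulrA ler_pM2r // leNgt => /negP; apply.
  have : c ^+ 2 < nm (Th (pdl x x') x) ^+ 2 by rewrite ltrXn2r ?nnegrE ?nm_ge0.
  have : c ^+ 2 < nm (Th (pdl x x') x') ^+ 2 by rewrite ltrXn2r ?nnegrE ?nm_ge0.
  lra.
rewrite sq_succ /w -iter_trZ; apply: le_iter_tr => z _.
set eta := Th _.
apply: le_trans (_ : tr (fib D) e (fun u => (if u == x then nm (eta x) ^+ 2 else 0) +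
   (if u == x' then nm (eta x') ^+ 2 else 0)) z <= _).
  rewrite trD !tr_delta ex ex' -Rx eq_sym !mul1r.
  by case: eqP => _; rewrite ?mulr1 ?mulr0 ?addr0.
apply: ler_sum => u _; rewrite ler_wpM2l ?ler0n //.
case: (eqVneq u x) => [->|_]; first by rewrite (negbTE nx) addr0.
by rewrite add0r; case: eqP => [->|_] //; rewrite exprn_ge0 ?nm_ge0.
Qed.

(** Compression by [S] cancels one layer: [S^* (f1 S b S^* g1) S = L(f1) b L(g1)]. This is how the
    induction on [n] descends. *)
Lemma Core_compress n b Th f g : Core n.+1 b Th ->
  Core n (S^s ** i f ** b ** i g ** S)
    (fun xi => L (fun z => f z * Th (fun u => g u * xi (R u)) z)).
Proof.
move=> [a [b2 [Th2 [hK -> hTh]]]].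
have -> : S^s ** i f ** (i a + b2) ** i g ** S =
    i (trA D (cfM (cfM f a) g)) + S^s ** i f ** b2 ** i g ** S.
  by rewrite -cS_tr !ciM cmulDr !cmulDl !cmulA.
apply: (Core_eq (Th := fun xi x => trA D (cfM (cfM f a) g) x * xi x +
   L (fun z => f z * Th2 (fun u => g u * xi (R u)) z) x)); last first.
  move=> xi x; rewrite !cfE mulrC -tr1 -trD; apply: tr_ext => z.
  by rewrite hTh !cfE; ring.
apply: (Core_add (Core_i _ _ _)).
elim: hK => [b0 Th0 -> h0|f1 g1 b1 Th1 b3 Th3 b4 Th4 P1 _ ih -> h4].
  rewrite cmul0r !cmul0l; apply: (Core_eq (Th := fun xi x => (0 : A) x * xi x)).
    by rewrite -(linear0 i); exact: Core_i.
  move=> xi x; rewrite [X in _ = X * _](_ : _ = 0) // mul0r /tr big1 // => u _.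
  by rewrite h0 !mulr0.
have -> : S^s ** i f ** (i f1 ** S ** b1 ** S^s ** i g1 + b3) ** i g ** S =
    i (trA D (cfM f f1)) ** (b1 ** i (trA D (cfM g1 g))) + S^s ** i f ** b3 ** i g ** S.
  by rewrite -!cS_tr !ciM cmulDr !cmulDl !cmulA.
apply: (Core_eq _ (Th := fun xi x => trA D (cfM f f1) x *
   Th1 (fun z => trA D (cfM g1 g) z * xi z) x +
   L (fun z => f z * Th3 (fun u => g u * xi (R u)) z) x)).
  apply: Core_add ih; apply: (Core_mul (Core_i r n (trA D (cfM f f1)))).
  exact: (Core_mul P1 (Core_i r n (trA D (cfM g1 g)))).
move=> xi x; rewrite !cfE mulrC -tr1 -trD; apply: tr_ext => z.
rewrite h4 !cfE mulrDr mulrA [_ * (f z * _)]mulrC; congr (_ * Th1 _ _ + _).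
apply/funext => u; rewrite mulrC -tr1; apply: tr_ext => w.
by rewrite !cfE; ring.
Qed.

Definition cpow (b : O) m := iter m (cmul b) one.

Lemma cpowSr b m : cpow b m.+1 = cpow b m ** b.
Proof.
elim: m => [|m ih]; first by rewrite /= unit_l unit_r.
by rewrite /cpow iterS -/(cpow b m.+1) {1}ih cmulA.
Qed.

Lemma cpowD b m n : cpow b (m + n) = cpow b m ** cpow b n.
Proof. by elim: m => [|m ih]; rewrite /= ?unit_l // ih cmulA. Qed.

Lemma iter_sq_cpow b k : iter k (fun y : O => y ** y) b = cpow b (2 ^ k).
Proof.
elim: k => [|k ih] /=; first by rewrite unit_r.
by rewrite ih -cpowD addnn -muln2 -expnSr.
Qed.

(** Puts a power between two fixed outer factors, the shape that [KS_sandwich] bounds. *)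
Lemma cpow_rot (b c : O) m : cpow (b ** c) m.+1 = b ** cpow (c ** b) m ** c.
Proof.
elim: m => [|m ih]; first by rewrite /= !unit_r.
by rewrite cpowSr ih cpowSr !cmulA.
Qed.

Lemma Core_cpow n b Th m (c : K) : 0 <= c -> Core n b Th -> bd D n Th c ->
  exists Th', Core n (cpow b m) Th' /\ bd D n Th' (c ^+ m).
Proof.
move=> c0 hC hb; elim: m => [|m [Th' [h1 h2]]].
  exists (fun xi x => cf1 K T x * xi x); split; first exact: Core_i.
  by apply: bd_mulf => // x; rewrite cfE nm1.
exists (fun xi => Th (Th' xi)); split; first exact: Core_mul.
by rewrite exprS; exact: bd_comp.
Qed.

Section NormStep.
Variable n : nat.
Hypothesis ih : forall b Th (c : K), 0 <= c -> Core n b Th -> bd D n Th c -> nm b <= c.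

Lemma KS_sandwich b1 Th1 b2 Th2 : KS (Core n) b1 Th1 -> KS (Core n) b2 Th2 ->
  exists2 M : K, 0 <= M & forall (y : O) Th (c : K), 0 <= c -> Core n.+1 y Th -> bd D n.+1 Th c ->
    nm (b1^s ** y ** b2) <= M * c.
Proof.
move=> h1 h2; elim: h1 => [b0 Th0 -> _|f g b Thb b3 Th3 b4 Th4 P1 _ [M3 M30 hM3] -> _].
  by exists 0 => // y Th c _ _ _; rewrite cstar0 !cmul0l nm0 mul0r.
suff [M M0 hM] : exists2 M : K, 0 <= M & forall (y : O) Th (c : K), 0 <= c -> Core n.+1 y Th ->
    bd D n.+1 Th c -> nm ((i f ** S ** b ** S^s ** i g)^s ** y ** b2) <= M * c.
  exists (M + M3); first exact: addr_ge0.
  move=> y Th c c0 hy hb; rewrite cstarD !cmulDl; apply: le_trans (nmD _ _) _.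
  by rewrite mulrDl lerD ?(hM _ _ _ c0 hy hb) ?(hM3 _ _ _ c0 hy hb).
elim: h2 {M3 M30 hM3} => [b0 Th0 -> _|f' g' b' Thb' b5 Th5 b6 Th6 P1' _ [M5 M50 hM5] -> _].
  by exists 0 => // y Th c _ _ _; rewrite cmul0r nm0 mul0r.
have [Mf f0 fM] := cts_bdd_ge0 D f; have [Mg g0 gM] := cts_bdd_ge0 D f'.
have d0 : 0 <= (deg D)%:R :> K by rewrite ler0n.
pose p := (i g)^s ** S ** b^s; pose q := b' ** S^s ** i g'.
exists (nm p * (Mf * Mg * (deg D)%:R) * nm q + M5).
  by rewrite addr_ge0 // !mulr_ge0 ?nm_ge0.
move=> y Th c c0 hy hb; rewrite cmulDr; apply: le_trans (nmD _ _) _.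
rewrite mulrDl lerD ?(hM5 _ _ _ c0 hy hb) //.
have -> : (i f ** S ** b ** S^s ** i g)^s ** y ** (i f' ** S ** b' ** S^s ** i g') =
    p ** (S^s ** i (cfconj f) ** y ** i f' ** S) ** q.
  by rewrite /p /q !cstarM cstarK ci_conj !cmulA.
have -> : nm p * (Mf * Mg * (deg D)%:R) * nm q * c =
  nm p * (Mf * Mg * (deg D)%:R * c) * nm q by ring.
apply: le_trans (nm_cmul _ _) _.
rewrite ler_wpM2r ?nm_ge0 //; apply: le_trans (nm_cmul _ _) _.
rewrite ler_wpM2l ?nm_ge0 //.
apply: (ih _ (Core_compress (cfconj f) f' hy)); first by rewrite !mulr_ge0.
move=> xi z; have cM x : nm (cfconj f x) <= Mf by rewrite cfE nm_conj.
apply: le_trans (bd_trf D n (Th (fun u => f' u * xi (R u))) z f0 cM) _.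
have := hb (fun u => f' u * xi (R u)) z.
have := bd_alf D n xi z g0 gM.
set t := sq D n.+1 _ z; set t' := sq D n.+1 _ z; move=> k1 k2.
have -> : (Mf * Mg * (deg D)%:R * c) ^+ 2 * sq D n xi z =
   Mf ^+ 2 * (deg D)%:R * (c ^+ 2 * (Mg ^+ 2 * (deg D)%:R * sq D n xi z)) by ring.
rewrite ler_wpM2l ?mulr_ge0 ?exprn_ge0 //; apply: le_trans k2 _.
by rewrite ler_wpM2l ?exprn_ge0.
Qed.

(** A power of [b^* b] is a power of [b b^*] between the outer factors [b^*] and [b]. The sandwich
    bound costs a constant for these factors, the same for all powers, and [pow_trick] removes
    it. *)
Lemma KS_nm b Th (c : K) : 0 < c -> KS (Core n) b Th -> bd D n.+1 Th c -> nm b <= c.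
Proof.
move=> c0 hK hb; have hC := KS_Core hK; have c0' := ltW c0.
have [M M0 hM] := KS_sandwich hK hK.
have [Th' [hC' ad]] := Core_star hC.
have hb' := adj_bd c0' ad hb.
rewrite -(@ler_pXn2r _ 2) ?nnegrE ?nm_ge0 //.
apply: (@pow_trick _ _ _ (M / c ^+ 2)); rewrite ?exprn_ge0 ?nm_ge0 // => k.
rewrite -nm_cstar2 -nm_sa2; last by rewrite cstarM cstarK.
rewrite iter_sq_cpow; have : (0 < 2 ^ k)%N by rewrite expn_gt0.
case: (2 ^ k)%N => // m _; rewrite cpow_rot.
have [Thm [k1 k2]] := Core_cpow m (mulr_ge0 c0' c0') (Core_mul hC hC') (bd_comp c0' hb hb').
apply: le_trans (hM _ _ _ _ k1 k2) _; first by rewrite exprn_ge0 ?mulr_ge0.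
have c2 : c ^+ 2 != 0 by rewrite gt_eqF ?exprn_gt0.
rewrite [_ ^+ 2 ^+ m.+1]exprS mulrA -[M / _ * _]mulrA mulVf // mulr1 expr2.
exact: lexx.
Qed.

(** A bump [v], equal to 1 near the branch points, splits [a]. On its support [|a| < c + d] by
    [Core_crit]; the rest of [a] vanishes near the branch points and joins the compact part by
    covariance. The constant is 1 for the first piece and 4 for the second, through [bd_add]. *)
Lemma nm_Core_step b Th (c : K) : 0 <= c -> Core n.+1 b Th -> bd D n.+1 Th c ->
  nm b <= 5 * c.
Proof.
move=> c0 [a [b2 [Th2 [hK bE hTh]]]] hb.
apply/ler_addgt0Pr => d' d'0; pose d := d' / 3; have d0 : 0 < d by rewrite /d; lra.
pose U := [set z | nm (a z) < c + d].
have [v [v1 v2 v3]] : exists v : A, [/\ forall z, 0 <= v z <= 1,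
    forall z, ~ U z -> v z = 0 & forall x, e x != 1%N -> \forall z \near x, v z = 1].
  suff hU x : x \in [seq x <- crit D | e x != 1%N] -> nbhs x U.
    have [v [v1 v2 v3]] := bump_seq hU.
    by exists v; split => // x ex; apply: v3; rewrite mem_filter ex critP.
  rewrite mem_filter => /andP[ex _].
  have := Core_crit c0 hK bE hTh hb ex.
  have /ctsP/(_ x d d0) := @cts_fun _ _ a.
  move=> h ax; apply: filterS h => z /= az; rewrite /U /=.
  have := nm_ler_dist (a z) (a x); rewrite (nmBC (a z)); lra.
have nv z : nm (v z) <= 1.
  have /andP[z0 z1] := v1 z; rewrite -lecR -nmE ger0_norm //.
have va z : nm (cfM v a z) <= c + d.
  rewrite cfE nmM; have [Uz|/v2 ->] := pselect (U z); last by rewrite nm0 mul0r; lra.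
  by apply: le_trans (ler_wpM2r (nm_ge0 _) (nv z)) _; rewrite mul1r ltW.
pose a1 : A := a + (-1) *: cfM v a.
have a1E z : a1 z = (1 - v z) * a z by rewrite /a1 !cfE; ring.
have [|s [sE sTh]] := @ci_cov _ _ _ _ r a1.
  by move=> x /v3; apply: filterS => z vz; rewrite a1E vz subrr mul0r.
have hK1 : KS (Core n) (i a1) (fun xi x => a1 x * xi x).
  rewrite sE; apply: (@KS_eq _ _ _ _ _ _ _ (fun xi x => \sum_(p <- s) p.1 x * L (fun z : T =>
      p.2 z * xi z) (R x))) => //.
  elim: s {sE sTh} => [|p s ihs]; first by apply: KS0 => [|xi x]; rewrite big_nil.
  apply: (@KSD _ _ _ _ _ _ p.1 p.2 _ _ _ _ _ _ (Core_i r n (cf1 K T)) ihs).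
    by rewrite big_cons -[i p.1 ** S ** one]cmulA one_S.
  move=> xi x; rewrite big_cons cfE mul1r //.
have hK2 := KS_add hK1 hK.
have bE2 : b = i (cfM v a) + (i a1 + b2).
  by rewrite bE addrA -linearD; congr (i _ + _); apply/continuousEP => z; rewrite /a1 !cfE; ring.
have hb2 : bd D n.+1 (fun xi x => a1 x * xi x + Th2 xi x) (2 * (`|c| + `|c + d|)).
  pose m : A := (-1) *: cfM v a.
  have hm : bd D n.+1 (fun xi x => m x * xi x) (c + d).
    by apply: bd_mulf; [lra | move=> x; rewrite cfE nmM nmN nm1 mul1r].
  move=> xi y; have := bd_add hb hm xi y.
  rewrite (_ : (fun x => Th xi x + m x * xi x) = (fun x => a1 x * xi x + Th2 xi x)) //.
  by apply/funext => x; rewrite hTh /m /a1 !cfE; ring.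
rewrite !ger0_norm in hb2; try lra.
have h1 : nm (i (cfM v a)) <= c + d by apply: nm_ci => //; lra.
have p2 : 0 < 2 * (c + (c + d)) by lra.
have h2 := KS_nm p2 hK2 hb2.
rewrite bE2; apply: le_trans (nmD _ _) _.
have : d' = 3 * d by rewrite /d; field.
lra.
Qed.

End NormStep.

(** The factor 5 of [nm_Core_step] is the same for every power of [b^* b], so it disappears and the
    induction continues with the sharp bound. *)
Lemma nm_Core n b Th (c : K) : 0 <= c -> Core n b Th -> bd D n Th c -> nm b <= c.
Proof.
elim: n b Th c => [|n ih] b Th c c0.
  move=> [a [-> h]] hb; apply: nm_ci => // x.
  have := hb (fun=> 1) x; rewrite /sq /= h mulr1 nm1 expr1n mulr1.
  by rewrite ler_pXn2r ?nnegrE ?nm_ge0.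
move=> hC hb; rewrite -(@ler_pXn2r _ 2) ?nnegrE ?nm_ge0 //.
have [Th' [hC' ad]] := Core_star hC; have hb' := adj_bd c0 ad hb.
apply: (@pow_trick _ _ _ 5); rewrite ?exprn_ge0 ?nm_ge0 // => k.
rewrite -nm_cstar2 -nm_sa2; last by rewrite cstarM cstarK.
have [Thm [k1 k2]] := Core_cpow (2 ^ k) (mulr_ge0 c0 c0) (Core_mul hC' hC) (bd_comp c0 hb' hb).
by rewrite iter_sq_cpow (nm_Core_step ih _ k1 k2) // exprn_ge0 ?mulr_ge0.
Qed.

End NormCore.

(** * Fejer means *)

Section FejerKernel.
Variable K : realType.
Local Notation C := (Cplx K).

(* Fourier coefficients of the Fejer kernel. *)
Definition fejer m (d : int) : C :=
  m%:R^-1 * \sum_(k < m) \sum_(l < m) (k%:Z - l%:Z + d == 0)%:R.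

Lemma fejer_out m d : (m <= `|d|)%N -> fejer m d = 0.
Proof.
move=> md; rewrite /fejer big1 ?mulr0 // => k _; rewrite big1 // => l _.
case: eqP => // h; have := ltn_ord k; have := ltn_ord l; lia.
Qed.

Lemma fejer_le1 m d : nm (fejer m d) <= 1.
Proof.
case: m => [|m]; first by rewrite /fejer invr0 mul0r nm0.
rewrite /fejer nmM nmV nm_nat mulrC ler_pdivrMr ?ltr0n // mul1r.
apply: le_trans (nm_sum _ _ _) _.
rewrite -[leRHS]mulr1 -[X in X%:R * _]card_ord mulr_natl -sumr_const.
apply: ler_sum => k _.
have [|hk] := boolP ((0 <= k%:Z + d) && (k%:Z + d < m.+1%:Z)).
  case/andP => h1 h2.
  have hl : (`|(k%:Z + d)%R| < m.+1)%N by lia.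
  rewrite (bigD1 (Ordinal hl)) //= big1 ?addr0.
    by case: eqP => _; rewrite ?nm1 ?nm0.
  move=> l /eqP hne; case: eqP => // h3; case: hne; apply: val_inj => /=.
  by have := ltn_ord l; lia.
rewrite big1 ?nm0 // => l _; case: eqP => // h3; have := ltn_ord l; lia.
Qed.

(** The coefficient is the proportion of [k < m] with [0 <= k + d < m]; at most [|d|] values of [k]
    are lost. *)
Lemma fejer_cvg m d : (0 < m)%N -> nm (1 - fejer m d) <= `|d|%N%:R / m%:R.
Proof.
move=> m0; have m0' : (0 : K) < m%:R by rewrite ltr0n.
have -> : 1 - fejer m d = m%:R^-1 * \sum_(k < m) (1 - \sum_(l < m) (k%:Z - l%:Z + d == 0)%:R).
  rewrite sumrB sumr_const card_ord mulrBr mulVf // pnatr_eq0 -lt0n //.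
rewrite nmM nmV nm_nat mulrC ler_pM2r ?invr_gt0 //.
apply: le_trans (nm_sum _ _ _) _.
apply: le_trans (_ : \sum_(k < m) (~~ ((0 <= k%:Z + d) && (k%:Z + d < m%:Z)))%:R <= _).
  apply: ler_sum => k _.
  case: (boolP ((0 <= k%:Z + d) && (k%:Z + d < m%:Z))) => /= [|hk].
    case/andP => h1 h2.
    have hl : (`|(k%:Z + d)%R| < m)%N by lia.
    rewrite (bigD1 (Ordinal hl)) //= big1 ?addr0.
      case: eqP => [_|]; first by rewrite subrr nm0.
      by lia.
    move=> l /eqP hne; case: eqP => // h3; case: hne; apply: val_inj => /=.
    by have := ltn_ord l; lia.
  rewrite big1 ?subr0 ?nm1 // => l _; case: eqP => // h3; have := ltn_ord l; lia.
rewrite -natr_sum ler_nat; case: (leP 0 d) => d0.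
  have -> : (\sum_(k < m) ~~ ((0 <= k%:Z + d)%R && (k%:Z + d < m%:Z)%R) =
      \sum_(k < m) (m - `|d| <= k))%N by apply: eq_bigr => k _; lia.
  have h n a : (\sum_(k < n) (a <= k) = n - a)%N.
    by elim: n => [|n ih]; rewrite ?big_ord0 ?big_ord_recr //= ?ih; lia.
  by rewrite h; lia.
have -> : (\sum_(k < m) ~~ ((0 <= k%:Z + d)%R && (k%:Z + d < m%:Z)%R) =
    \sum_(k < m) (k < `|d|))%N by apply: eq_bigr => k _; have := ltn_ord k; lia.
have h n a : (\sum_(k < n) (k < a) = minn a n)%N.
  by elim: n => [|n ih]; rewrite ?big_ord0 ?big_ord_recr //= ?ih; lia.
by rewrite h; lia.
Qed.

End FejerKernel.

(** * Words in the generators and their Fourier coefficients *)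

Section Words.
Variables (K : realType) (T : topologicalType) (D : dynamics K T).
Variables (O : cstarAlgType (Cplx K)) (r : covrep D O).
Local Notation C := (Cplx K).
Local Notation A := (continuousType T C).
Local Notation i := (ci r).
Local Notation S := (cS r).
Local Notation R := (dmap D).
Local Notation one := (i (cf1 K T)).
Local Notation al := (al D).
Local Notation trA := (trA D).
Local Notation Core := (Core r).
Implicit Types (a b f g : A) (x y z : O) (p q n m : nat).

Definition Sn n : O := cpow r S n.

Lemma SnS n : Sn n.+1 = S ** Sn n. Proof. by []. Qed.

Lemma SnD m n : Sn (m + n) = Sn m ** Sn n.
Proof. exact: cpowD. Qed.

Lemma Sn_ci n a : Sn n ** i a = i (iter n al a) ** Sn n.
Proof.
elim: n a => [|n ih] a; first by rewrite /Sn /= unit_l unit_r.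
by rewrite SnS -cmulA ih cmulA cS_ci !cmulA.
Qed.

Lemma ci_Sns n a : i a ** (Sn n)^s = (Sn n)^s ** i (iter n al a).
Proof.
have cj m (c : A) : cfconj (iter m al c) = iter m al (cfconj c).
  by elim: m => //= m <-; apply/continuousEP => u; rewrite !cfE.
rewrite -[LHS]cstarK cstarM cstarK -ci_conj Sn_ci cstarM -ci_conj cj.
by congr (_ ** i (iter _ _ _)); apply/continuousEP => u; rewrite !cfE conjCK.
Qed.

Lemma Sn_tr n a : (Sn n)^s ** i a ** Sn n = i (iter n trA a).
Proof.
elim: n a => [|n ih] a; first by rewrite /Sn /= (one_star r) unit_l unit_r.
rewrite SnS cstarM -[RHS]/(i (iter n.+1 trA a)) iterSr -ih -cS_tr.
by rewrite !cmulA.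
Qed.

(* The word (a, p, q, b) stands for i(a) S^p S*^q i(b). *)
Definition word := (A * nat * nat * A)%type.
Implicit Types (w : word) (ws : seq word).

Definition ev w : O := let: (a, p, q, b) := w in i a ** Sn p ** (Sn q)^s ** i b.
Definition evs ws : O := \sum_(w <- ws) ev w.
Definition dg w : int := let: (a, p, q, b) := w in p%:Z - q%:Z.

(** In the inner [S^*q i(c) S^p'] the smaller exponent is contracted by the transfer operator, and
    what remains of the larger one is moved outwards past the function. *)
Definition wmul w w' : word :=
  let: (a, p, q, b) := w in let: (a', p', q', b') := w' in
  let c := cfM b a' in
  if (q <= p')%N then
    (cfM a (iter p al (iter q trA c)), p + (p' - q), q', b')%N
  else (a, p, (q - p') + q', cfM (iter q' al (iter p' trA c)) b')%N.

Lemma evM w w' : ev w ** ev w' = ev (wmul w w').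
Proof.
case: w w' => [[[a p] q] b] [[[a' p'] q'] b'] /=.
have -> : i a ** Sn p ** (Sn q)^s ** i b ** (i a' ** Sn p' ** (Sn q')^s ** i b') =
    i a ** Sn p ** ((Sn q)^s ** i (cfM b a') ** Sn p') ** (Sn q')^s ** i b'.
  by rewrite ciM !cmulA.
case: ifPn => h /=.
  rewrite -{1}(subnKC h) SnD [_ ** (Sn q ** _)]cmulA Sn_tr SnD.
  by rewrite ciM [_ ** (i _ ** _)]cmulA -[i a ** Sn p ** i _]cmulA Sn_ci !cmulA.
rewrite -ltnNge in h.
rewrite -{1}(subnK (ltnW h)) addnC SnD cstarM -!cmulA.
have := Sn_tr p' (cfM b a'); rewrite -cmulA => e1.
have e2 x : (Sn p')^s ** (i (cfM b a') ** (Sn p' ** x)) = i (iter p' trA (cfM b a')) ** x.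
  by rewrite -e1 !cmulA.
have e3 c x : i c ** ((Sn q')^s ** x) = (Sn q')^s ** (i (iter q' al c) ** x).
  by rewrite !cmulA ci_Sns.
by rewrite e2 e3 [(q - p' + q')%N]addnC SnD cstarM ciM !cmulA.
Qed.

Definition wstar w : word :=
  let: (a, p, q, b) := w in (cfconj b, q, p, cfconj a).

Lemma ev_star w : (ev w)^s = ev (wstar w).
Proof. by case: w => [[[a p] q] b] /=; rewrite !cstarM cstarK !ci_conj !cmulA. Qed.

Definition wscale (c : C) w : word := let: (a, p, q, b) := w in (c *: a, p, q, b).

Lemma ev_scale c w : ev (wscale c w) = c *: ev w.
Proof. by case: w => [[[a p] q] b] /=; rewrite linearZ !cmulZl. Qed.

Lemma dg_scale c w : dg (wscale c w) = dg w.
Proof. by case: w => [[[a p] q] b]. Qed.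

Lemma evs_cat ws ws' : evs (ws ++ ws') = evs ws + evs ws'.
Proof. exact: big_cat. Qed.

Lemma evs_scale c ws : evs (map (wscale c) ws) = c *: evs ws.
Proof. by rewrite /evs big_map scaler_sumr; apply: eq_bigr => w _; exact: ev_scale. Qed.

Lemma gauge_ev (g : {linear O -> O}) (l : C) : l != 0 -> l^* = l^-1 ->
  (forall x y, g (x ** y) = g x ** g y) -> (forall x, g x^s = (g x)^s) ->
  (forall a, g (i a) = i a) -> g S = l *: S ->
  forall w, g (ev w) = l ^ (dg w) *: ev w.
Proof.
move=> l0 lc gM gs gi gS.
have gSn n : g (Sn n) = l ^+ n *: Sn n.
  elim: n => [|n ih]; first by rewrite expr0 scale1r gi.
  by rewrite SnS gM gS ih cmulZl cmulZr scalerA -exprS.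
case=> [[[a p] q] b] /=; rewrite !gM !gi gs !gSn cstarZ rmorphXn /= lc.
rewrite !(cmulZl, cmulZr) scalerA expfzDr //.
by rewrite mulrC exprVn exprnN.
Qed.

Lemma evs_dense x (d : K) : 0 < d -> exists ws, nm (x - evs ws) < d.
Proof.
pose E : set O := [set x | forall d : K, 0 < d -> exists ws, nm (x - evs ws) < d].
suff ET : E = setT by have h : E x; [rewrite ET | exact: h].
apply: (@ci_gen _ _ _ _ r).
- split.
  + move=> y cy d' d'0; have [|z [Ez yz]] := cy [set z | nm (y - z) < d' / 2].
      by apply/nbhs_nm; exists (d' / 2) => //; lra.
    have [ws hws] := Ez (d' / 2) ltac:(lra); exists ws.
    by have := nm_dist y z (evs ws); move: yz => /= ? ?; lra.
  + split; first by move=> d' d'0; exists [::]; rewrite /evs big_nil subr0 nm0.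
    move=> c y z Ey Ez d' d'0.
    have p0 : 0 < nm c + 1 by have := nm_ge0 c; lra.
    have [ws hws] := Ey (d' / (2 * (nm c + 1))) ltac:(by rewrite divr_gt0 ?mulr_gt0).
    have [ws' hws'] := Ez (d' / 2) ltac:(lra).
    exists (map (wscale c) ws ++ ws'); rewrite evs_cat evs_scale.
    have -> : c *: y + z - (c *: evs ws + evs ws') = c *: (y - evs ws) + (z - evs ws').
      by rewrite opprD addrACA scalerBr.
    apply: le_lt_trans (nmD _ _) _; rewrite nmZ.
    have : (nm c + 1) * nm (y - evs ws) < d' / 2.
      by move: hws; rewrite !ltr_pdivlMr ?mulr_gt0 // ; lra.
    have := nm_ge0 (y - evs ws); lra.
  + move=> y z Ey Ez d' d'0.
    have p1 : 0 < nm y + 1 by have := nm_ge0 y; lra.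
    have [ws' hws'] := Ez (d' / (2 * (nm y + 1))) ltac:(by rewrite divr_gt0 ?mulr_gt0).
    have p2 : 0 < nm (evs ws') + 1 by have := nm_ge0 (evs ws'); lra.
    have [ws hws] := Ey (d' / (2 * (nm (evs ws') + 1))) ltac:(by rewrite divr_gt0 ?mulr_gt0).
    exists [seq wmul w w' | w <- ws, w' <- ws'].
    have -> : evs [seq wmul w w' | w <- ws, w' <- ws'] = evs ws ** evs ws'.
      rewrite /evs big_allpairs_dep cmul_suml; apply: eq_bigr => w _.
      by rewrite cmul_sumr; apply: eq_bigr => w' _; rewrite evM.
    have -> : y ** z - evs ws ** evs ws' = y ** (z - evs ws') + (y - evs ws) ** evs ws'.
      by rewrite cmulBr cmulBl addrA subrK.
    apply: le_lt_trans (nmD _ _) _.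
    have := nm_cmul y (z - evs ws'); have := nm_cmul (y - evs ws) (evs ws').
    move: hws hws'; rewrite !ltr_pdivlMr ?mulr_gt0 //.
    have := nm_ge0 (z - evs ws'); have := nm_ge0 (y - evs ws); nra.
  + move=> y Ey d' d'0; have [ws hws] := Ey d' d'0; exists (map wstar ws).
    have -> : evs (map wstar ws) = (evs ws)^s.
      by rewrite /evs big_map cstar_sum; apply: eq_bigr => w _; rewrite ev_star.
    by rewrite -cstarB nm_cstar.
- move=> a d' d'0; exists [:: (a, 0, 0, cf1 K T)%N].
  rewrite /evs big_seq1 /= /Sn /= !unit_r (one_star r) unit_r subrr nm0 //.
- move=> d' d'0; exists [:: (cf1 K T, 1, 0, cf1 K T)%N].
  by rewrite /evs big_seq1 /= /Sn /= (one_star r) !unit_r unit_l subrr nm0.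
Qed.

(* Averages of the gauge action against a measure on the N-th roots of unity. *)
Lemma gauge_average N (w : C) (kap : 'I_N -> C) ws : N.-primitive_root w ->
  nm (\sum_(u <- ws) (\sum_(t < N) kap t * (w ^+ t) ^ (dg u)) *: ev u)
    <= (\sum_(t < N) nm (kap t)) * nm (evs ws).
Proof.
move=> pw; have w1 := prim_norm pw.
have w0 : w != 0 by rewrite -normr_eq0 w1 oner_eq0.
have h (t : 'I_N) : exists2 g : O -> O, (forall x, nm (g x) <= nm x) &
    g (evs ws) = \sum_(u <- ws) (w ^+ t) ^ (dg u) *: ev u.
  have n1 : `|w ^+ t| = 1 by rewrite normrX w1 expr1n.
  have [g [gM gs gi gS]] := ci_gauge r n1; exists g.
    apply: (hom_contractive (unit_l r) (unit_r r)) => //; first exact: linearD.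
    by move=> c y; rewrite linearZ.
  rewrite /evs linear_sum; apply: eq_bigr => u _; apply: gauge_ev => //.
    by rewrite expf_neq0.
  apply: (mulfI (expf_neq0 t w0)); rewrite mulfV ?expf_neq0 // -normCK n1.
  by rewrite expr1n.
have -> : \sum_(u <- ws) (\sum_(t < N) kap t * (w ^+ t) ^ (dg u)) *: ev u =
    \sum_(t < N) kap t *: \sum_(u <- ws) (w ^+ t) ^ (dg u) *: ev u.
  under [RHS]eq_bigr do rewrite scaler_sumr.
  rewrite exchange_big /=; apply: eq_bigr => u _; rewrite scaler_suml.
  by apply: eq_bigr => t _; rewrite scalerA.
rewrite mulr_suml; apply: le_trans (nm_sum _ _ _) _; apply: ler_sum => t _.
by have [g gn <-] := h t; rewrite nmZ ler_wpM2l ?nm_ge0.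
Qed.

Definition evj (j : int) ws : O := \sum_(u <- ws | dg u == j) ev u.

Lemma dg_bound ws : exists B, forall u, u \in ws -> (`|dg u| <= B)%N.
Proof.
elim: ws => [|u ws [B hB]]; first by exists 0%N.
exists (maxn `|dg u| B) => v; rewrite in_cons => /orP[/eqP ->|/hB h].
  exact: leq_maxl.
by rewrite (leq_trans h) // leq_maxr.
Qed.

Definition fej m ws : O := \sum_(u <- ws) fejer K m (dg u) *: ev u.

(** The Fejer mean is a gauge average against the positive weights [|D_ t|^2 / (N m)] on the [N]-th
    roots of unity. Their total mass is the coefficient in degree 0, which is 1. *)
Lemma nm_fej m ws : (0 < m)%N -> nm (fej m ws) <= nm (evs ws).
Proof.
(* The exponents [k - l + d] that occur are smaller than [N] in absolute value, so roots of unity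
   separate them as the circle would. *)
move=> m0; have [B hB] := dg_bound ws; pose N := (B + m + m).+1.
have [w pw] := @prim_root_exists K N isT; have w1 := prim_norm pw.
have w0 : w != 0 by rewrite -normr_eq0 w1 oner_eq0.
have Nn : N%:R != 0 :> C by rewrite pnatr_eq0.
have mn : m%:R != 0 :> C by rewrite pnatr_eq0 -lt0n.
pose D_ (t : 'I_N) : C := \sum_(k < m) (w ^+ t) ^+ k.
pose kap (t : 'I_N) : C := (N%:R * m%:R)^-1 * ((D_ t)^* * D_ t).
have wc (t : 'I_N) k : ((w ^+ t) ^+ k)^* = (w ^+ t) ^ (- k%:Z).
  rewrite -exprnN; apply: (mulfI (expf_neq0 k (expf_neq0 t w0))).
  by rewrite mulfV ?expf_neq0 // -normCK !normrX w1 !expr1n.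
have kapE (t : 'I_N) d : kap t * (w ^+ t) ^ d =
    (N%:R * m%:R)^-1 * \sum_(k < m) \sum_(l < m) (w ^ (k%:Z - l%:Z + d)) ^+ t.
  rewrite /kap -mulrA; congr (_ * _); rewrite [_^* * _]mulrC {2}/D_ rmorph_sum.
  rewrite /D_ !mulr_suml; apply: eq_bigr => k _; rewrite mulr_sumr mulr_suml.
  apply: eq_bigr => l _; rewrite [X in _ * X * _]wc !exprnP -!expfzDr ?expf_neq0 //.
  by rewrite exprzAC.
have kapS (d : int) : (`|d| <= B)%N -> \sum_(t < N) kap t * (w ^+ t) ^ d = fejer K m d.
  move=> dB; under eq_bigr do rewrite kapE.
  rewrite -mulr_sumr /fejer (_ : (N%:R * m%:R)^-1 = m%:R^-1 * N%:R^-1 :> C); last first.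
    by rewrite invfM mulrC.
  rewrite -mulrA; congr (_ * _).
  rewrite exchange_big mulr_sumr; apply: eq_bigr => k _ /=.
  rewrite exchange_big mulr_sumr; apply: eq_bigr => l _ /=.
  rewrite (sum_prim pw); last by have := ltn_ord k; have := ltn_ord l; rewrite /N; lia.
  by case: eqP => _; rewrite ?mulVf ?mulr0.
have := gauge_average kap ws pw.
have -> : \sum_(t < N) nm (kap t) = 1.
  apply: (@complexI K); rewrite rmorph_sum /=.
  transitivity (\sum_(t < N) kap t * (w ^+ t) ^ 0).
    apply: eq_bigr => t _; rewrite expr0z mulr1 -nmE ger0_norm // /kap mulr_ge0 //.
    by rewrite mulrC mul_conjC_ge0.
  rewrite kapS //; apply/eqP; rewrite eq_sym -subr_eq0 -nm_eq0 eq_le nm_ge0 andbT.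
  by have := fejer_cvg K 0 m0; rewrite mul0r.
rewrite mul1r; congr (_ <= _); congr (nm _); rewrite /fej !big_seq.
by apply: eq_bigr => u uws; rewrite kapS ?hB.
Qed.

Lemma fej_cvg ws (d : K) : 0 < d -> exists2 m, (0 < m)%N & nm (fej m ws - evs ws) <= d.
Proof.
move=> d0; pose c : K := \sum_(u <- ws) `|dg u|%N%:R * nm (ev u).
have c0 : 0 <= c by apply: sumr_ge0 => u _; rewrite mulr_ge0 ?nm_ge0 ?ler0n.
pose m := (Num.truncn (c / d)).+1; exists m => //.
have cm : c <= d * m%:R.
  rewrite mulrC -ler_pdivrMr //; apply: ltW; rewrite /m.
  by have /andP[_] := truncn_itv (divr_ge0 c0 (ltW d0)).
rewrite -nmN opprB /fej /evs -sumrB.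
apply: le_trans (nm_sum _ _ _) _.
apply: le_trans (_ : \sum_(u <- ws) `|dg u|%N%:R * nm (ev u) / m%:R <= _).
  apply: ler_sum => u _; rewrite -{1}[ev u]scale1r -scalerBl nmZ mulrAC.
  by rewrite ler_wpM2r ?nm_ge0 // fejer_cvg.
by rewrite -mulr_suml -/c ler_pdivrMr ?ltr0n.
Qed.

(** If every coefficient could be made small on good approximations, then so could finitely many of
    them at once, and a Fejer mean close to [h] would be small. The Fejer mean compares two
    approximations because it is norm-decreasing. *)
Lemma fourier_neq0 h : h != 0 -> exists j, exists2 d : K, 0 < d &
  forall e : K, 0 < e -> exists2 ws, nm (h - evs ws) < e & d <= nm (evj j ws).
Proof.
move=> h0; have H0 : 0 < nm h by rewrite nm_gt0.
apply: contrapT => hn.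
have hn2 (j : int) (d : K) : 0 < d -> exists2 e : K, 0 < e &
    forall ws, nm (h - evs ws) < e -> nm (evj j ws) < d.
  move=> d0; apply: contrapT => h1; apply: hn; exists j, d => // e e0.
  apply: contrapT => h2; apply: h1; exists e => // ws hws.
  by rewrite ltNge; apply/negP => h3; apply: h2; exists ws.
have hfin n (d : K) : 0 < d -> exists2 e : K, 0 < e & forall ws,
    nm (h - evs ws) < e -> forall j, (`|j| < n)%N -> nm (evj j ws) < d.
  move=> d0; elim: n => [|n [e e0 he]]; first by exists 1.
  have [e1 e10 he1] := hn2 n%:Z _ d0; have [e2 e20 he2] := hn2 (- n%:Z) _ d0.
  exists (Num.min e (Num.min e1 e2)); first by rewrite !lt_min e0 e10.
  move=> ws; rewrite !lt_min => /and3P[h1 h2 h3] j jn.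
  have [jn'|->|->] : [\/ (`|j| < n)%N, j = n%:Z | j = - n%:Z].
  - have [|nj] := ltnP `|j| n; first by constructor 1.
    by move: jn nj; clear; case: (leP 0 j) => j0; [constructor 2 | constructor 3]; lia.
  - exact: he.
  - exact: he1.
  - exact: he2.
(* [ws0] fixes the order [m]; then [ws] is chosen with small coefficients in all degrees up to [m].
   The four errors add up to three quarters of [nm h]. *)
have [ws0 hws0] := @evs_dense h (nm h / 8) ltac:(by rewrite divr_gt0).
have [m m0 hm] := @fej_cvg ws0 (nm h / 8) ltac:(by rewrite divr_gt0).
have m0' : (0 : K) < m%:R by rewrite ltr0n.
have [e e0 he] := @hfin m.+1 (nm h / (8 * m%:R)) ltac:(by rewrite divr_gt0 ?mulr_gt0).
have [ws hws] := @evs_dense h (Num.min e (nm h / 8)) ltac:(by rewrite lt_min e0 divr_gt0).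
move: hws; rewrite lt_min => /andP[hws1 hws2].
(* The degrees run from [-m] to [m - 1]; the extra degree [-m] carries the Fejer coefficient 0. *)
have fE : fej m ws = \sum_(k < m.*2) fejer K m (k%:Z - m%:Z) *: evj (k%:Z - m%:Z) ws.
  rewrite /fej /evj; under [RHS]eq_bigr do rewrite big_mkcond scaler_sumr.
  rewrite exchange_big /=; apply: eq_bigr => u _.
  have [um|um] := ltnP `|dg u| m.
    have hk : (`|(dg u + m%:Z)%R| < m.*2)%N by rewrite -addnn; lia.
    rewrite (bigD1 (Ordinal hk)) //= big1 ?addr0 => [|l /eqP hne].
      rewrite (_ : _ - _ = dg u) ?eqxx //; lia.
    case: eqP => [h3|_]; last by rewrite scaler0.
    by case: hne; apply: val_inj => /=; lia.
  rewrite fejer_out // scale0r big1 // => l _.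
  by case: eqP => [<-|_]; rewrite ?scaler0 // fejer_out // scale0r.
have f1 : nm (fej m ws) <= nm h / 4.
  rewrite fE; apply: le_trans (nm_sum _ _ _) _.
  apply: le_trans (_ : \sum_(k < m.*2) nm h / (8 * m%:R) <= _).
    apply: ler_sum => k _; rewrite nmZ.
    have k1 := fejer_le1 K m (k%:Z - m%:Z).
    have k2 : nm (evj (k%:Z - m%:Z) ws) < nm h / (8 * m%:R).
      by apply: he => //; have := ltn_ord k; clear; lia.
    by apply: le_trans (ler_pM (nm_ge0 _) (nm_ge0 _) k1 (ltW k2)) _; rewrite mul1r.
  rewrite sumr_const card_ord -[leLHS]mulr_natl -addnn natrD.
  by rewrite le_eqVlt; apply/orP; left; apply/eqP; field; rewrite gt_eqF.
have f2 : nm (fej m ws0 - fej m ws) <= nm h / 4.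
  have := nm_fej (ws0 ++ map (wscale (-1)) ws) m0.
  rewrite evs_cat evs_scale scaleN1r.
  have -> : fej m (ws0 ++ map (wscale (-1)) ws) = fej m ws0 - fej m ws.
    rewrite /fej big_cat big_map; congr (_ + _); rewrite -sumrN.
    by apply: eq_bigr => u _; rewrite ev_scale dg_scale scaleN1r scalerN.
  move/le_trans; apply; have := nm_dist (evs ws0) h (evs ws).
  rewrite (nmBC _ h); lra.
have := nm_dist h (evs ws0) (fej m ws0); rewrite (nmBC (evs ws0) (fej _ _)).
have := nm_ler_dist (fej m ws0) (fej m ws).
have := nm_ler_dist h (fej m ws0).
lra.
Qed.

End Words.

(** * Topology of the dynamical system *)

Section Topo.
Variables (K : realType) (T : topologicalType) (D : dynamics K T).
Local Notation C := (Cplx K).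
Local Notation A := (continuousType T C).
Local Notation R := (dmap D).

Lemma iter_dmap_cts n : continuous (iter n R).
Proof.
elim: n => [|n ih] x; first exact: cvg_id.
exact: (@continuous_comp _ _ _ (iter n R) R x (ih x) (@dmap_cts _ _ D _)).
Qed.

Lemma nbhs_notin (s : seq T) (x : T) : x \notin s -> nbhs x [set z | z \notin s].
Proof.
elim: s => [|y s ih]; first by move=> _; apply: (filterS _ (@filterT _ (nbhs x) _)) => z _.
rewrite in_cons negb_or => /andP[xy /ih h].
have h2 : nbhs x [set z | z != y].
  have := @T_haus _ _ D; rewrite open_hausdorff => /(_ x y xy) [[U V]] /= [xU yV] [oU oV UV].
  apply: filterS (open_nbhs_nbhs (conj oU (set_mem xU))) => z Uz /=; apply/negP => /eqP zy.
  have : (U `&` V) y by split; [rewrite -zy | exact: set_mem].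
  by rewrite (eqP UV).
by apply: filterS2 h h2 => z /= h3 h4; rewrite in_cons negb_or h3 h4.
Qed.

Lemma interpolate (s : seq T) (xi : T -> C) : exists f : A, forall x, x \in s -> f x = xi x.
Proof.
elim: s => [|x s [f hf]]; first by exists 0.
have [xs|xs] := boolP (x \in s).
  by exists f => z; rewrite in_cons => /orP[/eqP ->|/hf //]; exact: hf.
have [v [_ v2 v3]] := dyn_bump D (nbhs_notin xs).
exists (f + (xi x - f x) *: v) => z; rewrite in_cons => /orP[/eqP ->|zs]; rewrite !cfE.
  by rewrite (nbhs_singleton v3) mulr1 addrC subrK.
by rewrite v2 ?mulr0 ?addr0 ?hf //=; rewrite zs.
Qed.

Lemma iter_fib n (y : T) : exists s : seq T, forall x, iter n R x = y -> x \in s.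
Proof.
elim: n y => [|n ih] y; first by exists [:: y] => x /= ->; rewrite inE.
have [f hf] := choice (fun z => ih z).
exists (flatten (map f (fib D y))) => x /= xy; apply/flattenP.
exists (f (iter n R x)); last exact: hf.
by apply: map_f; rewrite mem_fib xy.
Qed.

(* If every point near x were periodic with period < M, then R^(M!) would be
   the identity by exactness, hence R injective. *)
Lemma aperiodic (x : T) (U : set T) M : nbhs x U -> exists2 y : T, nbhs y U &
  forall j, (0 < j < M)%N -> iter j R y != y.
Proof.
move=> nU; apply: contrapT => hn.
have [W [oW Wx WU]] : exists W, [/\ open W, W x & W `<=` U].
  by move: nU; rewrite nbhsE => -[W [oW Wx] WU]; exists W.
have per y : W y -> iter M`! R y = y.
  move=> Wy; apply: contrapT => hp; apply: hn; exists y.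
    by apply: filterS WU _; exact: open_nbhs_nbhs.
  move=> j /andP[j0 jM]; apply/negP => /eqP jy; apply: hp.
  have /dvdnP[q ->] : (j %| M`!)%N by apply: dvdn_fact; rewrite j0 ltnW.
  by elim: q => //= q ih; rewrite mulSn iterD ih.
have [n hx] := dmap_exact D (open_nbhs_nbhs (conj oW Wx)).
have pT y : iter M`! R y = y.
  by have [z Wz <-] := hx y; rewrite -iterD addnC iterD per.
have [x1 [x2 [/negP x12 Rx]]] := dmap_ninj D; apply: x12; apply/eqP.
by rewrite -(pT x1) -(pT x2) -(prednK (fact_gt0 M)) !iterSr Rx.
Qed.

(** Each of the finitely many points [R^j y] is separated from [y], and continuity of [R^j] carries
    the separation to a neighbourhood. *)
Lemma wandering (y : T) M : (forall j, (0 < j < M)%N -> iter j R y != y) ->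
  exists2 V : set T, nbhs y V & forall z j, V z -> (0 < j < M)%N -> ~ V (iter j R z).
Proof.
elim: M => [|M ih] h; first by exists setT => [|z j _]; [exact: filterT | lia].
have [|V nV hV] := ih; first by move=> j /andP[j0 jM]; apply: h; rewrite j0 ltnW.
have [->|M0] := posnP M; first by exists setT => [|z j _]; [exact: filterT | lia].
have := @T_haus _ _ D; rewrite open_hausdorff => /(_ y (iter M R y)).
rewrite eq_sym h ?M0 ?leqnn // => /(_ isT) [[A1 B1]] /= [/set_mem yA /set_mem yB] [oA oB AB].
exists (V `&` (A1 `&` iter M R @^-1` B1)).
  apply: filterI => //; apply: filterI; first exact: open_nbhs_nbhs.
  apply: (@iter_dmap_cts M y B1); exact: open_nbhs_nbhs.
move=> z j [Vz [Az Bz]] /andP[j0]; rewrite ltnS leq_eqVlt => /orP[/eqP ->|jM] [Vj [Aj _]].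
  by have : (A1 `&` B1) (iter M R z) by []; rewrite (eqP AB).
by apply: (hV z j) => //; rewrite j0.
Qed.

End Topo.

(** * Simplicity and pure infiniteness from the covariance relations *)

Section Final.
Variables (K : realType) (T : topologicalType) (D : dynamics K T).
Variables (O : cstarAlgType (Cplx K)) (r : covrep D O).
Local Notation C := (Cplx K).
Local Notation A := (continuousType T C).
Local Notation i := (ci r).
Local Notation S := (cS r).
Local Notation R := (dmap D).
Local Notation one := (i (cf1 K T)).
Local Notation al := (al D).
Local Notation trA := (trA D).
Local Notation Core := (Core r).
Local Notation L := (tr (fib D) (bri D)).
Local Notation Sn := (Sn r).
Local Notation word := (word K T).
Implicit Types (a b f g v : A) (h : O) (p q n m : nat) (ws : seq word).

Lemma iter_alE n a x : iter n al a x = a (iter n R x).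
Proof. by elim: n x => [//|n ih x]; rewrite iterS alE ih -iterSr. Qed.

Lemma iter_trAE n a x : iter n trA a x = iter n L (a : T -> C) x.
Proof. by elim: n x => [//|n ih x]; rewrite iterS trAE; apply: tr_ext. Qed.

(** On functions the word [(a, p, q, b)] acts by [f -> a * (L^q(b f) o R^p)]; [ev_act] relates this
    to left multiplication of [i f S^n]. *)
Definition wF (u : word) f : A :=
  let: (a, p, q, b) := u in cfM a (iter p al (iter q trA (cfM b f))).
Definition wq (u : word) : nat := u.1.2.
Definition wk n (u : word) : nat := (u.1.1.2 + (n - u.1.2))%N.

Lemma ev_act (u : word) f n : (wq u <= n)%N -> ev r u ** (i f ** Sn n) = i (wF u f) ** Sn (wk n u).
Proof.
case: u => [[[a p] q] b]; rewrite /wq /wk /= => qn.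
rewrite -{1}(subnKC qn) SnD.
have -> : i a ** Sn p ** (Sn q)^s ** i b ** (i f ** (Sn q ** Sn (n - q))) =
   i a ** (Sn p ** ((Sn q)^s ** i (cfM b f) ** Sn q)) ** Sn (n - q).
  by rewrite ciM !cmulA.
by rewrite Sn_tr Sn_ci ciM SnD !cmulA.
Qed.

(** A word with equal exponents [p + 1] is a single [KS] layer around the word with exponents [p]
    and coefficients 1. *)
Lemma Core_diag p n a b : (p <= n)%N -> exists Th,
  Core n (i a ** Sn p ** (Sn p)^s ** i b) Th /\
  forall (f : A) x, Th f x = a x * iter p al (iter p trA (cfM b f)) x.
Proof.
elim: p n a b => [|p ih] n a b pn.
  exists (fun xi x => cfM a b x * xi x); split.
    rewrite /Sn /cpow /= (one_star r) -cmulA unit_l unit_r -ciM; exact: Core_i.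
  by move=> f x; rewrite !cfE mulrA.
case: n pn => // n pn; have [Th [hC hT]] := ih n (cf1 K T) (cf1 K T) pn.
exists (fun xi x => a x * Th (L (fun z => b z * xi z)) (R x)); split; last first.
  move=> f x; rewrite (_ : L _ = trA (cfM b f)) ?hT; last exact/funext.
  have -> : cfM (cf1 K T) (trA (cfM b f)) = trA (cfM b f).
    by apply/continuousEP => z; rewrite cfME cf1E mul1r.
  by rewrite cf1E mul1r !iter_alE -!iterSr.
apply: KS_Core; apply: (@KSD _ _ _ _ _ _ a b _ _ 0 (fun=> fun=> 0) _ _ hC).
- exact: KS0.
- by rewrite unit_l unit_r addr0 SnS cstarM !cmulA.
- by move=> xi x; rewrite addr0.
Qed.

Lemma Core_evj0 ws n : (forall u, u \in ws -> (wq u <= n)%N) -> exists Th,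
  Core n (evj r 0 ws) Th /\ forall (f : A) x, Th f x = \sum_(u <- ws | dg u == 0) wF u f x.
Proof.
rewrite /evj; elim: ws => [|u ws ih] hq.
  exists (fun xi x => (0 : A) x * xi x); split.
    by rewrite big_nil -(linear0 i); exact: Core_i.
  by move=> f x; rewrite big_nil [X in X * _](_ : _ = 0) // mul0r.
have [|Th [hC hT]] := ih; first by move=> u' us; apply: hq; rewrite in_cons us orbT.
have := hq u (mem_head _ _); case: u {hq} => [[[a p] q] b]; rewrite /wq /= => qn.
have [pq|pq] := eqVneq (p%:Z - q%:Z) 0; last first.
  exists Th; rewrite big_cons /= (negbTE pq); split => // f x.
  by rewrite big_cons /= (negbTE pq).
have {}pq : p = q by lia.
rewrite pq; have [Th' [hC' hT']] := Core_diag a b qn.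
exists (fun xi x => Th' xi x + Th xi x); split.
  by rewrite big_cons /= subrr eqxx; exact: Core_add.
by move=> f x; rewrite big_cons /= subrr eqxx hT hT' cfE.
Qed.

Lemma Core_local n h Th xi eta y : Core n h Th ->
  (forall x, iter n R x = y -> xi x = eta x) ->
  forall x, iter n R x = y -> Th xi x = Th eta x.
Proof.
elim: n h Th xi eta => [|n ih] h Th xi eta /= [a].
  by move=> [_ hT] e x xy; rewrite !hT e.
move=> [b2 [Th2 [hK _ hT]]] e x xy; rewrite !hT e //; congr (_ + _).
elim: hK {hT} x xy => [b0 Th0 _ h0|f g b1 Th1 b4 Th4 b3 Th3 P1 _ ih2 _ h3] x xy.
  by rewrite !h0.
rewrite !h3 (ih2 x xy) (ih _ _ (L (fun z => g z * xi z)) (L (fun z => g z * eta z)) P1) //.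
  move=> z zy; apply: (tr_local _ (mem_fib D)) => w wz; rewrite e //= -zy -wz.
  by rewrite -iterS iterSr.
by rewrite -iterSr.
Qed.

(** By [nm_Core] the norm is seen by some function over some [y]. The fibre over [y] is finite and
    only the values there matter ([Core_local]), so a continuous interpolating function serves as
    well. *)
Lemma local_vector n h Th (c : K) : 0 <= c -> c < nm h -> Core n h Th ->
  exists f y, sq D n f y = 1 /\ c ^+ 2 < sq D n (Th f) y.
Proof.
move=> c0 ch hC.
have [xi [y hxi]] : exists xi y, c ^+ 2 * sq D n xi y < sq D n (Th xi) y.
  apply: contrapT => hn; move: ch; rewrite ltNge => /negP; apply.
  apply: (nm_Core c0 hC) => xi y; rewrite leNgt; apply/negP => hlt.
  by apply: hn; exists xi, y.
have [s hs] := iter_fib D n y; have [f hf] := interpolate D s xi.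
have fx x : iter n R x = y -> f x = xi x by move=> /hs /hf.
have Tfx := Core_local hC fx.
have sqE eta eta' : (forall x, iter n R x = y -> eta x = eta' x) -> sq D n eta y = sq D n eta' y.
  by move=> he; apply: (iter_tr_local _ (mem_fib D)) => x xy; rewrite he.
rewrite -(sqE _ _ fx) -(sqE _ _ Tfx) in hxi.
have s0 : 0 < sq D n f y.
  rewrite lt_def sq_ge0 andbT; apply/negP => /eqP z0.
  have [M M0 hM] := Core_bdd hC; have := hM f y.
  by rewrite z0 mulr0 leNgt => /negP; apply; rewrite z0 mulr0 in hxi.
pose l : K := (Num.sqrt (sq D n f y))^-1.
have l2 : l ^+ 2 * sq D n f y = 1.
  by rewrite /l exprVn sqr_sqrtr ?ltW // mulVf // gt_eqF.
have sqZ eta : sq D n (fun x => l%:C%C * eta x) y = l ^+ 2 * sq D n eta y.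
  rewrite /sq -iter_trZ; apply: iter_tr_ext => x.
  by rewrite nmM exprMn nm_real real_normK // num_real.
exists (l%:C%C *: f), y; split; first by rewrite -l2 -sqZ; apply: sqE => x _; rewrite cfE.
have -> : sq D n (Th (l%:C%C *: f)) y = l ^+ 2 * sq D n (Th f) y.
  rewrite -sqZ; apply: sqE => x _; rewrite -(lin_Z _ _ _ (Core_lin hC)).
  by congr (Th _ _).
rewrite -[c ^+ 2]mulr1 -l2 mulrCA ltr_pM2l // exprn_gt0 //.
by rewrite /l invr_gt0 sqrtr_gt0.
Qed.

(** [z^* h^* h z] is the square of [one - s] with [nm s < 1], and the inverse of [one - s] is
    absorbed into [z]. *)
Lemma scale_to_one h z : nm (one - z^s ** (h^s ** h) ** z) < 1 ->
  exists z', z'^s ** (h^s ** h) ** z' = one.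
Proof.
set t := one - _ => t1.
have st : t^s = t by rewrite /t cstarB (one_star r) !cstarM !cstarK !cmulA.
have [s [ss s1 hs _]] := sqrt_unit_sub (unit_l r) (unit_r r) st t1.
have [w [_ hw]] := neumann (unit_l r) (unit_r r) s1.
exists (z ** w).
have -> : (z ** w)^s ** (h^s ** h) ** (z ** w) = w^s ** (z^s ** (h^s ** h) ** z) ** w.
  by rewrite cstarM !cmulA.
have -> : z^s ** (h^s ** h) ** z = (one - s) ** (one - s) by rewrite hs /t opprB addrC subrK.
have -> : w^s ** ((one - s) ** (one - s)) ** w = ((one - s) ** w)^s ** ((one - s) ** w).
  by rewrite cstarM cstarB (one_star r) ss !cmulA.
by rewrite hw (one_star r) unit_l.
Qed.

Lemma cf_sumE (I : Type) (s : seq I) (P : pred I) (G : I -> A) x :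
  (\sum_(k <- s | P k) G k) x = \sum_(k <- s | P k) G k x.
Proof. by elim/big_rec2: _ => // k y1 y2 _ <-. Qed.

Lemma iter_tr_gt0 n (g : T -> K) z : (forall u, 0 <= g u) -> 0 < g z ->
  0 < iter n L g (iter n R z).
Proof.
move=> g0 gz; apply: lt_le_trans (iter_delta_gt0 D n z gz) _.
by apply: le_iter_tr => u _; case: eqP => [->|_].
Qed.

Lemma iter_trA_sq n f x : iter n trA (cfM (cfconj f) f) x = (sq D n f x)%:C%C.
Proof. by rewrite iter_trAE -ip_sq. Qed.

Lemma word_sum ws n f M : (forall u, u \in ws -> (wq u <= n)%N && (wk n u < M)%N) ->
  evs r ws ** (i f ** Sn n) =
  \sum_(k < M) i (\sum_(u <- ws | wk n u == k) wF u f) ** Sn k.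
Proof.
move=> hM; under [RHS]eq_bigr do rewrite linear_sum cmul_suml big_mkcond /=.
rewrite exchange_big /evs cmul_suml !big_seq; apply: eq_bigr => u /hM /andP[uq uk].
rewrite ev_act // (bigD1 (Ordinal uk)) //= eqxx big1 ?addr0 // => k /eqP hk.
by case: eqP => // uk'; case: hk; apply: val_inj.
Qed.

Lemma cross_diag k v F G : (forall z, (v z)^* = v z) ->
  (i F ** Sn k ** i v)^s ** (i G ** Sn k ** i v) =
  i (cfM (cfM v v) (iter k trA (cfM (cfconj F) G))).
Proof.
move=> vr; have sv : (i v)^s = i v by rewrite -ci_conj; apply: ci_ext => z; rewrite cfconjE.
have -> : (i F ** Sn k ** i v)^s ** (i G ** Sn k ** i v) =
    i v ** ((Sn k)^s ** i (cfM (cfconj F) G) ** Sn k) ** i v.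
  by rewrite !cstarM sv ciM ci_conj !cmulA.
by rewrite Sn_tr -!ciM; apply: ci_ext => z; rewrite !cfME; ring.
Qed.

(** Moving [S^j] past the right-hand [v] turns the two bumps into [v * (v o R^j)]. *)
Lemma cross_zero k j v F G : (forall z, v z * v (iter j R z) = 0) ->
  (forall z, (v z)^* = v z) ->
  (i F ** Sn k ** i v)^s ** (i G ** Sn (k + j) ** i v) = 0.
Proof.
move=> v0 vr; have sv : (i v)^s = i v by rewrite -ci_conj; apply: ci_ext => z; rewrite cfconjE.
have -> : (i F ** Sn k ** i v)^s ** (i G ** Sn (k + j) ** i v) =
    i v ** ((Sn k)^s ** i (cfM (cfconj F) G) ** Sn k) ** (Sn j ** i v).
  by rewrite !cstarM sv ciM ci_conj SnD !cmulA.
rewrite Sn_tr Sn_ci cmulA -!ciM (_ : i _ = 0) ?cmul0l //.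
rewrite -[RHS](linear0 i); apply: ci_ext => z; rewrite !cfME iter_alE.
by rewrite mulrAC v0 mul0r.
Qed.

Lemma compress_words ws n f v M :
  (forall u, u \in ws -> (wq u <= n)%N && (wk n u < M)%N) ->
  (forall z, (v z)^* = v z) ->
  (forall z j, (0 < j < M)%N -> v z * v (iter j R z) = 0) ->
  (evs r ws ** (i f ** Sn n) ** i v)^s ** (evs r ws ** (i f ** Sn n) ** i v) =
  i (cfM (cfM v v) (\sum_(k < M) iter k trA
      (cfM (cfconj (\sum_(u <- ws | wk n u == k) wF u f))
           (\sum_(u <- ws | wk n u == k) wF u f)))).
Proof.
move=> hM vr vj; pose F (k : nat) := \sum_(u <- ws | wk n u == k) wF u f.
have -> : evs r ws ** (i f ** Sn n) = \sum_(k < M) i (F k) ** Sn k by exact: word_sum.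
rewrite cmul_suml cstar_sum cmul_suml.
transitivity (\sum_(k < M) (i (F k) ** Sn k ** i v)^s ** (i (F k) ** Sn k ** i v)).
  apply: eq_bigr => k _; rewrite cmul_sumr (bigD1 k) //= big1 ?addr0 // => l lk.
  have [kl|kl|kl] := ltngtP k l; last by rewrite (val_inj kl) eqxx in lk.
    rewrite -{2}(subnKC (ltnW kl)) cross_zero // => z; apply: vj.
    by rewrite subn_gt0 kl (leq_ltn_trans (leq_subr _ _)).
  rewrite -[LHS]cstarK cstarM cstarK -{2}(subnKC (ltnW kl)) cross_zero ?cstar0 // => z.
  by apply: vj; rewrite subn_gt0 kl (leq_ltn_trans (leq_subr _ _)).
under eq_bigr do rewrite cross_diag //.
rewrite -linear_sum; congr (i _); apply/continuousEP => z.
by rewrite cf_sumE cfME cf_sumE mulr_sumr.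
Qed.

(** The point is the order of choices: the bound on [nm z] depends on [d] alone and is fixed before
    the approximation [c] of [h]. Then [z^* h^* h z] is within 1 of [z^* c^* c z = one]. *)
Lemma core_coefficient h (d : K) : 0 < d ->
  (forall e : K, 0 < e -> exists2 ws, nm (h - evs r ws) < e & d <= nm (evj r 0 ws)) ->
  exists z, z^s ** (h^s ** h) ** z = one.
Proof.
move=> d0 hd; pose kap : K := d / 2; have kap0 : 0 < kap by rewrite /kap; lra.
(* [B] will bound [nm z ^+ 2]: on the support of [v] one has [sq D N f < 2] and [gK > kap^2], and
   [z^* z] is a quotient of transfers of these two functions with the same weight. *)
pose B : K := 2 / kap ^+ 2; have B0 : 0 < B by rewrite divr_gt0 ?exprn_gt0.
have H0 := nm_ge0 h; have q0 : 0 < 2 * B * (2 * nm h + 1) by apply: mulr_gt0; [exact: mulr_gt0 | lra].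
have [ws] := hd (Num.min 1 (2 * B * (2 * nm h + 1))^-1) ltac:(by rewrite lt_min ltr01 invr_gt0).
rewrite lt_min; set c := evs r ws => /andP[hc1 hc2] hdc.
have [N hN] : exists N, forall u, u \in ws -> (wq u <= N)%N.
  elim: (ws) => [|u s [N hN]]; first by exists 0%N.
  exists (maxn (wq u) N) => u'; rewrite in_cons => /orP[/eqP ->|/hN h']; first exact: leq_maxl.
  by rewrite (leq_trans h') ?leq_maxr.
have [M0 hM0] : exists M, forall u, u \in ws -> (wk N u < M)%N.
  elim: (ws) => [|u s [M hM]]; first by exists 0%N.
  exists (maxn (wk N u).+1 M) => u'; rewrite in_cons => /orP[/eqP ->|/hM h'].
    by rewrite leq_max leqnn.
  by rewrite (leq_trans h') ?leq_maxr.
(* [N < M] makes [k = N] one of the summands of [g]. The same [M] is the number of iterates that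
   have to leave the support of [v]. *)
pose M := maxn M0 N.+1.
have hM u : u \in ws -> (wq u <= N)%N && (wk N u < M)%N.
  by move=> us; rewrite hN // (leq_trans (hM0 u us)) // leq_maxl.
have [Th [hC hT]] := Core_evj0 hN.
have kd : kap < nm (evj r 0 ws) by apply: lt_le_trans hdc; rewrite /kap; lra.
have [f [y [fy1 fy2]]] := local_vector (ltW kap0) kd hC.
pose F (k : nat) := \sum_(u <- ws | wk N u == k) wF u f.
pose g : A := \sum_(k < M) iter k trA (cfM (cfconj (F k)) (F k)).
pose gK x : K := \sum_(k < M) sq D k (F k) x.
have gE x : g x = (gK x)%:C%C.
  rewrite /g /gK rmorph_sum /= cf_sumE.
  by apply: eq_bigr => k _; exact: iter_trA_sq.
have gK0 x : 0 <= gK x by apply: sumr_ge0 => k _; exact: sq_ge0.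
have gy : kap ^+ 2 < gK y.
  apply: lt_le_trans fy2 _.
  have NM : (N < M)%N by rewrite leq_maxr.
  (* The words with [wk N u = N] are those with [p = q], so [F N] is the image of [f] under the
     degree 0 part. *)
  rewrite /gK (bigD1 (Ordinal NM)) //= (_ : sq D N (Th f) y = sq D N (F N) y).
    by rewrite lerDl sumr_ge0 // => k _; exact: sq_ge0.
  congr (sq _ _ _ _); apply/funext => x; rewrite hT /F.
  rewrite cf_sumE [LHS]big_seq_cond [RHS]big_seq_cond.
  apply: eq_bigl => u; case: (boolP (u \in ws)) => //= /hN.
  by case: u => [[[a p] q] b]; rewrite /wq /wk /=; lia.
pose W : set T := [set x | kap ^+ 2 < gK x /\ sq D N f x < 2].
have nW : nbhs y W.
  have e1 : 0 < gK y - kap ^+ 2 by lra.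
  have /ctsP/(_ y _ e1) n1 := @cts_fun _ _ g.
  have /ctsP/(_ y _ ltr01) n2 := @cts_fun _ _ (iter N trA (cfM (cfconj f) f)).
  apply: filterS2 n1 n2 => x; rewrite !gE !iter_trA_sq -!rmorphB !nm_real /= fy1.
  rewrite !ltr_norml => /andP[_ h1] /andP[h2 _]; split; lra.
have [y' nW' per] := aperiodic D M nW.
have [V nV hV] := wandering per.
have [v [v1 v2 v3]] := dyn_bump D (filterI nW' nV).
pose vK x := nm (v x).
have vE x : v x = (vK x)%:C%C.
  by have /andP[v0 _] := v1 x; rewrite /vK -nmE ger0_norm.
have vr x : (v x)^* = v x by rewrite vE conj_real.
have vV x : v x != 0 -> W x /\ V x.
  by move=> /eqP vx; apply: contrapT => h1; apply: vx; apply: v2.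
have vj z j : (0 < j < M)%N -> v z * v (iter j R z) = 0.
  move=> jM; have [->|/vV[_ Vz]] := eqVneq (v z) 0; first by rewrite mul0r.
  have [->|/vV[_ Vj]] := eqVneq (v (iter j R z)) 0; first by rewrite mulr0.
  by case: (hV z j Vz jM).
pose G := cfM (cfM v v) g.
have XE : (c ** (i f ** Sn N) ** i v)^s ** (c ** (i f ** Sn N) ** i v) = i G.
  exact: compress_words.
pose GK x := vK x ^+ 2 * gK x.
have GE x : G x = (GK x)%:C%C.
  by rewrite /G /GK !cfME gE vE rmorphM rmorphXn /= expr2.
clearbody G.
(* Every fibre of [R^m] contains a point with [v = 1], and there [G] is positive; hence [q] has no
   zero. *)
have [m hm] := dmap_exact D v3.
pose q := iter m trA (cfM (cfM v v) G).
pose qK x := iter m L (fun u => vK u ^+ 2 * GK u) x.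
have qE x : q x = (qK x)%:C%C.
  rewrite /q iter_trAE /qK.
  have -> : (cfM (cfM v v) G : T -> C) = fun u => (vK u ^+ 2 * GK u)%:C%C.
    by apply/funext => u; rewrite !cfME GE vE -!rmorphM -expr2.
  elim: (m) x => //= k ih x; rewrite rmorph_sum; apply: eq_bigr => u _.
  by rewrite ih rmorphM rmorph_nat.
have q_gt0 x : 0 < qK x.
  have [z vz <-] := hm x; apply: iter_tr_gt0 => [u|].
    by rewrite !mulr_ge0 ?exprn_ge0 ?nm_ge0.
  have vz1 : vK z = 1 by rewrite /vK vz nm1.
  rewrite /GK vz1 expr1n !mul1r; have [|[gz _] _] := vV z; first by rewrite vz oner_eq0.
  by apply: lt_trans gz; rewrite exprn_gt0.
have sc : continuous (fun x => Num.sqrt (qK x)^-1).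
  have -> : (fun x => Num.sqrt (qK x)^-1) = (fun x => Num.sqrt (nm (q x))^-1).
    by apply/funext => x; rewrite qE nm_real ger0_norm // ltW.
  move=> x; apply: (@continuous_comp _ _ _ (fun x => (nm (q x))^-1) Num.sqrt);
    last exact: sqrt_continuous.
  apply: cvgV; last exact: nm_cts.
  by rewrite qE nm_real ger0_norm ?gt_eqF // ltW.
have [t tE] : exists t : A, forall x, t x = (Num.sqrt (qK x)^-1)%:C%C by exists (rcf sc).
(* With [t = q^{-1/2}] the compression of [i a] by [s] is [L^m(v^2 a) / q], normalized so that [G]
   goes to 1. *)
pose f' := cfM v (iter m al t).
have f'E x : f' x = (vK x * Num.sqrt (qK (iter m R x))^-1)%:C%C.
  by rewrite /f' cfME iter_alE tE vE rmorphM.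
clearbody f'.
pose s := i f' ** Sn m.
have sand a (aK : T -> K) : (forall x, a x = (aK x)%:C%C) -> exists2 b : A,
    s^s ** i a ** s = i b & forall x, b x =
      ((qK x)^-1 * iter m L (fun u => vK u ^+ 2 * aK u) x)%:C%C.
  move=> aE; exists (iter m trA (cfM (cfM f' f') a)).
    have sf : (i f')^s = i f' by rewrite -ci_conj; apply: ci_ext => x; rewrite cfconjE f'E conj_real.
    have e1 : i (cfM (cfM f' f') a) = i f' ** i a ** i f'.
      by rewrite -!ciM; apply: ci_ext => x; rewrite !cfME; ring.
    by rewrite -Sn_tr e1 /s cstarM sf !cmulA.
  move=> x; rewrite iter_trAE.
  have -> : (cfM (cfM f' f') a : T -> C) =
      fun u => (fun w => (qK w)^-1%:C%C) (iter m R u) * (vK u ^+ 2 * aK u)%:C%C.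
    apply/funext => u; rewrite !cfME f'E aE -!rmorphM; congr (_%:C%C).
    rewrite mulrACA -!expr2 sqr_sqrtr ?invr_ge0 ?ltW //; ring.
  have -> := trn D m (fun u => (vK u ^+ 2 * aK u)%:C%C : C) (fun w => ((qK w)^-1)%:C%C : C) x.
  rewrite rmorphM /=; congr (_ * _).
  elim: (m) x => //= k ih x; rewrite rmorph_sum; apply: eq_bigr => u _.
  by rewrite ih rmorphM rmorph_nat.
have s1 : s^s ** i G ** s = one.
  have [b -> bE] := sand _ _ GE; apply: ci_ext => x.
  by rewrite bE -/(qK x) mulVf ?gt_eqF.
pose z := i f ** Sn N ** i v ** s.
have zc : z^s ** (c^s ** c) ** z = one.
  rewrite -s1 -XE /z !cstarM !cmulA //.
have zB : nm z ^+ 2 <= B.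
  pose w := cfM (cfM v v) (iter N trA (cfM (cfconj f) f)).
  have wE x : w x = (vK x ^+ 2 * sq D N f x)%:C%C.
    by rewrite /w !cfME iter_trA_sq vE rmorphM rmorphXn /= expr2.
  have [b bS bE] := sand _ _ wE.
  rewrite -nm_cstar2; have -> : z^s ** z = i b.
    rewrite -bS /w ciM -Sn_tr /z !ciM !ci_conj.
    have sv : (i v)^s = i v by rewrite -ci_conj; apply: ci_ext => x; rewrite cfconjE.
    have vcomm : i v ** i (iter N trA (cfM (cfconj f) f)) = i (iter N trA (cfM (cfconj f) f)) ** i v.
      by rewrite -!ciM; apply: ci_ext => x; rewrite !cfME mulrC.
    move: vcomm; rewrite -Sn_tr ciM ci_conj => vcomm.
    rewrite !cstarM sv -[i v ** i v ** _]cmulA vcomm !cmulA //.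
  apply: nm_ci; first exact: ltW.
  move=> x; rewrite bE nm_real ger0_norm; last first.
    apply: mulr_ge0; first by rewrite invr_ge0 ltW.
    apply: le_trans (_ : 0 * iter m L (fun=> 0 : K) x <= _); first by rewrite mul0r.
    rewrite -iter_trZ; apply: le_iter_tr => u _.
    by rewrite mul0r !mulr_ge0 ?exprn_ge0 ?nm_ge0 ?sq_ge0.
  rewrite mulrC ler_pdivrMr // /qK -iter_trZ; apply: le_iter_tr => u _.
  have [vu|/vV[[gu fu] _]] := eqVneq (v u) 0.
    by rewrite /vK vu nm0 !expr0n /= !mul0r mulr0.
  have v20 : 0 <= vK u ^+ 2 by rewrite exprn_ge0 ?nm_ge0.
  have -> : B * (vK u ^+ 2 * GK u) = vK u ^+ 2 * (vK u ^+ 2 * (B * gK u)).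
    by rewrite /GK; ring.
  rewrite ler_wpM2l // ler_wpM2l //; apply: le_trans (ltW fu) _.
  have -> : 2 = B * kap ^+ 2 by rewrite /B divfK // gt_eqF ?exprn_gt0.
  by rewrite ler_wpM2l ?ltW.
apply: (@scale_to_one h z).
have -> : one - z^s ** (h^s ** h) ** z = - (z^s ** (h^s ** h - c^s ** c) ** z).
  by rewrite cmulBr cmulBl opprB zc.
rewrite nmN.
have hcc : nm (h^s ** h - c^s ** c) <= nm (h - c) * (2 * nm h + 1).
  have -> : h^s ** h - c^s ** c = h^s ** (h - c) + (h - c)^s ** c.
    by rewrite cmulBr cstarB cmulBl addrA subrK.
  apply: le_trans (nmD _ _) _.
  have := nm_cmul h^s (h - c); have := nm_cmul (h - c)^s c; rewrite !nm_cstar.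
  have := nm_ler_dist c h; rewrite nmBC; have := nm_ge0 (h - c); nra.
have := nm_cmul (z^s ** (h^s ** h - c^s ** c)) z.
have := nm_cmul z^s (h^s ** h - c^s ** c); rewrite nm_cstar.
move: hc2; rewrite -[_^-1]mul1r ltr_pdivlMr // => hc2.
set X := nm (h^s ** h - _) in hcc *; set Y := nm (z^s ** _) => k1 k2.
apply: le_lt_trans k2 _.
have Z0 := nm_ge0 z.
apply: le_lt_trans (ler_wpM2r Z0 k1) _.
have -> : nm z * X * nm z = nm z ^+ 2 * X by ring.
have X0 : 0 <= X := nm_ge0 _.
apply: le_lt_trans (ler_pM (exprn_ge0 2 Z0) X0 zB hcc) _.
move: hc2; set u := nm (h - c); lra.
Qed.

(* Shifting by S turns the j-th Fourier coefficient into the 0-th one. *)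
Lemma sandwich_one h : h != 0 -> exists z, z^s ** (h^s ** h) ** z = one.
Proof.
move=> h0; have [j [d d0 hd]] := fourier_neq0 r h0.
have dg0 : (0 : K) < (deg D)%:R by rewrite ltr0n; have := deg_ge2 D; lia.
have SS n : (Sn n)^s ** Sn n = (deg D)%:R ^+ n *: one.
  elim: n => [|n ih]; first by rewrite expr0 scale1r /Sn /= (one_star r) unit_l.
  rewrite SnS cstarM cmulA -[_ ** S^s ** S]cmulA SsS cmulZr unit_r cmulZl ih.
  by rewrite scalerA -exprS.
have dgn n : (deg D)%:R ^+ n != 0 :> C.
  by rewrite expf_neq0 // pnatr_eq0; have := deg_ge2 D; case: (deg D).
have nmSS n : nm ((Sn n)^s ** Sn n) = (deg D)%:R ^+ n.
  have one1 : nm one = 1.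
    have [x x0] := ci_neq0 r; have h1 := nm_cmul one x; rewrite unit_l in h1.
    have x1 : 0 < nm x by rewrite nm_gt0.
    by apply/eqP; rewrite eq_le (nm_unit (unit_l r)) -(ler_pM2r x1) mul1r.
  by rewrite SS nmZ nmX nm_nat one1 mulr1.
have dgn1 n : (1 : K) <= (deg D)%:R ^+ n.
  by apply: exprn_ege1; rewrite ler1n; have := deg_ge2 D; lia.
have p0 n : 0 < nm (Sn n) + 1 by have := nm_ge0 (Sn n); lra.
have [j0|j0] := leP 0 j; pose n := `|j|%N.
- have [|z hz] := @core_coefficient (h ** (Sn n)^s) d d0; last first.
    exists ((Sn n)^s ** z); rewrite -hz !cstarM cstarK !cmulA //.
  move=> e e0; have [ws hws1 hws2] := hd (e / (nm (Sn n) + 1)) ltac:(by rewrite divr_gt0).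
  pose sh (u : word) : word := let: (a, p, q, b) := u in (a, p, q + n, iter n al b)%N.
  have shE u : ev r (sh u) = ev r u ** (Sn n)^s.
    case: u => [[[a p] q] b] /=; rewrite -[RHS]cmulA ci_Sns addnC SnD cstarM.
    by rewrite !cmulA.
  exists (map sh ws).
    have -> : evs r (map sh ws) = evs r ws ** (Sn n)^s.
      by rewrite /evs big_map cmul_suml; apply: eq_bigr.
    rewrite -cmulBl; apply: le_lt_trans (nm_cmul _ _) _; rewrite nm_cstar.
    move: hws1; rewrite ltr_pdivlMr //; have := nm_ge0 (h - evs r ws); nra.
  have -> : evj r 0 (map sh ws) = evj r j ws ** (Sn n)^s.
    rewrite /evj big_map cmul_suml; apply: eq_big => // u.
    by case: u => [[[a p] q] b] /=; rewrite /n; lia.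
  (* [S^*n S^n] is the scalar [deg^n >= 1], so multiplication by [S^*n] on the right does not shrink
     the coefficient. *)
  apply: le_trans hws2 _; set x := evj r j ws.
  rewrite -(@ler_pXn2r _ 2) ?nnegrE ?nm_ge0 //.
  have <- : nm ((x ** (Sn n)^s) ** (x ** (Sn n)^s)^s) = nm (x ** (Sn n)^s) ^+ 2.
    by rewrite -{1}[x ** _]cstarK nm_cstar2 nm_cstar.
  have -> : x ** (Sn n)^s ** (x ** (Sn n)^s)^s = (deg D)%:R ^+ n *: (x ** x^s).
    rewrite cstarM cstarK cmulA -[x ** _ ** Sn n]cmulA SS cmulZr unit_r cmulZl //.
  have -> : nm ((deg D)%:R ^+ n *: (x ** x^s)) = (deg D)%:R ^+ n * nm x ^+ 2.
    by rewrite nmZ nmX nm_nat -{1}[x]cstarK nm_cstar2 nm_cstar.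
  by rewrite ler_peMl ?exprn_ge0 ?nm_ge0.
- have [|z hz] := @core_coefficient (Sn n ** h) d d0; last first.
    (* Here [(S^n h)^* (S^n h) = deg^n h^* h]; the scalar goes into [z], and the defect is exactly
       0. *)
    apply: (@scale_to_one h ((Num.sqrt ((deg D)%:R ^+ n))%:C%C *: z)).
    have -> : one - ((Num.sqrt ((deg D)%:R ^+ n))%:C%C *: z)^s ** (h^s ** h) **
      ((Num.sqrt ((deg D)%:R ^+ n))%:C%C *: z) = 0; last by rewrite nm0 ltr01.
    rewrite cstarZ conj_real !(cmulZl, cmulZr) scalerA -rmorphM -expr2.
    rewrite sqr_sqrtr ?exprn_ge0 ?ler0n // rmorphXn rmorph_nat /= -hz.
    rewrite cstarM -!cmulA [(Sn n)^s ** _]cmulA SS cmulZl !cmulZr unit_l.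
    by rewrite !cmulA subrr.
  move=> e e0; have [ws hws1 hws2] := hd (e / (nm (Sn n) + 1)) ltac:(by rewrite divr_gt0).
  pose sh (u : word) : word := let: (a, p, q, b) := u in (iter n al a, n + p, q, b)%N.
  have shE u : ev r (sh u) = Sn n ** ev r u.
    by case: u => [[[a p] q] b] /=; rewrite !cmulA Sn_ci SnD !cmulA.
  exists (map sh ws).
    have -> : evs r (map sh ws) = Sn n ** evs r ws.
      by rewrite /evs big_map cmul_sumr; apply: eq_bigr.
    rewrite -cmulBr; apply: le_lt_trans (nm_cmul _ _) _.
    move: hws1; rewrite ltr_pdivlMr //; have := nm_ge0 (h - evs r ws); nra.
  have -> : evj r 0 (map sh ws) = Sn n ** evj r j ws.
    rewrite /evj big_map cmul_sumr; apply: eq_big => // u.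
    by case: u => [[[a p] q] b] /=; rewrite /n; lia.
  apply: le_trans hws2 _; set x := evj r j ws.
  rewrite -(@ler_pXn2r _ 2) ?nnegrE ?nm_ge0 // -!nm_cstar2.
  have -> : (Sn n ** x)^s ** (Sn n ** x) = (deg D)%:R ^+ n *: (x^s ** x).
    by rewrite cstarM cmulA -[_ ** Sn n]cmulA SS cmulZr unit_r cmulZl.
  by rewrite nmZ nmX nm_nat ler_peMl ?nm_ge0.
Qed.

(** If [a] is nonzero somewhere, exactness makes some [L^n(|a|^2)] invertible, while [i] sends it to
    [S^*n i(a)^* i(a) S^n]. So [i a = 0] would force [one = 0]. *)
Lemma ci_inj a : i a = 0 -> forall x, a x = 0.
Proof.
move=> a0 x; apply: contrapT => /eqP ax.
have /ctsP/(_ x (nm (a x))) := @cts_fun _ _ a; rewrite nm_gt0 => /(_ ax) n1.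
have [n hn] := dmap_exact D n1.
pose q := iter n trA (cfM (cfconj a) a).
have q0 y : 0 < sq D n a y.
  have [z az <-] := hn y; apply: iter_tr_gt0 => [u|]; first by rewrite exprn_ge0 ?nm_ge0.
  rewrite exprn_gt0 // nm_gt0; apply/eqP => az0; move: az.
  by rewrite az0 subr0 ltxx.
have sc : continuous (fun x => (sq D n a x)^-1).
  have -> : (fun x => (sq D n a x)^-1) = (fun x => (nm (q x))^-1).
    by apply/funext => y; rewrite /q iter_trA_sq nm_real ger0_norm // ltW.
  move=> y; apply: cvgV; last exact: nm_cts.
  by rewrite /q iter_trA_sq nm_real ger0_norm ?gt_eqF // ltW.
have : i (cfM q (rcf sc)) = 0.
  by rewrite ciM /q -Sn_tr ciM a0 !(cmul0r, cmul0l).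
have -> : i (cfM q (rcf sc)) = one.
  apply: ci_ext => y; rewrite cfME rcfE /q iter_trA_sq -rmorphM mulfV //.
  by rewrite gt_eqF.
move=> one0; have [y y0] := ci_neq0 r; case/negP: y0; apply/eqP.
by rewrite -(unit_l r y) one0 cmul0l.
Qed.

Lemma simple_covrep : simple_cstar O.
Proof.
split; first exact: (ci_neq0 r).
move=> I [cI [I0 IL] IM].
have [hI|/existsNP[h /not_implyP[Ih h0]]] := pselect (forall h, I h -> h = 0).
  by left; apply/seteqP; split => [h /hI ->|h ->].
right; have [z hz] := sandwich_one (introN eqP h0).
have I1 : I one.
  rewrite -hz; have h2 := (IM h^s h Ih).1; have h3 := (IM z^s _ h2).1.
  exact: (IM z _ h3).2.
by apply/seteqP; split => // x _; rewrite -[x](unit_r r); exact: (IM x one I1).1.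
Qed.

(** Otherwise conjugating [i v] by [S S^*] gives [deg v = (L v) o R], which is constant on fibres
    for every [v], whereas [R] is not injective. This makes [S / sqrt deg] a proper isometry. *)
Lemma SSs_neq : S ** S^s <> (deg D)%:R *: one.
Proof.
move=> h; have [x1 [x2 [x12 Rx]]] := dmap_ninj D.
have n1 : nbhs x1 [set z | z \notin [:: x2]] by apply: (nbhs_notin D); rewrite inE.
have [v [_ v2 /nbhs_singleton v3]] := dyn_bump D n1.
have d0 : (deg D)%:R != 0 :> C by rewrite pnatr_eq0; have := deg_ge2 D; case: (deg D).
have e1 : (deg D)%:R *: ((deg D)%:R *: i v) = (deg D)%:R *: i (al (trA v)).
  have <- : S ** S^s ** i v ** (S ** S^s) = (deg D)%:R *: ((deg D)%:R *: i v).
    by rewrite h cmulZl unit_l cmulZl cmulZr unit_r.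
  have -> : S ** S^s ** i v ** (S ** S^s) = S ** (S^s ** i v ** S) ** S^s.
    by rewrite !cmulA.
  by rewrite cS_tr cS_ci -cmulA h cmulZr unit_r.
have e2 : i ((deg D)%:R *: v - al (trA v)) = 0.
  by rewrite linearB linearZ; apply/eqP; rewrite subr_eq0; apply/eqP; exact: (scalerI d0 e1).
have e3 x : (deg D)%:R * v x = trA v (R x).
  by apply/eqP; rewrite -subr_eq0; apply/eqP; exact: (ci_inj e2 x).
have : (deg D)%:R * v x1 = (deg D)%:R * v x2 by rewrite !e3 Rx.
rewrite v3 v2 /= ?inE ?eqxx // mulr1 mulr0 => /eqP; rewrite (negbTE d0) //.
Qed.

(** [u = h z] is an isometry whose range projection lies below a multiple of [h h^*], hence in [H].
    Conjugating the proper isometry [S / sqrt deg] by [u] shows that this projection is infinite. *)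
Lemma purely_infinite_covrep : purely_infinite O.
Proof.
move=> H [cH [H0 HL] HM Hs] hH Hn0.
have [h Hh h0] : exists2 h, H h & h != 0.
  apply: contrapT => hn; apply: Hn0; apply/seteqP; split => [h Hh|h -> //].
  by apply: contrapT => /eqP h0; apply: hn; exists h.
have [z hz] := sandwich_one h0.
pose u := h ** z; have uu : u^s ** u = one by rewrite -hz /u cstarM !cmulA.
pose p := u ** u^s.
have dg0 : (0 : K) < (deg D)%:R by rewrite ltr0n; have := deg_ge2 D; lia.
exists p.
  pose c : K := nm z ^+ 2 + 1.
  have c0 : 0 < c by have := exprn_ge0 2 (nm_ge0 z); rewrite /c; lra.
  pose t := (c^-1)%:C%C *: (z ** z^s).
  have st : t^s = t by rewrite cstarZ conj_real cstarM cstarK.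
  have t1 : nm t < 1.
    rewrite nmZ nm_real ger0_norm ?invr_ge0 ?ltW // -{1}[z]cstarK nm_cstar2 nm_cstar.
    by rewrite mulrC ltr_pdivrMr // mul1r /c; lra.
  (* The square root [one - s] of [one - z z^* / c] exhibits [c h h^* - p] in the required form
     [y^* y]. *)
  have [s [ss _ hs _]] := sqrt_unit_sub (unit_l r) (unit_r r) st t1.
  apply: (hH _ (c%:C%C *: (h ** h^s))).
  - by exists u^s; rewrite cstarK.
  - exists ((Num.sqrt c)%:C%C *: ((one - s) ** h^s)).
    rewrite cstarZ conj_real cmulZl cmulZr scalerA -rmorphM -expr2 sqr_sqrtr ?ltW //.
    rewrite cstarM cstarK cstarB (one_star r) ss.
    have -> : h ** (one - s) ** ((one - s) ** h^s) = h ** ((one - s) ** (one - s)) ** h^s.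
      by rewrite !cmulA.
    rewrite hs cmulBr cmulBl unit_r scalerBr /t cmulZr cmulZl scalerA -rmorphM mulfV ?gt_eqF //.
    by rewrite scale1r /p /u cstarM !cmulA.
  - have := HL c%:C%C (h ** h^s) 0; rewrite addr0; apply => //; apply: HM => //; exact: Hs.
clearbody u.
have pp : p ** p = p by rewrite /p cmulA -[u ** u^s ** u]cmulA uu unit_r.
split; first by split => //; rewrite /p cstarM cstarK.
pose l : C := ((Num.sqrt (deg D)%:R)^-1)%:C%C.
have ll : l * l = (deg D)%:R^-1.
  rewrite /l -rmorphM -expr2 exprVn sqr_sqrtr ?ltW // fmorphV rmorph_nat //.
have lr : l^* = l by exact: conj_real.
have d0 : (deg D)%:R != 0 :> C by rewrite pnatr_eq0; have := deg_ge2 D; case: (deg D).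
pose S' := l *: S.
have S'S' : S'^s ** S' = one.
  by rewrite cstarZ lr cmulZl cmulZr scalerA ll SsS scalerA mulVf // scale1r.
have S'E : S' ** S'^s = (l * l) *: (S ** S^s) by rewrite cstarZ lr cmulZl cmulZr scalerA.
clearbody S'; exists (u ** S' ** u^s); split.
- have -> : (u ** S' ** u^s)^s ** (u ** S' ** u^s) = u ** (S'^s ** (u^s ** u) ** S') ** u^s.
    by rewrite !cstarM cstarK !cmulA.
  by rewrite uu unit_r S'S' unit_r.
- pose E := one - S' ** S'^s.
  have EE : E^s ** E = E.
    rewrite /E cstarB cstarM cstarK (one_star r) cmulBl !cmulBr !unit_l unit_r.
    have -> : S' ** S'^s ** (S' ** S'^s) = S' ** S'^s.
      by rewrite cmulA -[S' ** S'^s ** S']cmulA S'S' unit_r.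
    by rewrite subrr subr0.
  exists (E ** u^s).
  have -> : (E ** u^s)^s ** (E ** u^s) = u ** (E^s ** E) ** u^s.
    by rewrite cstarM cstarK !cmulA.
  rewrite EE /E cmulBr cmulBl unit_r /p; congr (_ - _).
  have -> : u ** S' ** u^s ** (u ** S' ** u^s)^s = u ** S' ** (u^s ** u) ** S'^s ** u^s.
    by rewrite !cstarM cstarK !cmulA.
  by rewrite uu unit_r !cmulA.
- move=> hv; apply: SSs_neq.
  have : u^s ** (u ** S' ** u^s ** (u ** S' ** u^s)^s) ** u = u^s ** p ** u by rewrite hv.
  have -> : u^s ** (u ** S' ** u^s ** (u ** S' ** u^s)^s) ** u =
      (u^s ** u) ** S' ** (u^s ** u) ** S'^s ** (u^s ** u).
    by rewrite !cstarM cstarK !cmulA.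
  have -> : u^s ** p ** u = (u^s ** u) ** (u^s ** u) by rewrite /p !cmulA.
  rewrite uu !(unit_l, unit_r) => h1.
  by rewrite -h1 S'E scalerA ll mulfV // scale1r.
Qed.

End Final.

(** * The Riemann sphere and rational maps *)

Section Sphere.
Variable K : realType.
Local Notation C := (Cplx K).
Implicit Types (v w u : C * C) (x y z : sphere K).

(** Homogeneous coordinates: [vec] picks a representative, [pt] projects back, and the geometry of
    the sphere is expressed by the determinant [wedge] and the Hermitian norm [en]. *)
Definition vec (x : sphere K) : C * C := if x is Some w then (w, 1) else (1, 0).
Definition pt (v : C * C) : sphere K := if v.2 == 0 then None else Some (v.1 / v.2).
Definition wedge v w : C := v.1 * w.2 - v.2 * w.1.
Definition sc (c : C) v : C * C := (c * v.1, c * v.2).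
Definition en2 v : K := nm v.1 ^+ 2 + nm v.2 ^+ 2.
Definition en v : K := Num.sqrt (en2 v).

Lemma en2_ge0 v : 0 <= en2 v.
Proof. by rewrite addr_ge0 ?sqr_ge0. Qed.

Lemma en_ge0 v : 0 <= en v. Proof. exact: sqrtr_ge0. Qed.

Lemma en_sq v : en v ^+ 2 = en2 v. Proof. by rewrite sqr_sqrtr // en2_ge0. Qed.

Lemma en_gt0 v : (0 < en v) = (v.1 != 0) || (v.2 != 0).
Proof.
rewrite sqrtr_gt0 lt_def en2_ge0 andbT paddr_eq0 ?sqr_ge0 // !sqrf_eq0 !nm_eq0.
by rewrite negb_and.
Qed.

Lemma en_sc c v : en (sc c v) = nm c * en v.
Proof.
rewrite /en /en2 /= !nmM !exprMn -mulrDr sqrtrM ?sqr_ge0 // sqrtr_sqr.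
by rewrite ger0_norm ?nm_ge0.
Qed.

Lemma nm1_en v : nm v.1 <= en v.
Proof.
by rewrite -ler_sqr ?nnegrE ?nm_ge0 ?en_ge0 // en_sq lerDl sqr_ge0.
Qed.

Lemma nm2_en v : nm v.2 <= en v.
Proof.
by rewrite -ler_sqr ?nnegrE ?nm_ge0 ?en_ge0 // en_sq lerDr sqr_ge0.
Qed.

Lemma en_le v : en v <= nm v.1 + nm v.2.
Proof.
rewrite -ler_sqr ?nnegrE ?en_ge0 ?addr_ge0 ?nm_ge0 // en_sq sqrrD /en2.
by have := mulr_ge0 (nm_ge0 v.1) (nm_ge0 v.2); lra.
Qed.

Lemma wedgeC v w : wedge v w = - wedge w v.
Proof. by rewrite /wedge; ring. Qed.

Lemma wedge_scl c v w : wedge (sc c v) w = c * wedge v w.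
Proof. by rewrite /wedge /=; ring. Qed.

Lemma wedge_scr c v w : wedge v (sc c w) = c * wedge v w.
Proof. by rewrite /wedge /=; ring. Qed.

Lemma wedgexx v : wedge v v = 0.
Proof. by rewrite /wedge; ring. Qed.

Lemma lagrange v w :
  nm (wedge v w) ^+ 2 + nm (v.1 * (w.1)^* + v.2 * (w.2)^*) ^+ 2 = en2 v * en2 w.
Proof.
apply: (@complexI K); rewrite rmorphD /= -!conjM_nm /en2 rmorphM /= !rmorphD /=.
by rewrite -!conjM_nm /wedge !(rmorphB, rmorphD, rmorphM) /= !conjCK; ring.
Qed.

Lemma wedge_en v w : nm (wedge v w) <= en v * en w.
Proof.
rewrite -ler_sqr ?nnegrE ?nm_ge0 ?mulr_ge0 ?en_ge0 // exprMn !en_sq -lagrange.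
by rewrite lerDl sqr_ge0.
Qed.

Lemma wedge_eq0 v w : 0 < en v -> 0 < en w ->
  (wedge v w == 0) = (pt v == pt w).
Proof.
rewrite !en_gt0 /pt /wedge; case: v w => [a b] [c e] /=.
case: (eqVneq b 0) => [->|b0]; case: (eqVneq e 0) => [->|e0] /=; rewrite ?orbF.
- by rewrite mulr0 mul0r subrr !eqxx.
- by move=> a0 _; rewrite mul0r subr0 mulf_eq0 (negbTE a0) (negbTE e0).
- by move=> _ c0; rewrite mulr0 sub0r oppr_eq0 mulf_eq0 (negbTE b0) (negbTE c0).
- move=> _ _; rewrite subr_eq0 (inj_eq (@Some_inj _)).
  by rewrite eqr_div // [c * b]mulrC.
Qed.

Lemma vec_gt0 x : 0 < en (vec x).
Proof. by rewrite en_gt0; case: x => [w|] /=; rewrite ?oner_eq0 ?orbT. Qed.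

Lemma pt_vec x : pt (vec x) = x.
Proof. by case: x => [w|]; rewrite /pt /= ?eqxx // oner_eq0 divr1. Qed.

Lemma vec_pt v : 0 < en v -> exists2 c, c != 0 & v = sc c (vec (pt v)).
Proof.
rewrite en_gt0 /pt; case: v => a b /=; case: (eqVneq b 0) => [->|b0].
  by rewrite orbF => a0; exists a; rewrite // /sc /= mulr1 mulr0.
by move=> _; exists b => //; rewrite /sc /= mulr1 mulrC divfK.
Qed.

Lemma sc_gt0 c v : c != 0 -> 0 < en v -> 0 < en (sc c v).
Proof. by move=> c0 v0; rewrite en_sc mulr_gt0 ?nm_gt0. Qed.

Lemma pt_sc c v : c != 0 -> pt (sc c v) = pt v.
Proof.
move=> c0; rewrite /pt /= mulf_eq0 (negbTE c0) /=; case: eqVneq => // v0.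
by rewrite -mulf_div mulfV // mul1r.
Qed.

(** Half the Euclidean distance of the stereographic images ([stereo_chd]), written in homogeneous
    coordinates. *)
Definition chd x z : K := nm (wedge (vec x) (vec z)) / (en (vec x) * en (vec z)).

Lemma chd_pt v w : 0 < en v -> 0 < en w ->
  chd (pt v) (pt w) = nm (wedge v w) / (en v * en w).
Proof.
move=> v0 w0; have [c c0 hv] := vec_pt v0; have [e e0 hw] := vec_pt w0.
rewrite [in RHS]hv [in RHS]hw !en_sc wedge_scl wedge_scr !nmM /chd.
have := vec_gt0 (pt v); have := vec_gt0 (pt w).
move: c0 e0; rewrite -!nm_gt0 => c0 e0 h1 h2; field.
by rewrite !gt_eqF.
Qed.

Lemma chd_ge0 x z : 0 <= chd x z.
Proof. by rewrite divr_ge0 ?nm_ge0 ?mulr_ge0 ?en_ge0. Qed.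

Lemma chdC x z : chd x z = chd z x.
Proof. by rewrite /chd wedgeC nmN mulrC [en _ * _]mulrC mulrC. Qed.

Lemma chd_eq0 x z : (chd x z == 0) = (x == z).
Proof.
rewrite mulf_eq0 invr_eq0 mulf_eq0 ![en _ == 0]gt_eqF ?vec_gt0 // !orbF nm_eq0.
by rewrite wedge_eq0 ?vec_gt0 // !pt_vec.
Qed.

Lemma chdxx x : chd x x = 0. Proof. by apply/eqP; rewrite chd_eq0. Qed.

Lemma chd_gt0 x z : (0 < chd x z) = (x != z).
Proof. by rewrite lt_def chd_ge0 andbT chd_eq0. Qed.

Lemma chd_le1 x z : chd x z <= 1.
Proof. by rewrite ler_pdivrMr ?mulr_gt0 ?vec_gt0 // mul1r wedge_en. Qed.

Lemma chd_unit v w : en v = 1 -> en w = 1 -> chd (pt v) (pt w) = nm (wedge v w).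
Proof. by move=> v1 w1; rewrite chd_pt ?v1 ?w1 ?ltr01 // mulr1 divr1. Qed.

Lemma unit_vec x : exists2 v, en v = 1 & pt v = x.
Proof.
have h := vec_gt0 x; exists (sc ((en (vec x))^-1)%:C%C (vec x)).
  by rewrite en_sc nm_real ger0_norm ?invr_ge0 ?en_ge0 // mulVf ?gt_eqF.
by rewrite pt_sc ?pt_vec // -nm_eq0 nm_real normr_eq0 invr_eq0 gt_eqF.
Qed.

Lemma stereo_chd x z :
  let s := stereo x in let t := stereo z in
  (s.1.1 - t.1.1) ^+ 2 + (s.1.2 - t.1.2) ^+ 2 + (s.2 - t.2) ^+ 2 = 4 * chd x z ^+ 2.
Proof.
have pos (a b : K) : 1 + (a ^+ 2 + b ^+ 2) != 0.
  by rewrite gt_eqF // ltr_pwDl ?addr_ge0 ?sqr_ge0.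
rewrite /chd !exprMn exprVn exprMn !en_sq /en2 !nm_sq /wedge.
case: x z => [[a b]|] [[c e]|] /=; rewrite ?(expr0n, mul0r, mulr0, addr0, add0r, subr0, mul1r,
    mulr1, expr1n, subrr, oppr0, invr1) //.
- have h1 := pos a b; have h2 := pos c e; field.
  by rewrite ![_ + _ + 1]addrC ?addrA -?addrA ?h1 ?h2.
- have h1 := pos a b; field.
  by rewrite ?[_ + _ + 1]addrC ?addrA -?addrA ?h1.
- have h1 := pos c e; field.
  by rewrite ?[_ + _ + 1]addrC ?addrA -?addrA ?h1.
Qed.

Lemma stereo_ball x z (e : K) : 0 < e -> chd x z < e -> ball (stereo x) (2 * e) (stereo z).
Proof.
move=> e0 h; have /= := stereo_chd x z; set s := stereo x; set t := stereo z => H.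
have key (a b c : K) : a ^+ 2 + b ^+ 2 + c ^+ 2 = 4 * chd x z ^+ 2 -> `|a| < 2 * e.
  move=> hh; rewrite -ltr_sqr ?nnegrE ?normr_ge0 ?mulr_ge0 ?ltW //.
  rewrite real_normK ?num_real //.
  have : chd x z ^+ 2 < e ^+ 2 by rewrite ltr_sqr ?nnegrE ?chd_ge0 ?ltW.
  have -> : (2 * e) ^+ 2 = 4 * e ^+ 2 by ring.
  have := sqr_ge0 b; have := sqr_ge0 c; lra.
split; [split|]; rewrite /ball /=; apply: key.
- exact: H.
- by rewrite -H addrAC; congr (_ + _); rewrite addrC.
- by rewrite -H -addrA addrC.
Qed.

Lemma ball_stereo x z (e : K) : 0 < e -> ball (stereo x) e (stereo z) -> chd x z < e.
Proof.
move=> e0 [[h1 h2] h3]; rewrite /ball /= in h1 h2 h3.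
rewrite -ltr_sqr ?nnegrE ?chd_ge0 ?ltW //.
have sq (a : K) : `|a| < e -> a ^+ 2 < e ^+ 2.
  by move=> h; rewrite -(real_normK (num_real a)) ltr_sqr ?nnegrE ?normr_ge0 ?ltW.
have /= := stereo_chd x z; have := sq _ h1; have := sq _ h2; have := sq _ h3.
by have := exprn_gt0 2 e0; lra.
Qed.

(** Obtained from the triangle inequality of the maximum norm on [R^3], through which the topology
    of the sphere is given; the passage there costs the factor 2. *)
Lemma chd_triangle y x z : chd x z <= 2 * (chd x y + chd y z).
Proof.
apply/ler_addgt0Pr => e e0; apply: ltW.
have e4 : 0 < e / 4 by lra.
have h1 : ball (stereo x) (2 * (chd x y + e / 4)) (stereo y).
  by apply: stereo_ball; rewrite ?ltrDl // ltr_wpDl ?chd_ge0.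
have h2 : ball (stereo y) (2 * (chd y z + e / 4)) (stereo z).
  by apply: stereo_ball; rewrite ?ltrDl // ltr_wpDl ?chd_ge0.
have := ball_triangle h1 h2; move/ball_stereo => h.
have : chd x z < 2 * (chd x y + e / 4) + 2 * (chd y z + e / 4).
  by apply: h; have := chd_ge0 x y; have := chd_ge0 y z; lra.
by lra.
Qed.

Lemma nbhs_chd x (U : set (sphere K)) :
  nbhs x U <-> exists2 e : K, 0 < e & forall z, chd x z < e -> U z.
Proof.
rewrite -nbhs_ballE; split=> [[e /= e0 h]|[e e0 h]].
  exists (e / 2); first lra.
  move=> z hz; apply: h; rewrite -initial_ballE /=.
  have -> : e = 2 * (e / 2) by lra.
  by apply: stereo_ball; [lra|].
exists e => //= z; rewrite -initial_ballE /= => hz; apply: h.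
exact: ball_stereo.
Qed.

Lemma entourage_chd (E : set (sphere K * sphere K)) :
  entourage E <-> exists2 e : K, 0 < e & forall x z, chd x z < e -> E (x, z).
Proof.
rewrite -entourage_ballE; split=> [[e /= e0 h]|[e e0 h]].
  exists (e / 2); first lra.
  move=> x z hz; apply: h; rewrite /= -initial_ballE /=.
  have -> : e = 2 * (e / 2) by lra.
  by apply: stereo_ball; [lra|].
exists e => //= -[x z] /=; rewrite -initial_ballE /= => hz; apply: h.
exact: ball_stereo.
Qed.

Lemma open_chd x (e : K) : 0 < e ->
  exists U : set (sphere K), [/\ open U, U x & forall z, U z -> chd x z < e].
Proof.
move=> e0; have : nbhs x [set z | chd x z < e] by apply/nbhs_chd; exists e.
rewrite nbhsE => -[U [oU Ux] h]; exists U; split => //.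
Qed.

End Sphere.

(** * Limits along ultrafilters *)

Section UltraLimits.
Variables (K : realType) (I : Type) (F : set_system I).
Hypothesis FU : UltraFilter F.
Local Notation C := (Cplx K).

Lemma ultra_pushforward (T : Type) (f : I -> T) : UltraFilter (fmap f F).
Proof.
split=> [|G]; first exact: fmap_proper_filter.
move=> PG FG; apply/seteqP; split=> // A GA; have [//|nA] := in_ultra_setVsetC (f @^-1` A) FU.
have : G (~` A) by apply: FG.
by move=> /(filterI GA); rewrite setICr => /filter_not_empty.
Qed.

(** Bounded quantities converge along an ultrafilter all at once, which takes the place of
    extracting subsequences and of diagonal arguments. *)
Lemma rulim (u : I -> K) (M : K) : (\forall n \near F, `|u n| <= M) ->
  exists l : K, u @ F --> l.
Proof.
move=> h; have := @segment_compact K (- M) M; rewrite compact_ultra => /(_ (u @ F)).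
have FU' := ultra_pushforward u.
case/(_ FU' _) => [|l [_ hl]]; last by exists l.
by apply: filterS h => n; rewrite ler_norml /= in_itv.
Qed.

Lemma cvg_nm (u : I -> C) (l : C) : u @ F --> l <->
  forall e : K, 0 < e -> \forall n \near F, nm (u n - l) < e.
Proof.
split=> [/cvgrPdist_lt h e e0|h].
  have := h e%:C%C; rewrite ltcR => /(_ e0); apply: filterS => n.
  by rewrite lt_nm nmBC.
apply/cvgrPdist_lt => e e0; have e0' : 0 < complex.Re e by rewrite -ltcR RRe_real // gtr0_real.
apply: filterS (h _ e0') => n; rewrite -(RRe_real (gtr0_real e0)) lt_nm nmBC //.
Qed.

Lemma culim (u : I -> C) (M : K) : (\forall n \near F, nm (u n) <= M) ->
  exists l : C, u @ F --> l.
Proof.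
move=> h.
have reM (z : C) : `|complex.Re z| <= nm z.
  by rewrite ler_norml re_le_nm andbT lerNl -(nmN z); apply: le_trans (re_le_nm _); case: z.
have imM (z : C) : `|complex.Im z| <= nm z.
  by rewrite ler_norml im_le_nm andbT lerNl -(nmN z); apply: le_trans (im_le_nm _); case: z.
have [a ha] : exists l : K, (fun n => complex.Re (u n)) @ F --> l.
  by apply: (@rulim _ M); apply: filterS h => n; apply: le_trans.
have [b hb] : exists l : K, (fun n => complex.Im (u n)) @ F --> l.
  by apply: (@rulim _ M); apply: filterS h => n; apply: le_trans.
exists (a +i* b)%C; apply/cvg_nm => e e0.
move/cvgrPdist_lt : ha => /(_ (e / 2) ltac:(lra)) ha.
move/cvgrPdist_lt : hb => /(_ (e / 2) ltac:(lra)) hb.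
apply: filterS2 ha hb => n; case: (u n) => c d /= h1 h2.
rewrite -ltr_sqr ?nnegrE ?nm_ge0 ?ltW // nm_sq /=.
have sq (t : K) : `|t| < e / 2 -> t ^+ 2 < (e / 2) ^+ 2.
  by move=> ht; rewrite -(real_normK (num_real t)) ltr_sqr ?nnegrE ?normr_ge0 ?ltW //; lra.
have := sq _ h1; have := sq _ h2; have := exprn_gt0 2 e0.
by rewrite exprMn -[(a - c) ^+ 2]sqrrN -[(b - d) ^+ 2]sqrrN !opprB; lra.
Qed.

Lemma cvg_nm_le (u : I -> C) (l : C) (f : I -> K) (a : K) :
  u @ F --> l -> f @ F --> a -> (\forall n \near F, nm (u n) <= f n) -> nm l <= a.
Proof.
move=> /cvg_nm ul /cvgrPdist_lt fa h; apply/ler_addgt0Pr => e e0.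
have /filter_ex[n] : F [set n | [/\ nm (u n - l) < e / 2, `|a - f n| < e / 2 & nm (u n) <= f n]].
  apply: filterS3 (ul (e / 2) _) (fa (e / 2) _) h => //; lra.
case=> h1 h2 h3; have := nm_ler_dist l (u n); rewrite nmBC; move: h2; rewrite ltr_norml; lra.
Qed.

Lemma cvg_nm_lim (u : I -> C) (l : C) : u @ F --> l -> (fun n => nm (u n)) @ F --> nm l.
Proof.
move=> /cvg_nm h; apply/cvgrPdist_lt => e e0; apply: filterS (h e e0) => n /=.
have := nm_ler_dist l (u n); have := nm_ler_dist (u n) l; rewrite (nmBC l) ltr_norml; lra.
Qed.

Lemma cvg_en (v : I -> C * C) (l : C * C) :
  (fun n => (v n).1) @ F --> l.1 -> (fun n => (v n).2) @ F --> l.2 ->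
  (fun n => en (v n)) @ F --> en l.
Proof.
move=> /cvg_nm_lim ha /cvg_nm_lim hb.
have h : (fun n => nm (v n).1 * nm (v n).1 + nm (v n).2 * nm (v n).2) @ F -->
    nm l.1 * nm l.1 + nm l.2 * nm l.2 by exact: (cvgD (cvgM ha ha) (cvgM hb hb)).
have -> : (fun n => en (v n)) =
    (fun n => Num.sqrt (nm (v n).1 * nm (v n).1 + nm (v n).2 * nm (v n).2)).
  by apply/funext => n; rewrite /en /en2 !expr2.
by rewrite /en /en2 !expr2; apply: (continuous_cvg _ (@sqrt_continuous K _) h).
Qed.

Lemma unit_ulim (v : I -> C * C) : (\forall n \near F, en (v n) = 1) ->
  exists l, [/\ en l = 1, (fun n => (v n).1) @ F --> l.1 & (fun n => (v n).2) @ F --> l.2].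
Proof.
move=> h.
have [a ha] : exists l : C, (fun n => (v n).1) @ F --> l.
  by apply: (@culim _ 1); apply: filterS h => n <-; exact: nm1_en.
have [b hb] : exists l : C, (fun n => (v n).2) @ F --> l.
  by apply: (@culim _ 1); apply: filterS h => n <-; exact: nm2_en.
exists (a, b); split; [|exact: ha|exact: hb].
have h1 : (fun n => en (v n)) @ F --> (1 : K).
  by apply/cvgrPdist_lt => e e0; apply: filterS h => n ->; rewrite subrr normr0.
by rewrite (cvg_unique (@norm_hausdorff _ _) (@cvg_en v (a, b) ha hb) h1).
Qed.

Lemma cvg_expn (f : I -> C) (a : C) k :
  f @ F --> a -> (fun n => f n ^+ k) @ F --> a ^+ k.
Proof.
move=> fa; elim: k => [|k ih]; first exact: cvg_cst.
have -> : (fun n => f n ^+ k.+1) = (fun n => f n * f n ^+ k).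
  by apply/funext => n; rewrite exprS.
by rewrite exprS; exact: (cvgM fa ih).
Qed.

Lemma cvg_big_sum (J : Type) (r : seq J) (f : J -> I -> C) (l : J -> C) :
  (forall j, f j @ F --> l j) ->
  (fun i => \sum_(j <- r) f j i) @ F --> \sum_(j <- r) l j.
Proof.
move=> h; elim: r => [|j r ih].
  have -> : (fun i => \sum_(j <- [::]) f j i) = (fun=> 0).
    by apply/funext => i; rewrite big_nil.
  by rewrite big_nil; exact: cvg_cst.
have -> : (fun i => \sum_(k <- j :: r) f k i) = (fun i => f j i + \sum_(k <- r) f k i).
  by apply/funext => i; rewrite big_cons.
by rewrite big_cons; exact: (cvgD (h j) ih).
Qed.

Lemma cvg_big_prod (J : Type) (r : seq J) (f : J -> I -> C) (l : J -> C) :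
  (forall j, f j @ F --> l j) ->
  (fun i => \prod_(j <- r) f j i) @ F --> \prod_(j <- r) l j.
Proof.
move=> h; elim: r => [|j r ih].
  have -> : (fun i => \prod_(j <- [::]) f j i) = (fun=> 1).
    by apply/funext => i; rewrite big_nil.
  by rewrite big_nil; exact: cvg_cst.
have -> : (fun i => \prod_(k <- j :: r) f k i) = (fun i => f j i * \prod_(k <- r) f k i).
  by apply/funext => i; rewrite big_cons.
by rewrite big_cons; exact: (cvgM (h j) ih).
Qed.

Lemma cvg_wedge (u u' : I -> C * C) (l l' : C * C) :
  (fun n => (u n).1) @ F --> l.1 -> (fun n => (u n).2) @ F --> l.2 ->
  (fun n => (u' n).1) @ F --> l'.1 -> (fun n => (u' n).2) @ F --> l'.2 ->
  (fun n => wedge (u n) (u' n)) @ F --> wedge l l'.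
Proof.
move=> h1 h2 h3 h4; exact: (cvgB (cvgM h1 h4) (cvgM h2 h3)).
Qed.

Lemma cvg_wedgel (v : C * C) (u : I -> C * C) (l : C * C) :
  (fun n => (u n).1) @ F --> l.1 -> (fun n => (u n).2) @ F --> l.2 ->
  (fun n => wedge v (u n)) @ F --> wedge v l.
Proof.
move=> h1 h2; exact: (cvg_wedge (u := fun=> v) (cvg_cst _) (cvg_cst _) h1 h2).
Qed.

Lemma cvg_wedger (v : C * C) (u : I -> C * C) (l : C * C) :
  (fun n => (u n).1) @ F --> l.1 -> (fun n => (u n).2) @ F --> l.2 ->
  (fun n => wedge (u n) v) @ F --> wedge l v.
Proof.
move=> h1 h2; exact: (cvg_wedge (u' := fun=> v) h1 h2 (cvg_cst _) (cvg_cst _)).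
Qed.

End UltraLimits.

Lemma real_eq (K : realType) (a b : K) : (forall e, 0 < e -> `|a - b| <= e) -> a = b.
Proof.
move=> h; apply/eqP; rewrite -subr_eq0 -normr_eq0 eq_le normr_ge0 andbT.
by apply/ler_addgt0Pr => e e0; rewrite add0r; exact: h.
Qed.

Lemma inv_small (K : realType) (e : K) : 0 < e ->
  exists N : nat, forall n, (N <= n)%N -> n.+1%:R^-1 < e.
Proof.
by move=> e0; have [N _ h] := near_infty_natSinv_lt (PosNum e0); exists N.
Qed.

Lemma cvg_inv_eq0 (K : realType) (F : set_system nat) (f : nat -> Cplx K) (a : Cplx K) :
  UltraFilter F -> (forall N, F [set n | (N <= n)%N]) -> f @ F --> a ->
  (forall n, nm (f n) <= n.+1%:R^-1) -> a = 0.
Proof.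
move=> FU hF fa hf; apply/eqP; rewrite -nm_eq0 eq_le nm_ge0 andbT.
apply/ler_addgt0Pr => e e0; rewrite add0r.
apply: (cvg_nm_le FU fa (cvg_cst e)); have [N hN] := inv_small e0.
by apply: filterS (hF N) => n Nn; apply: le_trans (hf n) _; apply/ltW/hN.
Qed.

Lemma nat_ultra : exists2 F : set_system nat, UltraFilter F & forall N, F [set n | (N <= n)%N].
Proof.
have [F [FU h]] := ultraFilterLemma (_ : ProperFilter (\oo : set_system nat)).
by exists F => // N; apply: h; exists N.
Qed.

(** * Homogeneous lifts and continuity of roots *)

Section RationalMap.
Variables (K : realType) (P Q : {poly Cplx K}).
Local Notation C := (Cplx K).
Local Notation d := (rat_degree P Q).
Local Notation R := (rat_map P Q).
Hypothesis hPQ : coprimep P Q.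
Hypothesis hdeg : (2 <= d)%N.
Implicit Types (v w : C * C) (x y : sphere K) (p : {poly C}).

(** The form of degree [d] that restricts to [p] on [v.2 = 1]; a drop in the degree of [p] becomes a
    zero at infinity. [lift] is then a homogeneous map of [C^2] over [R]. *)
Definition hom (p : {poly C}) v : C := \sum_(k < d.+1) p`_k * (v.1 ^+ k * v.2 ^+ (d - k)).
Definition lift v : C * C := (hom P v, hom Q v).

Lemma size_P : (size P <= d.+1)%N.
Proof. by rewrite /rat_degree; lia. Qed.

Lemma size_Q : (size Q <= d.+1)%N.
Proof. by rewrite /rat_degree; lia. Qed.

Lemma hom_sc p c v : hom p (sc c v) = c ^+ d * hom p v.
Proof.
rewrite /hom mulr_sumr; apply: eq_bigr => k _ /=.
have dk : c ^+ d = c ^+ k * c ^+ (d - k) by rewrite -exprD subnKC // -ltnS.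
by rewrite !exprMn dk; ring.
Qed.

Lemma lift_sc c v : lift (sc c v) = sc (c ^+ d) (lift v).
Proof. by rewrite /lift !hom_sc. Qed.

Lemma hom_fin p (a : C) : (size p <= d.+1)%N -> hom p (a, 1) = p.[a].
Proof.
move=> sp; rewrite (horner_coef_wide _ sp); apply: eq_bigr => k _ /=.
by rewrite expr1n mulr1.
Qed.

Lemma hom_inf p (a : C) : hom p (a, 0) = p`_d * a ^+ d.
Proof.
rewrite /hom big_ord_recr /= subnn expr0 mulr1 big1 ?add0r // => k _.
by rewrite expr0n subn_eq0 leqNgt ltn_ord /= !mulr0.
Qed.

Lemma no_common_root (a : C) : P.[a] = 0 -> Q.[a] = 0 -> False.
Proof.
move=> /eqP p0 /eqP q0.
by have := coprimep_root hPQ p0; rewrite (eqP q0) eqxx.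
Qed.

Lemma lead_neq0 : P`_d = 0 -> Q`_d = 0 -> False.
Proof.
have lc (p : {poly C}) n : (0 < n)%N -> (size p).-1 = n -> p`_n = 0 -> False.
  move=> n0 np; rewrite -np -lead_coefE => /eqP; rewrite lead_coef_eq0 => /eqP p0.
  by move: n0; rewrite -np p0 size_poly0.
move=> p0 q0; have := hdeg.
move: p0 q0; rewrite /rat_degree; have [h|h] := leqP (size P).-1 (size Q).-1.
  by move=> _ q0 h2; apply: (lc Q (size Q).-1) => //; apply: ltnW.
move=> p0 _ h2; apply: (lc P (size P).-1) => //; exact: ltnW.
Qed.

Lemma lift_gt0 v : 0 < en v -> 0 < en (lift v).
Proof.
move=> v0; have [c c0 ->] := vec_pt v0; rewrite lift_sc; apply: sc_gt0.
  by rewrite expf_neq0.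
rewrite en_gt0 -negb_and; apply/negP => /andP[/eqP] /=.
case: (pt v) => [a|] /=.
  by rewrite !hom_fin ?size_P ?size_Q // => h /eqP; exact: no_common_root.
by rewrite !hom_inf expr1n !mulr1 => h /eqP; exact: lead_neq0.
Qed.

Lemma rat_map_pt v : 0 < en v -> R (pt v) = pt (lift v).
Proof.
move=> v0; have [c c0 hv] := vec_pt v0.
rewrite [in RHS]hv lift_sc pt_sc ?expf_neq0 // /rat_map.
case: (pt v) => [a|]; rewrite /pt /=.
  by rewrite !hom_fin ?size_P ?size_Q.
by rewrite !hom_inf expr1n !mulr1.
Qed.

Lemma wedge_lift v w : wedge (lift v) w = hom (w.2 *: P - w.1 *: Q) v.
Proof.
rewrite /wedge /lift /= /hom !mulr_suml -sumrB; apply: eq_bigr => k _.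
by rewrite coefB !coefZ; ring.
Qed.

(** A vanishing combination makes [P] and [Q] proportional, and coprime proportional polynomials are
    constant, against degree at least 2. *)
Lemma pencil_neq0 w : 0 < en w -> w.2 *: P - w.1 *: Q != 0.
Proof.
rewrite en_gt0 => w0; apply/eqP => /eqP; rewrite subr_eq0 => /eqP h.
have cst (p q : {poly C}) (a b : C) : coprimep p q -> a != 0 -> a *: p = b *: q -> (size q <= 1)%N.
  move=> cpq a0 e; have : q %| p by rewrite -(@dvdpZr _ a) // e -mul_polyC dvdp_mull.
  move=> qp; have : coprimep q q by exact: coprimep_dvdr qp cpq.
  by rewrite coprimepp => /eqP ->.
have cst0 (p q : {poly C}) (a b : C) : coprimep p q -> a != 0 -> a *: p = b *: q -> (size p <= 1)%N.
  move=> cpq a0 e; have sq := cst p q a b cpq a0 e.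
  by rewrite -(size_scale _ a0) e (leq_trans (size_scale_leq _ _)).
have h2 : (size P <= 1)%N /\ (size Q <= 1)%N.
  case: (eqVneq w.2 0) => w2; last by split; [exact: (cst0 _ _ _ _ hPQ w2 h)|exact: (cst _ _ _ _ hPQ w2 h)].
  rewrite w2 eqxx orbF in w0.
  split; [apply: (@cst Q P w.1 w.2)|apply: (@cst0 Q P w.1 w.2)] => //; by rewrite coprimep_sym.
by move: hdeg; rewrite /rat_degree; case: h2; lia.
Qed.

Lemma hom_factor (p : {poly C}) : p != 0 -> (size p <= d.+1)%N ->
  exists (c : C) (z : 'I_d -> C * C), [/\ c != 0, forall j, 0 < en (z j) &
    forall v, hom p v = c * \prod_j wedge v (z j)].
Proof.
move=> p0 sp; have [rs prs] := closed_field_poly_normal p.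
have l0 : lead_coef p != 0 by rewrite lead_coef_eq0.
have srs : (size rs).+1 = size p by rewrite prs size_scale // size_prod_XsubC.
have srd : (size rs <= d)%N by rewrite -ltnS srs.
(* The roots missing from [rs] are at infinity. The representative [(-1, 0)] makes the corresponding
   factor exactly [v.2]. *)
pose z (j : 'I_d) : C * C := if (j < size rs)%N then (rs`_j, 1) else (-1, 0).
exists (lead_coef p), z; split => // [j|v].
  by rewrite en_gt0 /z; case: ifP; rewrite /= ?oner_eq0 ?oppr_eq0 ?oner_eq0 ?orbT.
have -> : \prod_(j < d) wedge v (z j) = \prod_(r <- rs) (v.1 - r * v.2) * v.2 ^+ (d - size rs).
  rewrite (big_nth 0) big_mkord -(big_mkord xpredT (fun j => wedge v (if (j <
      size rs)%N then (rs`_j, 1) else (-1, 0)))).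
  rewrite (@big_cat_nat _ _ _ (size rs)) //=; congr (_ * _).
    rewrite big_mkord; apply: eq_bigr => i _.
    by rewrite ltn_ord /wedge /= mulr1 [v.2 * _]mulrC.
  rewrite big_nat (eq_bigr (fun=> v.2)) => [|i /andP[h _]].
    by rewrite -big_nat prodr_const_nat.
  by rewrite ltnNge h /= /wedge /=; ring.
case: (eqVneq v.2 0) => v2.
  have -> : v = (v.1, 0) by rewrite -v2 -surjective_pairing.
  rewrite hom_inf /= expr0n subn_eq0; case: leqP => h /=.
    have e : d = size rs by apply/eqP; rewrite eqn_leq h srd.
    rewrite e mulr1 lead_coefE -srs /=; congr (_ * _).
    under eq_bigr do rewrite mulr0 subr0.
    by rewrite big_const_seq count_predT -Monoid.iteropE.
  by rewrite !mulr0 nth_default ?mul0r // -srs.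
have -> : v = sc v.2 (v.1 / v.2, 1) by rewrite /sc /= mulr1 mulrC divfK // -surjective_pairing.
rewrite hom_sc hom_fin // {1}prs hornerZ horner_prod /= mulr1.
rewrite mulrCA; congr (_ * _).
rewrite -[in LHS](subnK srd) exprD -mulrA mulrC; congr (_ * _).
have -> : v.2 ^+ size rs = \prod_(r <- rs) v.2.
  by rewrite big_const_seq count_predT -Monoid.iteropE.
rewrite -big_split /=; apply: eq_bigr => r _.
by rewrite hornerXsubC mulrBr [v.2 * r]mulrC.
Qed.

(* [z] lists the preimages of [pt w], with multiplicity, as unit vectors. *)
Definition fac w (z : 'I_d -> C * C) :=
  [/\ en w = 1, forall j, en (z j) = 1 &
   exists2 c : C, c != 0 & forall v, wedge (lift v) w = c * \prod_j wedge v (z j)].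

Lemma fac_ex w : en w = 1 -> exists z, fac w z.
Proof.
move=> w1; have w0 : 0 < en w by rewrite w1.
have sp : (size (w.2 *: P - w.1 *: Q)%R <= d.+1)%N.
  by rewrite (leq_trans (size_polyD _ _)) // size_polyN geq_max !(leq_trans (size_scale_leq _ _))
      ?size_P ?size_Q.
have [c [z [c0 z0 hz]]] := hom_factor (pencil_neq0 w0) sp.
pose u j := ((en (z j))^-1)%:C%C : C.
have u0 j : u j != 0 by rewrite -nm_eq0 nm_real normr_eq0 invr_eq0 gt_eqF.
exists (fun j => sc (u j) (z j)); split=> // [j|].
  by rewrite en_sc nm_real ger0_norm ?invr_ge0 ?en_ge0 // mulVf ?gt_eqF.
exists (c / \prod_j u j) => [|v].
  by rewrite mulf_neq0 // invr_eq0; apply/prodf_neq0 => j _.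
rewrite wedge_lift hz (eq_bigr _ (fun j _ => wedge_scr (u j) v (z j))).
rewrite big_split /= mulrA divfK //; apply/prodf_neq0 => j _ //.
Qed.

Lemma fac_root w z v : fac w z -> 0 < en v ->
  (R (pt v) == pt w) = [exists j, pt (z j) == pt v].
Proof.
move=> [w1 z1 [c c0 h]] v0; rewrite rat_map_pt // -wedge_eq0 ?lift_gt0 ?w1 //.
rewrite h mulf_eq0 (negbTE c0) /=; apply/prodf_eq0/existsP.
  by move=> [j _]; rewrite wedge_eq0 ?z1 // eq_sym; exists j.
by move=> [j]; rewrite eq_sym => hj; exists j; rewrite // wedge_eq0 ?z1.
Qed.

Lemma fac_rootx w z x : fac w z -> (R x == pt w) = [exists j, pt (z j) == x].
Proof. by move=> f; rewrite -{1}[x]pt_vec (fac_root f) ?vec_gt0 // pt_vec. Qed.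

Lemma fac_R w z j : fac w z -> R (pt (z j)) = pt w.
Proof.
by move=> f; apply/eqP; rewrite (fac_rootx _ f); apply/existsP; exists j.
Qed.

Lemma unit_gt0 v : en v = 1 -> 0 < en v. Proof. by move=> ->. Qed.

Section HomLimits.
Variables (I : Type) (F : set_system I).
Hypothesis FU : UltraFilter F.

Lemma cvg_hom p (u : I -> C * C) l : (fun n => (u n).1) @ F --> l.1 ->
  (fun n => (u n).2) @ F --> l.2 -> (fun n => hom p (u n)) @ F --> hom p l.
Proof.
move=> h1 h2; apply: cvg_big_sum => k.
have a := cvg_expn FU (k := k) h1; have b := cvg_expn FU (k := (d - k)%N) h2.
exact: (cvgM (cvg_cst _) (cvgM a b)).
Qed.

End HomLimits.

Lemma lift_lower : exists2 c : K, 0 < c & forall v, en v = 1 -> c <= en (lift v).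
Proof.
apply: contrapT => hn.
have /choice[u hu] (n : nat) : exists v, en v = 1 /\ en (lift v) < n.+1%:R^-1.
  apply: contrapT => h; apply: hn; exists n.+1%:R^-1; first by rewrite invr_gt0 ltr0n.
  by move=> v v1; rewrite leNgt; apply/negP => h2; apply: h; exists v.
have [F FU hF] := nat_ultra.
have [l [l1 la lb]] := unit_ulim FU (filterE _ (fun n => (hu n).1)).
have z0 (f : nat -> C) (a : C) : f @ F --> a -> (forall n, nm (f n) <= en (lift (u n))) -> a = 0.
  move=> fa hf; apply: (cvg_inv_eq0 FU hF fa) => n.
  by apply: le_trans (hf n) _; apply: ltW; case: (hu n).
have p0 : (lift l).1 = 0 by apply: (z0 _ _ (cvg_hom FU la lb)) => n; exact: (nm1_en (lift _)).
have q0 : (lift l).2 = 0 by apply: (z0 _ _ (cvg_hom FU la lb)) => n; exact: (nm2_en (lift _)).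
by have := lift_gt0 (unit_gt0 l1); rewrite en_gt0 p0 q0 !eqxx.
Qed.

Lemma lift_upper : exists2 c : K, 0 < c & forall v, en v = 1 -> en (lift v) <= c.
Proof.
have hb p : exists2 c : K, 0 <= c & forall v, en v = 1 -> nm (hom p v) <= c.
  exists (\sum_(k < d.+1) nm p`_k); first by apply: sumr_ge0 => k _; exact: nm_ge0.
  move=> v v1; apply: le_trans (nm_sum _ _ _) _; apply: ler_sum => k _.
  rewrite !nmM !nmX ler_piMr ?nm_ge0 //.
  by rewrite mulr_ile1 ?exprn_ge0 ?exprn_ile1 ?nm_ge0 // -v1 ?nm1_en ?nm2_en.
have [c1 c10 h1] := hb P; have [c2 c20 h2] := hb Q.
exists (c1 + c2 + 1); first lra.
move=> v v1; have := h1 v v1; have := h2 v v1; have := en_le (lift v) => /=; lra.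
Qed.

(** Over [w] representing [R x], one factor of [wedge (lift v) w] is the chordal distance to [x] and
    the others are at most 1. The leading scalar makes the constant depend on [x]. *)
Lemma rat_map_lip x : exists2 L : K, 0 < L & forall z, chd (R x) (R z) <= L * chd x z.
Proof.
have [w w1 wx] := unit_vec (R x); have [z f] := fac_ex w1.
have [c1 c10 hc] := lift_lower; have [_ z1 [c c0 h]] := f.
have /eqP := wx; rewrite eq_sym (fac_rootx _ f) => /existsP[j /eqP jx].
exists (nm c / c1); first by rewrite divr_gt0 ?nm_gt0.
move=> t; have [v v1 <-] := unit_vec t.
rewrite -wx -jx rat_map_pt ?v1 // chdC chd_pt ?w1 ?lift_gt0 ?v1 // mulr1 h nmM.
rewrite chdC chd_unit // (bigD1 j) //= nmM nm_prod.
rewrite -!mulrA ler_pM2l ?nm_gt0 // [leRHS]mulrC; apply: ler_pM.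
- exact: nm_ge0.
- by rewrite mulr_ge0 ?invr_ge0 ?en_ge0 // prodr_ge0 // => i _; exact: nm_ge0.
- by [].
- rewrite -[leRHS]mul1r; apply: ler_pM.
  + by rewrite prodr_ge0 // => i _; exact: nm_ge0.
  + by rewrite invr_ge0 en_ge0.
  + apply: prodr_ile1 => i _.
    by rewrite nm_ge0 /= (le_trans (wedge_en _ _)) // v1 z1 mulr1.
  + by rewrite lef_pV2 ?posrE ?lift_gt0 ?v1 // hc.
Qed.

Lemma sphere_infinite (s : seq (sphere K)) : exists x, x \notin s.
Proof.
apply: contrapT => h.
have : {subset [seq Some (i%:R : C) : sphere K | i <- iota 0 (size s).+1] <= s}.
  by move=> x _; apply: contrapT => /negP hx; apply: h; exists x.
move/uniq_leq_size; rewrite size_map size_iota map_inj_uniq ?iota_uniq ?ltnn => [/(_ isT)//|].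
by move=> i j [] /eqP; rewrite eqr_nat => /eqP.
Qed.

(** Along targets tending to [y0], an ultrafilter limit of factorizations is a factorization over
    [y0]. So roots are matched index by index, with multiplicities. *)
Lemma root_continuity y0 (r : K) : 0 < r -> exists2 dl : K, 0 < dl &
  forall y, chd y0 y < dl -> exists w w0 z z0,
    [/\ fac w z, fac w0 z0, pt w = y, pt w0 = y0 & forall j, chd (pt (z0 j)) (pt (z j)) < r].
Proof.
move=> r0; apply: contrapT => hn.
have inv0 (n : nat) : (0 : K) < n.+1%:R^-1 by rewrite invr_gt0 ltr0n.
have /choice[y hy] (n : nat) : exists y, chd y0 y < n.+1%:R^-1 /\ ~ exists w w0 z z0,
    [/\ fac w z, fac w0 z0, pt w = y, pt w0 = y0 & forall j, chd (pt (z0 j)) (pt (z j)) < r].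
  apply: contrapT => h; apply: hn; exists n.+1%:R^-1 => // y hy.
  by apply: contrapT => h2; apply: h; exists y.
have /choice[w hw] n : exists w, en w = 1 /\ pt w = y n.
  by have [w w1 wy] := unit_vec (y n); exists w.
have /choice[z hz] n : exists z, fac (w n) z by apply: fac_ex; case: (hw n).
have [F FU hF] := nat_ultra.
have [w0 [w01 wa wb]] := unit_ulim FU (filterE _ (fun n => (hw n).1)).
have /choice[z0 hz0] j : exists l, [/\ en l = 1, (fun n => (z n j).1) @ F --> l.1 & (fun n =>
    (z n j).2) @ F --> l.2].
  by apply: (unit_ulim FU); apply: filterE => n; case: (hz n).
have w0y : pt w0 = y0.
  apply/eqP; rewrite -chd_eq0 eq_le chd_ge0 andbT.
  have [u u1 uy] := unit_vec y0; rewrite -uy chd_unit //.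
  rewrite (_ : wedge w0 u = 0) ?nm0 //; apply: (cvg_inv_eq0 FU hF (cvg_wedger FU (v := u) wa wb)) => n.
  have [h1 h2] := hw n; rewrite -chd_unit // uy h2 chdC.
  by apply: ltW; case: (hy n).
have cpi v : (fun n => \prod_j wedge v (z n j)) @ F --> \prod_j wedge v (z0 j).
  apply: (cvg_big_prod FU) => j; have [_ h1 h2] := hz0 j.
  exact: (cvg_wedgel FU).
have cl v : (fun n => wedge (lift v) (w n)) @ F --> wedge (lift v) w0.
  exact: (cvg_wedgel FU).
(* The leading scalars converge because they can be read off at a vector [u] away from all limit
   roots. *)
have [x hx] := sphere_infinite [seq pt (z0 j) | j <- enum 'I_d].
have [u u1 ux] := unit_vec x.
have pi0 : \prod_j wedge u (z0 j) != 0.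
  apply/prodf_neq0 => j _; have [h1 _ _] := hz0 j.
  rewrite wedge_eq0 ?h1 ?u1 // ux; apply: contraNneq hx => ->.
  by apply: map_f; rewrite mem_enum.
pose c := wedge (lift u) w0 / \prod_j wedge u (z0 j).
have /choice[cc hcc] n : exists c : C, forall v, wedge (lift v) (w n) = c * \prod_j wedge v (z n j).
  by case: (hz n) => _ _ [c0 _ h]; exists c0.
have ccE : \forall n \near F, cc n = wedge (lift u) (w n) / \prod_j wedge u (z n j).
  have := cpi u => /cvg_nm/(_ (nm (\prod_j wedge u (z0 j)))); rewrite nm_gt0 => /(_ pi0).
  apply: filterS => n hn0; rewrite hcc mulfK //.
  by apply: contraTneq hn0 => ->; rewrite sub0r nmN ltxx.
have ccc : cc @ F --> c.
  have : (fun n => wedge (lift u) (w n) / \prod_j wedge u (z n j)) @ F --> c.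
    exact: (cvgM (cl u) (cvgV pi0 (cpi u))).
  move=> h; apply: cvg_trans h; apply: near_eq_cvg.
  by apply: filterS ccE => n ->.
have id0 v : wedge (lift v) w0 = c * \prod_j wedge v (z0 j).
  apply: (cvg_unique (@norm_hausdorff _ _) (cl v)).
  rewrite (_ : (fun n => _) = (fun n => cc n * \prod_j wedge v (z n j))).
    exact: (cvgM ccc (cpi v)).
  by apply/funext => n; rewrite hcc.
have f0 : fac w0 z0.
  split=> // [j|]; first by case: (hz0 j).
  (* A vanishing limit scalar would make [wedge (lift v) w0] vanish identically, but it is nonzero
     off the fibre over [pt w0]. *)
  exists c => //; apply/eqP => c0.
  have [z' f'] := fac_ex w01.
  have [x' hx'] := sphere_infinite [seq pt (z' j) | j <- enum 'I_d].
  have [u' u1' ux'] := unit_vec x'.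
  have : R (pt u') != pt w0.
    rewrite (fac_root f') ?u1' //; apply: contra hx' => /existsP[j /eqP hj].
    by apply/mapP; exists j; rewrite ?mem_enum // hj ux'.
  by rewrite rat_map_pt ?u1' // -wedge_eq0 ?lift_gt0 ?u1' ?w01 // id0 c0 mul0r eqxx.
have near j : \forall n \near F, chd (pt (z0 j)) (pt (z n j)) < r.
  have [h1 ha hb] := hz0 j.
  have : (fun n => wedge (z0 j) (z n j)) @ F --> wedge (z0 j) (z0 j).
    exact: (cvg_wedgel FU).
  move=> /cvg_nm/(_ r r0); apply: filterS => n; rewrite chd_unit //; last by case: (hz n).
  by rewrite wedgexx subr0.
have /filter_ex[n hn1] : F [set n | forall j, chd (pt (z0 j)) (pt (z n j)) < r].
  by apply: filter_forall => j; exact: near.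
have [w1 wn] := hw n.
by have [_] := hy n; apply; exists (w n), w0, (z n), z0; split.
Qed.

End RationalMap.

(** * Elementary bounds for polynomials near 0 *)

Section Polynomials.
Variable K : realType.
Local Notation C := (Cplx K).

Lemma poly_lip0 (p : {poly C}) : exists2 M : K, 0 < M &
  forall t : C, nm t <= 1 -> nm (p.[t] - p.[0]) <= M * nm t.
Proof.
have : root (p - p.[0]%:P) 0 by rewrite rootE !hornerE subrr.
move/factor_theorem => [q hq].
exists (\sum_(k < size q) nm q`_k + 1).
  by apply: ltr_wpDl => //; apply: sumr_ge0 => k _; exact: nm_ge0.
move=> t t1; have -> : p.[t] - p.[0] = (p - p.[0]%:P).[t] by rewrite !hornerE.
rewrite hq hornerM hornerXsubC subr0 nmM ler_wpM2r ?nm_ge0 // horner_coef.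
apply: le_trans (nm_sum _ _ _) _; apply: ler_wpDr => //; apply: ler_sum => k _.
by rewrite nmM nmX ler_piMr ?nm_ge0 // exprn_ile1 ?nm_ge0.
Qed.

Lemma poly_bd0 (p : {poly C}) : exists2 M : K, 0 < M &
  forall t : C, nm t <= 1 -> nm p.[t] <= M.
Proof.
have [M M0 h] := poly_lip0 p; exists (M + nm p.[0] + 1).
  by have := nm_ge0 p.[0]; lra.
move=> t t1; have := h t t1; have := nm_ler_dist p.[t] p.[0].
have : M * nm t <= M by rewrite ler_piMr // ltW.
lra.
Qed.

Lemma poly_lower0 (p : {poly C}) : p.[0] != 0 -> exists2 r : K, 0 < r &
  forall t : C, nm t < r -> nm p.[0] / 2 <= nm p.[t].
Proof.
move=> p0; have [M M0 h] := poly_lip0 p; have n0 : 0 < nm p.[0] by rewrite nm_gt0.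
exists (Num.min 1 (nm p.[0] / 2 / M)).
  by rewrite lt_min ltr01 !divr_gt0.
move=> t; rewrite lt_min => /andP[/ltW t1]; rewrite ltr_pdivlMr // mulrC => t2.
by have := h t t1; rewrite nmBC; have := nm_ler_dist p.[0] p.[t]; lra.
Qed.

Lemma poly_quot0 (a b : {poly C}) : b.[0] != 0 -> exists2 r : K, 0 < r &
  exists M : K, forall t : C, nm t < r ->
    b.[t] != 0 /\ nm (a.[t] / b.[t] - a.[0] / b.[0]) <= M * nm t.
Proof.
move=> b0; have [r1 r10 h1] := poly_lower0 b0.
have [M1 M10 hb] := poly_lip0 b; have [M2 M20 ha] := poly_lip0 a.
have [M3 M30 hA] := poly_bd0 a.
have n0 : 0 < nm b.[0] by rewrite nm_gt0.
exists (Num.min 1 r1); first by rewrite lt_min ltr01.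
exists ((M2 * nm b.[0] + M3 * M1) / (nm b.[0] / 2 * nm b.[0])) => t.
rewrite lt_min => /andP[/ltW t1 t2]; have lb := h1 t t2.
have bt : b.[t] != 0 by rewrite -nm_gt0; lra.
split => //.
have -> : a.[t] / b.[t] - a.[0] / b.[0] =
   ((a.[t] - a.[0]) * b.[0] - a.[0] * (b.[t] - b.[0])) / (b.[t] * b.[0]).
  by field; apply/andP.
rewrite nmM nmV ler_pdivrMr ?nm_gt0 ?mulf_neq0 //.
apply: le_trans (nmB _ _) _; rewrite !nmM.
have e1 := ha t t1; have e2 := hb t t1; have e3 := hA 0 _; rewrite nm0 ler01 in e3.
have {}e3 := e3 isT.
have : nm (a.[t] - a.[0]) * nm b.[0] <= M2 * nm t * nm b.[0] by rewrite ler_pM2r.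
have : nm a.[0] * nm (b.[t] - b.[0]) <= M3 * (M1 * nm t) by apply: ler_pM; rewrite ?nm_ge0.
have X0 : 0 <= (M2 * nm b.[0] + M3 * M1) * nm t.
  by rewrite mulr_ge0 ?nm_ge0 // addr_ge0 // mulr_ge0 // ltW.
have : (M2 * nm b.[0] + M3 * M1) / (nm b.[0] / 2 * nm b.[0]) * nm t * (nm b.[0] / 2 * nm b.[0])
   <= (M2 * nm b.[0] + M3 * M1) / (nm b.[0] / 2 * nm b.[0]) * nm t * (nm b.[t] * nm b.[0]).
  apply: ler_wpM2l; last by rewrite ler_pM2r.
  by rewrite mulrAC divr_ge0 // ltW // mulr_gt0 // divr_gt0.
have -> : (M2 * nm b.[0] + M3 * M1) / (nm b.[0] / 2 * nm b.[0]) * nm t * (nm b.[0] / 2 * nm b.[0])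
  = (M2 * nm b.[0] + M3 * M1) * nm t by field; rewrite gt_eqF.
lra.
Qed.

End Polynomials.

(** * The branch index as a multiplicity *)

Section BranchIndex.
Variables (K : realType) (P Q : {poly Cplx K}).
Local Notation C := (Cplx K).
Local Notation d := (rat_degree P Q).
Local Notation R := (rat_map P Q).
Hypothesis hPQ : coprimep P Q.
Hypothesis hdeg : (2 <= d)%N.
Implicit Types (v w : C * C) (x y : sphere K).

Definition dir x : C * C := if x is Some _ then (1, 0) else (0, 1).
(** An affine line in [C^2] avoiding the origin, whose parameter is the chart coordinate at [x]
    ([chart_line]). Along it, everything expressed through the lift is polynomial in [t]. *)
Definition line x (t : C) : C * C := ((vec x).1 + t * (dir x).1, (vec x).2 + t * (dir x).2).

Lemma dir_gt0 x : 0 < en (dir x).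
Proof. by rewrite en_gt0; case: x => [a|] /=; rewrite oner_eq0 ?orbT. Qed.

Lemma line_ge1 x t : 1 <= en (line x t).
Proof.
rewrite -(nm1 K); case: x => [a|]; rewrite /line /=.
  by have := nm2_en (a + t * 1, 1 + t * 0); rewrite /= mulr0 addr0.
by have := nm1_en (1 + t * 0, 0 + t * 1); rewrite /= mulr0 addr0.
Qed.

Lemma line_gt0 x t : 0 < en (line x t).
Proof. exact: lt_le_trans (line_ge1 x t). Qed.

Lemma line0 x : line x 0 = vec x.
Proof. by rewrite /line !mul0r !addr0 -surjective_pairing. Qed.

Lemma wedge_line x t v : wedge (line x t) v = wedge (vec x) v + t * wedge (dir x) v.
Proof. by rewrite /wedge /line /=; ring. Qed.

Lemma wedge_dir x : nm (wedge (vec x) (dir x)) = 1.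
Proof. by rewrite /wedge; case: x => [a|] /=; rewrite !(mulr0, mul0r, mulr1, sub0r, subr0, mul1r)
    ?nmN nm1. Qed.

Lemma dir_neq x : pt (dir x) != x.
Proof.
rewrite -[X in _ != X]pt_vec eq_sym -wedge_eq0 ?vec_gt0 ?dir_gt0 //.
by rewrite -nm_eq0 wedge_dir oner_eq0.
Qed.

Lemma vec_ge1 x : 1 <= en (vec x).
Proof. by rewrite -line0; exact: line_ge1. Qed.

Lemma chd_line x t : chd x (pt (line x t)) = nm t / (en (vec x) * en (line x t)).
Proof.
rewrite -{1}[x]pt_vec chd_pt ?vec_gt0 ?line_gt0 // wedgeC nmN wedge_line.
by rewrite wedgexx add0r nmM [wedge (dir x) _]wedgeC nmN wedge_dir mulr1.
Qed.

Lemma chd_line_le x t : chd x (pt (line x t)) <= nm t.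
Proof.
rewrite chd_line ler_pdivrMr ?mulr_gt0 ?vec_gt0 ?line_gt0 // ler_peMr ?nm_ge0 //.
by rewrite -[1]mulr1 ler_pM ?vec_ge1 ?line_ge1.
Qed.

Lemma chart_line x t : chart x (pt (line x t)) = t.
Proof.
case: x => [a|]; rewrite /line /pt /= !(mulr0, mulr1, addr0, add0r) ?oner_eq0.
  by rewrite divr1 addrC addKr.
by case: eqVneq => [->|t0] //; rewrite div1r invrK.
Qed.

Lemma line_chart x z : z != pt (dir x) -> z = pt (line x (chart x z)).
Proof.
case: x => [a|]; case: z => [b|]; rewrite /line /pt /= ?eqxx ?oner_eq0 //.
- by rewrite !(mulr0, mulr1, addr0) oner_eq0 divr1 addrC subrK.
- rewrite !(mulr0, mulr1, addr0, add0r) mul0r invr_eq0 div1r invrK.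
  by case: (eqVneq b 0) => [->|] //; rewrite eqxx.
- by rewrite !(mulr0, mulr1, addr0, add0r) eqxx.
Qed.

Lemma chart_wedge y v : 0 < en v -> pt v != pt (dir y) ->
  chart y (pt v) = - (wedge v (vec y) / wedge v (dir y)).
Proof.
move=> v0; rewrite -wedge_eq0 ?dir_gt0 //; case: y => [b|]; rewrite /wedge /pt /=.
  rewrite !(mulr0, mulr1, sub0r) oppr_eq0 => v2; rewrite (negbTE v2).
  by field.
rewrite !(mulr0, mulr1, sub0r, subr0) => v1.
case: eqVneq => [->|v2]; first by rewrite !(oppr0, mul0r).
by rewrite invf_div mulNr opprK.
Qed.

Lemma en_line_le x t : en (line x t) <= en (vec x) + nm t.
Proof.
have n0 := en_ge0 (vec x); have h0 : 0 <= en (vec x) + nm t by rewrite addr_ge0 ?nm_ge0.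
rewrite -ler_sqr ?nnegrE ?en_ge0 // en_sq sqrrD en_sq.
case: x n0 {h0} => [a|]; rewrite /line /en2 /= !(mulr0, mulr1, addr0, add0r) nm1.
  have /= := nm1_en (a, 1); have := nmD a t; have := nm_ge0 a; have := nm_ge0 t; have := nm_ge0 (a + t).
  move: (nm (a + t)) (nm a) (nm t) (en _) => p q r s; nra.
have /= := nm1_en (1 : C, 0 : C); have := nm_ge0 t; rewrite nm1 nm0.
move: (nm t) (en _) => r s; nra.
Qed.

Lemma near_chart x (e : K) : 0 < e ->
  \forall z \near x, z = pt (line x (chart x z)) /\ nm (chart x z) < e.
Proof.
move=> e0; have c0 : 0 < chd x (pt (dir x)) by rewrite chd_gt0 eq_sym dir_neq.
have v1 := vec_ge1 x; set n := en (vec x) in v1 *.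
have n0 : 0 < n by exact: vec_gt0.
pose dl := Num.min (chd x (pt (dir x))) (Num.min (n^-1 / 2) (e / (2 * n ^+ 2))).
apply/nbhs_chd; exists dl.
  by rewrite !lt_min c0 !divr_gt0 ?invr_gt0 ?mulr_gt0 ?exprn_gt0.
move=> z; rewrite !lt_min => /and3P[h1 h2 h3].
have hz : z = pt (line x (chart x z)).
  by apply: line_chart; apply: contraTneq h1 => ->; rewrite ltxx.
split => //; set t := chart x z in hz *.
have p0 : 0 < n * en (line x t) by rewrite mulr_gt0 ?line_gt0.
rewrite hz chd_line -/n ltr_pdivrMr // in h2.
rewrite hz chd_line -/n ltr_pdivrMr // in h3.
have hl : en (line x t) <= n + nm t by exact: en_line_le.
have t0 := nm_ge0 t; have l1 := line_ge1 x t.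
(* [h2] says [nm t < en (line x t) / 2], and [en (line x t) <= n + nm t]; so [nm t < n], and then
   [en (line x t)] is at most [2 n]. *)
have h4 : nm t < n.
  have : n^-1 / 2 * (n * en (line x t)) = en (line x t) / 2 by field; rewrite gt_eqF.
  by lra.
have : e / (2 * n ^+ 2) * (n * en (line x t)) <= e / (2 * n ^+ 2) * (n * (2 * n)).
  by rewrite ler_pM2l ?divr_gt0 ?mulr_gt0 ?exprn_gt0 // ler_pM2l //; lra.
have -> : e / (2 * n ^+ 2) * (n * (2 * n)) = e by field; rewrite gt_eqF.
by lra.
Qed.

Definition linep x : {poly C} * {poly C} :=
  ((vec x).1%:P + (dir x).1 *: 'X, (vec x).2%:P + (dir x).2 *: 'X).

Lemma linepE x t : ((linep x).1.[t], (linep x).2.[t]) = line x t.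
Proof. by rewrite /linep /line !hornerE /= ![_ * t]mulrC. Qed.

Definition homp (p : {poly C}) (v : {poly C} * {poly C}) : {poly C} :=
  \sum_(k < d.+1) p`_k *: (v.1 ^+ k * v.2 ^+ (d - k)).

Lemma hompE p (v : {poly C} * {poly C}) t : (homp p v).[t] = hom P Q p (v.1.[t], v.2.[t]).
Proof.
by rewrite /homp horner_sum; apply: eq_bigr => k _; rewrite !(hornerZ, hornerM, horner_exp).
Qed.

Definition liftp (v : {poly C} * {poly C}) := (homp P v, homp Q v).

Definition wedgep (v : {poly C} * {poly C}) (w : C * C) : {poly C} := w.2 *: v.1 - w.1 *: v.2.

Lemma wedgepE (v : {poly C} * {poly C}) w t : (wedgep v w).[t] = wedge (v.1.[t], v.2.[t]) w.
Proof. by rewrite /wedgep /wedge !hornerE /=; ring. Qed.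

(** Exponents [n1 < n2] would make [c1 t^n1] of order [t^(n1+1)] for small real [t]. *)
Lemma has_branch_uniq x n m : has_branch_index P Q x n -> has_branch_index P Q x m -> n = m.
Proof.
have main n1 n2 : (n1 < n2)%N -> has_branch_index P Q x n1 -> has_branch_index P Q x n2 -> False.
  move=> n12 [n10 [c1 c10 [M1 h1]]] [n20 [c2 c20 [M2 h2]]].
  have [e e0 h] := (nbhs_chd _ _).1 (filterI h1 h2).
  have cn : 0 < nm c1 by rewrite nm_gt0.
  pose A := nm M1 + nm M2 + nm c2 + 1.
  have A0 : 0 < A by rewrite /A; have := nm_ge0 M1; have := nm_ge0 M2; have := nm_ge0 c2; lra.
  pose t : K := Num.min (Num.min (e / 2) (1 / 2)) (nm c1 / (2 * A)).
  have t0 : 0 < t by rewrite !lt_min !divr_gt0 ?mulr_gt0.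
  have [te t1 tc] : [/\ t <= e / 2, t <= 1 / 2 & t <= nm c1 / (2 * A)].
    by split; rewrite !ge_min lexx ?orbT.
  have [] := h (pt (line x t%:C%C)).
    by apply: le_lt_trans (chd_line_le _ _) _; rewrite nm_real ger0_norm ?ltW //; lra.
  rewrite chart_line; set u := chart _ _.
  have tn : nm (t%:C%C : C) = t by rewrite nm_real ger0_norm ?ltW.
  move=> /norm_le_nm k1 /norm_le_nm k2; move: k1 k2; rewrite !nmM !nmX !nm_norm tn => k1 k2.
  have k3 : nm (c1 * t%:C%C ^+ n1) <= nm (u - c1 * t%:C%C ^+ n1) + nm (u - c2 * t%:C%C ^+ n2) +
      nm (c2 * t%:C%C ^+ n2).
    have {1}-> : c1 * t%:C%C ^+ n1 = - (u - c1 * t%:C%C ^+ n1) + (u - c2 * t%:C%C ^+ n2) +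
        c2 * t%:C%C ^+ n2 by ring.
    apply: le_trans (nmD _ _) _; rewrite lerD2r; apply: le_trans (nmD _ _) _.
    by rewrite nmN.
  rewrite !nmM !nmX tn in k3.
  have tp k : 0 < t ^+ k by exact: exprn_gt0.
  have tk k : (n1.+1 <= k)%N -> t ^+ k <= t ^+ n1.+1 by move=> hk; rewrite ler_wiXn2l ?ltW //; lra.
  have q1 : nm c2 * t ^+ n2 <= nm c2 * t ^+ n1.+1 by rewrite ler_wpM2l ?nm_ge0 ?tk.
  have q2 : nm M2 * t ^+ n2.+1 <= nm M2 * t ^+ n1.+1 by rewrite ler_wpM2l ?nm_ge0 ?tk // ltnW.
  have : nm c1 * t ^+ n1 <= (A * t) * t ^+ n1.
    rewrite -mulrA -exprS; apply: (@le_trans _ _ ((nm M1 + nm M2 + nm c2) * t ^+ n1.+1)).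
      by rewrite !mulrDl; lra.
    by rewrite ler_pM2r // /A; lra.
  rewrite ler_pM2r //; have : A * t <= nm c1 / 2.
    have : A * t <= A * (nm c1 / (2 * A)) by rewrite ler_pM2l.
    by have -> : A * (nm c1 / (2 * A)) = nm c1 / 2 by field; rewrite gt_eqF.
  by lra.
move=> hn hm; case: (ltngtP n m) => // h; exfalso; [exact: (main n m)|exact: (main m n)].
Qed.

Definition mult (z : 'I_d -> C * C) x : nat := #|[pred j | pt (z j) == x]|.

(** Along [line x t] each factor with root [x] contributes one [t], so in the charts [R] reads
    [t^n A(t) / B(t)] with [A(0)] and [B(0)] nonzero. *)
Lemma fac_has_branch w z x : fac w z -> R x = pt w -> has_branch_index P Q x (mult z x).
Proof.
move=> f Rx; have [w1 z1 [c c0 h]] := f.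
have w0 : 0 < en w by rewrite w1.
have [b b0 wb] := vec_pt w0; rewrite -Rx in wb.
have z0 j : 0 < en (z j) by rewrite z1.
split.
  by have /eqP := Rx; rewrite (fac_rootx hPQ hdeg _ f) => /existsP[j jx]; apply/card_gt0P; exists j.
pose n := mult z x.
pose a0 := - (c / b) * \prod_(j | pt (z j) == x) wedge (dir x) (z j).
pose A := a0 *: \prod_(j | pt (z j) != x) wedgep (linep x) (z j).
pose B := wedgep (liftp (linep x)) (dir (R x)).
have hA t : A.[t] = a0 * \prod_(j | pt (z j) != x) wedge (line x t) (z j).
  by rewrite hornerZ horner_prod; congr (_ * _); apply: eq_bigr => j _; rewrite wedgepE linepE.
have hB t : B.[t] = wedge (lift P Q (line x t)) (dir (R x)).
  by rewrite wedgepE /lift !hompE linepE.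
have B0 : B.[0] != 0.
  rewrite hB line0 wedge_eq0 ?lift_gt0 ?vec_gt0 ?dir_gt0 //.
  by rewrite -rat_map_pt ?vec_gt0 // pt_vec eq_sym dir_neq.
have A0 : A.[0] != 0.
  rewrite hA line0 mulf_neq0 //; last first.
    by apply/prodf_neq0 => j jx; rewrite wedge_eq0 ?vec_gt0 // pt_vec eq_sym.
  rewrite mulf_neq0 ?oppr_eq0 ?mulf_neq0 ?invr_eq0 //.
  by apply/prodf_neq0 => j /eqP jx; rewrite wedge_eq0 ?dir_gt0 // jx dir_neq.
have hAB t : (B.[t] != 0) -> chart (R x) (R (pt (line x t))) = t ^+ n * (A.[t] / B.[t]).
  move=> Bt; rewrite rat_map_pt ?line_gt0 // chart_wedge ?lift_gt0 ?line_gt0 //; last first.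
    by rewrite -wedge_eq0 ?dir_gt0 ?lift_gt0 ?line_gt0 // -hB.
  rewrite -hB mulrA -mulNr; congr (_ / _).
  have -> : wedge (lift P Q (line x t)) (vec (R x)) = b^-1 * wedge (lift P Q (line x t)) w.
    by rewrite wb wedge_scr mulKf.
  rewrite h (bigID (fun j => pt (z j) == x)) /= hA.
  have -> : \prod_(j | pt (z j) == x) wedge (line x t) (z j) =
      t ^+ n * \prod_(j | pt (z j) == x) wedge (dir x) (z j).
    rewrite /n /mult -prodr_const -big_split /=; apply: eq_bigr => j /eqP jx.
    rewrite wedge_line (_ : wedge (vec x) (z j) = 0) ?add0r //.
    by apply/eqP; rewrite wedge_eq0 ?vec_gt0 // pt_vec jx.
  by rewrite /a0; field.
have [r r0 [M hM]] := poly_quot0 A B0.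
exists (A.[0] / B.[0]); first by rewrite mulf_neq0 // invr_eq0.
exists M%:C%C; apply: filterS (near_chart x r0) => y [yx yr].
have [Bt hm] := hM _ yr; set t := chart x y in yx yr Bt hm *.
rewrite [in R y]yx hAB // [_ / _ * _]mulrC -mulrBr -/n.
rewrite !nmE nmM nmX -rmorphXn -rmorphM /= lecR exprS mulrA.
by rewrite mulrC ler_wpM2r ?exprn_ge0 ?nm_ge0.
Qed.

Lemma branch_index_fac w z x : fac w z -> R x = pt w -> branch_index P Q x = mult z x.
Proof.
move=> f Rx; apply: xget_unique; first exact: fac_has_branch f Rx.
by move=> n hn; apply: has_branch_uniq hn _; exact: fac_has_branch f Rx.
Qed.

Lemma branch_gt0 x : (0 < branch_index P Q x)%N.
Proof.
have [w w1 wx] := unit_vec (R x); have [z f] := fac_ex hPQ hdeg w1.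
by rewrite (branch_index_fac f (esym wx)); case: (fac_has_branch f (esym wx)).
Qed.

Lemma branch1_inj w (z : 'I_d -> C * C) x i j : fac w z -> branch_index P Q x = 1%N ->
  pt (z i) = x -> pt (z j) = x -> i = j.
Proof.
move=> f e1 ix jx; have Rx : R x = pt w by rewrite -ix (fac_R hPQ hdeg _ f).
have : (mult z x <= 1)%N by rewrite -(branch_index_fac f Rx) e1.
by move/card_le1_eqP; apply; rewrite inE ?ix ?jx.
Qed.

Lemma branch_neq1 w (z : 'I_d -> C * C) x : fac w z -> R x = pt w -> branch_index P Q x != 1%N ->
  exists i j, [/\ i != j, pt (z i) = x & pt (z j) = x].
Proof.
move=> f Rx; rewrite (branch_index_fac f Rx) => e1.
have : (1 < mult z x)%N.
  by rewrite ltn_neqAle eq_sym e1 /=; case: (fac_has_branch f Rx).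
move/card_gt1P => [i [j [/eqP ix /eqP jx ij]]]; by exists i, j.
Qed.

Lemma rat_map_open x (r : K) : 0 < r -> exists2 dl : K, 0 < dl &
  forall y, chd (R x) y < dl -> exists2 x', chd x x' < r & R x' = y.
Proof.
move=> r0; have [dl dl0 h] := root_continuity hPQ hdeg (R x) r0.
exists dl => // y hy; have [w [w0 [z [z0 [f f0 wy wx hz]]]]] := h y hy.
have /eqP := esym wx; rewrite (fac_rootx hPQ hdeg _ f0) => /existsP[j /eqP jx].
exists (pt (z j)); first by rewrite -jx.
by rewrite (fac_R hPQ hdeg _ f).
Qed.

Lemma rat_map_surj y : exists x, R x = y.
Proof.
have [w w1 <-] := unit_vec y; have [z f] := fac_ex hPQ hdeg w1.
have j0 : 'I_d by apply: (@Ordinal _ 0); lia.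
by exists (pt (z j0)); rewrite (fac_R hPQ hdeg _ f).
Qed.

(** Two points near [x] with one value are roots which [root_continuity] matches with [x], and at
    index 1 only one index is matched with [x]. *)
Lemma local_inj x : branch_index P Q x = 1%N -> exists2 r : K, 0 < r &
  forall x1 x2, chd x x1 < r -> chd x x2 < r -> R x1 = R x2 -> x1 = x2.
Proof.
move=> e1; have [w0 w01 w0x] := unit_vec (R x); have [zz ff] := fac_ex hPQ hdeg w01.
(* The value 1 at [x] itself keeps the minimum [s] over the fibre positive; elsewhere [s] bounds the
   distance to [x] from below. *)
pose g y : K := if y == x then 1 else chd x y.
have g0 y : 0 < g y by rewrite /g; case: eqVneq => // yx; rewrite chd_gt0 eq_sym.
pose s := \big[Num.min/1]_(y <- [seq pt (zz j) | j <- enum 'I_d]) g y.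
have s0 : 0 < s.
  by rewrite /s; elim/big_rec: _ => // y t _ t0; rewrite lt_min g0.
have hs y : R y = R x -> y != x -> s <= chd x y.
  move=> Ry yx; have : y \in [seq pt (zz j) | j <- enum 'I_d].
    have /eqP := Ry; rewrite -w0x (fac_rootx hPQ hdeg _ ff) => /existsP[j /eqP jy].
    by apply/mapP; exists j; rewrite ?mem_enum.
  have -> : chd x y = g y by rewrite /g (negbTE yx).
  rewrite /s; elim: [seq pt (zz j) | j <- enum 'I_d] => // a l ih.
  rewrite inE big_cons ge_min => /orP[/eqP ->|/ih ->]; by rewrite ?lexx ?orbT.
have r0 : 0 < s / 8 by lra.
have [dl dl0 h] := root_continuity hPQ hdeg (R x) r0.
have [L L0 hL] := rat_map_lip hPQ hdeg x.
exists (Num.min (s / 8) (dl / L)); first by rewrite lt_min r0 divr_gt0.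
move=> x1 x2; rewrite !lt_min => /andP[a1 b1] /andP[a2 b2] R12.
have [|w [w0' [z [z0 [f f0 wy wx hz]]]]] := h (R x1).
  by apply: le_lt_trans (hL x1) _; rewrite mulrC -ltr_pdivlMr.
have idx t : R t = R x1 -> chd x t < s / 8 -> exists2 j, pt (z j) = t & pt (z0 j) = x.
  move=> Rt ht; have /eqP := Rt; rewrite -wy (fac_rootx hPQ hdeg _ f) => /existsP[j /eqP jt].
  exists j => //; apply: contrapT => /eqP hj.
  have := hs _ (etrans (fac_R hPQ hdeg j f0) wx) hj.
  have := hz j; rewrite jt chdC; have := chd_triangle t x (pt (z0 j)); lra.
have [j1 j1x j1'] := idx x1 erefl a1; have [j2 j2x j2'] := idx x2 (esym R12) a2.
by rewrite -j1x -j2x (branch1_inj f0 e1 j1' j2').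
Qed.

End BranchIndex.

(** * Fatou and Julia sets *)

Section CriticalPoints.
Variables (K : realType) (P Q : {poly Cplx K}).
Local Notation C := (Cplx K).
Local Notation d := (rat_degree P Q).
Local Notation R := (rat_map P Q).
Hypothesis hPQ : coprimep P Q.
Hypothesis hdeg : (2 <= d)%N.

Lemma poly_ext (p q : {poly C}) : (forall t, p.[t] = q.[t]) -> p = q.
Proof.
move=> h; apply/eqP; rewrite -subr_eq0; apply: contraT => n0.
have := max_poly_roots n0 (rs := [seq i%:R | i <- iota 0 (size (p - q))]).
rewrite size_map size_iota ltnn => -> //.
  by apply/allP => t _; rewrite rootE !hornerE h subrr.
by rewrite map_inj_uniq ?iota_uniq // => i j /eqP; rewrite eqr_nat => /eqP.
Qed.

Lemma deriv_eq0 (p : {poly C}) : p^`() = 0 -> (size p <= 1)%N.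
Proof.
move=> h; apply/leq_sizeP => -[|j] // _; have : p^`()`_j = 0 by rewrite h coef0.
by rewrite coef_deriv => /eqP; rewrite mulrn_eq0 /= => /eqP.
Qed.

Lemma dvd_deriv (p : {poly C}) : p != 0 -> p %| p^`() -> (size p <= 1)%N.
Proof.
move=> p0 h; apply: deriv_eq0; apply/eqP; apply: contraT => n0.
by have := dvdp_leq n0 h; rewrite leqNgt lt_size_deriv.
Qed.

(** With [P] and [Q] coprime, [P' Q = P Q'] makes each divide its own derivative, hence constant. *)
Lemma wronskian_neq0 : P^`() * Q - P * Q^`() != 0.
Proof.
apply/eqP => /eqP; rewrite subr_eq0 => /eqP h.
have s0 (p q : {poly C}) : coprimep p q -> p = 0 -> (size p <= 1)%N /\ (size q <= 1)%N.
  move=> cpq p0; rewrite p0 size_poly0; split => //.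
  by move: cpq; rewrite p0 coprime0p => /eqp_size ->; rewrite size_poly1.
have [h1 h2] : (size P <= 1)%N /\ (size Q <= 1)%N.
  case: (eqVneq P 0) => [/(s0 _ _ hPQ)//|P0].
  case: (eqVneq Q 0) => [q0|Q0]; first by have [] := s0 Q P _ q0; rewrite // coprimep_sym.
  split; apply: dvd_deriv => //.
    by rewrite -(Gauss_dvdpl _ hPQ) h dvdp_mulr.
  have cQP : coprimep Q P by rewrite coprimep_sym.
  by rewrite -(Gauss_dvdpr _ cQP) -h dvdp_mull.
by move: hdeg; rewrite /rat_degree; lia.
Qed.

(** At a finite branch point some [w.2 P - w.1 Q] has a double root, which is a zero of the
    Wronskian. Infinity is put into the list outright. *)
Lemma crit_finite : exists s : seq (sphere K), forall x, branch_index P Q x != 1%N -> x \in s.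
Proof.
have [rs hrs] := closed_field_poly_normal (P^`() * Q - P * Q^`()).
exists (None :: map (fun a => Some a) rs) => -[a|//] ea; rewrite inE /=.
have l0 : lead_coef (P^`() * Q - P * Q^`()) != 0 by rewrite lead_coef_eq0 wronskian_neq0.
suff W0 : (P^`() * Q - P * Q^`()).[a] = 0.
  apply/mapP; exists a => //; move/eqP: W0; rewrite hrs hornerZ mulf_eq0 (negbTE l0) /=.
  by rewrite -[_ == 0]/(root _ a) root_prod_XsubC.
have [w w1 wx] := unit_vec (R (Some a)); have [z f] := fac_ex hPQ hdeg w1.
have [i [j [ij ia ja]]] := branch_neq1 hPQ hdeg f (esym wx) ea.
have [_ z1 [c c0 h]] := f.
have fl k : pt (z k) = Some a -> wedgep ('X, 1) (z k) = (z k).2 *: ('X - a%:P).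
  rewrite /pt; case: (eqVneq (z k).2 0) => // zk [] e.
  have e1 : (z k).1 = (z k).2 * a by rewrite -e mulrC divfK.
  by rewrite /wedgep /= e1 scalerBr alg_polyC; congr (_ - _); rewrite -mul_polyC polyCM.
pose p := w.2 *: P - w.1 *: Q.
have hp : p = c *: \prod_k wedgep ('X, 1) (z k).
  apply: poly_ext => t; rewrite hornerZ horner_prod.
  have -> : p.[t] = wedge (lift P Q (t, 1)) w.
    by rewrite /wedge /lift /= !hom_fin ?size_P ?size_Q // !hornerE; ring.
  by rewrite h; congr (_ * _); apply: eq_bigr => k _; rewrite wedgepE hornerX hornerC.
rewrite (bigD1 i) //= (bigD1 j) 1?eq_sym //= !fl // in hp.
have [g hg] : exists g, p = ('X - a%:P) * (('X - a%:P) * g).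
  move: hp; set G := \prod_(_ < _ | _) _ => ->.
  by exists ((c * (z i).2 * (z j).2)%:P * G); rewrite -!mul_polyC !polyCM; ring.
have p0 : p.[a] = 0 by rewrite hg hornerM hornerXsubC subrr mul0r.
have p0' : p^`().[a] = 0.
  by rewrite hg derivM hornerD !hornerM hornerXsubC subrr !(mul0r, mulr0) addr0.
move: p0 p0'; rewrite /p derivB !derivZ !hornerE /= => p0 p0'.
have w0 : 0 < en w by rewrite w1.
have e1 : w.2 * (P^`().[a] * Q.[a] - P.[a] * Q^`().[a]) = 0.
  have -> : w.2 * (P^`().[a] * Q.[a] - P.[a] * Q^`().[a]) =
    (w.2 * P^`().[a] - w.1 * Q^`().[a]) * Q.[a] - (w.2 * P.[a] - w.1 * Q.[a]) * Q^`().[a] by ring.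
  by rewrite p0 p0' !mul0r subr0.
have e2 : w.1 * (P^`().[a] * Q.[a] - P.[a] * Q^`().[a]) = 0.
  have -> : w.1 * (P^`().[a] * Q.[a] - P.[a] * Q^`().[a]) =
    (w.2 * P^`().[a] - w.1 * Q^`().[a]) * P.[a] - (w.2 * P.[a] - w.1 * Q.[a]) * P^`().[a] by ring.
  by rewrite p0 p0' !mul0r subr0.
move: w0; rewrite en_gt0 => /orP[] n0; [move/eqP: e2|move/eqP: e1];
    by rewrite mulf_eq0 (negbTE n0) /= => /eqP.
Qed.

End CriticalPoints.

(** * Invariance of the Fatou and Julia sets, and branching of backward orbits *)

Section FatouJulia.
Variables (K : realType) (P Q : {poly Cplx K}).
Local Notation C := (Cplx K).
Local Notation d := (rat_degree P Q).
Local Notation R := (rat_map P Q).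
Local Notation Rn n := (iter n R).
Hypothesis hPQ : coprimep P Q.
Hypothesis hdeg : (2 <= d)%N.
Implicit Types (x y z : sphere K).

Definition equic x := forall e : K, 0 < e -> exists2 dl : K, 0 < dl &
  forall y, chd x y < dl -> forall n, chd (Rn n x) (Rn n y) < e.

Lemma fatouP x : fatou_set P Q x <->
  exists2 e : K, 0 < e & forall y, chd x y < e -> equic y.
Proof.
split=> [[U [oU eU] Ux]|[e e0 h]].
  have [r r0 hr] := (nbhs_chd _ _).1 (open_nbhs_nbhs (conj oU Ux)).
  exists r => // y xy e e0; have Uy := hr _ xy.
  pose y' : U := exist _ y (mem_set Uy).
  have /eU : entourage [set p : sphere K * sphere K | chd p.1 p.2 < e].
    by apply/entourage_chd; exists e.
  move=> /(_ y') h1.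
  have : nbhs (y' : U) [set t : U | forall n, chd (Rn n y) (Rn n (\val t)) < e].
    by apply: filterS h1 => t ht n; exact: ht.
  rewrite nbhsE /= => -[B [[B1 oB1 <-] B1y] hB].
  have [r1 r10 hr1] := (nbhs_chd _ _).1 (open_nbhs_nbhs (conj oB1 B1y)).
  have [r2 r20 hr2] := (nbhs_chd _ _).1 (open_nbhs_nbhs (conj oU Uy)).
  exists (Num.min r1 r2); first by rewrite lt_min r10.
  move=> z; rewrite lt_min => /andP[z1 z2] n.
  have Uz := hr2 _ z2; exact: (hB (exist _ z (mem_set Uz)) (hr1 _ z1) n).
have [U [oU Ux hU]] := open_chd x e0.
exists U => //; split => // y' E /entourage_chd[e1 e10 hE].
have [dl dl0 hdl] := h _ (hU _ (set_mem (valP y'))) e1 e10.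
have [V [oV Vy hV]] := open_chd (\val y') dl0.
have : nbhs (y' : U) (\val @^-1` V : set U).
  by apply: open_nbhs_nbhs; split => //; exists V.
by apply: filterS => z' Vz n _; apply: hE; apply: hdl; exact: hV.
Qed.

Lemma lip_fatou x (r L : K) : 0 < r -> 0 < L ->
  (forall y z, chd x y < r -> chd x z < r ->
     forall n, chd (Rn n y) (Rn n z) <= L * chd y z) -> fatou_set P Q x.
Proof.
move=> r0 L0 h; apply/fatouP; exists (r / 4); first lra.
move=> y xy e e0; exists (Num.min (e / L) (r / 4)).
  by rewrite lt_min divr_gt0 //; lra.
move=> z; rewrite lt_min ltr_pdivlMr // mulrC => /andP[yz1 yz2] n.
apply: le_lt_trans yz1; apply: h; have := chd_ge0 x y; have := chd_triangle y x z; lra.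
Qed.

Lemma iter_cts n x (e : K) : 0 < e -> exists2 dl : K, 0 < dl &
  forall y, chd x y < dl -> chd (Rn n x) (Rn n y) < e.
Proof.
elim: n e => [|n ih] e e0; first by exists e.
have [L L0 hL] := rat_map_lip hPQ hdeg (Rn n x).
have [|dl dl0 h] := ih (e / L); first exact: divr_gt0.
exists dl => // y /h; rewrite ltr_pdivlMr // mulrC => h2.
by rewrite !iterS; apply: le_lt_trans (hL _) h2.
Qed.

Lemma iters_cts N x (e : K) : 0 < e -> exists2 dl : K, 0 < dl &
  forall y, chd x y < dl -> forall n, (n < N)%N -> chd (Rn n x) (Rn n y) < e.
Proof.
move=> e0; elim: N => [|N [d1 d10 h1]]; first by exists 1.
have [d2 d20 h2] := iter_cts N x e0.
exists (Num.min d1 d2); first by rewrite lt_min d10.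
move=> y; rewrite lt_min => /andP[y1 y2] n; rewrite ltnS leq_eqVlt => /orP[/eqP ->|]; auto.
Qed.

Lemma fatou_preim x : fatou_set P Q (R x) -> fatou_set P Q x.
Proof.
move=> /fatouP[e e0 h]; apply/fatouP.
have [L L0 hL] := rat_map_lip hPQ hdeg x.
exists (e / L) => [|y]; first exact: divr_gt0.
rewrite ltr_pdivlMr // mulrC => xy; have hy := h _ (le_lt_trans (hL _) xy).
move=> e1 e10; have [dl dl0 hd] := hy e1 e10.
have [L' L'0 hL'] := rat_map_lip hPQ hdeg y.
exists (Num.min e1 (dl / L')); first by rewrite lt_min e10 divr_gt0.
move=> z; rewrite lt_min ltr_pdivlMr // [_ * L']mulrC => /andP[z1 z2] [|n] //.
by rewrite !iterSr; apply: hd; apply: le_lt_trans (hL' _) z2.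
Qed.

(** Openness of [R] lifts points near [R x] to points near [x], where equicontinuity is known. *)
Lemma fatou_im x : fatou_set P Q x -> fatou_set P Q (R x).
Proof.
move=> /fatouP[e e0 h]; apply/fatouP.
have [dl dl0 hd] := rat_map_open hPQ hdeg x e0.
exists dl => // y /hd[x' xx' <-] e1 e10.
have [d1 d10 h1] := h _ xx' e1 e10.
have [d2 d20 h2] := rat_map_open hPQ hdeg x' d10.
exists d2 => // z /h2[x2 xx2 <-] n.
by rewrite -!iterSr; exact: h1.
Qed.

Lemma julia_im x : julia_set P Q x -> julia_set P Q (R x).
Proof. by move=> Jx /fatou_preim. Qed.

Lemma julia_preim x : julia_set P Q (R x) -> julia_set P Q x.
Proof. by move=> Jx /fatou_im. Qed.

Lemma julia_iter n x : julia_set P Q (Rn n x) <-> julia_set P Q x.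
Proof.
elim: n => // n ih; rewrite iterS; split=> [/julia_preim/ih//|/ih]; exact: julia_im.
Qed.

Lemma julia_closed x : (forall e : K, 0 < e -> exists2 y, chd x y < e & julia_set P Q y) ->
  julia_set P Q x.
Proof.
move=> h /fatouP[e e0 he]; have [|y xy] := h (e / 4); first lra.
apply; apply/fatouP; exists (e / 4); first lra.
by move=> z yz; apply: he; have := chd_triangle y x z; lra.
Qed.

Lemma iter_open n x (r : K) : 0 < r -> exists2 dl : K, 0 < dl &
  forall y, chd (Rn n x) y < dl -> exists2 x', chd x x' < r & Rn n x' = y.
Proof.
elim: n r => [|n ih] r r0; first by exists r => // y ?; exists y.
have [d1 d10 h1] := ih r r0; have [d2 d20 h2] := rat_map_open hPQ hdeg (Rn n x) d10.
by exists d2 => // y /h2[x1 /h1[x' xx' <-] <-]; exists x'.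
Qed.

(* Every preimage of a totally ramified value coincides with z, so the binary
   form vanishes to order d there, with a constant independent of z. *)
Lemma total_ramified : exists2 L : K, 0 < L & forall z,
  (forall x, R x = R z -> x = z) -> forall x, chd (R x) (R z) <= L * chd x z ^+ 2.
Proof.
have [c1 c10 h1] := lift_lower hPQ hdeg; have [c2 c20 h2] := lift_upper P Q.
exists (c2 / c1); first exact: divr_gt0.
move=> z hz x; have [w w1 wz] := unit_vec (R z).
have [zz f] := fac_ex hPQ hdeg w1; have [_ zz1 [c c0 h]] := f.
have zzz j : pt (zz j) = z by apply: hz; rewrite (fac_R hPQ hdeg j f).
have [u u1 uz] := unit_vec z.
have nw v j : en v = 1 -> nm (wedge v (zz j)) = chd (pt v) z.
  by move=> v1; rewrite -chd_unit // zzz.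
have cd : nm c <= c2.
  (* The antipode of [z] is at distance 1 from every root, so the form has modulus [nm c] there. *)
  pose v : C * C := (- (u.2)^*, (u.1)^*).
  have v1 : en v = 1 by rewrite -u1 /en /en2 /= nmN !nm_conj addrC.
  have vz : chd (pt v) z = 1.
    rewrite -uz chd_unit // /wedge /= mulNr -opprD nmN addrC ![_^* * _]conjM_nm.
    by rewrite -rmorphD /= -/(en2 u) -en_sq u1 expr1n nm1.
  have := wedge_en (lift P Q v) w; rewrite h w1 mulr1 nmM nm_prod.
  rewrite big1 ?mulr1 => [|j _]; last by rewrite nw.
  by move/le_trans; apply; exact: h2.
have [v v1 <-] := unit_vec x.
have lv : 0 < en (lift P Q v) by apply: lift_gt0; rewrite // v1.
rewrite -wz rat_map_pt ?v1 // chd_pt ?w1 // mulr1 h nmM nm_prod.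
rewrite (eq_bigr (fun=> chd (pt v) z)) => [|j _]; last exact: nw.
rewrite prodr_const card_ord ler_pdivrMr //.
have hd : chd (pt v) z ^+ d <= chd (pt v) z ^+ 2.
  by rewrite ler_wiXn2l ?chd_ge0 ?chd_le1.
apply: (@le_trans _ _ (c2 * chd (pt v) z ^+ 2)).
  by rewrite ler_pM ?nm_ge0 ?exprn_ge0 ?chd_ge0.
rewrite -mulrA [_^-1 * _]mulrC -mulrA -mulrA ler_pM2l // ler_peMr ?exprn_ge0 ?chd_ge0 //.
by rewrite mulrC ler_pdivlMr // mul1r h1.
Qed.

(* A periodic backward orbit of singleton fibres is superattracting. *)
Lemma backward_branch y : julia_set P Q y -> exists n z1 z2,
  [/\ z1 != z2, Rn n z1 = y & Rn n z2 = y].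
Proof.
move=> Jy; apply: contrapT => hn.
have sg n z1 z2 : Rn n z1 = y -> Rn n z2 = y -> z1 = z2.
  move=> h1 h2; apply: contrapT => /eqP h; apply: hn; exists n, z1, z2; by split.
have /choice[z hz] n : exists z, Rn n z = y.
  elim: n => [|n [z hz]]; first by exists y.
  by have [x hx] := rat_map_surj hPQ hdeg z; exists x; rewrite iterSr hx.
have zS n : R (z n.+1) = z n by apply: (sg n) => //; rewrite -iterSr.
have tr n x : R x = z n -> x = z n.+1 by move=> h; apply: (sg n.+1) => //; rewrite iterSr h.
have [s hs] := crit_finite hPQ hdeg.
(* All [d] preimages of [z n] coincide with [z n.+1], which is therefore a branch point. There are
   finitely many of these, so the backward orbit repeats. *)
have zs n : z n.+1 \in s.
  apply: hs; have [w w1 wx] := unit_vec (z n); have [zz f] := fac_ex hPQ hdeg w1.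
  rewrite (branch_index_fac hPQ hdeg f) ?zS ?wx //.
  have -> : mult zz (z n.+1) = d.
    rewrite /mult -[RHS]card_ord; apply: eq_card => j; rewrite !inE.
    by apply/eqP/tr; rewrite (fac_R hPQ hdeg j f).
  by apply/eqP => d1; move: hdeg; rewrite d1.
have [i [j [ij zij]]] : exists i j, (i < j)%N /\ z i = z j.
  apply: contrapT => h.
  have : {subset [seq z n.+1 | n <- iota 0 (size s).+1] <= s}.
    by move=> x /mapP[n _ ->].
  move/uniq_leq_size; rewrite size_map size_iota ltnn => /(_ _)/negP; apply => //.
  rewrite map_inj_in_uniq ?iota_uniq // => a b _ _ ab.
  by case: (ltngtP a b) => // ab'; exfalso; apply: h; [exists a.+1, b.+1|exists b.+1, a.+1].
have cyc n : exists l, (i < l <= j)%N /\ Rn n (z j) = z l.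
  elim: n => [|n [l [/andP[il lj] hl]]]; first by exists j; rewrite ij leqnn.
  rewrite iterS hl; case: l il lj {hl} => // l il lj; rewrite zS.
  move: il; rewrite ltnS leq_eqVlt => /orP[/eqP <-|il]; last by exists l; rewrite il ltnW.
  by exists j; rewrite ij leqnn.
have [L L0 hL] := total_ramified.
(* [L r <= 1/2], so the quadratic estimate of [total_ramified] at least halves the distance at each
   step of the cycle. *)
pose r := Num.min 1 (1 / (2 * L)).
have r0 : 0 < r by rewrite lt_min ltr01 divr_gt0 ?mulr_gt0.
have con n x : chd x (z j) < r -> chd (Rn n x) (Rn n (z j)) <= 2^-1 ^+ n * chd x (z j).
  move=> xr; elim: n => [|n ih]; first by rewrite expr0 mul1r.
  have [l [/andP[il lj] hl]] := cyc n.
  have ltr : forall t, R t = R (z l) -> t = z l.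
    case: l il {lj hl} => // l _ t; rewrite zS; exact: tr.
  rewrite !iterS; have := hL _ ltr (Rn n x); rewrite -hl => /le_trans; apply.
  have cr : chd (Rn n x) (Rn n (z j)) <= r.
    apply: le_trans ih _; apply: le_trans (ltW xr); rewrite ler_piMl ?chd_ge0 //.
    by rewrite exprn_ile1 ?invr_ge0 // invf_le1 // ler1n.
  have Lr : L * r <= 2^-1.
    have : L * r <= L * (1 / (2 * L)) by rewrite ler_pM2l // ge_min lexx orbT.
    by have -> : L * (1 / (2 * L)) = 2^-1 by field; rewrite gt_eqF.
  have c0 := chd_ge0 (Rn n x) (Rn n (z j)).
  move: (chd _ _) (chd _ _) cr ih c0 => c1 c2 cr ih c0.
  rewrite [2^-1 ^+ n.+1]exprS -mulrA expr2 mulrA; apply: ler_pM => //; first by rewrite mulr_ge0 // ltW.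
  by apply: le_trans Lr; rewrite ler_pM2l.
have : fatou_set P Q (z j).
  apply/fatouP; exists (r / 4); first lra.
  move=> a ja e e0.
  have [N hN] := @geometric_small K 4 2^-1 e ltac:(lra) ltac:(lra) e0.
  have [dl dl0 hd] := iters_cts N a e0.
  exists (Num.min dl (r / 4)); first by rewrite lt_min dl0; lra.
  move=> b; rewrite lt_min => /andP[ab1 ab2] n; case: (ltnP n N) => nN; first exact: hd.
  have ha : chd a (z j) < r by rewrite chdC; lra.
  have hb : chd b (z j) < r.
    by rewrite chdC; have := chd_triangle a (z j) b; lra.
  have bd t : chd t (z j) < r -> chd (Rn n t) (Rn n (z j)) <= 2^-1 ^+ n.
    move=> tr0; apply: le_trans (con n _ tr0) _.
    by rewrite ler_piMr ?chd_le1 // exprn_ge0 // invr_ge0.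
  have := chd_triangle (Rn n (z j)) (Rn n a) (Rn n b).
  have := hN n nN; have := bd _ ha; have := bd _ hb; rewrite (chdC (Rn n b)); lra.
by have : julia_set P Q (z j) by apply/(julia_iter j); rewrite hz.
Qed.

End FatouJulia.

(** * The Green function and exactness on the Julia set *)

Section LogSeries.
Variable K : realType.
Local Notation C := (Cplx K).

(** The truncated real part of a power series without constant term. A harmonic function minus its
    value at the centre appears below as the negative of such a series. *)
Definition expsum (a : nat -> C) N (w : C) : K :=
  \sum_(k < N) complex.Re (a k * w ^+ k.+1).

Lemma ReD (x y : C) : complex.Re (x + y) = complex.Re x + complex.Re y.
Proof. by case: x y => [? ?] [? ?]. Qed.

Lemma ReN (x : C) : complex.Re (- x) = - complex.Re x.
Proof. by case: x. Qed.

Lemma Re_sum (I : Type) (r : seq I) (f : I -> C) :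
  complex.Re (\sum_(i <- r) f i) = \sum_(i <- r) complex.Re (f i).
Proof. by elim: r => [|i r ih]; rewrite ?big_nil // !big_cons ReD ih. Qed.

Lemma Re_scale (r : K) (x : C) : complex.Re (r%:C%C * x) = r * complex.Re x.
Proof. by case: x => a b /=; rewrite mul0r subr0. Qed.

Lemma inv_conj (u : C) : u^-1 = ((nm u) ^- 2)%:C%C * u^*.
Proof.
have [->|u0] := eqVneq u 0; first by rewrite invr0 conjC0 mulr0.
apply: (mulIf u0); rewrite mulVf // -mulrA conjM_nm -rmorphM mulVf //.
by rewrite sqrf_eq0 nm_eq0.
Qed.

(** The mean value theorem for [ln |1 - t z|] plus its truncated series: the derivative in [t] is
    [- Re (z^(N+1) t^N / (1 - t z))], and [|1 - t z| >= 1/2]. *)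
Lemma ln_expand (z : C) N : nm z <= 1 / 2 ->
  `|ln (nm (1 - z)) + \sum_(k < N) complex.Re (z ^+ k.+1) / k.+1%:R| <= 2 * nm z ^+ N.+1.
Proof.
move=> z2; pose x := complex.Re z; pose y := complex.Im z.
(* [q.[t]] is [|1 - t z|^2], a real polynomial, so only real derivatives occur. *)
pose q : {poly K} := 1%:P - (2 * x) *: 'X + (x ^+ 2 + y ^+ 2) *: 'X^2.
pose p : {poly K} := \sum_(k < N) (complex.Re (z ^+ k.+1) / k.+1%:R) *: 'X^(k.+1).
pose u (t : K) : C := 1 - t%:C%C * z.
have qE t : q.[t] = nm (u t) ^+ 2.
  rewrite nm_sq /u /q !hornerE /x /y; case: (z) => a b /=; rewrite !(mul0r, subr0, addr0, sub0r); ring.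
have u0 (t : K) : 0 <= t -> t <= 1 -> 1 / 2 <= nm (u t).
  move=> t0 t1; have := nm_ler_dist 1 (t%:C%C * z); rewrite nm1 nmM nm_real ger0_norm // -/(u t).
  have : t * nm z <= nm z by rewrite ler_piMl ?nm_ge0.
  by lra.
have q0 (t : K) : 0 <= t -> t <= 1 -> 0 < q.[t].
  by move=> t0 t1; rewrite qE exprn_gt0 //; have := u0 t t0 t1; lra.
pose f t := ln q.[t] * 2^-1 + p.[t].
pose df t := (q.[t]^-1 * q^`().[t]) * 2^-1 + p^`().[t].
have fd (t : K) : 0 <= t -> t <= 1 -> is_derive t (1 : K) f (df t).
  move=> t0 t1; apply: is_deriveD.
  have h := is_derive1_comp (is_derive1_ln (q0 t t0 t1)) (is_derive_poly q t).
  have := is_deriveM h (is_derive_cst (2^-1 : K) t 1).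
  by move/is_derive_eq; apply; rewrite scaler0 add0r; rewrite /GRing.scale /= mulrC.
have dfE (t : K) : 0 <= t -> t <= 1 -> df t = - complex.Re (z ^+ N.+1 * t%:C%C ^+ N / u t).
  move=> t0 t1; have un : u t != 0 by rewrite -nm_gt0; have := u0 t t0 t1; lra.
  rewrite /df; have -> : p^`().[t] = complex.Re (\sum_(k < N) z ^+ k.+1 * t%:C%C ^+ k).
    rewrite Re_sum /p linear_sum /= horner_sum; apply: eq_bigr => k _.
    rewrite derivZ hornerZ derivXn hornerMn hornerXn /= -rmorphXn [z ^+ _ * _]mulrC Re_scale.
    by rewrite -[t ^+ k *+ _]mulr_natl mulrA divfK ?pnatr_eq0 // mulrC.
  have geo : \sum_(k < N) z ^+ k.+1 * t%:C%C ^+ k = z / u t - z ^+ N.+1 * t%:C%C ^+ N / u t.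
    apply: (mulIf un); rewrite mulrBl !divfK //.
    have -> : \sum_(k < N) z ^+ k.+1 * t%:C%C ^+ k = z * \sum_(k < N) (t%:C%C * z) ^+ k.
      by rewrite mulr_sumr; apply: eq_bigr => k _; rewrite exprS exprMn; ring.
    have := subrX1 (t%:C%C * z) N; rewrite /u => h.
    rewrite -mulrA -[_ * (1 - _)]opprK -mulrN opprB mulrC -[_ * (_ - 1)]mulrC.
    rewrite -h exprMn exprS; ring.
  rewrite geo ReD ReN addrA -[RHS]add0r; congr (_ + _).
  rewrite inv_conj mulrCA Re_scale -qE.
  have -> : q^`().[t] = - 2 * complex.Re (z * (u t)^*).
    rewrite /q !(derivD, derivN, derivZ, derivXn, derivX, derivC).
    rewrite !hornerE /= /u /x /y; case: (z) => a b /=; ring.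
  by field; rewrite gt_eqF // q0.
have [||c c01] := @MVT_segment K f df 0 1 ler01.
- by move=> t; rewrite in_itv /= => /andP[/ltW t0 /ltW t1]; exact: fd.
- apply: derivable_within_continuous => t; rewrite in_itv /= => /andP[t0 t1].
  by have [] := fd t t0 t1.
rewrite subr0 mulr1 => e.
move: c01; rewrite in_itv /= => /andP[c0 c1].
have f1 : f 1 = ln (nm (1 - z)) + \sum_(k < N) complex.Re (z ^+ k.+1) / k.+1%:R.
  rewrite /f qE /u mul1r; congr (_ + _).
    have h1 : 0 < nm (1 - z) by have := nm_ler_dist 1 z; rewrite nm1; lra.
    rewrite lnXn //.
    by rewrite mulr2n; lra.
  rewrite /p horner_sum; apply: eq_bigr => k _.
  by rewrite hornerZ hornerXn expr1n mulr1.
have f0 : f 0 = 0.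
  rewrite /f qE /u mul0r subr0 nm1 expr1n ln1 mul0r add0r /p horner_sum big1 // => k _.
  by rewrite hornerZ hornerXn expr0n mulr0.
rewrite -f1 -[f 1]subr0 -f0 e dfE // normrN.
apply: le_trans (abs_re_le _) _; rewrite !nmM nmV !nmX nm_real ger0_norm //.
have uc := u0 c c0 c1; have up : 0 < nm (u c) by lra.
rewrite ler_pdivrMr //.
have zN := exprn_ge0 N.+1 (nm_ge0 z).
apply: (@le_trans _ _ (nm z ^+ N.+1)); first by rewrite ler_piMr // exprn_ile1.
have : nm z ^+ N.+1 * (2 * nm (u c)) >= nm z ^+ N.+1 * 1 by rewrite ler_wpM2l //; lra.
by lra.
Qed.

Lemma ln_prod (I : Type) (r : seq I) (f : I -> K) : (forall i, 0 < f i) ->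
  ln (\prod_(i <- r) f i) = \sum_(i <- r) ln (f i).
Proof.
move=> f0; elim: r => [|i r ih]; first by rewrite !big_nil ln1.
by rewrite !big_cons lnM ?posrE ?ih // prodr_gt0.
Qed.

(** [ln_expand] is summed over the at most [D] roots, all at distance at least [s] from [p].
    Dividing by [D] makes the bounds on coefficients and remainder independent of the polynomial and
    its degree. *)
Lemma poly_log_expand (h : {poly C}) D (p : C) (s : K) :
  (0 < D)%N -> (size h <= D.+1)%N -> 0 < s ->
  (forall w, nm w < s -> h.[p + w] != 0) ->
  exists a : nat -> C, (forall k, nm (a k) <= s ^- k.+1) /\
   forall N w, nm w <= s / 2 ->
    `|(ln (nm h.[p + w]) - ln (nm h.[p])) / D%:R + expsum a N w| <= 2 * (nm w / s) ^+ N.+1.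
Proof.
move=> D0 sh s0 hn; have [rs hrs] := closed_field_poly_normal h.
have hp0 : h.[p] != 0 by rewrite -[p]addr0 hn // nm0.
have h0 : h != 0 by apply: contraNneq hp0 => ->; rewrite horner0.
have l0 : lead_coef h != 0 by rewrite lead_coef_eq0.
have srs : (size rs <= D)%N.
  by rewrite -ltnS (leq_trans _ sh) // {1}hrs size_scale // size_prod_XsubC.
have rsz r : r \in rs -> s <= nm (r - p).
  move=> rr; rewrite leNgt; apply/negP => /hn; rewrite addrC subrK hrs hornerZ mulf_eq0 (negbTE l0) /=.
  by rewrite -[_ == 0]/(root _ r) root_prod_XsubC rr.
have D0' : (0 : K) < D%:R by rewrite ltr0n.
exists (fun k => D%:R^-1 * \sum_(r <- rs) (r - p) ^- k.+1 / k.+1%:R); split=> [k|N w ws].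
  rewrite nmM nmV nm_nat mulrC ler_pdivrMr //; apply: le_trans (nm_sum _ _ _) _.
  apply: (@le_trans _ _ (\sum_(r <- rs) s ^- k.+1)).
    rewrite big_seq [leRHS]big_seq; apply: ler_sum => r rr.
    rewrite nmM !nmV nmX nm_nat ler_pdivrMr ?ltr0n //.
    apply: (@le_trans _ _ (s ^- k.+1)); last first.
      by rewrite ler_peMr ?ler1n // invr_ge0 exprn_ge0 // ltW.
    have ns := rsz r rr; have n0 : 0 < nm (r - p) by exact: lt_le_trans ns.
    by rewrite lef_pV2 ?posrE ?exprn_gt0 // lerXn2r ?nnegrE ?nm_ge0 // ltW.
  rewrite big_const_seq count_predT iter_addr_0 -[leLHS]mulr_natr ler_wpM2l ?ler_nat // invr_ge0 exprn_ge0 //.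
  exact: ltW.
pose z r := if r \in rs then w / (r - p) else 0.
have zb r : nm (z r) <= nm w / s.
  rewrite /z; case: ifP => rr; last by rewrite nm0 divr_ge0 ?nm_ge0 ?ltW.
  have ns := rsz r rr; rewrite nmM nmV ler_wpM2l ?nm_ge0 // lef_pV2 ?posrE //.
  exact: lt_le_trans ns.
have ws2 : nm w / s <= 1 / 2 by rewrite ler_pdivrMr //; lra.
have z1 r : 0 < nm (1 - z r).
  by have := nm_ler_dist 1 (z r); rewrite nm1; have := zb r; lra.
have hE : h.[p + w] = h.[p] * \prod_(r <- rs) (1 - z r).
  rewrite hrs !hornerZ !horner_prod -mulrA -big_split /=; congr (_ * _).
  rewrite big_seq [RHS]big_seq; apply: eq_bigr => r rr; rewrite !hornerXsubC /z rr.
  have ns := rsz r rr; have n0 : r - p != 0 by rewrite -nm_gt0; exact: lt_le_trans ns.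
  by field.
rewrite hE nmM nm_prod lnM ?posrE ?nm_gt0 //; last by apply: prodr_gt0.
rewrite ln_prod // [ln (nm h.[p]) + _]addrC addrK.
have -> : expsum (fun k => D%:R^-1 * \sum_(r <- rs) (r - p) ^- k.+1 / k.+1%:R) N w =
  (\sum_(r <- rs) \sum_(k < N) complex.Re (z r ^+ k.+1) / k.+1%:R) / D%:R.
  rewrite /expsum exchange_big /= mulr_suml; apply: eq_bigr => k _.
  have -> : (D%:R : C)^-1 = (D%:R^-1)%:C%C by rewrite fmorphV rmorph_nat.
  rewrite -mulrA Re_scale mulrC; congr (_ / _).
  rewrite mulr_suml Re_sum big_seq [RHS]big_seq; apply: eq_bigr => r rr.
  rewrite /z rr exprMn exprVn.
  have -> : (k.+1%:R : C)^-1 = (k.+1%:R^-1)%:C%C by rewrite fmorphV rmorph_nat.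
  by rewrite -mulrA mulrCA Re_scale mulrC [w ^+ _ * _]mulrC.
rewrite -mulrDl -big_split /= normrM [ `|_^-1|]gtr0_norm ?invr_gt0 // ler_pdivrMr //.
apply: le_trans (ler_norm_sum _ _ _) _.
apply: (@le_trans _ _ (\sum_(r <- rs) 2 * (nm w / s) ^+ N.+1)).
  apply: ler_sum => r _; apply: le_trans (ln_expand _ (le_trans (zb r) ws2)) _.
  by rewrite ler_pM2l // lerXn2r ?nnegrE ?nm_ge0 // divr_ge0 ?nm_ge0 // ltW.
rewrite big_const_seq count_predT iter_addr_0 -[leLHS]mulr_natr ler_wpM2l ?ler_nat //.
by rewrite mulr_ge0 // exprn_ge0 // divr_ge0 ?nm_ge0 // ltW.
Qed.

(** The identity theorem for real parts: at the first nonzero coefficient the direction [z] with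
    [z^(k+1) = (b k)^*] makes the leading term a positive multiple of [e^(k+1)], against a bound of
    order [e^(k+2)]. *)
Lemma coef_vanish (b : nat -> C) (eta t : K) : 0 < eta -> 0 < t ->
  (forall N w, nm w < eta -> `|expsum b N w| <= 4 * (nm w / t) ^+ N.+1) -> forall k, b k = 0.
Proof.
move=> eta0 t0 h k; elim/ltn_ind: k => k ih; apply/eqP; apply: contraT => bk.
have hs w : expsum b k.+1 w = complex.Re (b k * w ^+ k.+1).
  by rewrite /expsum big_ord_recr /= big1 ?add0r // => i _; rewrite ih // mul0r.
pose z := k.+1.-root ((b k)^*).
have zk : z ^+ k.+1 = (b k)^* by rewrite rootCK.
have z0 : 0 < nm z.
  by rewrite nm_gt0; apply: contra_neq bk => z0; apply: (can_inj conjCK); rewrite -zk z0 expr0n conjC0.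
have b0 : 0 < nm (b k) by rewrite nm_gt0.
pose A := (nm z / t) ^+ k.+2.
have A0 : 0 < A by rewrite exprn_gt0 // divr_gt0.
pose e := Num.min (eta / (2 * nm z)) (nm (b k) ^+ 2 / (8 * A)).
have p1 : 0 < eta / (2 * nm z) by rewrite divr_gt0 // mulr_gt0.
have p2 : 0 < nm (b k) ^+ 2 / (8 * A).
  by apply: divr_gt0; [exact: exprn_gt0|exact: mulr_gt0].
have e0 : 0 < e by rewrite lt_min p1 p2.
have [e1 e2] : e <= eta / (2 * nm z) /\ e <= nm (b k) ^+ 2 / (8 * A).
  by split; rewrite ge_min lexx ?orbT.
have nw : nm (e%:C%C * z) = e * nm z by rewrite nmM nm_real gtr0_norm.
have ez : e * nm z < eta.
  have : e * nm z <= eta / (2 * nm z) * nm z by rewrite ler_pM2r.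
  by have -> : eta / (2 * nm z) * nm z = eta / 2; [field; rewrite gt_eqF|lra].
have := h k.+1 (e%:C%C * z); rewrite nw hs => /(_ ez); rewrite exprMn zk.
have -> : b k * (e%:C%C ^+ k.+1 * (b k)^*) = (e ^+ k.+1 * nm (b k) ^+ 2)%:C%C.
  by rewrite mulrCA [b k * _]mulrC conjM_nm -rmorphXn -rmorphM.
have p0 : 0 < e ^+ k.+1 by exact: exprn_gt0.
rewrite ger0_norm; last by rewrite mulr_ge0 ?exprn_ge0 // ltW.
have -> : 4 * (e * nm z / t) ^+ k.+2 = e ^+ k.+1 * (4 * e * A).
  by rewrite -mulrA exprMn -/A [e ^+ k.+2]exprS; ring.
rewrite ler_pM2l // => hh.
have : e * A <= nm (b k) ^+ 2 / (8 * A) * A by rewrite ler_pM2r.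
have -> : nm (b k) ^+ 2 / (8 * A) * A = nm (b k) ^+ 2 / 8 by field; rewrite gt_eqF.
have := exprn_gt0 2 b0; move: hh; rewrite -mulrA; lra.
Qed.

(** Cauchy's estimate, with the mean over the circle replaced by the mean over [size p] equidistant
    points, which is exact for [p]. *)
Lemma cauchy_coef (p : {poly C}) (B tau : K) k : 0 < tau ->
  (forall w, nm w <= tau -> nm p.[w] <= B) -> nm p`_k * tau ^+ k <= B.
Proof.
move=> t0 h; have B0 : 0 <= B by apply: le_trans (h 0 _); rewrite ?nm_ge0 // nm0 ltW.
case: (ltnP k (size p)) => kp; last by rewrite nth_default // nm0 mul0r.
pose N := size p; have N0 : (0 < N)%N by exact: leq_ltn_trans kp.
have [w pw] := @prim_root_exists K N N0.
have w1 : nm w = 1 by rewrite /nm (prim_norm pw).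
have w0 : w != 0 by rewrite -nm_eq0 w1 oner_eq0.
have key : \sum_(t < N) p.[tau%:C%C * w ^+ t] * (w ^+ t) ^- k = N%:R * (p`_k * tau%:C%C ^+ k).
  transitivity (\sum_(j < N) p`_j * tau%:C%C ^+ j * \sum_(t < N) (w ^ (j%:Z - k%:Z)) ^+ t).
    under eq_bigr do rewrite horner_coef mulr_suml; rewrite exchange_big /=.
    apply: eq_bigr => j _; rewrite mulr_sumr; apply: eq_bigr => t _.
    rewrite exprMn -!mulrA; congr (_ * (_ * _)).
    by rewrite expfzDr // exprMn -exprnP -exprnN exprVn ![w ^+ t ^+ _]exprAC.
  rewrite (bigD1 (Ordinal kp)) //= sum_prim // subrr ?eqxx //.
  rewrite big1 ?addr0 1?mulrC // => j jk; rewrite sum_prim //; last first.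
    have jN : (j < N)%N := ltn_ord j; have kN : (k < N)%N := kp.
    by move: (nat_of_ord j) jN => jj jN; clear -jN kN; lia.
  rewrite subr_eq0 eqz_nat ifN ?mulr0 //; apply: contraNneq jk => jk; exact/eqP/val_inj.
have : nm (\sum_(t < N) p.[tau%:C%C * w ^+ t] * (w ^+ t) ^- k) <= N%:R * B.
  apply: le_trans (nm_sum _ _ _) _.
  apply: (@le_trans _ _ (\sum_(t < N) B)); last by rewrite sumr_const card_ord mulr_natl.
  apply: ler_sum => t _; rewrite nmM nmV !nmX w1 !expr1n invr1 mulr1.
  by apply: h; rewrite nmM nmX w1 expr1n mulr1 nm_real gtr0_norm.
by rewrite key !nmM nm_nat nmX nm_real gtr0_norm // ler_pM2l // ltr0n.
Qed.

Lemma poly_lipschitz (p : {poly C}) (B tau : K) : 0 < tau ->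
  (forall w, nm w <= tau -> nm p.[w] <= B) ->
  forall w w', nm w <= tau / 2 -> nm w' <= tau / 2 ->
  nm (p.[w] - p.[w']) <= 4 * B / tau * nm (w - w').
Proof.
move=> t0 h w w' hw hw'.
have B0 : 0 <= B by apply: le_trans (h 0 _); rewrite ?nm_ge0 // nm0 ltW.
have geo n : \sum_(k < n) k%:R * 2 * 2^-1 ^+ k <= 4 :> K.
  have -> : \sum_(k < n) k%:R * 2 * 2^-1 ^+ k = 4 - 4 * (n%:R + 1) * 2^-1 ^+ n :> K.
    elim: n => [|n ih]; first by rewrite big_ord0 expr0; ring.
    by rewrite big_ord_recr /= ih -natr1 exprS; field.
  by rewrite gerBl mulr_ge0 ?exprn_ge0 ?invr_ge0 // mulr_ge0 // addr_ge0.
have pw k : nm (w ^+ k - w' ^+ k) <= k%:R * (tau / 2) ^+ k.-1 * nm (w - w').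
  rewrite subrXX nmM mulrC ler_wpM2r ?nm_ge0 //.
  apply: le_trans (nm_sum _ _ _) _.
  apply: (@le_trans _ _ (\sum_(i < k) (tau / 2) ^+ k.-1)); last by rewrite sumr_const card_ord mulr_natl.
  apply: ler_sum => i _; rewrite nmM !nmX.
  have -> : (tau / 2) ^+ k.-1 = (tau / 2) ^+ (k.-1 - i) * (tau / 2) ^+ i.
    by rewrite -exprD subnK //; have := ltn_ord i; lia.
  have t2 : 0 <= tau / 2 by lra.
  by rewrite ler_pM ?exprn_ge0 ?nm_ge0 // lerXn2r ?nnegrE ?nm_ge0.
have -> : p.[w] - p.[w'] = \sum_(k < size p) p`_k * (w ^+ k - w' ^+ k).
  by rewrite !horner_coef -sumrB; apply: eq_bigr => k _; rewrite mulrBr.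
apply: le_trans (nm_sum _ _ _) _.
apply: (@le_trans _ _ (\sum_(k < size p) (B / tau * nm (w - w')) * (k%:R * 2 * 2^-1 ^+ k))).
  apply: ler_sum => k _; rewrite nmM.
  have pk : nm p`_k <= B / tau ^+ k by rewrite ler_pdivlMr ?exprn_gt0 // cauchy_coef.
  apply: le_trans (ler_pM (nm_ge0 _) (nm_ge0 _) pk (pw k)) _.
  case: (val k) => [|n]; first by rewrite !(mul0r, mulr0).
  rewrite le_eqVlt; apply/orP; left; apply/eqP => /=.
  by rewrite exprMn !exprS; field; rewrite expf_neq0 gt_eqF.
rewrite -mulr_sumr mulrC; have := geo (size p).
have X0 : 0 <= B / tau * nm (w - w') by rewrite mulr_ge0 ?nm_ge0 // divr_ge0 // ltW.
move/(ler_wpM2r X0)/le_trans; apply.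
by rewrite !mulrA.
Qed.

(** A polynomial substitute for [exp (-z)]: the error in the logarithm of the modulus is at most
    [2 |z|^2 / M]. *)
Lemma exp_approx (A : K) M : (0 < M)%N -> 2 * A <= M%:R -> 2 * A ^+ 2 <= M%:R ->
  forall z : C, nm z <= A -> 0 < nm ((1 - z / M%:R) ^+ M) /\
    `|ln (nm ((1 - z / M%:R) ^+ M)) + complex.Re z| <= 1.
Proof.
move=> M0 hA hA2 z zA; have M0' : (0 : K) < M%:R by rewrite ltr0n.
have n : nm (z / M%:R) = nm z / M%:R by rewrite nmM nmV nm_nat.
have zM : nm (z / M%:R) <= 1 / 2 by rewrite n ler_pdivrMr //; lra.
have := @ln_expand (z / M%:R) 1 zM; rewrite big_ord1 expr1 divr1 n => h.
have p0 : 0 < nm (1 - z / M%:R).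
  by have := nm_ler_dist 1 (z / M%:R); rewrite nm1 ; lra.
rewrite nmX lnXn //; split; first exact: exprn_gt0.
have -> : ln (nm (1 - z / M%:R)) *+ M + complex.Re z = M%:R * (ln (nm (1 - z / M%:R)) +
    complex.Re (z / M%:R)).
  have -> : (M%:R : C)^-1 = (M%:R^-1)%:C%C by rewrite fmorphV rmorph_nat.
  rewrite [z * _]mulrC Re_scale mulrDr mulrA mulfV ?gt_eqF // mul1r mulr_natl //.
rewrite normrM (ger0_norm (ltW M0')); apply: le_trans (ler_wpM2l (ltW M0') h) _.
have : M%:R * (2 * (nm z / M%:R) ^+ 2) = 2 * nm z ^+ 2 / M%:R by field; rewrite gt_eqF.
move=> ->; rewrite ler_pdivrMr // mul1r; apply: le_trans hA2.
by rewrite ler_pM2l // lerXn2r ?nnegrE ?nm_ge0 // (le_trans (nm_ge0 _) zA).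
Qed.

End LogSeries.

(** * The Green function and the potentials of moving targets *)

Section GreenFunction.
Variables (K : realType) (P Q : {poly Cplx K}).
Local Notation C := (Cplx K).
Local Notation d := (rat_degree P Q).
Local Notation R := (rat_map P Q).
Local Notation Rn n := (iter n R).
Local Notation lift := (lift P Q).
Local Notation liftn n := (iter n lift).
Hypothesis hPQ : coprimep P Q.
Hypothesis hdeg : (2 <= d)%N.
Implicit Types (x : sphere K) (v w : C * C).

Definition dn n : K := d%:R ^+ n.

Lemma dn_gt0 n : 0 < dn n.
Proof. by rewrite exprn_gt0 // ltr0n; lia. Qed.

Lemma dn_ge n : 2 ^+ n <= dn n.
Proof. by rewrite /dn lerXn2r ?nnegrE // ler_nat. Qed.

Lemma dnE n : dn n = (d ^ n)%:R. Proof. by rewrite natrX. Qed.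

Lemma dn_small (c e : K) : 0 < e -> exists N, forall n, (N <= n)%N -> c / dn n < e.
Proof.
move=> e0; have [N hN] := @geometric_small K `|c| 2^-1 e ltac:(lra) ltac:(lra) e0.
exists N => n /hN; apply: le_lt_trans; apply: (@le_trans _ _ (`|c| / dn n)).
  by rewrite ler_wpM2r ?invr_ge0 ?ler_norm // ltW // dn_gt0.
rewrite ler_wpM2l // exprVn lef_pV2 ?posrE ?dn_gt0 ?exprn_gt0 //; exact: dn_ge.
Qed.

Lemma liftn_gt0 n v : 0 < en v -> 0 < en (liftn n v).
Proof. by move=> v0; elim: n => // n ih; rewrite iterS lift_gt0. Qed.

Lemma liftn_pt n v : 0 < en v -> pt (liftn n v) = Rn n (pt v).
Proof. by move=> v0; elim: n => // n ih; rewrite !iterS -rat_map_pt ?liftn_gt0 // ih. Qed.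

Lemma liftn_sc n c v : liftn n (sc c v) = sc (c ^+ (d ^ n)) (liftn n v).
Proof.
elim: n => [|n ih]; first by rewrite expn0 expr1.
by rewrite !iterS ih lift_sc -exprM expnSr.
Qed.

Definition Gn n v : K := ln (en (liftn n v)) / dn n.

Lemma ln_lift : exists2 c : K, 0 < c & forall v, 0 < en v ->
  `|ln (en (lift v)) - d%:R * ln (en v)| <= c.
Proof.
have [c1 c10 h1] := lift_lower hPQ hdeg; have [c2 c20 h2] := lift_upper P Q.
exists (`|ln c1| + `|ln c2| + 1).
  by have := normr_ge0 (ln c1); have := normr_ge0 (ln c2); lra.
move=> v v0; pose u := sc ((en v)^-1)%:C%C v.
have nu : nm ((en v)^-1)%:C%C = (en v)^-1 :> K by rewrite nm_real gtr0_norm ?invr_gt0.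
have u1 : en u = 1 by rewrite en_sc nu mulVf ?gt_eqF.
have hv : v = sc (en v)%:C%C u.
  rewrite /u /sc /= !mulrA -!rmorphM mulfV ?gt_eqF // !mul1r; by case: (v).
clearbody u; set r := en v in v0 hv *; clearbody r; rewrite hv.
have u0 : 0 < en u by rewrite u1.
have lu0 := lift_gt0 hPQ hdeg u0.
rewrite lift_sc en_sc nmX nm_real (gtr0_norm v0) lnM ?posrE ?exprn_gt0 //.
rewrite lnXn // -[ln r *+ d]mulr_natl addrC addKr.
have l1 := h1 u u1; have l2 := h2 u u1.
have l0 : 0 < en (lift u) by exact: lt_le_trans l1.
have : ln c1 <= ln (en (lift u)) by rewrite ler_ln.
have : ln (en (lift u)) <= ln c2 by rewrite ler_ln.
rewrite ler_norml; have := ler_norm (ln c2); have := ler_norm (- ln c1); rewrite normrN.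
by have := normr_ge0 (ln c1); have := normr_ge0 (ln c2); lra.
Qed.

(** By [ln_lift] the increments of [Gn] are at most [c / d^(n+1)]. The rate is kept with the limit
    because the potentials are compared with [G] at each finite level. *)
Lemma green_ex : exists G : C * C -> K, exists2 c : K, 0 < c &
  forall v, 0 < en v -> forall n, `|G v - Gn n v| <= c / dn n.
Proof.
have [c c0 hc] := ln_lift.
have step v n : 0 < en v -> `|Gn n.+1 v - Gn n v| <= c / dn n.+1.
  move=> v0; have dp := dn_gt0 n; have dp1 := dn_gt0 n.+1.
  have -> : Gn n.+1 v - Gn n v = (ln (en (lift (liftn n v))) - d%:R * ln (en (liftn n v))) / dn n.+1.
    rewrite /Gn iterS mulrBl; congr (_ - _).
    have d0 : d%:R != 0 :> K by rewrite pnatr_eq0; lia.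
    by rewrite /dn exprS; field; rewrite d0 expf_neq0.
  rewrite normrM [ `|_^-1|]gtr0_norm ?invr_gt0 // ler_pM2r ?invr_gt0 //.
  by apply: hc; exact: liftn_gt0.
have far v n m : 0 < en v -> `|Gn (n + m) v - Gn n v| <= c / dn n * (1 - 2^-1 ^+ m).
  move=> v0; elim: m => [|m ih]; first by rewrite addn0 !subrr normr0 mulr0.
  have : `|Gn (n + m.+1) v - Gn n v| <= `|Gn (n + m).+1 v - Gn (n + m) v| + `|Gn (n + m) v - Gn n v|.
    by rewrite addnS; apply: le_trans (ler_normD _ _); rewrite addrA subrK.
  have := step v (n + m)%N v0.
  have : c / dn (n + m).+1 <= c / dn n * (2^-1 ^+ m.+1).
    rewrite -mulrA ler_pM2l // exprVn -invfM lef_pV2 ?posrE ?dn_gt0 //; last first.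
      by rewrite mulr_gt0 ?dn_gt0 // exprn_gt0.
    rewrite -addnS; have -> : dn (n + m.+1) = dn n * dn m.+1 by rewrite /dn exprD.
    by rewrite ler_pM2l ?dn_gt0 ?dn_ge.
  have -> : 2^-1 ^+ m.+1 = 2^-1 * 2^-1 ^+ m :> K by rewrite exprS.
  move: (c / dn n) (2^-1 ^+ m) ih => A B ih; lra.
have far' v n m : 0 < en v -> (n <= m)%N -> `|Gn m v - Gn n v| <= c / dn n.
  move=> v0 nm; rewrite -(subnKC nm); apply: le_trans (far _ _ _ v0) _.
  rewrite ler_piMr ?divr_ge0 ?ltW ?dn_gt0 // gerBl exprn_ge0 ?invr_ge0 //.
have [F FU hF] := nat_ultra.
have lim v : exists l : K, 0 < en v -> forall n, `|l - Gn n v| <= c / dn n.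
  case: (pselect (0 < en v)) => v0; last by exists 0.
  have [l hl] : exists l : K, (fun n => Gn n v) @ F --> l.
    apply: (rulim FU (M := `|Gn 0 v| + c / dn 0)); apply: filterE => n.
    have := far' v 0%N n v0 (leq0n _); have := ler_normD (Gn n v - Gn 0 v) (Gn 0 v).
    by rewrite subrK; lra.
  exists l => _ n; apply/ler_addgt0Pr => e e0.
  move/cvgrPdist_lt : hl => /(_ e e0) hl.
  have /filter_ex[m [h1 h2]] : F [set m | `|l - Gn m v| < e /\ (n <= m)%N].
    exact: filterI hl (hF n).
  have := far' v n m v0 h2; have := ler_normD (l - Gn m v) (Gn m v - Gn n v).
  by rewrite addrA subrK; move: h1 => /=; lra.
by have [G hG] := choice lim; exists G, c.
Qed.

Section Potential.
Variables (G : C * C -> K) (cG : K).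
Hypothesis cG0 : 0 < cG.
Hypothesis hG : forall v, 0 < en v -> forall n, `|G v - Gn n v| <= cG / dn n.

Lemma G_sc c v : c != 0 -> 0 < en v -> G (sc c v) = G v + ln (nm c).
Proof.
move=> c0 v0; have cp : 0 < nm c by rewrite nm_gt0.
have cv0 := sc_gt0 c0 v0.
have Gs n : Gn n (sc c v) = Gn n v + ln (nm c).
  rewrite /Gn liftn_sc en_sc nmX lnM ?posrE ?exprn_gt0 ?liftn_gt0 // lnXn //.
  by rewrite -mulr_natr -dnE; field; rewrite gt_eqF ?dn_gt0.
apply: real_eq => e e0; have [N hN] := dn_small (2 * cG) e0.
have h1 := hG cv0 N; have h2 := hG v0 N; rewrite Gs in h1.
have := ler_normB (G (sc c v) - (Gn N v + ln (nm c))) (G v - Gn N v).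
have -> : G (sc c v) - (Gn N v + ln (nm c)) - (G v - Gn N v) = G (sc c v) - (G v + ln (nm c)) by ring.
by have := hN N (leqnn N); rewrite -mulrA; lra.
Qed.

Lemma G_cvg (I : Type) (F : set_system I) (u : I -> C * C) (l : C * C) :
  UltraFilter F -> (fun n => (u n).1) @ F --> l.1 -> (fun n => (u n).2) @ F --> l.2 ->
  0 < en l -> (forall n, 0 < en (u n)) -> (fun n => G (u n)) @ F --> G l.
Proof.
move=> FU ha hb l0 u0; apply/cvgrPdist_lt => e e0.
have [N hN] := dn_small (3 * cG) e0; have h3 := hN N (leqnn N).
have lc m : ((fun n => (liftn m (u n)).1) @ F --> (liftn m l).1) /\
  ((fun n => (liftn m (u n)).2) @ F --> (liftn m l).2).
  elim: m => [|m [ih1 ih2]]; first by split; [exact: ha|exact: hb].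
  by split; [exact: (@cvg_hom _ P Q _ F FU P _ _ ih1 ih2)|exact: (@cvg_hom _ P Q _ F FU Q _ _ ih1 ih2)].
have [l1 l2] := lc N; have le := cvg_en FU l1 l2.
have lN0 := liftn_gt0 N l0.
have : (fun n => ln (en (liftn N (u n)))) @ F --> ln (en (liftn N l)).
  exact: (continuous_cvg _ (continuous_ln lN0) le).
move/cvgrPdist_lt; have dp := dn_gt0 N; have c1 : 0 < cG / dn N * dn N by rewrite divfK ?gt_eqF.
move=> /(_ _ c1); apply: filterS => n /= hn.
have a1 := hG (u0 n) N; have a2 := hG l0 N.
have a3 : `|Gn N l - Gn N (u n)| < cG / dn N.
  by rewrite /Gn -mulrBl normrM [ `|_^-1|]gtr0_norm ?invr_gt0 // ltr_pdivrMr.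
have := ler_normD (G l - Gn N l) (Gn N l - Gn N (u n)).
have := ler_normB (G l - Gn N l + (Gn N l - Gn N (u n))) (G (u n) - Gn N (u n)).
have -> : G l - Gn N l + (Gn N l - Gn N (u n)) - (G (u n) - Gn N (u n)) = G l - G (u n) by ring.
by rewrite -mulrA in h3; lra.
Qed.

Section AtPoint.
Variable x : sphere K.

Definition V n (t : C) : C * C := liftn n (line x t).
Definition Vp n : {poly C} * {poly C} := iter n (liftp P Q) (linep x).
Definition g (t : C) : K := G (line x t).

Lemma VpE n t : ((Vp n).1.[t], (Vp n).2.[t]) = V n t.
Proof.
elim: n => [|n ih]; first exact: linepE.
by rewrite /Vp /V !iterS /liftp /lift /= !hompE ih.
Qed.

Lemma V_gt0 n t : 0 < en (V n t).
Proof. by apply: liftn_gt0; exact: line_gt0. Qed.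

Lemma V_pt n t : pt (V n t) = Rn n (pt (line x t)).
Proof. by rewrite liftn_pt // line_gt0. Qed.

Lemma size_homp (p : {poly C}) (a : {poly C} * {poly C}) D : (size a.1 <= D.+1)%N ->
  (size a.2 <= D.+1)%N -> (size (homp P Q p a) <= (D * d).+1)%N.
Proof.
move=> h1 h2; rewrite /homp; apply: (leq_trans (size_sum _ _ _)).
apply/bigmax_leqP => k _; apply: (leq_trans (size_scale_leq _ _)).
apply: (leq_trans (size_polyMleq _ _)).
have pw (q : {poly C}) m : (size q <= D.+1)%N -> (size (q ^+ m) <= (D * m).+1)%N.
  move=> hq; apply: (leq_trans (size_poly_exp_leq _ _)); rewrite ltnS leq_mul2r.
  by apply/orP; right; lia.
have := pw _ k h1; have := pw _ (d - k)%N h2.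
have kd : (k <= d)%N by rewrite -ltnS.
have -> : (D * d = D * k + D * (d - k))%N by rewrite -mulnDr subnKC.
lia.
Qed.

Lemma size_Vp n : (size (Vp n).1 <= (d ^ n).+1)%N /\ (size (Vp n).2 <= (d ^ n).+1)%N.
Proof.
elim: n => [|n [h1 h2]].
  have h (a b : C) : (size (a%:P + b *: 'X)%R <= 2)%N.
    rewrite (leq_trans (size_polyD _ _)) // geq_max (leq_trans (size_polyC_leq1 _)) //.
    by rewrite (leq_trans (size_scale_leq _ _)) // size_polyX.
  by split; exact: h.
by rewrite /Vp iterS expnSr; split; exact: size_homp.
Qed.

(** The normalized potential of the target [y]: harmonic in [t] where [F^n] misses [y], at most [g]
    up to [O(d^-n)], and close to [g] unless [F^n] is nearly parallel to [y]. *)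
Definition u n (y : C * C) t : K := ln (nm (wedge (V n t) y)) / dn n.

Lemma u_upper n y t : en y = 1 -> wedge (V n t) y != 0 -> u n y t <= g t + cG / dn n.
Proof.
move=> y1 w0; have := hG (line_gt0 x t) n.
have : u n y t <= Gn n (line x t).
  rewrite ler_pM2r ?invr_gt0 ?dn_gt0 // ler_ln ?posrE ?nm_gt0 ?V_gt0 //.
  by apply: le_trans (wedge_en _ _) _; rewrite y1 mulr1.
by rewrite /g ler_norml; lra.
Qed.

Lemma u_lower n y t (s : K) : 0 < s -> s * en (V n t) <= nm (wedge (V n t) y) ->
  g t - (cG + `|ln s|) / dn n <= u n y t.
Proof.
move=> s0 h; have v0 := V_gt0 n t; have := hG (line_gt0 x t) n.
have : Gn n (line x t) + ln s / dn n <= u n y t.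
  rewrite -mulrDl ler_pM2r ?invr_gt0 ?dn_gt0 // addrC -lnM ?posrE //.
  by rewrite ler_ln ?posrE ?mulr_gt0 // (lt_le_trans _ h) // mulr_gt0.
have : - `|ln s| / dn n <= ln s / dn n.
  by rewrite ler_pM2r ?invr_gt0 ?dn_gt0 // lerNl -normrN ler_norm.
by rewrite /g ler_norml mulrDl mulNr; lra.
Qed.

(** [wedge y1 y2 * v = wedge v y2 * y1 - wedge v y1 * y2], so [v] cannot be almost parallel to two
    separated unit vectors. *)
Lemma two_targets (v y1 y2 : C * C) (s : K) : 0 < s -> s <= nm (wedge y1 y2) ->
  en y1 = 1 -> en y2 = 1 -> s / 2 * en v <= nm (wedge v y1) \/ s / 2 * en v <= nm (wedge v y2).
Proof.
move=> s0 hs e1 e2.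
have h : nm (wedge y1 y2) * en v <= nm (wedge v y1) + nm (wedge v y2).
  rewrite -en_sc.
  have -> : sc (wedge y1 y2) v = (y1.1 * wedge v y2 - y2.1 * wedge v y1, y1.2 * wedge v y2 - y2.2 *
      wedge v y1).
    by rewrite /sc /wedge; congr pair; ring.
  set a := wedge v y1; set b := wedge v y2.
  have h0 : 0 <= nm a + nm b by rewrite addr_ge0 ?nm_ge0.
  rewrite -ler_sqr ?nnegrE ?en_ge0 // en_sq /en2 /=.
  have t1 := nmB (y1.1 * b) (y2.1 * a); have t2 := nmB (y1.2 * b) (y2.2 * a).
  rewrite !nmM in t1 t2.
  have q1 : nm y1.1 ^+ 2 + nm y1.2 ^+ 2 = 1 by rewrite -/(en2 y1) -en_sq e1 expr1n.
  have q2 : nm y2.1 ^+ 2 + nm y2.2 ^+ 2 = 1 by rewrite -/(en2 y2) -en_sq e2 expr1n.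
  have n1 := nm_ge0 (y1.1 * b - y2.1 * a); have n2 := nm_ge0 (y1.2 * b - y2.2 * a).
  have s1 : nm (y1.1 * b - y2.1 * a) ^+ 2 <= (nm y1.1 * nm b + nm y2.1 * nm a) ^+ 2.
    by rewrite lerXn2r ?nnegrE // (le_trans n1).
  have s2 : nm (y1.2 * b - y2.2 * a) ^+ 2 <= (nm y1.2 * nm b + nm y2.2 * nm a) ^+ 2.
    by rewrite lerXn2r ?nnegrE // (le_trans n2).
  have ab : 0 <= nm a * nm b by rewrite mulr_ge0 ?nm_ge0.
  move: (nm_ge0 a) (nm_ge0 b) ab s1 s2 q1 q2 => {t1 t2 n1 n2 h0}.
  move: (nm (_ - _)) (nm (_ - _)) (nm a) (nm b) (nm y1.1) (nm y1.2) (nm y2.1) (nm y2.2).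
  move=> X Y A B p q r s' A0 B0 AB s1 s2 q1 q2.
  have cs : p * r + q * s' <= 1.
    by have := sqr_ge0 (p - r); have := sqr_ge0 (q - s'); nra.
  have : A * B * (p * r + q * s') <= A * B by rewrite ler_piMr.
  have : Y ^+ 2 + X ^+ 2 <= (p ^+ 2 + q ^+ 2) * B ^+ 2 + (r ^+ 2 + s' ^+ 2) * A ^+ 2 +
      2 * (A * B * (p * r + q * s')).
    by apply: le_trans (lerD s1 s2) _; rewrite le_eqVlt; apply/orP; left; apply/eqP; ring.
  by rewrite q1 q2 sqrrD; lra.
have hv : s * en v <= nm (wedge y1 y2) * en v by rewrite ler_wpM2r ?en_ge0.
case: (lerP (s / 2 * en v) (nm (wedge v y1))) => h1; [by left|right; lra].
Qed.

Section Targets.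
Variable F : set_system nat.
Hypothesis FU : UltraFilter F.
Hypothesis hF : forall N, F [set n | (N <= n)%N].
Implicit Types y : nat -> C * C.

(** Along an ultrafilter, the potential of targets missed over the disc ([nv]) either tends to [g t]
    or stays below it by a fixed amount ([low]); this dichotomy is [not_low]. *)
Definition tends y t := forall e : K, 0 < e -> F [set n | `|u n (y n) t - g t| < e].
Definition low y t (e : K) := F [set n | u n (y n) t <= g t - e].
Definition nv y (s : K) :=
  F [set n | en (y n) = 1 /\ forall t, nm t < s -> wedge (V n t) (y n) != 0].
Definition sep y y' (s : K) := F [set n | s <= nm (wedge (y n) (y' n))].

Lemma FI (A B : set nat) : F A -> F B -> F (A `&` B).
Proof. exact: filterI. Qed.

Lemma FS (A B : set nat) : A `<=` B -> F A -> F B.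
Proof. exact: filterS. Qed.

Lemma FS2 (A B D : set nat) : (forall n, A n -> B n -> D n) -> F A -> F B -> F D.
Proof. exact: filterS2. Qed.

Lemma FS3 (A B D E : set nat) :
  (forall n, A n -> B n -> D n -> E n) -> F A -> F B -> F D -> F E.
Proof. exact: filterS3. Qed.

Lemma FE (A : set nat) : F A -> exists n, A n.
Proof. exact: filter_ex. Qed.

Lemma near_small (c e : K) : 0 < e -> F [set n | c / dn n < e].
Proof.
by move=> e0; have [N hN] := dn_small c e0; apply: FS (hF N) => n; exact: hN.
Qed.

Lemma not_low y s t : nv y s -> nm t < s -> (forall e, 0 < e -> ~ low y t e) -> tends y t.
Proof.
move=> hn ts hl e e0.
have h1 : F [set n | g t - e < u n (y n) t].
  have [//|h] := in_ultra_setVsetC [set n | g t - e < u n (y n) t] FU.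
  exfalso; apply: (hl e e0); apply: FS h => n /= h; rewrite leNgt; exact/negP.
apply: FS3 h1 hn (near_small cG e0) => n /= a [y1 b] c.
by have := u_upper y1 (b t ts); rewrite ltr_norml; lra.
Qed.

(** Where the first potential drops, [F^n] is nearly parallel to the first target, hence not to the
    second, whose potential is then squeezed against [g]. *)
Lemma low_other y y' s (sg e : K) t : nv y s -> nv y' s -> 0 < sg -> sep y y' sg ->
  nm t < s -> 0 < e -> low y t e -> tends y' t.
Proof.
move=> h1 h2 sg0 hs ts e0 hl e1 e10.
have sg2 : 0 < sg / 2 by lra.
have a0 : F [set n | cG / dn n < e1] by exact: near_small.
have a1 := near_small (cG + `|ln (sg / 2)|) e0.
have a2 := near_small (cG + `|ln (sg / 2)|) e10.
have := FI (FI h1 h2) (FI (FI hs hl) (FI a0 (FI a1 a2))).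
apply: FS => n /= [[[y1 b1] [y2 b2]] [[sn ln] [c0 [c1 c2]]]].
have up := u_upper y2 (b2 t ts).
have [k|k] := two_targets (V n t) sg0 sn y1 y2; have := u_lower sg2 k.
  by lra.
by rewrite ltr_norml; lra.
Qed.

Lemma expansion y s p : nv y s -> nm p < s -> exists a : nat -> nat -> C,
  F [set n | (forall k, nm (a n k) <= (s - nm p) ^- k.+1) /\ forall N t, nm t <= (s - nm p) / 2 ->
    `|u n (y n) (p + t) - u n (y n) p + expsum (a n) N t| <= 2 * (nm t / (s - nm p)) ^+ N.+1].
Proof.
move=> hn ps; have s0 : 0 < s - nm p by lra.
have /choice[a ha] n : exists a : nat -> C,
   (en (y n) = 1 /\ forall t, nm t < s -> wedge (V n t) (y n) != 0) ->
   (forall k, nm (a k) <= (s - nm p) ^- k.+1) /\ forall N t, nm t <= (s - nm p) / 2 ->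
    `|u n (y n) (p + t) - u n (y n) p + expsum a N t| <= 2 * (nm t / (s - nm p)) ^+ N.+1.
  case: (pselect (en (y n) = 1 /\ forall t, nm t < s -> wedge (V n t) (y n) != 0)); last by exists (fun=> 0).
  move=> [y1 hv]; pose h := wedgep (Vp n) (y n).
  have hE t : h.[t] = wedge (V n t) (y n) by rewrite wedgepE VpE.
  have sh : (size h <= (d ^ n).+1)%N.
    have [s1 s2] := size_Vp n.
    rewrite (leq_trans (size_polyD _ _)) // size_polyN geq_max.
    by rewrite !(leq_trans (size_scale_leq _ _)).
  have D0 : (0 < d ^ n)%N by rewrite expn_gt0; lia.
  have [|a [a1 a2]] := poly_log_expand D0 sh s0 (p := p).
    by move=> t ht; rewrite hE; apply: hv; have := nmD p t; lra.
  exists a => _; split=> // N t ht; have := a2 N t ht.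
  by rewrite !hE -dnE mulrBl.
by exists a; apply: FS hn => n; exact: ha.
Qed.

Lemma expsum_cvg (a : nat -> nat -> C) (b : nat -> C) N t : (forall k, (a^~ k) @ F --> b k) ->
  forall e : K, 0 < e -> F [set n | `|expsum (a n) N t - expsum b N t| < e].
Proof.
move=> h e e0.
have eE c : expsum c N t = complex.Re (\sum_(k < N) c k * t ^+ k.+1) by rewrite Re_sum.
have : (fun n => \sum_(k < N) a n k * t ^+ k.+1) @ F --> \sum_(k < N) b k * t ^+ k.+1.
  by apply: (cvg_big_sum FU) => k; exact: (cvgM (h k) (cvg_cst _)).
move/(cvg_nm FU)/(_ e e0); apply: FS => n.
move=> h1; rewrite /= !eE -ReN -ReD; exact: le_lt_trans (abs_re_le _) h1.
Qed.

Lemma g_cts p (e : K) : 0 < e -> exists2 eta : K, 0 < eta &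
  forall t, nm t < eta -> `|g (p + t) - g p| < e.
Proof.
move=> e0; apply: contrapT => hn.
have /choice[t ht] (n : nat) : exists t, nm t < n.+1%:R^-1 /\ e <= `|g (p + t) - g p|.
  apply: contrapT => h; apply: hn; exists n.+1%:R^-1; first by rewrite invr_gt0 ltr0n.
  by move=> t h1; rewrite ltNge; apply/negP => h2; apply: h; exists t.
have ct : t @ F --> (0 : C).
  apply/(cvg_nm FU) => e1 e10; have [N hN] := inv_small e10.
  apply: FS (hF N) => n Nn; rewrite subr0; have [h1 _] := ht n.
  exact: lt_trans h1 (hN n Nn).
have cl (a b : C) : (fun n => a + (p + t n) * b) @ F --> a + p * b.
  have := cvgD (cvg_cst a) (cvgM (cvgD (cvg_cst p) ct) (cvg_cst b)).
  by rewrite addr0; apply.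
have := @G_cvg _ F (fun n => line x (p + t n)) (line x p) FU (cl (vec x).1 (dir x).1) (cl (vec x).2
    (dir x).2) (line_gt0 x p) (fun n => line_gt0 x (p + t n)).
move/cvgrPdist_lt/(_ e e0)/FE => [n]; have [_ h] := ht n.
by rewrite /= distrC; move: h; rewrite /g => h /(le_lt_trans h); rewrite ltxx.
Qed.

(* If the first potential drops below g somewhere, the other two agree there,
   hence on the whole disc by the identity theorem, so neither can drop. *)
Lemma three_targets y1 y2 y3 (s sg : K) : 0 < s -> 0 < sg ->
  nv y1 s -> nv y2 s -> nv y3 s -> sep y1 y2 sg -> sep y1 y3 sg -> sep y2 y3 sg ->
  (forall t, nm t <= s / 8 -> tends y1 t) \/ (forall t, nm t <= s / 8 -> tends y2 t).
Proof.
move=> s0 sg0 n1 n2 n3 s12 s13 s23.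
case: (pselect (forall t, nm t <= s / 8 -> tends y1 t)); first by left.
move/existsNP => [p /not_implyP[ps np]]; right.
have ps' : nm p < s by have := nm_ge0 p; lra.
have [e e0 lp] : exists2 e : K, 0 < e & low y1 p e.
  apply: contrapT => h; apply: np; apply: (not_low n1 ps') => e e0 hl.
  by apply: h; exists e.
set r := s - nm p; have r0 : 7 / 8 * s <= r by rewrite /r; lra.
have r0' : 0 < r by lra.
have [a1 ha1] := expansion n1 ps'; have [a2 ha2] := expansion n2 ps'; have [a3 ha3] := expansion n3 ps'.
rewrite -/r in ha1 ha2 ha3.
have e4 : 0 < e / 4 by rewrite divr_gt0.
have [et et0 het] := g_cts p e4.
(* On this disc [g] moves by less than [e / 4], and by the expansion of order 0 the first potential
   moves by at most [e / 4]; so the drop by [e] at [p] persists as a drop by [e / 4]. *)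
pose eta := Num.min et (Num.min (r / 2) (e * r / 8)).
have eta0 : 0 < eta by rewrite !lt_min et0 !divr_gt0 ?mulr_gt0.
have etaP (t : C) : nm t < eta -> [/\ nm t < et, nm t < r / 2 & nm t < e * r / 8].
  by rewrite !lt_min => /and3P[].
have near t : nm t < eta -> low y1 (p + t) (e / 4).
  move=> /etaP[t1 t2 t3]; apply: FS2 ha1 lp => n [_ h1] h2 /=.
  have := h1 0%N t (ltW t2); rewrite /expsum big_ord0 addr0 expr1.
  have : 2 * (nm t / r) <= e / 4.
    have : nm t / r < e / 8 by rewrite ltr_pdivrMr //; lra.
    by lra.
  have := het t t1; rewrite ltr_norml ler_norml.
  by move: h2 => /=; lra.
have ptl t : nm t < eta -> nm (p + t) < s.
  by move=> /etaP[_ t2 _]; have := nmD p t; rewrite /r in t2; have := nm_ge0 p; lra.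
have eq23 t : nm t < eta -> forall e1 : K, 0 < e1 -> F [set n | `|u n (y2 n) (p +
    t) - u n (y3 n) (p + t)| < e1].
  move=> ht e1 e10; have b2 := low_other n1 n2 sg0 s12 (ptl t ht) e4 (near t ht).
  have b3 := low_other n1 n3 sg0 s13 (ptl t ht) e4 (near t ht).
  have e12 : 0 < e1 / 2 by rewrite divr_gt0.
  apply: FS2 (b2 _ e12) (b3 _ e12) => n /=.
  by rewrite !ltr_norml; lra.
have eqp e1 : 0 < e1 -> F [set n | `|u n (y2 n) p - u n (y3 n) p| < e1].
  by move=> e10; have := eq23 0; rewrite nm0 addr0; apply.
have /choice[b hb] k : exists l : C, (fun n => a2 n k - a3 n k) @ F --> l.
  apply: (culim FU (M := 2 * r ^- k.+1)); apply: FS2 ha2 ha3 => n [h2 _] [h3 _].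
  by have := nmB (a2 n k) (a3 n k); have := h2 k; have := h3 k; lra.
have esB n N t : expsum (fun k => a2 n k - a3 n k) N t = expsum (a2 n) N t - expsum (a3 n) N t.
  by rewrite /expsum -sumrB; apply: eq_bigr => k _; rewrite mulrBl ReD ReN.
(* The difference of the second and third potentials tends to 0 on a small disc about [p], which
   kills the limit coefficients; but its expansion is valid up to radius [r / 2]. *)
have b0 : forall k, b k = 0.
  apply: (coef_vanish eta0 r0') => N t ht; apply/ler_addgt0Pr => e1 e10.
  have [_ t2 _] := etaP t ht; have e13 : 0 < e1 / 3 by rewrite divr_gt0.
  have := FI (FI ha2 ha3) (FI (expsum_cvg N t hb e13)
     (FI (eq23 t ht _ e13) (eqp _ e13))).
  move/FE => [n [[[_ h2] [_ h3]] [h4 [h5 h6]]]].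
  move: h4 h5 h6 (h2 N t (ltW t2)) (h3 N t (ltW t2)) => /=; rewrite esB.
  move: (expsum _ _ _) (expsum _ _ _) (expsum _ _ _) ((_ / _) ^+ _) => E1 E2 E3 Z.
  by rewrite !ltr_norml !ler_norml; lra.
move=> t0 t0s; apply: contrapT => nt.
have t0s' : nm t0 < s by have := nm_ge0 t0; lra.
have [e2 e20 l2] : exists2 e : K, 0 < e & low y2 t0 e.
  apply: contrapT => h; apply: nt; apply: (not_low n2 t0s') => e2 e20 hl.
  by apply: h; exists e2.
have e26 : 0 < e2 / 6 by rewrite divr_gt0.
(* If the second potential dropped at [t0], the third would tend to [g] there, while the vanishing
   expansion makes the two agree. *)
have T3 := low_other n2 n3 sg0 s23 t0s' e20 l2.
pose t := t0 - p; have tr : nm t <= s / 4 by have := nmB t0 p; rewrite /t; lra.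
have pt0 : p + t = t0 by rewrite /t addrC subrK.
have tr2 : nm t <= r / 2 by lra.
have q1 : nm t / r <= 1 / 2 by rewrite ler_pdivrMr //; lra.
have [N hN] := @geometric_small K 4 2^-1 (e2 / 6) ltac:(lra) ltac:(lra) e26.
have hN1 : 4 * (nm t / r) ^+ N.+1 < e2 / 6.
  apply: le_lt_trans (hN N.+1 (leqnSn N)); rewrite ler_pM2l // lerXn2r ?nnegrE ?divr_ge0 ?nm_ge0 ?invr_ge0 //.
    exact: ltW.
  by lra.
have E0 : expsum b N t = 0 by rewrite /expsum big1 // => k _; rewrite b0 mul0r.
have := FI (FI ha2 ha3) (FI (expsum_cvg N t hb e26)
     (FI (eqp _ e26) (FI l2 (T3 _ e26)))).
move/FE => [n [[[_ h2] [_ h3]] [h4 [h5 [h6 h7]]]]].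
move: h4 h5 h6 h7 (h2 N t tr2) (h3 N t tr2) => /=; rewrite esB E0 subr0 pt0.
move: hN1.
move: (expsum _ _ _) (expsum _ _ _) ((_ / _) ^+ _) => E2 E3 Z.
by rewrite !ltr_norml !ler_norml; lra.
Qed.

(** The coefficient bounds do not depend on [n], so the expansions of the potentials pass to the
    limit and become one of [g]. *)
Lemma limit_expansion y s (r : K) : 0 < s -> r <= s / 2 -> nv y s -> 0 <= r ->
  (forall t, nm t <= r -> tends y t) ->
  exists a : nat -> C, (forall k, nm (a k) <= s ^- k.+1) /\
    forall N t, nm t <= r -> `|g t - g 0 + expsum a N t| <= 2 * (nm t / s) ^+ N.+1.
Proof.
move=> s0 rs hn r0 ht; have [|a ha] := expansion hn (p := 0); first by rewrite nm0.
rewrite nm0 subr0 in ha.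
have /choice[b hb] k : exists l : C, (a^~ k) @ F --> l.
  by apply: (culim FU (M := s ^- k.+1)); apply: FS ha => n [h _].
exists b; split=> [k|N t tr].
  apply: (cvg_nm_le FU (hb k) (cvg_cst (s ^- k.+1))); by apply: FS ha => n [h _].
apply/ler_addgt0Pr => e e0; have ts : nm t <= s / 2 by lra.
have e3 : 0 < e / 3 by rewrite divr_gt0.
have T0 : tends y 0 by apply: ht; rewrite nm0.
have := FI ha (FI (expsum_cvg N t hb e3)
     (FI (T0 _ e3) (ht t tr _ e3))).
move/FE => [n [[_ h2] [h4 [h5 h6]]]].
move: h4 h5 h6 (h2 N t ts) => /=; rewrite add0r.
move: (expsum _ _ _) (expsum _ _ _) ((_ / _) ^+ _) => E2 E3 Z.
by rewrite !ltr_norml !ler_norml; lra.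
Qed.

End Targets.
End AtPoint.
End Potential.
End GreenFunction.

(** * Exactness and perfectness of the Julia set *)

Section JuliaDynamics.
Variables (K : realType) (P Q : {poly Cplx K}).
Local Notation C := (Cplx K).
Local Notation d := (rat_degree P Q).
Local Notation R := (rat_map P Q).
Local Notation Rn n := (iter n R).
Hypothesis hPQ : coprimep P Q.
Hypothesis hdeg : (2 <= d)%N.
Implicit Types (x y z : sphere K).

Section HarmonicFatou.
Variables (G : C * C -> K) (cG : K).
Hypothesis cG0 : 0 < cG.
Hypothesis hG : forall v, 0 < en v -> forall n, `|G v - Gn P Q n v| <= cG / dn P Q n.
Local Notation g := (g G).
Local Notation V := (V P Q).
Local Notation Vp := (Vp P Q).
Local Notation dn := (@dn K P Q).

(* If g is harmonic, with holomorphic completion f, the maps F^n exp(-d^n f)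
   have bounded modulus above and below, so their derivatives are bounded and
   R^n is uniformly Lipschitz; exp is replaced by (1 - ./M)^M. *)
Lemma harmonic_iterates x (a : nat -> C) (s r : K) : 0 < r -> r <= s / 2 ->
  (forall k, nm (a k) <= s ^- k.+1) ->
  (forall N t, nm t <= r -> `|g x t - g x 0 + expsum a N t| <= 2 * (nm t / s) ^+ N.+1) ->
  exists2 L : K, 0 < L & forall n t t', nm t <= r / 2 -> nm t' <= r / 2 ->
    chd (pt (V x n t)) (pt (V x n t')) <= L * nm (t - t').
Proof.
move=> r0 rs ha hg; have s0 : 0 < s by lra.
(* Three errors add up in the logarithm of [|F^n| |E|]: [cG] from the Green function, 1 from
   truncating the series, 1 from replacing the exponential. *)
pose c := cG + 2; exists (8 * expR (2 * c) ^+ 2 / r).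
  by rewrite divr_gt0 // mulr_gt0 // exprn_gt0 // expR_gt0.
move=> n t1 t2 ht1 ht2; have dp := dn_gt0 hPQ hdeg n.
(* Truncation at order [d^n] leaves an error of at most [2^-N], which stays below 1 after
   multiplication by [d^n]. *)
pose N := (d ^ n)%N; have N0 : (0 < N)%N by rewrite /N expn_gt0; lia.
pose f : {poly C} := - \sum_(k < N) a k *: 'X^(k.+1).
have fE t : complex.Re f.[t] = - expsum a N t.
  rewrite /f hornerN ReN horner_sum Re_sum; congr (- _); apply: eq_bigr => k _.
  by rewrite hornerZ hornerXn.
have geo m : \sum_(k < m) 2^-1 ^+ k.+1 <= 1 :> K.
  have -> : \sum_(k < m) 2^-1 ^+ k.+1 = 1 - 2^-1 ^+ m :> K.
    elim: m => [|m ih]; first by rewrite big_ord0 expr0 subrr.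
    by rewrite big_ord_recr /= ih exprS; field.
  by rewrite gerBl exprn_ge0 // invr_ge0.
have f1 t : nm t <= r -> nm f.[t] <= 1.
  move=> tr; rewrite /f hornerN nmN horner_sum; apply: le_trans (nm_sum _ _ _) _.
  apply: le_trans (geo N); apply: ler_sum => k _; rewrite hornerZ hornerXn nmM nmX.
  have -> : 2^-1 ^+ k.+1 = s ^- k.+1 * (s / 2) ^+ k.+1 :> K.
    by rewrite exprMn mulrA mulVf ?mul1r // expf_neq0 // gt_eqF.
  rewrite ler_pM ?nm_ge0 ?exprn_ge0 ?nm_ge0 // lerXn2r ?nnegrE ?nm_ge0 //; lra.
have gE t : nm t <= r -> `|dn n * (g x t - g x 0 - complex.Re f.[t])| <= 1.
  move=> tr; rewrite fE opprK normrM (gtr0_norm dp).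
  apply: le_trans (ler_wpM2l (ltW dp) (hg N t tr)) _.
  have q1 : (nm t / s) ^+ N.+1 <= 2^-1 ^+ N.+1.
    rewrite lerXn2r ?nnegrE ?invr_ge0 ?divr_ge0 ?nm_ge0 ?(ltW s0) //.
    by rewrite ler_pdivrMr //; lra.
  apply: (@le_trans _ _ (dn n * (2 * 2^-1 ^+ N.+1))).
    by rewrite ler_pM2l // ler_pM2l.
  rewrite exprS mulrA mulfV ?mul1r ?pnatr_eq0 // exprVn ler_pdivrMr ?exprn_gt0 // mul1r dnE.
  by rewrite -natrX ler_nat ltnW // ltn_expl.
pose A : K := dn n; pose M := (2 * N ^ 2)%N.
have M0 : (0 < M)%N by rewrite muln_gt0 expn_gt0 N0.
have AN : A = N%:R by rewrite /A dnE.
have MA2 : 2 * A ^+ 2 <= M%:R by rewrite /M natrM natrX -AN.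
have A1 : 1 <= A by rewrite AN ler1n.
have MA : 2 * A <= M%:R.
  by apply: le_trans MA2; rewrite ler_pM2l // expr2 ler_peMr //; lra.
pose E : {poly C} := (1%:P - (N%:R / M%:R) *: f) ^+ M.
have EE t : E.[t] = (1 - (N%:R * f.[t]) / M%:R) ^+ M.
  by rewrite horner_exp !hornerE mulrAC.
have hE t : nm t <= r -> 0 < nm E.[t] /\ `|ln (nm E.[t]) + dn n * complex.Re f.[t]| <= 1.
  move=> tr; have fA : nm (N%:R * f.[t]) <= A.
    by rewrite nmM nm_nat -AN ler_piMr ?f1 //; lra.
  have [h1 h2] := exp_approx M0 MA MA2 fA; rewrite EE; split => //.
  move: h2; have -> : N%:R * f.[t] = N%:R%:C%C * f.[t] by rewrite rmorph_nat.
  by rewrite Re_scale -AN.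
have hV t : nm t <= r ->
  expR (dn n * g x 0 - c) <= en (V x n t) * nm E.[t] <= expR (dn n * g x 0 + c).
  move=> tr; have [e0 e1] := hE t tr; have v0 := V_gt0 hPQ hdeg x n t.
  have p0 : 0 < en (V x n t) * nm E.[t] by exact: mulr_gt0.
  rewrite -[X in _ <= X <= _]lnK ?posrE // !ler_expR lnM ?posrE //.
  have h1 : `|dn n * g x t - ln (en (V x n t))| <= cG.
    have -> : dn n * g x t - ln (en (V x n t)) = dn n * (g x t - Gn P Q n (line x t)).
      by rewrite mulrBr; congr (_ - _); rewrite /Gn mulrC divfK ?gt_eqF.
    rewrite normrM (gtr0_norm dp) mulrC -ler_pdivlMr //; apply: hG; exact: line_gt0.
  have := gE t tr; move: h1 e1; rewrite /c !mulrBr !ler_norml.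
  by move=> /andP[? ?] /andP[? ?] /andP[? ?]; apply/andP; split; lra.
set B := expR (dn n * g x 0 + c) in hV; set b := expR (dn n * g x 0 - c) in hV.
have B0 : 0 < B by exact: expR_gt0.
have b0 : 0 < b by exact: expR_gt0.
have Bb : B = expR (2 * c) * b by rewrite /B /b -expRD; congr expR; ring.
(* The rescaled lift still represents [R^n]. It is a pair of polynomials bounded by [B], of norm at
   least [b], with [B / b] independent of [n]. *)
pose p1 := (Vp x n).1 * E; pose p2 := (Vp x n).2 * E.
have pE t : (p1.[t], p2.[t]) = sc E.[t] (V x n t).
  by rewrite -VpE /p1 /p2 !hornerM /sc /= ![_ * E.[t]]mulrC.
have pen t : en (p1.[t], p2.[t]) = en (V x n t) * nm E.[t] by rewrite pE en_sc mulrC.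
have pB1 t : nm t <= r -> nm p1.[t] <= B.
  by move=> /hV /andP[_ h]; rewrite -pen in h; exact: le_trans (nm1_en (p1.[t], p2.[t])) h.
have pB2 t : nm t <= r -> nm p2.[t] <= B.
  by move=> /hV /andP[_ h]; rewrite -pen in h; exact: le_trans (nm2_en (p1.[t], p2.[t])) h.
have tr1 : nm t1 <= r by lra.
have tr2 : nm t2 <= r by lra.
have L1 := poly_lipschitz r0 pB1 ht2 ht1; have L2 := poly_lipschitz r0 pB2 ht2 ht1.
have ptE t : nm t <= r -> pt (V x n t) = pt (p1.[t], p2.[t]).
  by move=> tr; rewrite pE pt_sc // -nm_gt0; case: (hE t tr).
have p0 t : nm t <= r -> b <= en (p1.[t], p2.[t]).
  by move=> /hV /andP[h _]; rewrite pen.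
have e1 := p0 _ tr1; have e2 := p0 _ tr2.
rewrite !ptE // chd_pt; [|lra|lra].
have ee : 0 < en (p1.[t1], p2.[t1]) * en (p1.[t2], p2.[t2]) by apply: mulr_gt0; lra.
rewrite ler_pdivrMr //.
have -> : wedge (p1.[t1], p2.[t1]) (p1.[t2], p2.[t2]) =
  p1.[t1] * (p2.[t2] - p2.[t1]) - p2.[t1] * (p1.[t2] - p1.[t1]) by rewrite /wedge /=; ring.
apply: le_trans (nmB _ _) _; rewrite !nmM.
rewrite [nm (t2 - t1)]nmBC in L1 L2.
have q1 : nm p1.[t1] * nm (p2.[t2] - p2.[t1]) <= B * (4 * B / r * nm (t1 - t2)).
  by rewrite ler_pM ?nm_ge0 ?pB1.
have q2 : nm p2.[t1] * nm (p1.[t2] - p1.[t1]) <= B * (4 * B / r * nm (t1 - t2)).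
  by rewrite ler_pM ?nm_ge0 ?pB2.
have bb : b ^+ 2 <= en (p1.[t1], p2.[t1]) * en (p1.[t2], p2.[t2]).
  by rewrite expr2 ler_pM // ltW.
have X0 : 0 <= 8 * expR (2 * c) ^+ 2 / r * nm (t1 - t2).
  by rewrite mulr_ge0 ?nm_ge0 // divr_ge0 ?(ltW r0) // mulr_ge0 // exprn_ge0 // expR_ge0.
have := ler_wpM2l X0 bb; apply: le_trans.
have -> : 8 * expR (2 * c) ^+ 2 / r * nm (t1 - t2) * b ^+ 2 =
   B * (4 * B / r * nm (t1 - t2)) + B * (4 * B / r * nm (t1 - t2)).
  by rewrite Bb; field; rewrite gt_eqF.
exact: lerD.
Qed.

Lemma harmonic_fatou x (a : nat -> C) (s r : K) : 0 < r -> r <= s / 2 ->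
  (forall k, nm (a k) <= s ^- k.+1) ->
  (forall N t, nm t <= r -> `|g x t - g x 0 + expsum a N t| <= 2 * (nm t / s) ^+ N.+1) ->
  fatou_set P Q x.
Proof.
move=> r0 rs ha hg; have [L L0 hL] := harmonic_iterates r0 rs ha hg.
have r2 : 0 < r / 2 by lra.
have [e e0 he] := (nbhs_chd _ _).1 (near_chart x r2).
have v0 := vec_gt0 x; pose k := en (vec x) + r; have k0 : 0 < k by rewrite /k; lra.
apply: (@lip_fatou _ _ _ x e (L * k ^+ 2)) => //; first by rewrite mulr_gt0 ?exprn_gt0.
move=> y z /he[]; move: (chart x y) => t -> ty /he[]; move: (chart x z) => t' -> tz n.
rewrite -!(V_pt hPQ hdeg); apply: le_trans (hL n t t' (ltW ty) (ltW tz)) _.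
rewrite -mulrA ler_pM2l // chd_pt ?line_gt0 //.
have -> : wedge (line x t) (line x t') = (t' - t) * wedge (vec x) (dir x).
  by rewrite /wedge /line /=; ring.
rewrite nmM wedge_dir mulr1 [nm (t' - t)]nmBC mulrC -mulrA ler_peMr ?nm_ge0 //.
rewrite mulrC ler_pdivlMr ?mulr_gt0 ?line_gt0 // mul1r expr2.
have h t0 : nm t0 < r / 2 -> en (line x t0) <= k.
  by move=> h0; have := en_line_le x t0; rewrite /k; lra.
by rewrite ler_pM ?en_ge0 ?h.
Qed.

End HarmonicFatou.

(** Branch once from [y], again from one of the two preimages, and pull the other one back to the
    same level. *)
Lemma backward3 y : julia_set P Q y -> exists k z1 z2 z3,
  [/\ [/\ z1 != z2, z1 != z3 & z2 != z3], Rn k z1 = y, Rn k z2 = y & Rn k z3 = y].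
Proof.
move=> Jy; have [n [z1 [z2 [z12 h1 h2]]]] := backward_branch hPQ hdeg Jy.
have Jz : julia_set P Q z1 by apply/(julia_iter hPQ hdeg n); rewrite h1.
have [m [w1 [w2 [w12 e1 e2]]]] := backward_branch hPQ hdeg Jz.
have [w3 e3] : exists w, Rn m w = z2.
  elim: (m) => [|j [w hw]]; first by exists z2.
  by have [x hx] := rat_map_surj hPQ hdeg w; exists x; rewrite iterSr hx.
exists (n + m)%N, w1, w2, w3; rewrite !iterD e1 e2 e3; split => //; split => //.
  by apply: contraNneq z12 => h; rewrite -e1 h e3.
by apply: contraNneq z12 => h; rewrite -e2 h e3.
Qed.

(** If no [n] works, each [R^n] misses some [y n] of the Julia set over the disc. A limit of the
    [y n] has three preimages under some [R^k], and openness of [R^k] perturbs them to three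
    preimages of [y n]: these are the moving targets, missed by [R^(n-k)]. *)
Lemma julia_exact x (r : K) : julia_set P Q x -> 0 < r ->
  exists n, forall y, julia_set P Q y -> exists2 z, chd x z < r & Rn n z = y.
Proof.
move=> Jx r0; apply: contrapT => hn.
have /choice[y hy] (n : nat) : exists y, julia_set P Q y /\ forall z, chd x z < r -> Rn n z <> y.
  apply: contrapT => h; apply: hn; exists n => y Jy; apply: contrapT => h2; apply: h.
  by exists y; split => // z xz zy; apply: h2; exists z.
have [F FU hF] := nat_ultra.
have /choice[v hv] n : exists v, en v = 1 /\ pt v = y n by have [v v1 vy] := unit_vec (y n); exists v.
have [l [l1 la lb]] := unit_ulim FU (filterE _ (fun n => (hv n).1)).
have lim e : 0 < e -> F [set n | chd (pt l) (y n) < e].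
  move=> e0; have := cvg_wedgel FU (v := l) la lb; rewrite wedgexx => /(cvg_nm FU)/(_ e e0).
  by apply: filterS => n; rewrite subr0; have [h1 h2] := hv n; rewrite /= -h2 chd_unit.
have Jl : julia_set P Q (pt l).
  apply: julia_closed => e e0; have /filter_ex[n hn0] := lim e e0.
  by exists (y n) => //; case: (hy n).
have [k [z1 [z2 [z3 [[z12 z13 z23] e1 e2 e3]]]]] := backward3 Jl.
pose sg := Num.min (chd z1 z2) (Num.min (chd z1 z3) (chd z2 z3)).
have sg0 : 0 < sg by rewrite !lt_min !chd_gt0 z12 z13 z23.
have [s12 s13 s23] : [/\ sg <= chd z1 z2, sg <= chd z1 z3 & sg <= chd z2 z3].
  by split; rewrite !ge_min lexx ?orbT.
(* Targets within [sg / 16] of points [sg] apart remain [sg / 16] apart, even after two uses of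
   [chd_triangle] with its factor 2. *)
have rho0 : 0 < sg / 16 by lra.
have target z : Rn k z = pt l -> exists Y : nat -> C * C,
    F [set n | [/\ en (Y n) = 1, chd z (pt (Y n)) < sg / 16 & Rn k (pt (Y n)) = y n]].
  move=> ez; have [dl dl0 hdl] := iter_open hPQ hdeg k z rho0.
  have /choice[Y hY] n : exists Y : C * C, chd (pt l) (y n) < dl ->
      [/\ en Y = 1, chd z (pt Y) < sg / 16 & Rn k (pt Y) = y n].
    case: (pselect (chd (pt l) (y n) < dl)) => h; last by exists (0, 0).
    have [|z' zz' hz'] := hdl (y n); first by rewrite ez.
    by have [Y Y1 Yz] := unit_vec z'; exists Y => _; rewrite Yz.
  by exists Y; apply: filterS (lim dl dl0) => n; exact: hY.
have [Y1 hY1] := target z1 e1; have [Y2 hY2] := target z2 e2; have [Y3 hY3] := target z3 e3.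
(* Reindexing by [n - k]: the target used at level [n - k] is the one found over [y n]. *)
pose F' : set_system nat := fmap (fun n => (n - k)%N) F.
have FU' : UltraFilter F' := ultra_pushforward FU _.
have hF' N : F' [set n | (N <= n)%N].
  change (F [set n | (N <= n - k)%N]).
  by apply: filterS (hF (N + k)%N) => n /= h; rewrite leq_subRL ?(leq_trans (leq_addl _ _) h) // addnC.
have nvY Y z : F [set n | [/\ en (Y n) = 1, chd z (pt (Y n)) < sg / 16 & Rn k (pt (Y n)) = y n]] ->
   nv P Q x F' (fun m => Y (m + k)%N) r.
  move=> h; change (F [set n | en (Y (n - k + k)%N) = 1 /\ forall t, nm t < r ->
    wedge (V P Q x (n - k) t) (Y (n - k + k)%N) != 0]).
  apply: filterS (filterI h (hF k)) => n [[Y0 _ hY] /= kn].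
  rewrite subnK //; split => // t tr.
  rewrite wedge_eq0 ?V_gt0 ?Y0 // V_pt //; apply/eqP => h2.
  have xt : chd x (pt (line x t)) < r by apply: le_lt_trans (chd_line_le _ _) tr.
  have [_ /(_ _ xt)] := hy n; apply.
  by rewrite -hY -h2 -iterD subnKC.
have sepY Ya Yb za zb : sg <= chd za zb ->
   F [set n | [/\ en (Ya n) = 1, chd za (pt (Ya n)) < sg / 16 & Rn k (pt (Ya n)) = y n]] ->
   F [set n | [/\ en (Yb n) = 1, chd zb (pt (Yb n)) < sg / 16 & Rn k (pt (Yb n)) = y n]] ->
   sep F' (fun m => Ya (m + k)%N) (fun m => Yb (m + k)%N) (sg / 16).
  move=> hs ha hb; change (F [set n | sg / 16 <= nm (wedge (Ya (n - k + k)%N) (Yb (n - k + k)%N))]).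
  apply: filterS (filterI (filterI ha hb) (hF k)) => n [[[a1 a2 _] [b1 b2 _]] /= kn].
  rewrite subnK // -chd_unit //.
  have := chd_triangle (pt (Ya n)) za zb; have := chd_triangle (pt (Yb n)) (pt (Ya n)) zb.
  by rewrite [chd (pt (Yb n)) zb]chdC; lra.
have [G [cG cG0 hG]] := green_ex hPQ hdeg.
have fin Y : nv P Q x F' Y r -> (forall t, nm t <= r / 8 -> tends P Q G x F' Y t) -> False.
  move=> nY hY; have r8 : 0 < r / 8 by lra.
  have [|a [a1 a2]] := limit_expansion hPQ hdeg cG0 FU' r0 _ nY (ltW r8) hY; first lra.
  by apply: Jx; apply: (harmonic_fatou cG0 hG r8 _ a1 a2); lra.
have [h|h] := three_targets hPQ hdeg cG0 hG FU' hF' r0 rho0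
   (nvY _ _ hY1) (nvY _ _ hY2) (nvY _ _ hY3) (sepY _ _ _ _ s12 hY1 hY2)
   (sepY _ _ _ _ s13 hY1 hY3) (sepY _ _ _ _ s23 hY2 hY3).
  exact: (fin _ (nvY _ _ hY1) h).
exact: (fin _ (nvY _ _ hY2) h).
Qed.

(** If [x] were isolated, exactness on a disc containing no other point of the Julia set would
    reduce that set to one point, but [backward_branch] gives two. *)
Lemma julia_perfect x (r : K) (s : seq (sphere K)) : julia_set P Q x -> 0 < r ->
  exists2 y, julia_set P Q y & chd x y < r /\ y \notin s.
Proof.
move=> Jx r0; elim: s r r0 => [|a s ih] r r0.
  by exists x => //; rewrite chdxx.
have [n [z1 [z2 [z12 e1 e2]]]] : exists n z1 z2, [/\ z1 != z2, Rn n z1 = x & Rn n z2 = x].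
  exact: backward_branch.
have [|m hm] := julia_exact Jx (_ : 0 < (if a == x then r else Num.min r (chd x a))).
  by case: eqVneq => // ax; rewrite lt_min r0 chd_gt0 eq_sym.
case: (eqVneq a x) hm => [ax|ax] hm; last first.
  have [|y Jy [xy ys]] := ih (Num.min r (chd x a)); first by rewrite lt_min r0 chd_gt0 eq_sym.
  move: xy; rewrite lt_min => /andP[y1 y2]; exists y => //; split => //.
  by rewrite inE negb_or ys andbT; apply: contraTneq y2 => ->; rewrite ltxx.
apply: contrapT => hn.
have only y : julia_set P Q y -> chd x y < r -> y \notin s -> y = x.
  move=> Jy xy ys; apply: contrapT => /eqP yx; apply: hn; exists y => //.
  by rewrite inE negb_or ys andbT xy ax yx.
have Jz z : Rn n z = x -> julia_set P Q z by move=> h; apply/(julia_iter hPQ hdeg n); rewrite h.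
pose r' := \big[Num.min/r]_(b <- s) (if b == x then r else chd x b).
have r'0 : 0 < r'.
  rewrite /r'; elim/big_rec: _ => // b t _ t0; rewrite lt_min t0 andbT.
  by case: eqVneq => // bx; rewrite chd_gt0 eq_sym.
have [r'r r's] : r' <= r /\ forall b, b \in s -> b != x -> r' <= chd x b.
  rewrite /r'; elim: (s) => [|b l [h1 h2]]; first by rewrite big_nil.
  rewrite big_cons; split; first by rewrite ge_min h1 orbT.
  move=> c; rewrite inE => /orP[/eqP -> /negbTE ->|cl cx]; first by rewrite ge_min lexx.
  by rewrite ge_min h2 ?orbT.
have only' y : julia_set P Q y -> chd x y < r' -> y = x.
  move=> Jy xy; case: (boolP (y \in s)) => ys; last by apply: only => //; exact: lt_le_trans r'r.
  apply: contrapT => /eqP yx; have := r's _ ys yx; lra.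
have [m' hm'] := julia_exact Jx r'0.
have J1 z : julia_set P Q z -> z = Rn m' x.
  move=> Jz0; have [w xw hw] := hm' _ Jz0.
  have Jw : julia_set P Q w by apply/(julia_iter hPQ hdeg m'); rewrite hw.
  by rewrite -hw (only' _ Jw xw).
by move: z12; rewrite (J1 _ (Jz _ e1)) (J1 _ (Jz _ e2)) eqxx.
Qed.

End JuliaDynamics.

Lemma ln_gap (K : realType) (S rho p : K) : 1 <= S -> 0 < rho -> rho <= 1 / 2 ->
  S ^+ 4 + 2 * S ^+ 2 * rho ^+ 2 <= p -> ln (S ^+ 4) + rho ^+ 2 / S ^+ 2 <= ln p.
Proof.
move=> S1 rho0 h2 hp; have S0 : 0 < S by lra.
pose tau := 2 * rho ^+ 2 / S ^+ 2.
have S2 : 1 <= S ^+ 2 by rewrite expr2; nra.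
have r4 : rho ^+ 2 <= 1 / 4 by rewrite expr2; nra.
have tau0 : 0 < tau by rewrite divr_gt0 ?mulr_gt0 ?exprn_gt0.
have tau1 : tau <= 1 by rewrite /tau ler_pdivrMr; lra.
have hS : S ^+ 4 * (1 + tau) = S ^+ 4 + 2 * S ^+ 2 * rho ^+ 2.
  by rewrite /tau; field; rewrite gt_eqF.
have t2 : 0 < 1 + tau by lra.
have t1 : tau / 2 <= ln (1 + tau).
  have := @le_ln1Dx K (- (tau / (1 + tau))).
  have -> : 1 + - (tau / (1 + tau)) = (1 + tau)^-1 by field; rewrite gt_eqF.
  rewrite lnV ?posrE // lerN2 => h; apply: (@le_trans _ _ (tau / (1 + tau))).
    by rewrite ler_pM2l // lef_pV2 ?posrE //; lra.
  by apply: h; rewrite ltrN2 ltr_pdivrMr //; lra.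
have : ln (S ^+ 4) + ln (1 + tau) <= ln p.
  have S4 : 0 < S ^+ 4 by exact: exprn_gt0.
  have p0 : 0 < p by apply: lt_le_trans hp; rewrite -hS mulr_gt0.
  by rewrite -lnM ?posrE // ler_ln ?posrE ?mulr_gt0 // hS.
have -> : rho ^+ 2 / S ^+ 2 = tau / 2 by rewrite /tau; field; rewrite gt_eqF.
by lra.
Qed.

(** * The Julia set is non-empty *)

Section JuliaSpace.
Variables (K : realType) (P Q : {poly Cplx K}).
Local Notation C := (Cplx K).
Local Notation d := (rat_degree P Q).
Local Notation R := (rat_map P Q).
Local Notation Rn n := (iter n R).
Hypothesis hPQ : coprimep P Q.
Hypothesis hdeg : (2 <= d)%N.
Implicit Types (x y z : sphere K).

(** By equicontinuity the images of a small disc stay near [R^n x], so at each [n] one of the points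
    0 and infinity is avoided by a definite distance. With these targets the potentials tend to
    [g]. *)
Lemma fatou_expansion (G : C * C -> K) (cG : K) x : 0 < cG ->
  (forall v, 0 < en v -> forall n, `|G v - Gn P Q n v| <= cG / dn P Q n) ->
  fatou_set P Q x -> exists (a : nat -> C) (s r : K), [/\ 0 < r, r <= s / 2 &
   forall N t, nm t <= r -> `|g G x t - g G x 0 + expsum a N t| <= 2 * (nm t / s) ^+ N.+1].
Proof.
move=> cG0 hG /fatouP[e0 e00 he]; have ex : equic P Q x by apply: he; rewrite chdxx.
have [s s0 hs] := ex (1 / 100) ltac:(lra).
pose q1 : C * C := (1, 0); pose q2 : C * C := (0, 1).
have q1n : en q1 = 1 by rewrite /en /en2 /= nm1 nm0 expr1n expr0n addr0 sqrtr1.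
have q2n : en q2 = 1 by rewrite /en /en2 /= nm1 nm0 expr1n expr0n add0r sqrtr1.
have q12 : chd (pt q1) (pt q2) = 1 by rewrite chd_unit // /wedge /= mulr1 mulr0 subr0 nm1.
(* The two points are at distance 1, so by [chd_triangle] one of them is at distance at least [1/4]
   from [R^n x]. *)
pose Y n := if 1 / 4 <= chd (Rn n x) (pt q1) then q1 else q2.
have Y1 n : en (Y n) = 1 by rewrite /Y; case: ifP.
have far n : 1 / 4 <= chd (Rn n x) (pt (Y n)).
  rewrite /Y; case: ifP => // /negbT; rewrite -ltNge => h.
  by have := chd_triangle (Rn n x) (pt q1) (pt q2); rewrite q12 [chd (pt q1) _]chdC; lra.
have low n t : nm t < s -> 1 / 10 * en (V P Q x n t) <= nm (wedge (V P Q x n t) (Y n)).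
  move=> ts; have v0 := V_gt0 hPQ hdeg x n t.
  have : chd (Rn n x) (Rn n (pt (line x t))) < 1 / 100.
    by apply: hs; apply: le_lt_trans (chd_line_le _ _) ts.
  have := chd_triangle (Rn n (pt (line x t))) (Rn n x) (pt (Y n)); have := far n.
  rewrite -V_pt // [chd (pt (V _ _ _ _ _)) (pt (Y n))]chd_pt ?Y1 // mulr1 => a b c.
  by rewrite -ler_pdivlMr //; lra.
have [F FU hF] := nat_ultra.
have hn : nv P Q x F Y s.
  apply: filterE => n; split => // t ts; rewrite -nm_gt0.
  by apply: lt_le_trans (low n t ts); rewrite mulr_gt0 ?V_gt0.
have ht t : nm t <= s / 2 -> tends P Q G x F Y t.
  move=> ts e ep; have ts' : nm t < s by lra.
  have t10 : (0 : K) < 1 / 10 by lra.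
  apply: filterS2 (near_small hPQ hdeg FU hF cG ep) (near_small hPQ hdeg FU hF (cG +
      `|ln (1 / 10 : K)|) ep) => n /= h1 h2.
  have w0 : wedge (V P Q x n t) (Y n) != 0.
    by rewrite -nm_gt0; apply: lt_le_trans (low n t ts'); rewrite mulr_gt0 ?V_gt0.
  have := u_upper hPQ hdeg hG (Y1 n) w0; have := u_lower hPQ hdeg hG t10 (low n t ts').
  by rewrite ltr_norml; lra.
have s2 : 0 < s / 2 by lra.
have [a [_ ha]] := limit_expansion hPQ hdeg cG0 FU s0 (lexx _) hn (ltW s2) ht.
by exists a, s, (s / 2).
Qed.

(** Strict subharmonicity of [ln (1 + |t|^2)] in discrete form: the product over four points of a
    circle exceeds the fourth power of the central value by a term of order [rho^2]. *)
Lemma line_mean x (rho : K) : 0 <= rho -> rho <= 1 / 2 ->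
  let S := en2 (vec x) in let D (t : C) := en2 (line x t) in
  S ^+ 4 + 2 * S ^+ 2 * rho ^+ 2 <=
  D rho%:C%C * D (- rho%:C%C) * (D ('i * rho%:C%C) * D (- ('i * rho%:C%C))).
Proof.
move=> r0 r2 /=; have [al [be [hS hD]]] : exists al be : K,
   en2 (vec x) = 1 + al ^+ 2 + be ^+ 2 /\
   forall t : C, en2 (line x t) = 1 + (al + complex.Re t) ^+ 2 + (be + complex.Im t) ^+ 2.
  case: x => [[al be]|]; [exists al, be|exists 0, 0]; split=> [|[p q]];
    rewrite /en2 /line /= !nm_sq /= ?(mulr0, mulr1, addr0, add0r, mul0r, subr0, expr0n, expr1n) //=; ring.
rewrite hS !hD /=; rewrite !(mul0r, mul1r, mulr0, subr0, add0r, addr0, oppr0, sub0r).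
set S := 1 + al ^+ 2 + be ^+ 2; set L := S + rho ^+ 2.
have S1 : 1 <= S by rewrite /S; have := sqr_ge0 al; have := sqr_ge0 be; lra.
have -> : (1 + (al + rho) ^+ 2 + be ^+ 2) * (1 + (al + - rho) ^+ 2 + be ^+ 2) *
  ((1 + al ^+ 2 + (be + rho) ^+ 2) * (1 + al ^+ 2 + (be + - rho) ^+ 2)) =
  L ^+ 2 * (L ^+ 2 - 4 * rho ^+ 2 * (S - 1)) + 16 * (al * be * rho ^+ 2) ^+ 2.
  by rewrite /L /S; ring.
have -> : L ^+ 2 * (L ^+ 2 - 4 * rho ^+ 2 * (S - 1)) =
  (S ^+ 4 + 2 * S ^+ 2 * rho ^+ 2) + (2 * S ^+ 2 * rho ^+ 2 * (1 - 2 * rho ^+ 2) + 8 * S * rho ^+ 4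
    + (S ^+ 2 + 2 * S * rho ^+ 2) * rho ^+ 4 + rho ^+ 4 * (S ^+ 2 - 2 * S * rho ^+ 2 +
        4 * rho ^+ 2 + rho ^+ 4)).
  by rewrite /L; ring.
have q0 : 0 <= rho ^+ 2 by exact: sqr_ge0.
have q1 : rho ^+ 2 <= 1 / 4 by rewrite expr2; nra.
have q4 : 0 <= rho ^+ 4 by exact: exprn_ge0.
have S0 : 0 <= S by lra.
have SS : 0 <= S ^+ 2 by exact: sqr_ge0.
have a1 : 0 <= 2 * S ^+ 2 * rho ^+ 2 * (1 - 2 * rho ^+ 2).
  by apply: mulr_ge0; [rewrite mulr_ge0 // mulr_ge0|lra].
have a2 : 0 <= 8 * S * rho ^+ 4 by rewrite mulr_ge0 // mulr_ge0.
have a3 : 0 <= (S ^+ 2 + 2 * S * rho ^+ 2) * rho ^+ 4.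
  by rewrite mulr_ge0 // addr_ge0 // mulr_ge0 // mulr_ge0.
have a4 : 0 <= rho ^+ 4 * (S ^+ 2 - 2 * S * rho ^+ 2 + 4 * rho ^+ 2 + rho ^+ 4).
  apply: mulr_ge0 => //; have : 2 * S * rho ^+ 2 <= S ^+ 2 by rewrite expr2; nra.
  by lra.
by have := sqr_ge0 (al * be * rho ^+ 2); lra.
Qed.

(* Otherwise G is harmonic along every line; at a minimum of G - ln|.| on the
   sphere this contradicts the strict subharmonicity of ln|.|. *)
Lemma julia_nonempty : exists x, julia_set P Q x.
Proof.
apply: contrapT => hn.
have hf x : fatou_set P Q x by apply: contrapT => h; apply: hn; exists x.
have [G [cG cG0 hG]] := green_ex hPQ hdeg.
pose A := [set G v | v in [set v : C * C | en v = 1]].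
have Ai : has_inf A.
  split; first by exists (G (1, 0)), (1, 0) => //=; rewrite /en /en2 /= nm1 nm0 expr1n expr0n addr0 sqrtr1.
  exists (- cG) => _ [v /= v1 <-]; have := hG v ltac:(by rewrite v1) 0%N.
  by rewrite /Gn /= v1 ln1 mul0r subr0 /dn expr0 divr1 ler_norml => /andP[].
have /choice[v hv] (n : nat) : exists v, en v = 1 /\ G v < inf A + n.+1%:R^-1.
  have n0 : (0 : K) < n.+1%:R^-1 by rewrite invr_gt0 ltr0n.
  by have [_ [v /= v1 <-] h] := inf_adherent n0 Ai; exists v.
have [F FU hF] := nat_ultra.
have [l [l1 la lb]] := unit_ulim FU (filterE _ (fun n => (hv n).1)).
have lp : 0 < en l by rewrite l1.
have vp n : 0 < en (v n) by case: (hv n) => ->.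
have Gl : G l <= inf A.
  apply/ler_addgt0Pr => e e0; have e2 : 0 < e / 2 by rewrite divr_gt0.
  have /cvgrPdist_lt/(_ _ e2) cl := G_cvg hPQ hdeg cG0 hG FU la lb lp vp.
  have [N hN] := inv_small e2.
  have /filter_ex[n [h1 h2]] : F [set n | `|G l - G (v n)| < e / 2 /\ (N <= n)%N].
    exact: filterI cl (hF N).
  have [_ h3] := hv n; move: h3 (hN n h2) h1; move: (n.+1%:R^-1) => q; rewrite ltr_norml.
  by move=> ? ? /andP[? ?]; lra.
have Gmin w : 0 < en w -> G l + ln (en w) <= G w.
  move=> w0; have i0 : ((en w)^-1)%:C%C != 0 :> C.
    by rewrite -nm_eq0 nm_real normr_eq0 invr_eq0 gt_eqF.
  have nw : nm (((en w)^-1)%:C%C : C) = (en w)^-1 by rewrite nm_real gtr0_norm ?invr_gt0.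
  have := G_sc hPQ hdeg hG i0 w0; rewrite nw lnV ?posrE // => h.
  have : inf A <= G (sc ((en w)^-1)%:C%C w).
    apply: ge_inf; first by case: Ai.
    by exists (sc ((en w)^-1)%:C%C w) => //=; rewrite en_sc nw mulVf ?gt_eqF.
  by lra.
pose x := pt l; have [c c0 hl] := vec_pt lp.
have x0 := vec_gt0 x; have cp : 0 < nm c by rewrite nm_gt0.
have gx0 : g G x 0 = G l + ln (en (vec x)).
  have := G_sc hPQ hdeg hG c0 x0; rewrite -hl => ->.
  have : ln (nm c * en (vec x)) = 0 by rewrite -en_sc -hl l1 ln1.
  by rewrite lnM ?posrE // /g line0; lra.
have [a [s [r [r0 rs ha]]]] := fatou_expansion cG0 hG (hf x).
have s0 : 0 < s by lra.
pose S := en2 (vec x); have S0 : 0 < S by rewrite /S -en_sq exprn_gt0.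
have S1 : 1 <= S by have := vec_ge1 x; rewrite /S -en_sq expr2; nra.
(* So small that the four cubic remainders add up to at most [rho^2 / (4 S^2)], half of the gain
   provided by [line_mean]. *)
pose rho := Num.min (Num.min r (1 / 2)) (s ^+ 3 / (32 * S ^+ 2)).
have rho0 : 0 < rho.
  rewrite !lt_min r0 /=; apply/andP; split; first lra.
  by rewrite divr_gt0 ?exprn_gt0 // mulr_gt0 // exprn_gt0.
have [h1 h2 h3] : [/\ rho <= r, rho <= 1 / 2 & rho <= s ^+ 3 / (32 * S ^+ 2)].
  by split; rewrite !ge_min lexx ?orbT.
have hm := line_mean x (ltW rho0) h2; rewrite /= -/S in hm.
have gb t : nm t = rho -> `|g G x t - g G x 0 + complex.Re (a 0%N * t) +
    complex.Re (a 1%N * t ^+ 2)| <= 2 * (rho / s) ^+ 3.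
  move=> tr; have := ha 2 t ltac:(by rewrite tr); rewrite tr.
  by rewrite /expsum !big_ord_recr big_ord0 /= add0r expr1 addrA.
have nr : nm (rho%:C%C : C) = rho by rewrite nm_real gtr0_norm.
have ni : nm ('i : C) = 1 by rewrite /nm normCi.
have b1 := gb rho%:C%C nr; have b2 := gb (- rho%:C%C) ltac:(by rewrite nmN).
have b3 := gb ('i * rho%:C%C) ltac:(by rewrite nmM ni mul1r).
have b4 := gb (- ('i * rho%:C%C)) ltac:(by rewrite nmN nmM ni mul1r).
(* Over the four points [i^k rho] the terms of first and second order cancel. *)
rewrite !mulrN !sqrrN !ReN in b2 b4.
have i2 : ('i * rho%:C%C) ^+ 2 = - rho%:C%C ^+ 2 :> C by rewrite exprMn sqrCi mulN1r.
rewrite i2 mulrN ReN in b3; rewrite i2 mulrN ReN in b4.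
have m t : G l + ln (en2 (line x t)) / 2 <= g G x t.
  have := Gmin _ (line_gt0 x t); rewrite -en_sq lnXn ?line_gt0 // mulr2n /g.
  by have -> : (ln (en (line x t)) + ln (en (line x t))) / 2 = ln (en (line x t)) by field.
have m0 : g G x 0 = G l + ln S / 2.
  rewrite gx0 /S -en_sq lnXn // mulr2n.
  by have -> : (ln (en (vec x)) + ln (en (vec x))) / 2 = ln (en (vec x)) by field.
have D0 t : 0 < en2 (line x t) by rewrite -en_sq exprn_gt0 // line_gt0.
have lnp : ln (S ^+ 4) + rho ^+ 2 / S ^+ 2 <= ln (en2 (line x rho%:C%C) * en2 (line x (- rho%:C%C)) *
   (en2 (line x ('i * rho%:C%C)) * en2 (line x (- ('i * rho%:C%C))))).
  by apply: (ln_gap S1 rho0 h2); lra.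
rewrite lnXn // !lnM ?posrE ?mulr_gt0 // in lnp.
have rr : (rho / s) ^+ 3 <= rho ^+ 2 / S ^+ 2 / 32.
  have s3 : 0 < s ^+ 3 by exact: exprn_gt0.
  have : rho * rho ^+ 2 <= s ^+ 3 / (32 * S ^+ 2) * rho ^+ 2 by rewrite ler_pM2r // exprn_gt0.
  have -> : s ^+ 3 / (32 * S ^+ 2) * rho ^+ 2 = rho ^+ 2 / S ^+ 2 / 32 * s ^+ 3.
    by field; rewrite gt_eqF.
  by rewrite exprMn exprVn ler_pdivrMr // -exprS.
have q0 : 0 < rho ^+ 2 / S ^+ 2 by rewrite divr_gt0 ?exprn_gt0.
have m1 := m rho%:C%C; have m2 := m (- rho%:C%C).
have m3 := m ('i * rho%:C%C); have m4 := m (- ('i * rho%:C%C)).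
move: b1 b2 b3 b4; rewrite !ler_norml => /andP[_ ?] /andP[_ ?] /andP[_ ?] /andP[_ ?].
by rewrite -[ln S *+ 4]mulr_natr in lnp; lra.
Qed.

End JuliaSpace.

Lemma real_ctsP (K : realType) (T : topologicalType) (h : T -> K) :
  (forall x (r : K), 0 < r -> \forall z \near x, `|h x - h z| < r) -> continuous h.
Proof. by move=> hh x; apply/cvgrPdist_lt => r r0; exact: hh. Qed.

Lemma clamp_near (K : realType) (A B r : K) : `|B - A| < r / 2 ->
  `|Num.max 0 (Num.min 1 (2 - 2 * B)) - Num.max 0 (Num.min 1 (2 - 2 * A))| < r.
Proof.
have clamp (t : K) : [\/ Num.max 0 (Num.min 1 t) = t /\ 0 <= t <= 1,
    Num.max 0 (Num.min 1 t) = 1 /\ 1 <= t | Num.max 0 (Num.min 1 t) = 0 /\ t <= 0].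
  case: (leP 1 t) => [t1|t1]; first by apply: Or32; rewrite max_r.
  case: (leP 0 t) => [t0|t0]; first by apply: Or31; split; rewrite ?t0 ?ltW.
  by apply: Or33; rewrite ltW.
case: (clamp (2 - 2 * B)) (clamp (2 - 2 * A)) => [[-> ?]|[-> ?]|[-> ?]] [[-> ?]|[-> ?]|[-> ?]];
  by rewrite !ltr_norml; lra.
Qed.

(** * The restriction to the Julia set as a [dynamics] *)

Section DynamicsOnJulia.
Variables (K : realType) (P Q : {poly Cplx K}).
Local Notation C := (Cplx K).
Local Notation d := (rat_degree P Q).
Local Notation R := (rat_map P Q).
Hypothesis hPQ : coprimep P Q.
Hypothesis hdeg : (2 <= d)%N.
Local Notation J := (julia_set P Q).
Implicit Types (x y z : J).

Lemma nbhs_julia x (W : set J) :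
  nbhs x W <-> exists2 e : K, 0 < e & forall z, chd (\val x) (\val z) < e -> W z.
Proof.
split=> [|[e e0 h]].
  rewrite nbhsE /= => -[B [[B1 oB1 <-] B1y] hB].
  have [r1 r10 hr1] := (nbhs_chd _ _).1 (open_nbhs_nbhs (conj oB1 B1y)).
  by exists r1 => // z xz; apply: hB; exact: hr1.
have [V [oV Vy hV]] := open_chd (\val x) e0.
have : nbhs x (\val @^-1` V : set J) by apply: open_nbhs_nbhs; split => //; exists V.
by apply: filterS => z Vz; apply: h; exact: hV.
Qed.

Definition mkJ (t : sphere K) (h : J t) : J := exist _ t (mem_set h).

Lemma valJ x : J (\val x). Proof. exact: set_mem (valP x). Qed.
Arguments valJ : clear implicits.

Lemma J_eq x y : \val x = \val y -> x = y. Proof. exact: val_inj. Qed.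

Lemma julia_hausdorff : hausdorff_space J.
Proof.
move=> x y h; apply: J_eq; apply/eqP; rewrite -chd_eq0; apply: contraT => n0.
have c0 : 0 < chd (\val x) (\val y) / 4 by rewrite divr_gt0 // lt_def n0 chd_ge0.
have nx : nbhs x [set z | chd (\val x) (\val z) < chd (\val x) (\val y) / 4].
  by apply/nbhs_julia; exists (chd (\val x) (\val y) / 4).
have ny : nbhs y [set z | chd (\val y) (\val z) < chd (\val x) (\val y) / 4].
  by apply/nbhs_julia; exists (chd (\val x) (\val y) / 4).
have [z [/= h1 h2]] := h _ _ nx ny.
by have := chd_triangle (\val z) (\val x) (\val y); rewrite [chd (\val z) _]chdC; lra.
Qed.

Lemma julia_compact : compact [set: J].
Proof.
rewrite compact_ultra => F FU _.
have /choice[v hv] x : exists v, en v = 1 /\ pt v = \val x.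
  by have [v v1 vx] := unit_vec (\val x); exists v.
have [l [l1 la lb]] := unit_ulim FU (filterE _ (fun n => (hv n).1)).
have lim (e : K) : 0 < e -> F [set x | chd (pt l) (\val x) < e].
  move=> e0; have := cvg_wedgel FU (v := l) la lb; rewrite wedgexx => /(cvg_nm FU)/(_ e e0).
  by apply: filterS => n; rewrite subr0; have [h1 h2] := hv n; rewrite /= -h2 chd_unit.
have Jl : J (pt l).
  apply: julia_closed => e e0; have /filter_ex[n hn0] := lim e e0.
  by exists (\val n) => //; exact: valJ.
exists (mkJ Jl); split => // W /nbhs_julia[e e0 hW].
by apply: filterS (lim e e0) => x; exact: hW.
Qed.

Lemma julia_bounded (a : continuousType J C) : exists M : K, forall x, nm (a x) <= M.
Proof.
apply: contrapT => hn.
have /choice[x hx] (n : nat) : exists x, n%:R < nm (a x).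
  apply: contrapT => h; apply: hn; exists n%:R => x; rewrite leNgt; apply/negP => h2.
  by apply: h; exists x.
have [F FU hF] := nat_ultra.
have := julia_compact; rewrite compact_ultra => /(_ (fmap x F) (ultra_pushforward FU x) filterT).
move=> [p [_ hp]]; have /ctsP/(_ p 1 ltr01)/hp := @cts_fun _ _ a.
have [N hN] : exists N : nat, nm (a p) + 1 < N%:R.
  exists (archimedean.Num.bound (nm (a p) + 1)).
  by apply: archimedean.Num.Theory.archi_boundP; rewrite addr_ge0 ?nm_ge0.
move=> h; have /filter_ex[n [h1 h2]] : F [set n | nm (a p - a (x n)) < 1 /\ (N <= n)%N].
  have h' : F [set n | nm (a p - a (x n)) < 1] := h; exact: filterI h' (hF N).
have := hx n; have : N%:R <= n%:R :> K by rewrite ler_nat.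
by have := nm_ler_dist (a (x n)) (a p); rewrite nmBC; lra.
Qed.

(** The squared chordal distance is a polynomial in the coordinates of [stereo], which gives its
    continuity. Clamping [2 - 2 chd^2 / e^2] to the unit interval yields 1 up to radius [e / 2] and
    0 from [e] on. *)
Lemma julia_bump x (U : set J) : nbhs x U -> exists v : continuousType J C,
  [/\ forall z, 0 <= v z <= 1, forall z, ~ U z -> v z = 0 & \forall z \near x, v z = 1].
Proof.
move=> /nbhs_julia[e e0 hU].
pose h z : K := Num.max 0 (Num.min 1 (2 - 2 * (chd (\val x) (\val z) ^+ 2 / e ^+ 2))).
have e2 : 0 < e ^+ 2 by exact: exprn_gt0.
have cd z0 (r : K) : 0 < r -> \forall z \near z0,
    `|chd (\val x) (\val z0) ^+ 2 - chd (\val x) (\val z) ^+ 2| < r.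
  move=> r0; pose dl := Num.min 1 (r / 16).
  have dl0 : 0 < dl by rewrite lt_min ltr01 divr_gt0.
  apply/nbhs_julia; exists dl => // z zz.
  have zr : chd (\val z0) (\val z) < r / 16 by move: zz; rewrite lt_min => /andP[].
  have := stereo_chd (\val x) (\val z0); have := stereo_chd (\val x) (\val z).
  have [[c1 c2] c3] := stereo_ball dl0 zz.
  have bd (t : sphere K) : [/\ `|(stereo t).1.1| <= 1, `|(stereo t).1.2| <= 1 & `|(stereo t).2| <= 1].
    case: t => [[p q]|] /=; last by rewrite !normr0 normr1; split.
    have s0 : 0 < 1 + (p ^+ 2 + q ^+ 2) by have := sqr_ge0 p; have := sqr_ge0 q; lra.
    rewrite !normrM normfV (gtr0_norm s0) !ler_pdivrMr // !mul1r !ler_norml.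
    have n2 : `|2 : K| = 2 by rewrite ger0_norm.
    rewrite n2; split; last by have := sqr_ge0 p; have := sqr_ge0 q; lra.
      have : `|p| ^+ 2 = p ^+ 2 by rewrite real_normK ?num_real.
      by move: (normr_ge0 p) (sqr_ge0 q) (sqr_ge0 (1 - `|p|)); move: (`|p|) => b; nra.
    have : `|q| ^+ 2 = q ^+ 2 by rewrite real_normK ?num_real.
    by move: (normr_ge0 q) (sqr_ge0 p) (sqr_ge0 (1 - `|q|)); move: (`|q|) => b; nra.
  have [x1 x2 x3] := bd (\val x); have [y1 y2 y3] := bd (\val z0); have [z1 z2 z3] := bd (\val z).
  have dr : dl <= r / 16 by rewrite ge_min lexx orbT.
  rewrite /ball /= in c1 c2 c3.
  have key (a b c : K) : `|a| <= 1 -> `|b| <= 1 -> `|c| <= 1 -> `|b - c| < 2 * dl ->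
     `|(a - b) ^+ 2 - (a - c) ^+ 2| <= 8 * dl.
    move=> ha hb hc hbc; have -> : (a - b) ^+ 2 - (a - c) ^+ 2 = (c - b) * (a + a - b - c) by ring.
    rewrite normrM distrC; apply: (@le_trans _ _ (2 * dl * 4)); last lra.
    apply: ler_pM => //; first exact: ltW.
    by move: ha hb hc; clear; rewrite !ler_norml; lra.
  have := key _ _ _ x1 y1 z1 c1; have := key _ _ _ x2 y2 z2 c2; have := key _ _ _ x3 y3 z3 c3.
  by move=> /= k3 k2 k1 e1 e3; move: r0 dr e1 e3 k1 k2 k3; clear=> /= r0 dr e1 e3;
      rewrite !ler_norml ltr_norml; lra.
have hc : continuous h.
  apply: real_ctsP => z0 r r0; have r0' : 0 < r * e ^+ 2 / 2 by rewrite !divr_gt0 ?mulr_gt0.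
  apply: filterS (cd z0 _ r0') => z hz; rewrite /h.
  have : `|chd (\val x) (\val z0) ^+ 2 / e ^+ 2 - chd (\val x) (\val z) ^+ 2 / e ^+ 2| < r / 2.
    by rewrite -mulrBl normrM [ `|_^-1|]gtr0_norm ?invr_gt0 // ltr_pdivrMr //; lra.
  exact: clamp_near.
have h01 z : 0 <= h z <= 1.
  by rewrite /h le_max lexx /= ge_max ler01 ge_min lexx.
exists (rcf hc); split=> [z|z Uz|].
- by rewrite rcfE -[1]/(1%:C%C) !lecR.
- rewrite rcfE /h (_ : Num.max _ _ = 0) //; apply/max_idPl; rewrite ge_min; apply/orP; right.
  have : e <= chd (\val x) (\val z) by rewrite leNgt; apply/negP => /hU.
  move=> ez; have : 1 <= chd (\val x) (\val z) ^+ 2 / e ^+ 2.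
    by rewrite ler_pdivlMr // mul1r lerXn2r ?nnegrE ?chd_ge0 // ltW.
  by lra.
- apply/nbhs_julia; exists (e / 2); first lra.
  move=> z xz; rewrite rcfE /h (_ : Num.max _ _ = 1) //.
  have : chd (\val x) (\val z) ^+ 2 / e ^+ 2 <= 1 / 2.
    rewrite ler_pdivrMr //; apply: (@le_trans _ _ ((e / 2) ^+ 2)).
      by rewrite lerXn2r ?nnegrE ?chd_ge0 ?ltW // divr_gt0.
    by rewrite exprMn; lra.
  by move=> hh; rewrite min_l ?max_r //; lra.
Qed.

Definition jmap x : J := mkJ (julia_im hPQ hdeg (valJ x)).

Lemma jmapE x : \val (jmap x) = R (\val x). Proof. by []. Qed.

Lemma jmap_iter n x : \val (iter n jmap x) = iter n R (\val x).
Proof. by elim: n => // n ih; rewrite !iterS jmapE ih. Qed.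

Lemma jmap_cts : continuous jmap.
Proof.
move=> x W /nbhs_julia[e e0 hW]; have [L L0 hL] := rat_map_lip hPQ hdeg (\val x).
apply/nbhs_julia; exists (e / L) => [|z xz]; first exact: divr_gt0.
by apply: hW; rewrite !jmapE; apply: le_lt_trans (hL _) _; rewrite mulrC -ltr_pdivlMr.
Qed.

Lemma fac_julia y w (z : 'I_d -> C * C) j : fac w z -> pt w = \val y -> J (pt (z j)).
Proof.
by move=> f wy; apply: (julia_preim hPQ hdeg); rewrite (fac_R hPQ hdeg j f) wy; exact: valJ.
Qed.
Arguments fac_julia : clear implicits.

Lemma jroots_ex y : exists Z : 'I_d -> J, exists w (z : 'I_d -> C * C),
  [/\ fac w z, pt w = \val y & forall j, \val (Z j) = pt (z j)].
Proof.
have [w w1 wy] := unit_vec (\val y); have [z f] := fac_ex hPQ hdeg w1.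
by exists (fun j => mkJ (fac_julia _ _ _ j f wy)), w, z.
Qed.

Definition jroots y : 'I_d -> J := projT1 (cid (jroots_ex y)).

Definition jfib y : seq J := undup [seq jroots y j | j <- enum 'I_d].

Definition jbri x : nat := branch_index P Q (\val x).

Lemma mem_jfib x y : (x \in jfib y) = (jmap x == y).
Proof.
rewrite mem_undup /jroots; case: cid => Z [w [z [f wy hZ]]] /=.
have -> : (jmap x == y) = (R (\val x) == pt w).
  by rewrite wy -jmapE (inj_eq val_inj).
rewrite (fac_rootx hPQ hdeg _ f); apply/mapP/existsP => [[j _ ->]|[j /eqP jx]].
  by exists j; rewrite hZ.
by exists j; rewrite ?mem_enum //; apply: J_eq; rewrite hZ jx.
Qed.

(** The branch index counts the occurrences of a point among the [d] roots, so the weighted sum over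
    the fibre is a plain sum over the roots of any factorization. In this form [root_continuity]
    gives continuity of the transfer operator. *)
Lemma sum_jfib (M : nmodType) (f : J -> M) y w (z : 'I_d -> C * C) (Z : 'I_d -> J) :
  fac w z -> pt w = \val y -> (forall j, \val (Z j) = pt (z j)) ->
  \sum_(x <- jfib y) f x *+ jbri x = \sum_j f (Z j).
Proof.
move=> fz wy hZ; set s := [seq Z j | j <- enum 'I_d].
have mem x : (x \in s) = (jmap x == y).
  have -> : (jmap x == y) = (R (\val x) == pt w) by rewrite wy -jmapE (inj_eq val_inj).
  rewrite (fac_rootx hPQ hdeg _ fz); apply/mapP/existsP => [[j _ ->]|[j /eqP jx]].
    by exists j; rewrite hZ.
  by exists j; rewrite ?mem_enum //; apply: J_eq; rewrite hZ jx.
have -> : \sum_j f (Z j) = \sum_(x <- s) f x by rewrite big_map big_enum.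
rewrite -[RHS]big_undup_iterop_count /=.
have pe : perm_eq (jfib y) (undup s).
  by apply: uniq_perm; rewrite ?undup_uniq // => x; rewrite mem_undup mem mem_jfib.
rewrite (perm_big _ pe) /= big_seq [RHS]big_seq; apply: eq_bigr => x.
rewrite mem_undup mem => /eqP xy.
have Rx : R (\val x) = pt w by rewrite wy -xy.
have -> : jbri x = count_mem x s; last by [].
rewrite /jbri (branch_index_fac hPQ hdeg fz Rx) /mult count_map.
rewrite -sum1_card -sum1_count big_enum_cond /=.
by apply: eq_bigl => j; rewrite !inE /= -hZ (inj_eq val_inj).
Qed.

Lemma sum_jbri y : (\sum_(x <- jfib y) jbri x)%N = d.
Proof.
have [Z [w [z [f wy hZ]]]] := jroots_ex y.
have := sum_jfib (fun=> 1 : C) f wy hZ; rewrite sumr_const card_ord -natr_sum => /eqP.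
by rewrite eqr_nat => /eqP.
Qed.

Lemma jtr_cts (a : continuousType J C) : continuous (tr jfib jbri (a : J -> C)).
Proof.
apply/ctsP => y0 e e0.
have d0 : (0 : K) < d%:R by rewrite ltr0n; lia.
have ed : 0 < e / d%:R by rewrite divr_gt0.
have /choice[r hr] x : exists r : K, 0 < r /\ forall z, chd (\val x) (\val z) < r ->
    nm (a x - a z) < e / d%:R.
  have /ctsP/(_ x _ ed)/nbhs_julia[r r0 hr] := @cts_fun _ _ a.
  by exists r.
pose r0 := \big[Num.min/1]_(x <- jfib y0) r x.
have r00 : 0 < r0.
  by rewrite /r0; elim/big_rec: _ => // x t _ t0; rewrite lt_min (hr x).1.
have r0r x : x \in jfib y0 -> r0 <= r x.
  rewrite /r0; elim: (jfib y0) => // b l ih; rewrite inE big_cons ge_min.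
  by move=> /orP[/eqP ->|/ih ->]; rewrite ?lexx ?orbT.
have [dl dl0 hdl] := root_continuity hPQ hdeg (\val y0) r00.
apply/nbhs_julia; exists dl => // y /hdl[w [w0 [z [z0 [f f0 wy wy0 hz]]]]].
pose Z j := mkJ (fac_julia _ _ _ j f wy); pose Z0 j := mkJ (fac_julia _ _ _ j f0 wy0).
have trE (t : J) w' (z' : 'I_d -> C * C) (Z' : 'I_d -> J) : fac w' z' -> pt w' = \val t ->
    (forall j, \val (Z' j) = pt (z' j)) ->
    tr jfib jbri (a : J -> C) t = \sum_j a (Z' j).
  move=> f' wt hZ; rewrite -(sum_jfib _ f' wt hZ) /tr; apply: eq_bigr => x _.
  by rewrite mulr_natl.
rewrite (trE _ _ _ Z0 f0 wy0) // (trE _ _ _ Z f wy) // -sumrB.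
apply: le_lt_trans (nm_sum _ _ _) _.
have hj j : nm (a (Z0 j) - a (Z j)) < e / d%:R.
  apply: (hr (Z0 j)).2; apply: lt_le_trans (hz j) _; apply: r0r.
  rewrite mem_jfib; apply/eqP/J_eq; rewrite jmapE /= (fac_R hPQ hdeg j f0) //.
have j0 : 'I_d by apply: (@Ordinal _ 0); lia.
apply: (@lt_le_trans _ _ (\sum_(j < d) e / d%:R)).
  rewrite (bigD1 j0) //= [ltRHS](bigD1 j0) //=; apply: ltr_leD => //.
  by apply: ler_sum => j _; apply: ltW.
by rewrite sumr_const card_ord -[_ *+ _]mulr_natr divfK // gt_eqF.
Qed.

Lemma jcrit_ex : exists s : seq J, forall x, jbri x != 1%N -> x \in s.
Proof.
have [s hs] := crit_finite hPQ hdeg; exists (pmap insub s) => x /hs xs.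
by rewrite mem_pmap_sub.
Qed.

(** Perfectness provides a value near [R x] that no branch point takes. Two roots that coincide at
    [x] move to two roots over it, both of index 1 and therefore distinct. *)
Lemma jcrit_pair x (U : set J) : jbri x != 1%N -> nbhs x U ->
  exists x1 x2, [/\ U x1, U x2, x1 != x2, jmap x1 = jmap x2 & jbri x1 = 1%N /\ jbri x2 = 1%N].
Proof.
move=> ex /nbhs_julia[e e0 hU]; have [s hs] := crit_finite hPQ hdeg.
have [dl dl0 hdl] := root_continuity hPQ hdeg (R (\val x)) e0.
have [y Jy [xy ys]] := julia_perfect hPQ hdeg [seq R t | t <- s] (valJ (jmap x)) dl0.
have [w [w0 [z [z0 [f f0 wy wx hz]]]]] := hdl y xy.
have [i [j [ij ix jx]]] := branch_neq1 hPQ hdeg f0 (esym wx) ex.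
have Jz k : J (pt (z k)) by apply: (julia_preim hPQ hdeg); rewrite (fac_R hPQ hdeg k f) wy.
have b1 k : branch_index P Q (pt (z k)) = 1%N.
  apply/eqP; apply: contraT => /hs h; case/negP: ys; apply/mapP; exists (pt (z k)) => //.
  by rewrite (fac_R hPQ hdeg k f).
exists (mkJ (Jz i)), (mkJ (Jz j)); split; try exact: b1.
- by apply: hU; rewrite -ix; exact: hz.
- by apply: hU; rewrite -jx; exact: hz.
- apply: contra ij => /eqP /(congr1 val) /= h; apply/eqP.
  by apply: (branch1_inj hPQ hdeg f (b1 i)).
- by apply: J_eq; rewrite !jmapE /= !(fac_R hPQ hdeg _ f).
- by split; exact: b1.
Qed.

Lemma jmap_ninj : exists x1 x2, x1 != x2 /\ jmap x1 = jmap x2.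
Proof.
have [y Jy] := julia_nonempty hPQ hdeg.
have [n [z1 [z2 [z12 h1 h2]]]] := backward_branch hPQ hdeg Jy.
have main m t1 t2 : J t1 -> J t2 -> t1 != t2 -> iter m R t1 = iter m R t2 ->
    exists x1 x2 : J, x1 != x2 /\ jmap x1 = jmap x2.
  elim: m t1 t2 => [|m ih] t1 t2 J1 J2 t12; first by move=> /= h; rewrite h eqxx in t12.
  rewrite !iterSr; case: (eqVneq (R t1) (R t2)) => [h _|h].
    by exists (mkJ J1), (mkJ J2); split=> //; apply: J_eq; rewrite !jmapE.
  by apply: ih => //; exact: (julia_im hPQ hdeg).
apply: (main n z1 z2) => //; try (by apply/(julia_iter hPQ hdeg n); rewrite ?h1 ?h2).
by rewrite h1 h2.
Qed.

Lemma jmap_exact x (U : set J) : nbhs x U -> exists n, forall y, exists2 z, U z & iter n jmap z = y.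
Proof.
move=> /nbhs_julia[e e0 hU]; have [n hn] := julia_exact hPQ hdeg (valJ x) e0.
exists n => y; have [z xz hz] := hn _ (valJ y).
have Jz : J z by apply/(julia_iter hPQ hdeg n); rewrite hz; exact: valJ.
by exists (mkJ Jz); [exact: hU|apply: J_eq; rewrite jmap_iter].
Qed.

Lemma julia_dynamics : exists D : dynamics K J,
  [/\ dmap D = jmap, fib D = jfib & bri D = jbri].
Proof.
have [x0 Jx0] := julia_nonempty hPQ hdeg; have [s hs] := jcrit_ex.
by exists (Dynamics jmap_cts (fun y => undup_uniq _) mem_jfib (fun x => branch_gt0 hPQ hdeg (\val x))
  hdeg sum_jbri jtr_cts julia_hausdorff (mkJ Jx0) julia_bounded julia_bump hs jcrit_pair jmap_ninj
      jmap_exact).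
Qed.

Lemma jmap_local_inj x : jbri x = 1%N -> exists2 U : set J, nbhs x U &
  forall z1 z2, U z1 -> U z2 -> jmap z1 = jmap z2 -> z1 = z2.
Proof.
move=> /(local_inj hPQ hdeg)[r r0 h]; exists [set z | chd (\val x) (\val z) < r].
  by apply/nbhs_julia; exists r.
by move=> z1 z2 /= h1 h2 /(congr1 val) e; apply: J_eq; exact: h.
Qed.

End DynamicsOnJulia.

(** * Bounded operators on a Hilbert space *)

Lemma seq_complete (K : realType) (V : normedModType (Cplx K)) :
  (forall u : nat -> V, (forall e : K, 0 < e ->
     exists N, forall n m, (N <= n)%N -> (N <= m)%N -> nm (u n - u m) < e) ->
   exists l, forall e : K, 0 < e -> exists N, forall n, (N <= n)%N -> nm (l - u n) < e) ->
  forall F : set_system V, ProperFilter F -> cauchy F -> cvg F.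
Proof.
move=> hV F FF /cauchyP cF.
have /choice[x hx] (n : nat) : exists x : V, F [set y | nm (x - y) < n.+1%:R^-1].
  have := cF (n.+1%:R^-1)%:C%C; rewrite ltcR invr_gt0 ltr0Sn => /(_ isT).
  by move=> [x hx]; exists x; apply: filterS hx => y; rewrite -ball_normE /= lt_nm.
have hxx n m : nm (x n - x m) < n.+1%:R^-1 + m.+1%:R^-1.
  have /filter_ex[y [h1 h2]] : F ([set y | nm (x n - y) < n.+1%:R^-1] `&`
      [set y | nm (x m - y) < m.+1%:R^-1]) by exact: filterI (hx n) (hx m).
  by apply: le_lt_trans (nm_dist _ y _) _; rewrite (nmBC y); apply: ltrD.
have small (e : K) : 0 < e -> exists N : nat, forall n, (N <= n)%N -> n.+1%:R^-1 < e.
  exact: inv_small.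
have [l hl] : exists l, forall e : K, 0 < e -> exists N, forall n, (N <= n)%N -> nm (l - x n) < e.
  apply: hV => e e0; have [N hN] := small (e / 2) ltac:(by rewrite divr_gt0).
  exists N => n m nN mN; apply: lt_trans (hxx _ _) _.
  by have := hN _ nN; have := hN _ mN; move: (n.+1%:R^-1) (m.+1%:R^-1) => a b; lra.
apply/cvg_ex; exists l; apply/cvgrPdist_lt => e e0.
have eR : e = (complex.Re e)%:C%C by rewrite RRe_real // gtr0_real.
rewrite eR ltcR in e0; have e2 : 0 < complex.Re e / 2 by rewrite divr_gt0.
have [N1 h1] := small _ e2; have [N2 h2] := hl _ e2.
apply: filterS (hx (maxn N1 N2)) => y hy; rewrite eR lt_nm.
apply: le_lt_trans (nm_dist _ (x (maxn N1 N2)) _) _.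
have := h1 _ (leq_maxl N1 N2); have := h2 _ (leq_maxr N1 N2); move: hy => /=.
by move: (_.+1%:R^-1) (nm _) (nm _) => a b c; lra.
Qed.

Record hilbert (K : realType) := Hilbert {
  hV :> lmodType (Cplx K) ;
  hip : hV -> hV -> Cplx K ;
  hipr : forall u c v w, hip u (c *: v + w) = c * hip u v + hip u w ;
  hipC : forall u v, hip v u = (hip u v)^* ;
  hip_ge0 : forall u, 0 <= hip u u ;
  hip_eq0 : forall u, hip u u = 0 -> u = 0 ;
  hip_complete : forall u : nat -> hV,
    (forall e : K, 0 < e -> exists N, forall n m, (N <= n)%N -> (N <= m)%N ->
       complex.Re (hip (u n - u m) (u n - u m)) < e) ->
    exists l, forall e : K, 0 < e -> exists N, forall n, (N <= n)%N ->
       complex.Re (hip (l - u n) (l - u n)) < e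
}.

Section HilbertNorm.
Variables (K : realType) (V : hilbert K).
Local Notation C := (Cplx K).
Implicit Types (u v w : V) (c : C).

Lemma hipDr u v w : hip u (v + w) = hip u v + hip u w.
Proof. by rewrite -{1}[v]scale1r hipr mul1r. Qed.
Lemma hip0r u : hip u 0 = 0.
Proof. by apply: (addrI (hip u 0)); rewrite -hipDr !addr0. Qed.
Lemma hipZr c u v : hip u (c *: v) = c * hip u v.
Proof. by rewrite -[c *: v]addr0 hipr hip0r addr0. Qed.
Lemma hipNr u v : hip u (- v) = - hip u v.
Proof. by rewrite -scaleN1r hipZr mulN1r. Qed.
Lemma hipBr u v w : hip u (v - w) = hip u v - hip u w.
Proof. by rewrite hipDr hipNr. Qed.
Lemma hipDl u v w : hip (v + w) u = hip v u + hip w u.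
Proof. by rewrite hipC hipDr rmorphD /= -!hipC. Qed.
Lemma hipNl u v : hip (- v) u = - hip v u.
Proof. by rewrite hipC hipNr rmorphN /= -!hipC. Qed.
Lemma hipBl u v w : hip (v - w) u = hip v u - hip w u.
Proof. by rewrite hipDl hipNl. Qed.
Lemma hip0l u : hip 0 u = 0.
Proof. by rewrite hipC hip0r rmorph0. Qed.
Lemma hipZl c u v : hip (c *: v) u = c^* * hip v u.
Proof. by rewrite hipC hipZr rmorphM /= -hipC. Qed.

Definition hn v : K := Num.sqrt (complex.Re (hip v v)).

Lemma hn_ge0 v : 0 <= hn v. Proof. exact: sqrtr_ge0. Qed.

Lemma hipE v : hip v v = (hn v ^+ 2)%:C%C.
Proof.
have r : hip v v \is Num.real by apply/ger0_real/hip_ge0.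
by rewrite sqr_sqrtr ?RRe_real // -lecR RRe_real // hip_ge0.
Qed.

Lemma hn_eq0 v : hn v = 0 -> v = 0.
Proof. by move=> h; apply: hip_eq0; rewrite hipE h expr0n. Qed.

Lemma cauchy_schwarz u v : nm (hip u v) <= hn u * hn v.
Proof.
have [v0|v0] := eqVneq (hn v) 0; first by rewrite (hn_eq0 v0) hip0r nm0 mulr_ge0 ?hn_ge0.
have n0 : 0 < hn v ^+ 2 by rewrite exprn_gt0 // lt_def v0 hn_ge0.
set n := hn v ^+ 2 in n0; pose a := hip v u; pose w := n%:C%C *: u - a *: v.
have wv : hip w v = 0 by rewrite hipC hipBr !hipZr hipE -/a -/n [a * _]mulrC subrr rmorph0.
have wu : hip w u = (n * hn u ^+ 2 - nm a ^+ 2)%:C%C.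
  rewrite hipBl !hipZl hipE -/a conj_real -!rmorphM /= conjM_nm.
  by rewrite -rmorphB.
have ww : hip w w = (n * (n * hn u ^+ 2 - nm a ^+ 2))%:C%C.
  by rewrite {2}/w hipBr !hipZr wv mulr0 subr0 wu -rmorphM.
have : 0 <= n * (n * hn u ^+ 2 - nm a ^+ 2) by rewrite -lecR -ww hip_ge0.
rewrite pmulr_rge0 // subr_ge0 => h.
have -> : hip u v = a^* by rewrite -hipC.
rewrite nm_conj -(@ler_pXn2r _ 2) ?nnegrE ?mulr_ge0 ?nm_ge0 ?hn_ge0 //.
by rewrite exprMn [_ * hn v ^+ 2]mulrC.
Qed.

Lemma hn_le v (c : K) : 0 <= c -> nm (hip v v) <= c * hn v -> hn v <= c.
Proof.
move=> c0; rewrite hipE nm_real ger0_norm ?exprn_ge0 ?hn_ge0 // expr2 => h.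
have [->//|v0] := eqVneq (hn v) 0.
by rewrite -(@ler_pM2r _ (hn v)) // lt_def v0 hn_ge0.
Qed.

Lemma hnD u v : hn (u + v) <= hn u + hn v.
Proof.
apply: hn_le; first by rewrite addr_ge0 ?hn_ge0.
rewrite hipDl mulrDl; apply: le_trans (nmD _ _) _.
by apply: lerD; exact: cauchy_schwarz.
Qed.

Lemma hnZ c v : hn (c *: v) = nm c * hn v.
Proof.
apply/eqP; rewrite -(@eqrXn2 _ 2) ?mulr_ge0 ?nm_ge0 ?hn_ge0 //; apply/eqP.
apply: (@complexI K); rewrite -hipE hipZl hipZr mulrA conjM_nm hipE exprMn.
by rewrite -rmorphM.
Qed.

Lemma hnN v : hn (- v) = hn v.
Proof. by rewrite -scaleN1r hnZ nmN nm1 mul1r. Qed.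

Lemma hn0 : hn 0 = 0.
Proof. by rewrite -(scale0r 0) hnZ nm0 mul0r. Qed.

Lemma hip_inj u v : (forall w, hip u w = hip v w) -> u = v.
Proof.
move=> h; apply/eqP; rewrite -subr_eq0; apply/eqP; apply: hip_eq0.
by rewrite hipBl h subrr.
Qed.

Lemma hn_complete (x : nat -> V) :
  (forall e : K, 0 < e -> exists N, forall n m, (N <= n)%N -> (N <= m)%N -> hn (x n - x m) < e) ->
  exists l, forall e : K, 0 < e -> exists N, forall n, (N <= n)%N -> hn (l - x n) < e.
Proof.
move=> h.
have ReE v : complex.Re (hip v v) = hn v ^+ 2 by rewrite hipE.
have [|l hl] := @hip_complete _ V x.
  move=> e e0; have s0 : 0 < Num.sqrt e by rewrite sqrtr_gt0.
  have [N hN] := h _ s0; exists N => n m nN mN; rewrite ReE -[e]sqr_sqrtr ?(ltW e0) //.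
  by rewrite ltrXn2r ?nnegrE ?hn_ge0 ?hN // ltW.
exists l => e e0; have [N hN] := hl (e ^+ 2) (exprn_gt0 _ e0); exists N => n nN.
by have := hN _ nN; rewrite ReE ltr_pXn2r ?nnegrE ?hn_ge0 ?(ltW e0).
Qed.

End HilbertNorm.

Section BoundedOperators.
Variables (K : realType) (V : hilbert K).
Local Notation C := (Cplx K).
Implicit Types (u v w : V) (c : C) (f : V -> V).

(** The adjoint is part of the definition: it yields linearity ([bop_lin]), and [bstar] is obtained
    by choosing it. *)
Definition bop_axiom f :=
  (exists f', forall u v, hip (f u) v = hip u (f' v)) /\
  (exists2 c : K, 0 <= c & forall v, hn (f v) <= c * hn v).

Record bop := Bop { bopf :> V -> V ; bopP : bop_axiom bopf }.

Implicit Types (S T : bop).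

Lemma bop_eq S T : (forall v, S v = T v) -> S = T.
Proof.
move=> h; case: S T h => [f hf] [g hg] /= /funext h.
by subst g; congr Bop; exact: Prop_irrelevance.
Qed.

Lemma bop_lin T c u v : T (c *: u + v) = c *: T u + T v.
Proof.
have [[f' h] _] := bopP T; apply: hip_inj => w.
by rewrite hipDl hipZl !h hipDl hipZl.
Qed.
Lemma bopD T u v : T (u + v) = T u + T v.
Proof. by rewrite -{1}[u]scale1r bop_lin scale1r. Qed.
Lemma bop0 T : T 0 = 0.
Proof. by apply: (addrI (T 0)); rewrite -bopD !addr0. Qed.
Lemma bopZ T c u : T (c *: u) = c *: T u.
Proof. by rewrite -[c *: u]addr0 bop_lin bop0 addr0. Qed.

Lemma adj_bounded f f' : bop_axiom f -> (forall u v, hip (f u) v = hip u (f' v)) -> bop_axiom f'.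
Proof.
move=> [_ [c c0 hc]] h; split.
  by exists f => u v; rewrite hipC -h -hipC.
exists c => // v; apply: hn_le; first by rewrite mulr_ge0 ?hn_ge0.
rewrite -h; apply: le_trans (cauchy_schwarz _ _) _.
by rewrite mulrAC ler_wpM2r ?hn_ge0.
Qed.

Definition bstar T : bop :=
  Bop (adj_bounded (bopP T) (projT2 (cid (bopP T).1))).

Lemma bstarE T u v : hip (T u) v = hip u (bstar T v).
Proof. exact: (projT2 (cid (bopP T).1)). Qed.

Lemma bstarE' T u v : hip (bstar T u) v = hip u (T v).
Proof. by rewrite hipC -bstarE -hipC. Qed.

Lemma bstar_uniq T f : (forall u v, hip (T u) v = hip u (f v)) -> forall v, bstar T v = f v.
Proof. by move=> h v; apply: hip_inj => w; rewrite hipC -bstarE h -hipC. Qed.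

Fact bop0_ax : bop_axiom (fun=> 0).
Proof.
split; first by exists (fun=> 0) => u v; rewrite hip0l hip0r.
by exists 0 => // v; rewrite hn0 mul0r.
Qed.

Fact bopN_ax T : bop_axiom (fun v => - T v).
Proof.
split; first by exists (fun v => - bstar T v) => u v; rewrite hipNl hipNr bstarE.
by have [_ [c c0 h]] := bopP T; exists c => // v; rewrite hnN.
Qed.

Fact bopD_ax S T : bop_axiom (fun v => S v + T v).
Proof.
split; first by exists (fun v => bstar S v + bstar T v) => u v; rewrite hipDl hipDr !bstarE.
have [_ [c c0 h]] := bopP S; have [_ [d d0 h']] := bopP T.
exists (c + d) => [|v]; first by rewrite addr_ge0.
by apply: le_trans (hnD _ _) _; rewrite mulrDl lerD.
Qed.

Fact bopZ_ax c T : bop_axiom (fun v => c *: T v).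
Proof.
split; first by exists (fun v => c^* *: bstar T v) => u v; rewrite hipZl hipZr bstarE.
have [_ [d d0 h]] := bopP T; exists (nm c * d) => [|v]; first by rewrite mulr_ge0 ?nm_ge0.
by rewrite hnZ -mulrA ler_wpM2l ?nm_ge0.
Qed.

Fact bopM_ax S T : bop_axiom (fun v => S (T v)).
Proof.
split; first by exists (fun v => bstar T (bstar S v)) => u v; rewrite !bstarE.
have [_ [c c0 h]] := bopP S; have [_ [d d0 h']] := bopP T.
exists (c * d) => [|v]; first by rewrite mulr_ge0.
by apply: le_trans (h _) _; rewrite -mulrA ler_wpM2l.
Qed.

Definition b0 := Bop bop0_ax.
Definition bN T := Bop (bopN_ax T).
Definition bD S T := Bop (bopD_ax S T).
Definition bZ c T := Bop (bopZ_ax c T).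
Definition bM S T := Bop (bopM_ax S T).

HB.instance Definition _ := gen_eqMixin bop.
HB.instance Definition _ := gen_choiceMixin bop.

Fact bDA : associative bD.
Proof. by move=> f g h; apply: bop_eq => x /=; exact: addrA. Qed.
Fact bDC : commutative bD.
Proof. by move=> f g; apply: bop_eq => x /=; exact: addrC. Qed.
Fact b0D : left_id b0 bD.
Proof. by move=> f; apply: bop_eq => x /=; exact: add0r. Qed.
Fact bND : left_inverse b0 bN bD.
Proof. by move=> f; apply: bop_eq => x /=; exact: addNr. Qed.

HB.instance Definition _ := GRing.isZmodule.Build bop bDA bDC b0D bND.

Fact bZA a b T : bZ a (bZ b T) = bZ (a * b) T.
Proof. by apply: bop_eq => x /=; exact: scalerA. Qed.
Fact b1Z : left_id 1 bZ.
Proof. by move=> f; apply: bop_eq => x /=; exact: scale1r. Qed.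
Fact bZDr : right_distributive bZ +%R.
Proof. by move=> a f g; apply: bop_eq => x /=; exact: scalerDr. Qed.
Fact bZDl T : {morph bZ^~ T : a b / a + b}.
Proof. by move=> a b; apply: bop_eq => x /=; exact: scalerDl. Qed.

HB.instance Definition _ := GRing.Zmodule_isLmodule.Build C bop bZA b1Z bZDr bZDl.

Lemma bDE S T v : (S + T) v = S v + T v. Proof. by []. Qed.
Lemma bBE S T v : (S - T) v = S v - T v. Proof. by []. Qed.
Lemma bZE c T v : (c *: T) v = c *: T v. Proof. by []. Qed.
Lemma b0E v : (0 : bop) v = 0. Proof. by []. Qed.

Definition bn T : K := inf [set c : K | 0 <= c /\ forall v, hn (T v) <= c * hn v].

Let bn_has_inf T : has_inf [set c : K | 0 <= c /\ forall v, hn (T v) <= c * hn v].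
Proof.
split; first by have [_ [c c0 h]] := bopP T; exists c.
by exists 0 => c [].
Qed.

Lemma bn_ge0 T : 0 <= bn T.
Proof. by apply: lb_le_inf => [|c []//]; case: (bn_has_inf T). Qed.

Lemma bn_le T (c : K) : 0 <= c -> (forall v, hn (T v) <= c * hn v) -> bn T <= c.
Proof. by move=> c0 h; apply: ge_inf => //; case: (bn_has_inf T). Qed.

Lemma bnP T v : hn (T v) <= bn T * hn v.
Proof.
have [v0|v0] := eqVneq (hn v) 0.
  by rewrite (hn_eq0 v0) bop0 hn0 mulr0.
have vp : 0 < hn v by rewrite lt_def v0 hn_ge0.
rewrite -ler_pdivrMr //; apply: lb_le_inf; first by case: (bn_has_inf T).
by move=> c [_ h]; rewrite ler_pdivrMr.
Qed.

Lemma bnD S T : bn (S + T) <= bn S + bn T.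
Proof.
apply: bn_le => [|v]; first by rewrite addr_ge0 ?bn_ge0.
by apply: le_trans (hnD _ _) _; rewrite mulrDl lerD ?bnP.
Qed.

Lemma bnM S T : bn (bM S T) <= bn S * bn T.
Proof.
apply: bn_le => [|v]; first by rewrite mulr_ge0 ?bn_ge0.
by apply: le_trans (bnP S (T v)) _; rewrite -mulrA ler_wpM2l ?bnP ?bn_ge0.
Qed.

Lemma bnZ_le c T : bn (c *: T) <= nm c * bn T.
Proof.
apply: bn_le => [|v]; first by rewrite mulr_ge0 ?nm_ge0 ?bn_ge0.
by rewrite bZE hnZ -mulrA ler_wpM2l ?nm_ge0 ?bnP.
Qed.

Lemma bnZ c T : bn (c *: T) = nm c * bn T.
Proof.
apply/eqP; rewrite eq_le bnZ_le /=; have [->|c0] := eqVneq c 0.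
  by rewrite nm0 mul0r bn_ge0.
rewrite mulrC -ler_pdivlMr ?nm_gt0 // mulrC -nmV; apply: le_trans (bnZ_le _ _).
by rewrite scalerA mulVf // scale1r.
Qed.

Lemma bn_eq0 T : bn T = 0 -> T = 0.
Proof.
move=> h; apply: bop_eq => v; apply: hn_eq0; apply/eqP.
by rewrite eq_le hn_ge0 andbT; have := bnP T v; rewrite h mul0r.
Qed.

Lemma bn_star2 T : bn T ^+ 2 <= bn (bM (bstar T) T).
Proof.
have h : bn T <= Num.sqrt (bn (bM (bstar T) T)).
  apply: bn_le => [|v]; first exact: sqrtr_ge0.
  rewrite -(@ler_pXn2r _ 2) ?nnegrE ?mulr_ge0 ?sqrtr_ge0 ?hn_ge0 //.
  rewrite exprMn [Num.sqrt (bn _) ^+ 2]sqr_sqrtr ?bn_ge0 //.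
  have := cauchy_schwarz (bM (bstar T) T v) v; rewrite bstarE' hipE nm_real.
  rewrite ger0_norm ?exprn_ge0 ?hn_ge0 // => /le_trans; apply.
  by rewrite expr2 mulrA ler_wpM2r ?hn_ge0 ?bnP.
by rewrite -[leRHS]sqr_sqrtr ?bn_ge0 // lerXn2r ?nnegrE ?bn_ge0 ?sqrtr_ge0.
Qed.

Lemma bn_bstar_le T : bn (bstar T) <= bn T.
Proof.
apply: bn_le => [|v]; first exact: bn_ge0.
apply: hn_le; first by rewrite mulr_ge0 ?bn_ge0 ?hn_ge0.
rewrite bstarE'; apply: le_trans (cauchy_schwarz _ _) _.
apply: le_trans (ler_wpM2l (hn_ge0 v) (bnP T _)) _.
by rewrite mulrA [hn v * _]mulrC.
Qed.

Lemma bn_cstar T : bn (bM (bstar T) T) = bn T ^+ 2.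
Proof.
apply/eqP; rewrite eq_le bn_star2 andbT; apply: le_trans (bnM _ _) _.
by rewrite expr2 ler_wpM2r ?bn_ge0 ?bn_bstar_le.
Qed.

Definition bnorm T : C := (bn T)%:C%C.

Fact bnormD S T : bnorm (S + T) <= bnorm S + bnorm T.
Proof. by rewrite /bnorm -rmorphD lecR bnD. Qed.
Fact bnormZ c T : bnorm (c *: T) = `|c| * bnorm T.
Proof. by rewrite /bnorm bnZ nmE rmorphM. Qed.
Fact bnorm_eq0 T : bnorm T = 0 -> T = 0.
Proof. by move=> /(@complexI K)/bn_eq0. Qed.

HB.instance Definition _ := Lmodule_isNormed.Build C bop bnormD bnormZ bnorm_eq0.

Lemma nm_bn T : nm T = bn T.
Proof. by []. Qed.

(** Pointwise limits exist both for [T n] and for the adjoints, and the second limit is an adjoint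
    of the first. *)
Lemma bop_complete (T : nat -> bop) :
  (forall e : K, 0 < e -> exists N, forall n m, (N <= n)%N -> (N <= m)%N -> nm (T n - T m) < e) ->
  exists L, forall e : K, 0 < e -> exists N, forall n, (N <= n)%N -> nm (L - T n) < e.
Proof.
move=> h.
have lim (S : nat -> bop) : (forall e : K, 0 < e -> exists N, forall n m, (N <= n)%N -> (N <=
    m)%N -> bn (S n - S m) < e) ->
    exists f : V -> V, forall v (e : K), 0 < e -> exists N, forall n, (N <= n)%N -> hn (f v - S n v) < e.
  move=> hS; suff /choice[f hf] v : exists l, forall e : K, 0 < e -> exists N, forall n, (N <=
      n)%N -> hn (l - S n v) < e.
    by exists f.
  apply: hn_complete => e e0; have v1 : 0 < hn v + 1 by have := hn_ge0 v; lra.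
  have [N hN] := hS (e / (hn v + 1)) ltac:(by rewrite divr_gt0).
  exists N => n m nN mN; rewrite -bBE; apply: le_lt_trans (bnP _ _) _.
  have := hN _ _ nN mN; rewrite ltr_pdivlMr //; apply: le_lt_trans.
  by rewrite ler_wpM2l ?bn_ge0 //; lra.
have [f hf] := lim _ h.
have bstarB S S' : bstar (S - S') = bstar S - bstar S'.
  by apply: bop_eq; apply: bstar_uniq => u v; rewrite bBE hipBl hipBr !bstarE.
have [|f' hf'] := lim (fun n => bstar (T n)).
  move=> e e0; have [N hN] := h e e0; exists N => n m nN mN.
  by rewrite -bstarB; apply: le_lt_trans (bn_bstar_le _) _; exact: hN.
have close (e : K) N : (forall n m, (N <= n)%N -> (N <= m)%N -> nm (T n - T m) < e) ->
    forall n v, (N <= n)%N -> hn (f v - T n v) <= e * hn v.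
  move=> hN n v nN; apply/ler_addgt0Pr => r r0; have [M hM] := hf v r r0.
  have -> : f v - T n v = (f v - T (maxn N M) v) + (T (maxn N M) - T n) v.
    by rewrite bBE addrA subrK.
  apply: le_trans (hnD _ _) _; rewrite addrC; apply: lerD; last exact/ltW/hM/leq_maxr.
  apply: le_trans (bnP _ _) _; rewrite ler_wpM2r ?hn_ge0 //; apply/ltW/hN => //.
  exact: leq_maxl.
have fax : bop_axiom f.
  split.
    exists f' => u v; apply: nm_eq => e e0.
    have p : 0 < hn u + hn v + 1 by have := hn_ge0 u; have := hn_ge0 v; lra.
    have e1 : 0 < e / (hn u + hn v + 1) by rewrite divr_gt0.
    have ea : e / (hn u + hn v + 1) * (hn u + hn v + 1) = e by rewrite divfK // gt_eqF.
    move: (e / _) e1 ea => a e1 ea.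
    have [N1 h1] := hf u _ e1; have [N2 h2] := hf' v _ e1.
    have {}h1 := h1 _ (leq_maxl N1 N2); have {}h2 := h2 _ (leq_maxr N1 N2).
    set n := maxn N1 N2 in h1 h2.
    have -> : hip (f u) v - hip u (f' v) = hip (f u - T n u) v - hip u (f' v - bstar (T n) v).
      by rewrite hipBl hipBr bstarE; ring.
    apply: le_trans (nmB _ _) _; apply: le_trans (lerD (cauchy_schwarz _ _) (cauchy_schwarz _ _)) _.
    rewrite -ea; have := ler_wpM2r (hn_ge0 v) (ltW h1); have := ler_wpM2l (hn_ge0 u) (ltW h2).
    by move: e1; lra.
  have [N hN] := h 1 ltr01; exists (1 + bn (T N)) => [|v]; first by rewrite addr_ge0 ?bn_ge0.
  rewrite -[f v](subrK (T N v)) mulrDl; apply: le_trans (hnD _ _) _.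
  by apply: lerD; [exact: (close _ _ hN _ _ (leqnn N))|exact: bnP].
exists (Bop fax) => e e0; have [N hN] := h (e / 2) ltac:(by rewrite divr_gt0).
exists N => n nN; apply: (@le_lt_trans _ _ (e / 2)); last by lra.
by apply: bn_le => [|v]; [lra|exact: (close _ _ hN)].
Qed.

HB.instance Definition _ := Uniform_isComplete.Build bop (seq_complete bop_complete).

Fact bMA : associative bM. Proof. by move=> f g h; apply: bop_eq. Qed.
Fact bMDl S T U : bM (S + T) U = bM S U + bM T U. Proof. exact: bop_eq. Qed.
Fact bMDr S T U : bM S (T + U) = bM S T + bM S U.
Proof. by apply: bop_eq => v /=; exact: bopD. Qed.
Fact bMZl c S T : bM (c *: S) T = c *: bM S T. Proof. exact: bop_eq. Qed.
Fact bMZr c S T : bM S (c *: T) = c *: bM S T.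
Proof. by apply: bop_eq => v /=; exact: bopZ. Qed.
Fact bstarK : involutive bstar.
Proof. by move=> T; apply: bop_eq; apply: bstar_uniq => u v; exact: bstarE'. Qed.
Fact bstarD S T : bstar (S + T) = bstar S + bstar T.
Proof. by apply: bop_eq; apply: bstar_uniq => u v; rewrite bDE hipDl hipDr !bstarE. Qed.
Fact bstarZ c T : bstar (c *: T) = c^* *: bstar T.
Proof. by apply: bop_eq; apply: bstar_uniq => u v; rewrite bZE hipZl hipZr !bstarE. Qed.
Fact bstarM S T : bstar (bM S T) = bM (bstar T) (bstar S).
Proof. by apply: bop_eq; apply: bstar_uniq => u v; rewrite /= !bstarE. Qed.
Fact bnormM S T : `|bM S T| <= `|S| * `|T|.
Proof. by rewrite !nmE -rmorphM lecR bnM. Qed.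
Fact bnorm_star T : `|bM (bstar T) T| = `|T| ^+ 2.
Proof. by rewrite !nmE -rmorphXn nm_bn bn_cstar. Qed.

HB.instance Definition _ := isCStarAlgebra.Build C bop bMA bMDl bMDr bMZl bMZr
  bstarK bstarD bstarZ bstarM bnormM bnorm_star.

End BoundedOperators.

(** * The Hilbert space of square-summable functions *)

Section SquareSummable.
Variables (K : realType) (T : choiceType).
Local Notation C := (Cplx K).
Implicit Types (f g h : T -> C) (F G : {fset T}).

Lemma fset_split (M : nmodType) (a : T -> M) F G : (F `<=` G)%fset ->
  \sum_(x <- G) a x = \sum_(x <- F) a x + \sum_(x <- (G `\` F)%fset) a x.
Proof.
move=> FG; have pe : perm_eq G (F ++ (G `\` F)%fset).
  apply: uniq_perm; first exact: fset_uniq.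
    rewrite cat_uniq !fset_uniq andbT /=; apply/hasPn => x.
    by rewrite !inE => /andP[].
  move=> x; rewrite mem_cat in_fsetD; case: (boolP (x \in F)) => //= xF.
  by rewrite (fsubsetP FG).
by rewrite (perm_big _ pe) big_cat.
Qed.

Lemma fset_sum_le (a : T -> K) F G : (forall x, 0 <= a x) -> (F `<=` G)%fset ->
  \sum_(x <- F) a x <= \sum_(x <- G) a x.
Proof. by move=> a0 FG; rewrite (fset_split _ FG) lerDl sumr_ge0. Qed.

Definition nsq f x : K := nm (f x) ^+ 2.

Lemma nsq_ge0 f x : 0 <= nsq f x. Proof. exact: sqr_ge0. Qed.

Definition l2 f := exists M : K, forall F, \sum_(x <- F) nsq f x <= M.

Definition l2s f : K := sup (range (fun F => \sum_(x <- F) nsq f x)).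

Lemma l2s_ub f F : l2 f -> \sum_(x <- F) nsq f x <= l2s f.
Proof.
move=> [M hM]; apply: sup_ubound; last by exists F.
by exists M => _ [G _ <-].
Qed.

Lemma l2s_le f (M : K) : (forall F, \sum_(x <- F) nsq f x <= M) -> l2s f <= M.
Proof.
move=> h; apply: ge_sup => [|_ [F _ <-]//].
by exists (\sum_(x <- fset0) nsq f x); exists fset0.
Qed.

Lemma l2s_approx f (e : K) : l2 f -> 0 < e -> exists F, l2s f - e < \sum_(x <- F) nsq f x.
Proof.
move=> [M hM] e0; have [|_ [F _ <-] h] := @sup_adherent _ (range (fun F => \sum_(x <- F) nsq f x)) e e0.
  split; first by exists (\sum_(x <- fset0) nsq f x); exists fset0.
  by exists M => _ [G _ <-].
by exists F.
Qed.

Lemma fset_ultra : exists U : set_system {fset T},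
  UltraFilter U /\ forall F0, U [set F | (F0 `<=` F)%fset].
Proof.
pose B : set_system {fset T} := [set A | exists F0 : {fset T}, forall F : {fset T}, (F0 `<=` F)%fset -> A F].
have FB : Filter B.
  split; first by exists fset0.
    move=> A A' [F hF] [F' hF']; exists (F `|` F')%fset => G h.
    by split; [apply: hF|apply: hF']; apply: fsubset_trans h; rewrite ?fsubsetUl ?fsubsetUr.
  by move=> A A' AA' [F hF]; exists F => G /hF; exact: AA'.
have PB : ProperFilter B.
  by apply: Build_ProperFilter_ex => // A [F hF]; exists F; apply: hF; exact: fsubset_refl.
have [U [FU BU]] := ultraFilterLemma PB.
by exists U; split => // F0; apply: BU; exists F0.
Qed.

Definition fU := projT1 (cid fset_ultra).

Lemma fU_ultra : UltraFilter fU. Proof. by rewrite /fU; case: cid => U []. Qed.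

Lemma fU_sup F0 : fU [set F | (F0 `<=` F)%fset].
Proof. exact: (projT2 (cid fset_ultra)).2 F0. Qed.

Definition psum f g F : C := \sum_(x <- F) (f x)^* * g x.

(** A limit along a cofinal ultrafilter of finite sets. By [psum_net] its value on square-summable
    functions does not depend on the ultrafilter. *)
Definition ip2 f g : C := xget 0 [set l | psum f g @ fU --> l].

Lemma nm_psum f g F :
  nm (psum f g F) <= \sum_(x <- F) nsq f x + \sum_(x <- F) nsq g x.
Proof.
apply: le_trans (nm_sum _ _ _) _; rewrite -big_split /=; apply: ler_sum => x _.
rewrite nmM nm_conj /nsq; have := nm_ge0 (f x); have := nm_ge0 (g x).
by move: (nm _) (nm _) => a b a0 b0; have := sqr_ge0 (a - b); nra.
Qed.

Lemma psum_cvg f g : l2 f -> l2 g -> psum f g @ fU --> ip2 f g.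
Proof.
move=> [M hM] [N hN]; have FU := fU_ultra.
have [|l hl] := @culim _ _ fU FU (psum f g) (M + N).
  by apply: nearW => F; apply: le_trans (nm_psum _ _ _) (lerD (hM _) (hN _)).
exact: (@xgetPex _ 0 [set l | psum f g @ fU --> l] (ex_intro _ l hl)).
Qed.

Lemma fU_uniq (u : {fset T} -> C) (a b : C) : u @ fU --> a -> u @ fU --> b -> a = b.
Proof. by have FU := fU_ultra; apply: cvg_unique. Qed.

Lemma ip2_eq f g (l : C) : psum f g @ fU --> l -> ip2 f g = l.
Proof.
move=> h; apply: (fU_uniq _ h).
exact: (@xgetPex _ 0 [set l | psum f g @ fU --> l] (ex_intro _ l h)).
Qed.

Lemma ip2_self f : l2 f -> ip2 f f = (l2s f)%:C%C.
Proof.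
move=> lf; apply: ip2_eq; have FU := fU_ultra; apply/(cvg_nm FU) => e e0.
have [F0 hF0] := l2s_approx lf e0; apply: filterS (fU_sup F0) => F /= F0F.
have -> : psum f f F = (\sum_(x <- F) nsq f x)%:C%C.
  by rewrite rmorph_sum; apply: eq_bigr => x _; rewrite conjM_nm.
rewrite -rmorphB nm_real ltr_norml.
have := l2s_ub F lf; have := fset_sum_le (nsq_ge0 f) F0F.
by move: hF0; lra.
Qed.

Lemma l2_lin c f g : l2 f -> l2 g -> l2 (fun x => c * f x + g x).
Proof.
move=> [M hM] [N hN]; exists (2 * nm c ^+ 2 * M + 2 * N) => F.
apply: (@le_trans _ _ (\sum_(x <- F) (2 * nm c ^+ 2 * nsq f x + 2 * nsq g x))).
  apply: ler_sum => x _; rewrite /nsq -mulrA -exprMn -nmM.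
  have := nmD (c * f x) (g x); have := nm_ge0 (c * f x + g x).
  move: (nm _) (nm _) (nm _) => a b s s0 sab; have := sqr_ge0 (b - a).
  have : s ^+ 2 <= (b + a) ^+ 2 by rewrite lerXn2r ?nnegrE //; lra.
  by nra.
rewrite big_split -!mulr_sumr; apply: lerD; apply: ler_wpM2l => //.
by rewrite mulr_ge0 ?sqr_ge0.
Qed.

Lemma l2_0 : l2 (fun=> 0).
Proof. by exists 0 => F; rewrite big1 // => x _; rewrite /nsq nm0 expr0n. Qed.

(* The finite partial sums of an inner product form a convergent net, so they
   can be evaluated along any cofinal family of finite sets. *)
Lemma psum_net f g (e : K) : l2 f -> l2 g -> 0 < e ->
  exists F0, forall F, (F0 `<=` F)%fset -> nm (psum f g F - ip2 f g) < e.
Proof.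
move=> lf lg e0; have e8 : 0 < e / 8 by rewrite divr_gt0.
have [F1 h1] := l2s_approx lf e8; have [F2 h2] := l2s_approx lg e8.
pose F0 := (F1 `|` F2)%fset.
have tail F G : (F0 `<=` F)%fset -> (F `<=` G)%fset -> nm (psum f g G - psum f g F) < e / 4.
  move=> h0 FG; rewrite /psum (fset_split _ FG) addrAC subrr add0r.
  apply: le_lt_trans (nm_psum f g _) _.
  have := fset_split (nsq f) FG; have := fset_split (nsq g) FG.
  have := l2s_ub G lf; have := l2s_ub G lg.
  have := fset_sum_le (nsq_ge0 f) (fsubset_trans (fsubsetUl F1 F2) h0).
  have := fset_sum_le (nsq_ge0 g) (fsubset_trans (fsubsetUr F1 F2) h0).
  by lra.
have FU := fU_ultra; have /(cvg_nm FU)/(_ (e / 4) ltac:(by rewrite divr_gt0)) near := psum_cvg lf lg.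
have [F3 [h3 h3']] : exists F3, (F0 `<=` F3)%fset /\ nm (psum f g F3 - ip2 f g) < e / 4.
  have /filter_ex[F3 [k1 k2]] : fU ([set F | (F0 `<=` F)%fset] `&` [set F | nm (psum f g F - ip2 f
      g) < e / 4]).
    exact: filterI (fU_sup F0) near.
  by exists F3.
exists F0 => F hF; have t1 := tail _ (F `|` F3)%fset hF (fsubsetUl _ _).
have t2 := tail _ (F `|` F3)%fset h3 (fsubsetUr _ _).
have := nm_dist (psum f g F) (psum f g (F `|` F3)%fset) (ip2 f g).
have := nm_dist (psum f g (F `|` F3)%fset) (psum f g F3) (ip2 f g).
by rewrite (nmBC (psum f g F) (psum f g (F `|` F3)%fset)); lra.
Qed.

Record l2v := L2v { l2f :> T -> C ; l2P : l2 l2f }.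
Implicit Types u v w : l2v.

Lemma l2v_eq u v : (forall x, u x = v x) -> u = v.
Proof.
move=> h; case: u v h => [f hf] [g hg] /= /funext h.
by subst g; congr L2v; exact: Prop_irrelevance.
Qed.

Fact l2N_ax u : l2 (fun x => - u x).
Proof. by case: u => f [M hM]; exists M => F /=; under eq_bigr do rewrite /nsq nmN. Qed.
Fact l2D_ax u v : l2 (fun x => u x + v x).
Proof.
have [M hM] := l2_lin 1 (l2P u) (l2P v); exists M => F.
by have := hM F; under eq_bigr do rewrite /nsq mul1r.
Qed.
Fact l2Z_ax (c : C) u : l2 (fun x => c * u x).
Proof.
have [M hM] := l2_lin c (l2P u) l2_0; exists M => F.
by have := hM F; under eq_bigr do rewrite /nsq addr0.
Qed.

HB.instance Definition _ := gen_eqMixin l2v.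
HB.instance Definition _ := gen_choiceMixin l2v.

Let z0 := L2v l2_0.
Let zN u := L2v (l2N_ax u).
Let zD u v := L2v (l2D_ax u v).
Let zZ c u := L2v (l2Z_ax c u).

Fact zDA : associative zD.
Proof. by move=> f g h; apply: l2v_eq => x /=; exact: addrA. Qed.
Fact zDC : commutative zD.
Proof. by move=> f g; apply: l2v_eq => x /=; exact: addrC. Qed.
Fact z0D : left_id z0 zD.
Proof. by move=> f; apply: l2v_eq => x /=; exact: add0r. Qed.
Fact zND : left_inverse z0 zN zD.
Proof. by move=> f; apply: l2v_eq => x /=; exact: addNr. Qed.

HB.instance Definition _ := GRing.isZmodule.Build l2v zDA zDC z0D zND.

Fact zZA a b u : zZ a (zZ b u) = zZ (a * b) u.
Proof. by apply: l2v_eq => x /=; exact: mulrA. Qed.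
Fact z1Z : left_id 1 zZ.
Proof. by move=> f; apply: l2v_eq => x /=; exact: mul1r. Qed.
Fact zZDr : right_distributive zZ +%R.
Proof. by move=> a f g; apply: l2v_eq => x /=; exact: mulrDr. Qed.
Fact zZDl u : {morph zZ^~ u : a b / a + b}.
Proof. by move=> a b; apply: l2v_eq => x /=; exact: mulrDl. Qed.

HB.instance Definition _ := GRing.Zmodule_isLmodule.Build C l2v zZA z1Z zZDr zZDl.

Lemma l2vE c u v x : (c *: u + v) x = c * u x + v x. Proof. by []. Qed.
Lemma l2vB u v x : (u - v) x = u x - v x. Proof. by []. Qed.

Fact ip2_r u c v w : ip2 u (c *: v + w) = c * ip2 u v + ip2 u w.
Proof.
have FU := fU_ultra; apply: ip2_eq.
have -> : psum u (c *: v + w) = (fun F => c * psum u v F + psum u w F).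
  apply/funext => F; rewrite /psum mulr_sumr -big_split; apply: eq_bigr => x _ /=.
  by rewrite mulrDr mulrCA.
apply: cvgD (psum_cvg (l2P u) (l2P w)); apply: cvgM (psum_cvg (l2P u) (l2P v)).
exact: cvg_cst.
Qed.

Fact ip2_C u v : ip2 v u = (ip2 u v)^*.
Proof.
have FU := fU_ultra; apply: ip2_eq; apply/(cvg_nm FU) => e e0.
have /(cvg_nm FU)/(_ e e0) := psum_cvg (l2P u) (l2P v); apply: filterS => F.
have -> : psum v u F = (psum u v F)^*.
  by rewrite rmorph_sum; apply: eq_bigr => x _; rewrite rmorphM /= conjCK mulrC.
by rewrite -rmorphB nm_conj.
Qed.

Lemma l2s_ge0 u : 0 <= l2s u.
Proof. by have := l2s_ub fset0 (l2P u); rewrite big_seq_fset0. Qed.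

Fact ip2_ge0 u : 0 <= ip2 u u.
Proof. by rewrite (ip2_self (l2P u)) lecR l2s_ge0. Qed.

Lemma nsq_le_l2s u x : nsq u x <= l2s u.
Proof. by have := l2s_ub [fset x]%fset (l2P u); rewrite big_seq_fset1. Qed.

Fact ip2_eq0 u : ip2 u u = 0 -> u = 0.
Proof.
rewrite (ip2_self (l2P u)) => /(@complexI K) h; apply: l2v_eq => x /=.
apply/eqP; rewrite -nm_eq0 -sqrf_eq0; apply/eqP/le_anti.
by rewrite sqr_ge0 andbT -h nsq_le_l2s.
Qed.

Lemma Re_ip2 u : complex.Re (ip2 u u) = l2s u.
Proof. by rewrite (ip2_self (l2P u)). Qed.

Fact ip2_complete (u : nat -> l2v) :
  (forall e : K, 0 < e -> exists N, forall n m, (N <= n)%N -> (N <= m)%N ->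
     complex.Re (ip2 (u n - u m) (u n - u m)) < e) ->
  exists l : l2v, forall e : K, 0 < e -> exists N, forall n, (N <= n)%N ->
     complex.Re (ip2 (l - u n) (l - u n)) < e.
Proof.
move=> h; have [U UU hU] := nat_ultra.
have hx n m x (e : K) : l2s (u n - u m) < e -> nsq (u n - u m) x < e.
  by apply: le_lt_trans; exact: nsq_le_l2s.
have /choice[f hf] : forall x, exists l : C, (fun n => u n x : C) @ U --> l.
  move=> x.
  have [N hN] := h 1 ltr01.
  apply: (@culim _ _ U UU _ (nm (u N x) + 1)); apply: filterS (hU N) => n nN.
  have := hN n N nN (leqnn N); rewrite Re_ip2 => /(hx _ _ x); rewrite /nsq l2vB.
  have := nm_ler_dist (u n x) (u N x); have := nm_ge0 (u n x - u N x).
  by move: (nm (_ - _)) => a; nra.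
have main (e : K) N : (forall n m, (N <= n)%N -> (N <= m)%N -> l2s (u n - u m) < e) ->
    forall n F, (N <= n)%N -> \sum_(x <- F) nsq (fun x => f x - u n x) x <= e.
  move=> hN n F nN; have FU : ProperFilter U by apply: ultra_proper.
  have c : (fun m => \sum_(x <- F) nsq (fun x => u m x - u n x) x) @ U -->
      \sum_(x <- F) nsq (fun x => f x - u n x) x.
    elim: (F : seq T) => [|x s ih].
      have -> : (fun m => \sum_(x <- [::]) nsq (fun x => u m x - u n x) x) = (fun=> 0 : K).
        by apply/funext => m; rewrite big_nil.
      rewrite big_nil; exact: cvg_cst.
    have -> : (fun m => \sum_(x <- x :: s) nsq (fun x => u m x - u n x) x) =
       (fun m => nm (u m x - u n x) * nm (u m x - u n x) + \sum_(x <- s) nsq (fun x => u m x - u n x) x).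
      by apply/funext => m; rewrite big_cons /nsq expr2.
    have -> : \sum_(x <- x :: s) nsq (fun x => f x - u n x) x =
        nm (f x - u n x) * nm (f x - u n x) + \sum_(x <- s) nsq (fun x => f x - u n x) x.
      by rewrite big_cons /nsq expr2.
    have c1 : (fun m => nm (u m x - u n x)) @ U --> nm (f x - u n x).
      apply: (cvg_nm_lim UU); apply: cvgB (hf x) _; exact: cvg_cst.
    exact: cvgD (cvgM c1 c1) ih.
  apply/ler_addgt0Pr => r r0; move/cvgrPdist_lt : c => /(_ r r0) c.
  have UI (A B : set nat) : U A -> U B -> exists m, A m /\ B m.
    by move=> hA hB; have /filter_ex[m []] : U (A `&` B) by [exact: filterI]; exists m.
  have [m [k1 k2]] := UI _ _ c (hU N).
  have : \sum_(x <- F) nsq (fun x => u m x - u n x) x < e.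
    by apply: le_lt_trans (hN m n k2 nN); exact: (l2s_ub F (l2P (u m - u n))).
  by move: k1 => /=; rewrite ltr_norml; lra.
have [N0 hN0] := h 1 ltr01.
have hN0' n m : (N0 <= n)%N -> (N0 <= m)%N -> l2s (u n - u m) < 1 by rewrite -Re_ip2; exact: hN0.
have lf : l2 f.
  have d : l2 (fun x => f x - u N0 x) by exists 1 => F; exact: (main 1 N0 hN0' N0 F (leqnn N0)).
  have [M hM] := l2_lin 1 d (l2P (u N0)); exists M => F.
  by have := hM F; under eq_bigr do rewrite /nsq mul1r subrK.
exists (L2v lf) => e e0; have [N hN] := h (e / 2) ltac:(by rewrite divr_gt0).
exists N => n nN; rewrite Re_ip2; apply: (@le_lt_trans _ _ (e / 2)); last lra.
apply: l2s_le => F; apply: (main _ N) => // a b aN bN; rewrite -Re_ip2; exact: hN.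
Qed.

Definition l2space : hilbert K := Hilbert ip2_r ip2_C ip2_ge0 ip2_eq0 ip2_complete.

Lemma hn_l2 (v : l2space) : hn v ^+ 2 = l2s (v : l2v).
Proof. by apply: (@complexI K); rewrite -hipE -(ip2_self (l2P (v : l2v))). Qed.

Lemma hip_l2 (u v : l2space) : hip u v = ip2 (u : l2v) (v : l2v).
Proof. by []. Qed.

End SquareSummable.

Lemma sum_sqr_le (K : realType) (I : Type) (s : seq I) (t : I -> K) :
  (\sum_(i <- s) t i) ^+ 2 <= (size s)%:R * \sum_(i <- s) t i ^+ 2.
Proof.
elim: s => [|i s ih]; first by rewrite !big_nil mulr0 expr0n.
rewrite !big_cons /=; have [/size0nil ->|n0] := eqVneq (size s) 0%N.
  by rewrite !big_nil !addr0 mul1r.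
move: ih; move: (\sum_(_ <- s) _) (\sum_(_ <- s) _) => Q S ih.
have : 0 < (size s)%:R :> K by rewrite ltr0n lt0n.
rewrite -natr1; move: (size s)%:R ih => n ih np.
have : 0 <= n * (n * t i ^+ 2 - 2 * t i * S + Q) by have := sqr_ge0 (n * t i - S); nra.
by rewrite pmulr_rge0 //; nra.
Qed.

(** * Multiplication operators and the weighted composition operator *)

Section ConcreteRepresentation.
Variables (K : realType) (T : topologicalType) (D : dynamics K T).
Local Notation C := (Cplx K).
Local Notation R := (dmap D).
Local Notation fib := (fib D).
Local Notation e := (bri D).
Local Notation H := (l2space K T).
Implicit Types (f g xi eta : T -> C) (F G : {fset T}) (u v : H).

Definition ff y := [fset x in fib y]%fset.

Lemma mem_ff x y : (x \in ff y) = (R x == y).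
Proof. by rewrite !inE mem_fib. Qed.

Lemma sum_ff (M : nmodType) (a : T -> M) y : \sum_(x <- ff y) a x = \sum_(x <- fib y) a x.
Proof.
apply: perm_big; apply: uniq_perm; rewrite ?fset_uniq ?fib_uniq // => x.
by rewrite mem_ff mem_fib.
Qed.

Definition preim G : {fset T} := (\bigcup_(y <- G) ff y)%fset.

Lemma mem_preim x G : (x \in preim G) = (R x \in G).
Proof.
apply/bigfcupP/idP => [[y /andP[yG _]]|RG]; first by rewrite mem_ff => /eqP ->.
by exists (R x); rewrite ?RG ?mem_ff.
Qed.

Lemma sum_preim (M : nmodType) (a : T -> M) G :
  \sum_(x <- preim G) a x = \sum_(y <- G) \sum_(x <- fib y) a x.
Proof.
rewrite /preim partition_disjoint_bigfcup /=; first by apply: eq_bigr => y _; exact: sum_ff.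
move=> y z _ _ yz; apply/fdisjointP => x; rewrite !mem_ff => /eqP ->.
by apply: contraNN yz => /eqP ->.
Qed.

Lemma sub_preim F : (F `<=` preim (R @` F))%fset.
Proof. by apply/fsubsetP => x xF; rewrite mem_preim; apply/imfsetP; exists x. Qed.

(** Preimages of finite sets are cofinal among the finite sets, so an inner product may be summed
    fibre by fibre. *)
Lemma fibre_sum_cvg f g : l2 f -> l2 g ->
  (fun G => \sum_(y <- G) \sum_(x <- fib y) (f x)^* * g x) @ @fU T --> ip2 f g.
Proof.
move=> lf lg; have FU := fU_ultra T; apply/(cvg_nm FU) => r r0.
have [F0 h0] := psum_net lf lg r0.
apply: filterS (fU_sup (R @` F0)%fset) => G hG; rewrite -sum_preim; apply: h0.
apply: fsubset_trans (sub_preim F0) _; apply/fsubsetP => x; rewrite !mem_preim.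
exact: (fsubsetP hG).
Qed.

Lemma fibre_l2s f G : l2 f -> \sum_(y <- G) \sum_(x <- fib y) nsq f x <= l2s f.
Proof. by move=> lf; rewrite -sum_preim; exact: l2s_ub. Qed.

Lemma mk_bop (A A' : (T -> C) -> T -> C) (c c' : K) : 0 <= c ->
  (forall f, l2 f -> forall F, \sum_(x <- F) nsq (A f) x <= c * l2s f) ->
  (forall f, l2 f -> forall F, \sum_(x <- F) nsq (A' f) x <= c' * l2s f) ->
  (forall f g, l2 f -> l2 g -> ip2 (A f) g = ip2 f (A' g)) ->
  exists b : bop H, (forall u x, (b u : l2v K T) x = A (u : l2v K T) x) /\
    (forall u x, (bstar b u : l2v K T) x = A' (u : l2v K T) x).
Proof.
move=> c0 hA hA' adj.
have lA f : l2 f -> l2 (A f) by move=> lf; exists (c * l2s f); exact: hA.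
have lA' f : l2 f -> l2 (A' f) by move=> lf; exists (c' * l2s f); exact: hA'.
pose B (u : H) : H := L2v (lA _ (l2P (u : l2v K T))).
pose B' (u : H) : H := L2v (lA' _ (l2P (u : l2v K T))).
have BB' u v : hip (B u) v = hip u (B' v) by rewrite !hip_l2; apply: adj; exact: l2P.
have ax : bop_axiom B.
  split; first by exists B'.
  exists (Num.sqrt c) => [|v]; first exact: sqrtr_ge0.
  rewrite -(@ler_pXn2r _ 2) ?nnegrE ?mulr_ge0 ?sqrtr_ge0 ?hn_ge0 //.
  rewrite exprMn [Num.sqrt c ^+ 2]sqr_sqrtr // !hn_l2; apply: l2s_le.
  by apply: hA; exact: l2P.
exists (Bop ax); split => // u x.
by rewrite (@bstar_uniq _ _ (Bop ax) B').
Qed.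

(** The adjoint inherits the bound: over a fibre, the square norm [W] of [A' f] is the pairing of
    [A (A' f)] with [f], at most [W / 2] plus [c / 2] times the square norm of [f]. *)
Lemma fibre_bop (A A' : (T -> C) -> T -> C) (c : K) : 1 <= c ->
  (forall f y, \sum_(x <- fib y) nsq (A f) x <= c * \sum_(x <- fib y) nsq f x) ->
  (forall f g y, \sum_(x <- fib y) (A f x)^* * g x = \sum_(x <- fib y) (f x)^* * A' g x) ->
  exists b : bop H, (forall u x, (b u : l2v K T) x = A (u : l2v K T) x) /\
    (forall u x, (bstar b u : l2v K T) x = A' (u : l2v K T) x).
Proof.
move=> c1 hA adj; have c0 : 0 < c by apply: lt_le_trans c1.
have hA' f y : \sum_(x <- fib y) nsq (A' f) x <= c * \sum_(x <- fib y) nsq f x.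
  set W := (X in X <= _); set N := (X in _ <= c * X).
  have WE : W%:C%C = \sum_(x <- fib y) (A (A' f) x)^* * f x.
    by rewrite adj /W rmorph_sum; apply: eq_bigr => x _; rewrite conjM_nm.
  have W0 : 0 <= W by apply: sumr_ge0 => x _; exact: nsq_ge0.
  have : W <= \sum_(x <- fib y) ((2 * c)^-1 * nsq (A (A' f)) x + c / 2 * nsq f x).
    rewrite -[W](@ger0_norm _ W) // -(@nm_real K) WE; apply: le_trans (nm_sum _ _ _) _.
    apply: ler_sum => x _; rewrite nmM nm_conj /nsq.
    have c2 : (2 * c)^-1 * (2 * c) = 1 by rewrite mulVf // gt_eqF // mulr_gt0.
    have ci : 0 < (2 * c)^-1 by rewrite invr_gt0 mulr_gt0.
    move: (nm _) (nm _) ((2 * c)^-1) c2 ci => a b q c2 q0.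
    have -> : c / 2 = q * c ^+ 2 by rewrite expr2 mulrA (_ : q * c = 1 / 2); lra.
    have -> : b * a = q * (2 * c) * b * a by rewrite c2 mul1r.
    rewrite -subr_ge0 (_ : _ - _ = q * (b - c * a) ^+ 2); last by ring.
    by rewrite mulr_ge0 ?sqr_ge0 // ltW.
  rewrite big_split -!mulr_sumr /= -/N; have := hA (A' f) y; rewrite -/W => hW hh.
  have : (2 * c)^-1 * \sum_(x <- fib y) nsq (A (A' f)) x <= W / 2.
    rewrite ler_pdivrMl ?mulr_gt0 //; apply: le_trans hW _.
    by rewrite le_eqVlt; apply/orP; left; apply/eqP; field.
  by lra.
have bnd B : (forall f y, \sum_(x <- fib y) nsq (B f) x <= c * \sum_(x <- fib y) nsq f x) ->
    forall f, l2 f -> forall F, \sum_(x <- F) nsq (B f) x <= c * l2s f.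
  move=> hB f lf F; apply: le_trans (fset_sum_le (nsq_ge0 _) (sub_preim F)) _.
  rewrite sum_preim; apply: le_trans (ler_sum _ (fun y _ => hB f y)) _.
  by rewrite -mulr_sumr ler_wpM2l ?(ltW c0) // fibre_l2s.
apply: (@mk_bop _ _ c c (ltW c0) (bnd _ hA) (bnd _ hA')) => f g lf lg.
have lA h : l2 h -> l2 (A h) by move=> lh; exists (c * l2s h); exact: bnd.
have lA' h : l2 h -> l2 (A' h) by move=> lh; exists (c * l2s h); exact: bnd.
apply: (fU_uniq (fibre_sum_cvg (lA _ lf) lg)).
have -> : (fun G => \sum_(y <- G) \sum_(x <- fib y) (A f x)^* * g x) =
   (fun G => \sum_(y <- G) \sum_(x <- fib y) (f x)^* * A' g x).
  by apply/funext => G; apply: eq_bigr => y _; exact: adj.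
exact: fibre_sum_cvg lf (lA' _ lg).
Qed.

Lemma bi_ex (a : continuousType T C) : exists b : bop H,
  forall u x, (b u : l2v K T) x = a x * (u : l2v K T) x.
Proof.
have [M hM] := cts_bdd D a.
have M1 : 1 <= M ^+ 2 + 1 by rewrite lerDr sqr_ge0.
have [|f g y|b [hb _]] := @fibre_bop (fun f x => a x * f x) (fun f x => (a x)^* * f x) _ M1.
- move=> f y; rewrite mulr_sumr; apply: ler_sum => x _; rewrite /nsq nmM exprMn.
  rewrite ler_wpM2r ?sqr_ge0 //; have := hM x; have := nm_ge0 (a x).
  by move: (nm _) => t t0 tM; nra.
- by apply: eq_bigr => x _; rewrite rmorphM mulrCA mulrA.
by exists b.
Qed.

Definition bi (a : continuousType T C) : bop H := projT1 (cid (bi_ex a)).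

Lemma biE a u x : (bi a u : l2v K T) x = a x * (u : l2v K T) x.
Proof. exact: (projT2 (cid (bi_ex a))). Qed.

Lemma bop_l2_eq (b b' : bop H) :
  (forall u x, (b u : l2v K T) x = (b' u : l2v K T) x) -> b = b'.
Proof. by move=> h; apply: bop_eq => u; apply: l2v_eq => x. Qed.

Fact bi_lin c a a' : bi (c *: a + a') = c *: bi a + bi a'.
Proof. by apply: bop_l2_eq => u x; rewrite l2vE !biE; rewrite cfDE cfZE mulrDl mulrA. Qed.

(** The space carries counting measure, so the weight [e x] of the transfer operator is shared
    equally between [S] and its adjoint. *)
Definition sqe x : C := (Num.sqrt (e x)%:R)%:C%C.

Lemma sqe2 x : sqe x * sqe x = (e x)%:R.
Proof. by rewrite -rmorphM -expr2 sqr_sqrtr ?ler0n // rmorph_nat. Qed.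

Lemma conj_sqe x : (sqe x)^* = sqe x. Proof. exact: conj_real. Qed.

Lemma nm_sqe2 x : nm (sqe x) ^+ 2 = (e x)%:R.
Proof. by rewrite nm_real ger0_norm ?sqrtr_ge0 // sqr_sqrtr ?ler0n. Qed.

Lemma sqe_neq0 x : sqe x != 0.
Proof. by rewrite -nm_eq0 -sqrf_eq0 nm_sqe2 pnatr_eq0 -lt0n bri_gt0. Qed.

Lemma size_fib y : (size (fib y) <= deg D)%N.
Proof.
rewrite -(sum_bri D y) -sum1_size; apply: leq_sum => x _; exact: bri_gt0.
Qed.

Lemma bri_le_deg x : (e x <= deg D)%N.
Proof.
have xx : x \in fib (R x) by rewrite mem_fib.
by rewrite -(sum_bri D (R x)) (big_rem x xx) leq_addr.
Qed.

Lemma bS_ex : exists b : bop H,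
  (forall u x, (b u : l2v K T) x = sqe x * (u : l2v K T) (R x)) /\
  (forall u y, (bstar b u : l2v K T) y = \sum_(x <- fib y) sqe x * (u : l2v K T) x).
Proof.
have d0 : 0 <= (deg D)%:R :> K by rewrite ler0n.
have h1 f : l2 f -> forall F, \sum_(x <- F) nsq (fun x => sqe x * f (R x)) x <= (deg D)%:R * l2s f.
  move=> lf F; apply: le_trans (fset_sum_le (nsq_ge0 _) (sub_preim F)) _.
  rewrite sum_preim; apply: (@le_trans _ _ (\sum_(y <- (R @` F)%fset) (deg D)%:R * nsq f y)).
    apply: ler_sum => y _; rewrite -(sum_bri D y) natr_sum mulr_suml.
    rewrite big_seq [leRHS]big_seq; apply: ler_sum => x; rewrite mem_fib => /eqP <-.
    by rewrite /nsq nmM exprMn nm_sqe2.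
  by rewrite -mulr_sumr ler_wpM2l // l2s_ub.
have h2 f : l2 f -> forall F, \sum_(y <- F) nsq (fun y => \sum_(x <- fib y) sqe x * f x) y <=
    (deg D)%:R ^+ 2 * l2s f.
  move=> lf F; apply: (@le_trans _ _ (\sum_(y <- F) \sum_(x <- fib y) (deg D)%:R ^+ 2 * nsq f x)).
    apply: ler_sum => y _; rewrite /nsq.
    apply: (@le_trans _ _ ((\sum_(x <- fib y) nm (sqe x * f x)) ^+ 2)).
      by rewrite lerXn2r ?nnegrE ?nm_ge0 ?sumr_ge0 // => [x _|]; [exact: nm_ge0|exact: nm_sum].
    apply: le_trans (sum_sqr_le _ _) _; rewrite mulr_sumr; apply: ler_sum => x _.
    rewrite nmM exprMn nm_sqe2 expr2 -!mulrA; apply: ler_pM; rewrite ?ler0n ?ler_nat ?size_fib //.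
      by rewrite mulr_ge0 ?ler0n ?sqr_ge0.
    by rewrite ler_wpM2r ?sqr_ge0 // ler_nat bri_le_deg.
  under eq_bigr do rewrite -mulr_sumr; rewrite -mulr_sumr ler_wpM2l ?sqr_ge0 //.
  exact: fibre_l2s.
apply: (mk_bop d0 h1 h2) => f g lf lg.
have l1 : l2 (fun x => sqe x * f (R x)) by exists ((deg D)%:R * l2s f); exact: h1.
have l2' : l2 (fun y => \sum_(x <- fib y) sqe x * g x) by exists ((deg D)%:R ^+ 2 * l2s g); exact: h2.
apply: (fU_uniq (fibre_sum_cvg l1 lg)).
have -> : (fun G => \sum_(y <- G) \sum_(x <- fib y) (sqe x * f (R x))^* * g x) =
   psum f (fun y => \sum_(x <- fib y) sqe x * g x).
  apply/funext => G; apply: eq_bigr => y _; rewrite mulr_sumr.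
  apply: eq_big_seq => x; rewrite mem_fib => /eqP ->.
  by rewrite rmorphM /= conj_sqe [in RHS]mulrCA mulrA.
exact: psum_cvg lf l2'.
Qed.

Definition bS : bop H := projT1 (cid bS_ex).

Lemma bSE u x : (bS u : l2v K T) x = sqe x * (u : l2v K T) (R x).
Proof. exact: (projT2 (cid bS_ex)).1. Qed.

Lemma bS_starE u y :
  (bstar bS u : l2v K T) y = \sum_(x <- fib y) sqe x * (u : l2v K T) x.
Proof. exact: (projT2 (cid bS_ex)).2. Qed.

Lemma l2space_neq0 : exists b : bop H, b != 0.
Proof.
have ax : bop_axiom (fun u : H => u).
  by split; [exists id|exists 1 => // v; rewrite mul1r].
exists (Bop ax); apply/eqP => h.
have [p hp] : exists p : H, (p : l2v K T) (T_inh D) = 1.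
  have l : l2 (fun x => if x == T_inh D then 1 else 0 : C).
    exists 1 => F; apply: le_trans (fset_sum_le (nsq_ge0 _) (fsubsetUr [fset T_inh D]%fset F)) _.
    rewrite (fset_split _ (fsubsetUl _ F)) big_seq_fset1 [X in _ + X]big_seq big1 => [|x].
      by rewrite addr0 /nsq eqxx nm1 expr1n.
    by rewrite !inE => /andP[/negPf xT _]; rewrite /nsq xT nm0 expr0n.
  by exists (L2v l); rewrite /= eqxx.
have := congr1 (fun b : bop H => (b p : l2v K T) (T_inh D)) h; rewrite /= hp => /eqP.
by rewrite oner_eq0.
Qed.

End ConcreteRepresentation.

(** * The bimodule of a rational function *)

Lemma compact_cover_seq (T : topologicalType) (W : T -> set T) :
  compact [set: T] -> (forall x, nbhs x (W x)) ->
  exists s : seq T, forall z, exists2 x, x \in s & W x z.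
Proof.
move=> cT hW; apply: contrapT => hn.
pose B : set_system T := [set A | exists s : seq T, forall z, (forall x, x \in s -> ~ W x z) -> A z].
have FB : Filter B.
  split; first by exists [::].
    move=> A A' [s hs] [s' hs']; exists (s ++ s') => z h.
    by split; [apply: hs|apply: hs'] => x xs; apply: h; rewrite mem_cat xs ?orbT.
  by move=> A A' AA' [s hs]; exists s => z /hs; exact: AA'.
have PB : ProperFilter B.
  apply: Build_ProperFilter_ex => // A [s hs]; apply: contrapT => nA; apply: hn.
  exists s => z; apply: contrapT => hz; apply: nA; exists z; apply: hs => x xs Wx.
  by apply: hz; exists x.
have [p [_ hp]] := cT B PB filterT.
have Bp : B (~` W p) by exists [:: p] => z h; apply: h; rewrite inE.
by have [z [h1 h2]] := hp _ _ Bp (hW p).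
Qed.

Section JuliaBimodule.
Variables (K : realType) (P Q : {poly Cplx K}).
Local Notation C := (Cplx K).
Local Notation J := (julia_set P Q).
Local Notation G := (@julia_graph K P Q).
Local Notation A := (continuousType J C).
Local Notation X := (continuousType G C).
Variable D : dynamics K J.
Hypothesis hR : forall x : J, \val (dmap D x) = rat_map P Q (\val x).
Hypothesis hB : forall x : J, bri D x = branch_index P Q (\val x).
Local Notation R := (dmap D).
Local Notation fib := (fib D).
Local Notation e := (bri D).
Implicit Types (x y z : J) (a b : A) (f g h : X).

(** The inverse of [gsrc]: through [toJ], functions on the graph become functions on the Julia
    set. *)
Definition sec x : G := exist _ (x, R x) (mem_set (hR x)).

Lemma gtgtE (p : G) : gtgt p = R (gsrc p).
Proof. by apply: val_inj; rewrite hR; have := set_mem (valP p). Qed.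

Lemma sec_gsrc (p : G) : sec (gsrc p) = p.
Proof.
apply: val_inj => /=; rewrite -gtgtE /gsrc /gtgt.
exact: esym (surjective_pairing _).
Qed.

Lemma sec_cts : continuous sec.
Proof.
apply: (@continuous_comp_initial _ _ _ (fun q : G => \val q)) => x.
exact: (cvg_pair (@cvg_id _ (nbhs x)) (@dmap_cts _ _ D x)).
Qed.

Definition toJ f : A := f \o mkcts sec_cts.
Definition toX a : X := a \o mkcts (@gsrc_continuous _ P Q).

Lemma toJE f x : toJ f x = f (sec x). Proof. by []. Qed.

Lemma toX_eq f g : (forall x, toJ f x = toJ g x) -> f = g.
Proof. by move=> h; apply/continuousEP => p; have := h (gsrc p); rewrite !toJE sec_gsrc. Qed.

Lemma toXK a : toJ (toX a) = a. Proof. by apply/continuousEP. Qed.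
Lemma toJK f : toX (toJ f) = f.
Proof. by apply: toX_eq => x; rewrite toXK. Qed.

Lemma toJ_lin c f g x : toJ (c *: f + g) x = c * toJ f x + toJ g x. Proof. by []. Qed.

Lemma lactE a f x : toJ (lact a f) x = a x * toJ f x. Proof. by []. Qed.

Lemma ractE f a x : toJ (ract f a) x = toJ f x * a (R x). Proof. by []. Qed.

(** The defining sum is the transfer of a continuous function, hence continuous, so [cts_of] returns
    it and not its default. *)
Lemma innerE f g y :
  inner f g y = tr fib e (fun x => (toJ f x)^* * toJ g x) y.
Proof.
have E t : \sum_(p \in [set p : G | gtgt p = t])
      ((branch_index P Q (\val (gsrc p)))%:R * (f p)^* * g p) =
    tr fib e (fun x => (toJ f x)^* * toJ g x) t.
  have -> : [set p : G | gtgt p = t] = [set` [seq sec x | x <- fib t]].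
    apply/seteqP; split => p /=.
      by move=> pt; apply/mapP; exists (gsrc p); rewrite ?sec_gsrc ?mem_fib -?gtgtE ?pt.
    by move=> /mapP[x]; rewrite mem_fib => /eqP <- ->.
  rewrite -fsbig_seq; last by rewrite map_inj_uniq ?fib_uniq // => x z /(congr1 (@gsrc _ _ _)).
  by rewrite big_map; apply: eq_bigr => x _; rewrite -hB mulrA.
rewrite /inner /cts_of; case: pselect => [c|[]]; first exact: E.
rewrite (_ : (fun _ => _) = tr fib e (cfM (cfconj (toJ f)) (toJ g) : J -> C)); last exact/funext.
exact: tr_cts.
Qed.

Lemma A_ext a b : (forall x, a x = b x) -> a = b.
Proof. by move=> h; apply/continuousEP. Qed.

Lemma thetaE f g h x : toJ (theta f g h) x = toJ f x * inner g h (R x).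
Proof. by []. Qed.

Lemma inner_self f y :
  inner f f y = (\sum_(x <- fib y) (e x)%:R * nm (toJ f x) ^+ 2)%:C%C.
Proof.
rewrite innerE rmorph_sum; apply: eq_bigr => x _.
by rewrite conjM_nm -[(e x)%:R in LHS](rmorph_nat (real_complex K)) -rmorphM.
Qed.

Lemma inner_self_eq0 f y : inner f f y = 0 -> forall x, R x = y -> toJ f x = 0.
Proof.
rewrite inner_self => /(@complexI K) /eqP; rewrite psumr_eq0 => [/allP h x xy|x _].
  have := h x; rewrite mem_fib xy eqxx => /(_ isT) /=.
  by rewrite mulf_eq0 pnatr_eq0 gtn_eqF ?bri_gt0 //= sqrf_eq0 nm_eq0 => /eqP.
by rewrite mulr_ge0 ?sqr_ge0.
Qed.

Lemma theta_adjoint f g : is_adjoint (theta f g) (theta g f).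
Proof.
move=> h k; apply: A_ext => y.
transitivity ((inner g h y)^* * inner f k y); rewrite ?[LHS]innerE ?[RHS]innerE.
  rewrite [X in _ = _ * X]innerE /tr mulr_sumr; apply: eq_big_seq => x.
  by rewrite mem_fib => /eqP xy; rewrite thetaE xy rmorphM; ring.
rewrite [X in X^* * _ = _]innerE /tr rmorph_sum mulr_suml; apply: eq_big_seq => x.
rewrite mem_fib => /eqP xy; rewrite thetaE xy !rmorphM rmorph_nat /= conjCK; ring.
Qed.

Lemma supnorm_ub a y : nm (a y) <= supnorm a.
Proof.
have [M hM] := cts_bdd D a; apply: sup_ubound; last by exists y.
by exists M => _ [z _ <-]; exact: hM.
Qed.

Lemma supnorm_le a (M : K) : (forall y, nm (a y) <= M) -> supnorm a <= M.
Proof.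
move=> h; apply: ge_sup => [|_ [z _ <-]]; last exact: h.
by exists (nm (a (T_inh D))); exists (T_inh D).
Qed.

Lemma module_norm_ge0 f : 0 <= module_norm f. Proof. exact: sqrtr_ge0. Qed.

Lemma module_norm2 f : module_norm f ^+ 2 = supnorm (inner f f).
Proof.
by rewrite sqr_sqrtr // (le_trans (nm_ge0 _) (supnorm_ub _ (T_inh D))).
Qed.

Lemma nm_inner_self f y :
  nm (inner f f y) = \sum_(x <- fib y) (e x)%:R * nm (toJ f x) ^+ 2.
Proof.
rewrite inner_self nm_real ger0_norm // sumr_ge0 // => x _.
by rewrite mulr_ge0 ?sqr_ge0.
Qed.

Lemma fibre_le_module f y :
  \sum_(x <- fib y) (e x)%:R * nm (toJ f x) ^+ 2 <= module_norm f ^+ 2.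
Proof. by rewrite module_norm2 -nm_inner_self supnorm_ub. Qed.

Lemma module_le f (M : K) : (forall x, nm (toJ f x) ^+ 2 <= M) ->
  module_norm f ^+ 2 <= (deg D)%:R * M.
Proof.
move=> h; rewrite module_norm2; apply: supnorm_le => y; rewrite nm_inner_self.
rewrite -(sum_bri D y) natr_sum mulr_suml; apply: ler_sum => x _.
by rewrite ler_wpM2l.
Qed.

Lemma module_norm0 : module_norm (0 : X) = 0.
Proof.
apply/eqP; rewrite -sqrf_eq0; apply/eqP/le_anti; rewrite sqr_ge0 andbT.
by rewrite -[leRHS](mulr0 (deg D)%:R); apply: module_le => x; rewrite /toJ /= nm0 expr0n.
Qed.

Lemma finite_rank_compact (T : X -> X) : adjointable T -> finite_rank T -> compact_op T.
Proof.
move=> aT fT; split => // r r0; exists T => // f; rewrite subrr module_norm0.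
by rewrite mulr_ge0 ?module_norm_ge0 // ltW.
Qed.

Lemma theta_compact f g : compact_op (theta f g).
Proof.
apply: finite_rank_compact; first by exists (theta g f); exact: theta_adjoint.
exists 1%N, (fun=> 1), (fun=> f), (fun=> g); apply/funext => h.
by rewrite big_ord1 scale1r.
Qed.

End JuliaBimodule.

(** * The representation on square-summable functions *)

Section JuliaRepresentation.
Variables (K : realType) (P Q : {poly Cplx K}).
Local Notation C := (Cplx K).
Local Notation J := (julia_set P Q).
Local Notation G := (@julia_graph K P Q).
Local Notation A := (continuousType J C).
Local Notation X := (continuousType G C).
Variable D : dynamics K J.
Hypothesis hR : forall x : J, \val (dmap D x) = rat_map P Q (\val x).
Hypothesis hB : forall x : J, bri D x = branch_index P Q (\val x).
Local Notation R := (dmap D).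
Local Notation fib := (fib D).
Local Notation e := (bri D).
Local Notation sqe := (sqe D).
Local Notation d := (deg D).
Local Notation toJ := (toJ hR).
Local Notation H := (l2space K J).
Local Notation B := (bop H).
Implicit Types (x y z : J) (a : A) (f g h : X) (T : X -> X) (u v : H) (b : B).

(** Arbitrary values on one fibre come from an element of the bimodule whose supremum is controlled
    by those values; dividing by [sqe] matches the convention of [fibrewise]. *)
Lemma fibre_interpolate (xi : J -> C) y : exists h : X,
  (forall z, R z = y -> toJ h z * sqe z = xi z) /\
  (forall z, nm (toJ h z) ^+ 2 <= d%:R * \sum_(x <- fib y) nsq xi x).
Proof.
have /choice[v hv] x : exists v : A, [/\ forall z, nm (v z) <= 1,
    v x = 1 & forall z, R z = y -> z != x -> v z = 0].
  have nx : x \notin [seq z <- fib y | z != x] by rewrite mem_filter eqxx.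
  have [v [v1 v2 v3]] := dyn_bump D (nbhs_notin D nx); exists v; split.
  - move=> z; have /andP[v0 v11] := v1 z; rewrite -le_nm ger0_norm //.
  - exact: nbhs_singleton v3.
  - by move=> z zy zx; apply: v2; rewrite /= mem_filter zx mem_fib zy eqxx.
pose c x := xi x / sqe x.
exists (toX (\sum_(x <- fib y) c x *: v x)); rewrite toXK; split => z.
- move=> zy; rewrite cf_sumE (bigD1_seq z) ?fib_uniq ?mem_fib ?zy //=.
  rewrite big1 => [|x xz]; last by have [_ _ h] := hv x; rewrite cfZE h ?mulr0 // eq_sym.
  by have [_ h _] := hv z; rewrite addr0 cfZE h mulr1 /c divfK // sqe_neq0.
- rewrite cf_sumE; apply: (@le_trans _ _ ((\sum_(x <- fib y) nm ((c x *: v x) z)) ^+ 2)).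
    by rewrite lerXn2r ?nnegrE ?nm_ge0 ?sumr_ge0 // => [x _|]; [exact: nm_ge0|exact: nm_sum].
  apply: le_trans (sum_sqr_le _ _) _; apply: ler_pM.
  + exact: ler0n.
  + by apply: sumr_ge0 => x _; exact: sqr_ge0.
  + by rewrite ler_nat size_fib.
  apply: ler_sum => x _; have [h _ _] := hv x.
  rewrite cfZE /c nmM nmM nmV /nsq -mulrA exprMn; apply: ler_piMr; first exact: sqr_ge0.
  rewrite exprn_ile1 ?mulr_ge0 ?invr_ge0 ?nm_ge0 //.
  apply: mulr_ile1; rewrite ?invr_ge0 ?nm_ge0 //.
  rewrite invf_le1 ?nm_gt0 ?sqe_neq0 // -(@expr_ge1 _ 2) ?nm_ge0 // nm_sqe2.
  by rewrite ler1n bri_gt0.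
Qed.

(** [T] is within operator distance 1 of a finite rank operator, which is bounded explicitly. *)
Lemma compact_bounded T : compact_op T -> exists2 c : K, 0 <= c &
  forall h (M : K), 0 <= M -> (forall z, nm (toJ h z) ^+ 2 <= M) ->
  forall y, \sum_(x <- fib y) (e x)%:R * nm (toJ (T h) x) ^+ 2 <= c * M.
Proof.
move=> [_ /(_ 1 ltr01)[_ [n [c [f [g ->]]]] hT]].
have /choice[mf hmf] k := cts_bdd D (toJ (f k)).
have /choice[mg hmg] k := cts_bdd D (toJ (g k)).
have mf0 k : 0 <= mf k by exact: le_trans (nm_ge0 _) (hmf k (T_inh D)).
have mg0 k : 0 <= mg k by exact: le_trans (nm_ge0 _) (hmg k (T_inh D)).
pose L := \sum_(k < n) nm (c k) * (mf k * (d%:R * mg k)).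
have L0 : 0 <= L by apply: sumr_ge0 => k _; rewrite !mulr_ge0 ?nm_ge0.
exists (2 * d%:R + 2 * d%:R * L ^+ 2) => [|h M M0 hM y].
  by rewrite addr_ge0 ?mulr_ge0 ?sqr_ge0.
pose s := Num.sqrt M; have s0 : 0 <= s by exact: sqrtr_ge0.
have s2 : s ^+ 2 = M by rewrite sqr_sqrtr.
have hs z : nm (toJ h z) <= s by rewrite -(@ler_pXn2r _ 2) ?nnegrE ?nm_ge0 // s2.
have inn k t : nm (inner (g k) h t) <= d%:R * mg k * s.
  rewrite (innerE hR hB); apply: le_trans (nm_sum _ _ _) _.
  rewrite -(sum_bri D t) natr_sum !mulr_suml; apply: ler_sum => x _.
  by rewrite !nmM nm_conj nm_nat -mulrA ler_wpM2l // ler_pM ?nm_ge0.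
pose T0 h := \sum_(k < n) c k *: theta (f k) (g k) h.
have T0E x : nm (toJ (T0 h) x) <= L * s.
  rewrite toJE /T0 cf_sumE mulr_suml; apply: le_trans (nm_sum _ _ _) _.
  apply: ler_sum => k _; rewrite cfZE nmM -mulrA ler_wpM2l ?nm_ge0 //.
  by rewrite -toJE thetaE nmM -mulrA ler_pM ?nm_ge0.
apply: (@le_trans _ _ (\sum_(x <- fib y) (2 * ((e x)%:R * nm (toJ (T h - T0 h) x) ^+ 2) +
    (e x)%:R * (2 * (L ^+ 2 * M))))).
  apply: ler_sum => x _; rewrite [2 * (_ * _)]mulrCA -mulrDr ler_wpM2l //.
  have -> : toJ (T h) x = toJ (T h - T0 h) x + toJ (T0 h) x.
    by rewrite -[in LHS](subrK (T0 h) (T h)).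
  have := nmD (toJ (T h - T0 h) x) (toJ (T0 h) x); have := T0E x.
  have := nm_ge0 (toJ (T0 h) x); have := nm_ge0 (toJ (T h - T0 h) x).
  have := nm_ge0 (toJ (T h - T0 h) x + toJ (T0 h) x).
  rewrite -s2 -exprMn; move: (nm _) (nm _) (nm _) (L * s) => r q p t p0 q0 r0 rt pqr.
  have : p ^+ 2 <= (q + r) ^+ 2 by rewrite lerXn2r ?nnegrE // addr_ge0.
  have : r ^+ 2 <= t ^+ 2 by rewrite lerXn2r ?nnegrE // (le_trans r0).
  by have := sqr_ge0 (q - r); nra.
rewrite big_split /= -mulr_sumr -mulr_suml -natr_sum (sum_bri D y).
have := fibre_le_module hR hB (T h - T0 h) y.
have : module_norm (T h - T0 h) ^+ 2 <= d%:R * M.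
  have hm : module_norm h ^+ 2 <= d%:R * M by exact: (module_le hB hM).
  have hTh : module_norm (T h - T0 h) <= module_norm h by move: (hT h); rewrite mul1r.
  apply: le_trans hm; apply: lerXn2r hTh; rewrite nnegrE; exact: module_norm_ge0.
by move: (\sum_(x <- _) _) => S; nra.
Qed.

Lemma inner_conj f g y : inner g f y = (inner f g y)^*.
Proof.
rewrite [LHS](innerE hR hB) [X in _ = X^*](innerE hR hB) /tr rmorph_sum.
by apply: eq_bigr => z _; rewrite !rmorphM rmorph_nat /= conjCK [(toJ g z)^* * _]mulrC.
Qed.

(** Inner products at [y] see only the fibre over [y], and [T h] enters them through pairings of [h]
    with [T' g]. *)
Lemma adjoint_local T T' h h' y : is_adjoint T T' ->
  (forall z, R z = y -> toJ h z = toJ h' z) -> forall x, R x = y -> toJ (T h) x = toJ (T h') x.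
Proof.
move=> adj hh x xy; apply/eqP; rewrite -subr_eq0; apply/eqP.
have E g : inner h g y = inner h' g y.
  rewrite [LHS](innerE hR hB) [RHS](innerE hR hB); apply: eq_big_seq => z.
  by rewrite mem_fib => /eqP zy; rewrite hh.
have F g : inner (T h) g y = inner (T h') g y.
  by rewrite [in LHS](adj h g) [in RHS](adj h' g).
have := @inner_self_eq0 _ _ _ D hR hB (T h - T h') y _ x xy; apply.
have -> : inner (T h - T h') (T h - T h') y =
    inner (T h) (T h - T h') y - inner (T h') (T h - T h') y.
  rewrite [LHS](innerE hR hB) [X in _ = X - _](innerE hR hB) [X in _ = _ - X](innerE hR hB).
  rewrite /tr -sumrB; apply: eq_bigr => z _; rewrite -mulrBr -mulrBl -rmorphB //.
by apply/eqP; rewrite subr_eq0; apply/eqP; exact: F.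
Qed.

(* [b] acts on each fibre as [T], when a function on the fibre is divided by the
   square root of the branch index and extended to the graph. *)
Definition fibrewise T b := forall u x h,
  (forall z, R z = R x -> toJ h z * sqe z = (u : l2v K J) z) ->
  (b u : l2v K J) x = sqe x * toJ (T h) x.

Lemma fibrewise_uniq T b b' : fibrewise T b -> fibrewise T b' -> b = b'.
Proof.
move=> hb hb'; apply: bop_l2_eq => u x.
have [h [h1 _]] := fibre_interpolate (u : l2v K J) (R x).
by rewrite (hb _ _ _ h1) (hb' _ _ _ h1).
Qed.

(** [T] acts on each fibre by [adjoint_local], uniformly boundedly by [compact_bounded]. Conjugation
    by [sqe] turns the weighted inner product into the plain one, and the fibre actions glue. *)
Lemma fibrewise_ex T T' : compact_op T -> is_adjoint T T' ->
  exists2 b, fibrewise T b & fibrewise T' (bstar b).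
Proof.
move=> cT adj; have adj' : is_adjoint T' T.
  move=> f g; apply: A_ext => y; apply: etrans (inner_conj g (T' f) y) _.
  apply: esym; apply: etrans (inner_conj (T g) f y) _.
  by rewrite [in LHS](adj g f).
have [c c0 hc] := compact_bounded cT.
have /choice[it hit] (p : (J -> C) * J) := fibre_interpolate p.1 p.2.
pose op S (xi : J -> C) x := sqe x * toJ (S (it (xi, R x))) x.
have c1 : 1 <= c * d%:R + 1 by rewrite lerDr mulr_ge0.
have sum0 (xi : J -> C) y : 0 <= \sum_(x <- fib y) nsq xi x.
  by apply: sumr_ge0 => x _; exact: nsq_ge0.
have opl S S' (u : H) x h : is_adjoint S S' ->
    (forall z, R z = R x -> toJ h z * sqe z = (u : l2v K J) z) ->
    op S (u : l2v K J) x = sqe x * toJ (S h) x.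
  move=> aS hh; rewrite /op; congr (_ * _); apply: (adjoint_local aS _ (erefl (R x))) => z zx.
  apply: (mulIf (sqe_neq0 D z)); rewrite hh //.
  by have [-> //] := hit ((u : l2v K J) : J -> C, R x).
have [||b [h1 h2]] := @fibre_bop _ _ D (op T) (op T') _ c1.
- move=> xi y; apply: (@le_trans _ _ (c * (d%:R * \sum_(x <- fib y) nsq xi x))); last first.
    by rewrite mulrA ler_wpM2r // lerDl.
  have [_ hM] := hit (xi, y).
  apply: le_trans (hc _ _ _ hM y); last by rewrite mulr_ge0.
  rewrite big_seq [leRHS]big_seq; apply: ler_sum => x; rewrite mem_fib => /eqP xy.
  by rewrite /nsq /op nmM exprMn nm_sqe2 xy.
- move=> xi eta y.
  transitivity (inner (T (it (xi, y))) (it (eta, y)) y).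
    rewrite [RHS](innerE hR hB); apply: eq_big_seq => x; rewrite mem_fib => /eqP xy.
    have E := (hit (eta, y)).1 x xy.
    by rewrite -[eta x]E /op xy rmorphM /= conj_sqe -(sqe2 D x); ring.
  rewrite adj [LHS](innerE hR hB); apply: eq_big_seq => x; rewrite mem_fib => /eqP xy.
  have E := (hit (xi, y)).1 x xy.
  by rewrite -[xi x]E /op xy rmorphM /= conj_sqe -(sqe2 D x); ring.
exists b.
  by move=> u x h hh; rewrite h1; exact: (opl T T' u x h adj hh).
by move=> u x h hh; rewrite h2; exact: (opl T' T u x h adj' hh).
Qed.

(** The default 0 never concerns compact operators, which all have a fibrewise realization. *)
Definition iKc T : B := xget 0 [set b | fibrewise T b].

Lemma iKcE T b : fibrewise T b -> iKc T = b.
Proof.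
move=> hb; apply: fibrewise_uniq (hb).
exact: (@xgetPex _ 0 [set b | fibrewise T b] (ex_intro _ b hb)).
Qed.

HB.instance Definition _ := GRing.isLinear.Build C A B *:%R (bi D) (@bi_lin K J D).

Definition bSf f : B := cmul (bi D (toJ f)) (bS D).

Fact bSf_lin c f g : bSf (c *: f + g) = c *: bSf f + bSf g.
Proof.
rewrite /bSf -cmulZl -cmulDl -bi_lin; congr (cmul (bi D _) _).
exact: A_ext.
Qed.

HB.instance Definition _ := GRing.isLinear.Build C X B *:%R bSf bSf_lin.

Lemma cmulE b b' u : cmul b b' u = b (b' u). Proof. by []. Qed.

Lemma bSfE f u x : (bSf f u : l2v K J) x = toJ f x * sqe x * (u : l2v K J) (R x).
Proof. by rewrite /bSf cmulE biE bSE mulrA. Qed.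

Lemma biM a a' : bi D (cfM a a') = cmul (bi D a) (bi D a').
Proof. by apply: bop_l2_eq => u x; rewrite cmulE !biE mulrA. Qed.

Lemma bi_conj a : bi D (cfconj a) = cstar (bi D a).
Proof.
apply: bop_eq => u; apply/esym; apply: bstar_uniq => {}u v.
rewrite !hip_l2 /ip2; congr xget; apply/seteqP; split => l.
  suff -> : psum (bi D a u : l2v K J) (v : l2v K J) = psum (u : l2v K J) (bi D (cfconj a) v : l2v K J) by [].
  by apply/funext => F; apply: eq_bigr => x _; rewrite !biE rmorphM cfconjE; ring.
suff -> : psum (bi D a u : l2v K J) (v : l2v K J) = psum (u : l2v K J) (bi D (cfconj a) v : l2v K J) by [].
by apply/funext => F; apply: eq_bigr => x _; rewrite !biE rmorphM cfconjE; ring.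
Qed.

Lemma bSf_starE g u y : (cstar (bSf g) u : l2v K J) y =
  \sum_(x <- fib y) sqe x * ((toJ g x)^* * (u : l2v K J) x).
Proof.
rewrite /bSf cstarM -bi_conj cmulE -[cstar (bS D)]/(bstar (bS D)) bS_starE.
by apply: eq_bigr => x _; rewrite biE.
Qed.

Lemma bSf_inner f g : cmul (cstar (bSf f)) (bSf g) = bi D (inner f g).
Proof.
apply: bop_l2_eq => u y; rewrite cmulE bSf_starE biE [X in _ = X * _](innerE hR hB).
rewrite /tr mulr_suml; apply: eq_big_seq => x; rewrite mem_fib => /eqP <-.
by rewrite bSfE -(sqe2 D x); ring.
Qed.

Lemma fibrewise_theta f g : fibrewise (theta f g) (cmul (bSf f) (cstar (bSf g))).
Proof.
move=> u x h hh; rewrite cmulE bSfE bSf_starE thetaE [X in _ = _ * (_ * X)](innerE hR hB).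
rewrite mulrA [sqe x * _]mulrC; congr (_ * _); apply: eq_big_seq => z.
by rewrite mem_fib => /eqP zx; rewrite -hh // -(sqe2 D z); ring.
Qed.

Lemma fibrewise_lact a : fibrewise (lact a) (bi D a).
Proof. by move=> u x h hh; rewrite biE -hh // lactE; ring. Qed.

Lemma julia_rep_iK : is_iK bSf iKc.
Proof.
have ex T : compact_op T -> exists2 b, fibrewise T b & forall T', is_adjoint T T' -> fibrewise T' (bstar b).
  move=> cT; have [[T' aT] _] := cT; have [b hb hb'] := fibrewise_ex cT aT.
  exists b => // T'' aT''; have [b2 hb2 hb2'] := fibrewise_ex cT aT''.
  by rewrite (fibrewise_uniq hb hb2).
split.
- move=> c T T' /ex[b hb _] /ex[b' hb' _]; rewrite (iKcE hb) (iKcE hb'); apply: iKcE.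
  by move=> u x h hh; rewrite l2vE (hb _ _ _ hh) (hb' _ _ _ hh) toJ_lin; ring.
- move=> T T' /ex[b hb _] /ex[b' hb' _]; rewrite (iKcE hb) (iKcE hb'); apply: iKcE.
  move=> u x h hh; rewrite cmulE; apply: hb => z zx; rewrite mulrC.
  by apply/esym/hb' => t tz; apply: hh; rewrite tz.
- by move=> T T' /ex[b hb hb'] aT; rewrite (iKcE hb); apply: iKcE; exact: hb'.
- by move=> f g; apply: iKcE; exact: fibrewise_theta.
Qed.

Lemma bi_lact a f : cmul (bi D a) (bSf f) = bSf (lact a f).
Proof. by apply: bop_l2_eq => u x; rewrite cmulE biE !bSfE lactE !mulrA. Qed.

Lemma bi_ract f a : cmul (bSf f) (bi D a) = bSf (ract f a).
Proof. by apply: bop_l2_eq => u x; rewrite cmulE !bSfE biE ractE; ring. Qed.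

Lemma julia_rep_cov : exists2 iK, is_iK bSf iK &
  forall a, covariance_ideal a -> bi D a = iK (lact a).
Proof.
exists iKc; first exact: julia_rep_iK.
by move=> a _; apply/esym/iKcE; exact: fibrewise_lact.
Qed.

Definition julia_rep : cuntz_pimsner_rep P Q B :=
  @CuntzPimsnerRep K P Q B (bi D : {linear A -> B}) (bSf : {linear X -> B})
    biM bi_conj bi_lact bi_ract bSf_inner julia_rep_cov.

Lemma julia_rep_cf1 : rep_i julia_rep (cf1 K J) != 0.
Proof.
have [b b0] := l2space_neq0 D; apply: contra b0 => /eqP h; apply/eqP.
apply: bop_l2_eq => u x; have := congr1 (fun T : B => (T (b u) : l2v K J) x) h.
by rewrite /= biE mul1r.
Qed.

End JuliaRepresentation.

(** * Functions vanishing near the branch points act with finite rank *)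

Section Decomposition.
Variables (K : realType) (T : topologicalType) (D : dynamics K T).
Local Notation C := (Cplx K).
Local Notation A := (continuousType T C).
Local Notation R := (dmap D).
Local Notation fib := (fib D).
Local Notation e := (bri D).
Hypothesis cT : compact [set: T].
Hypothesis hinj : forall x, e x = 1%N -> exists2 U : set T, nbhs x U &
  forall z1 z2, U z1 -> U z2 -> R z1 = R z2 -> z1 = z2.

Let good (v : A) := (forall z1 z2, v z1 != 0 -> v z2 != 0 -> R z1 = R z2 -> z1 = z2) /\
  (forall z, v z != 0 -> e z = 1%N).

Lemma good_bump x : e x = 1%N -> exists2 v : A, good v & \forall z \near x, v z = 1.
Proof.
move=> /hinj[U nU injU]; rewrite nbhsE in nU; case: nU => W [oW Wx] WU.
have [v [_ v2 v3]] := dyn_bump D (open_nbhs_nbhs (conj oW Wx)); exists v => //.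
have vW z : v z != 0 -> W z by move=> vz; apply: contrapT => /v2 h; rewrite h eqxx in vz.
split=> [z1 z2 /vW h1 /vW h2|z /vW h]; first by apply: injU; exact: WU.
(* A branch point inside [W] would have two distinct points with one value nearby, against
   injectivity on [U]. *)
apply/eqP; apply: contraT => ez; have nz : nbhs z W by exact: open_nbhs_nbhs.
have [x1 [x2 [U1 U2 x12 h12 _]]] := crit_pair ez nz.
by rewrite (injU _ _ (WU _ U1) (WU _ U2) h12) eqxx in x12.
Qed.

Lemma good_tr v (xi : T -> C) x : good v ->
  v x * tr fib e (fun z => v z * xi z) (R x) = v x * v x * xi x.
Proof.
move=> [v1 v2]; have [->|vx] := eqVneq (v x) 0; first by rewrite !mul0r.
rewrite /tr (bigD1_seq x) ?fib_uniq ?mem_fib //= v2 // mul1r big_seq_cond big1 => [|z].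
  by rewrite addr0 mulrA.
rewrite mem_fib => /andP[/eqP zx zn]; have [->|vz] := eqVneq (v z) 0; first by rewrite mul0r mulr0.
by rewrite (v1 _ _ vz vx zx) eqxx in zn.
Qed.

(** For [v] supported in a domain of injectivity, multiplication by [v^2] is the rank one operator
    of [good_tr]. Finitely many bumps make the product of the [1 - v^2] vanish, and peeling them off
    one at a time distributes [a] over them; the bumps at branch points live where [a] is 0. *)
Lemma covariance_decomposition (a : A) :
  (forall x, e x != 1%N -> \forall z \near x, a z = 0) ->
  exists s : seq (A * A), forall (xi : T -> C) x,
    a x * xi x = \sum_(p <- s) p.1 x * tr fib e (fun z => p.2 z * xi z) (R x).
Proof.
move=> ha.
pose PV (b v : A) := good v \/ forall z, b z * v z = 0.
have vex : forall x : T, exists v : A, PV a v /\ \forall z \near x, v z = 1.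
  move=> x.
  have [ex|ex] := eqVneq (e x) 1%N.
    by have [v gv v1] := good_bump ex; exists v; split => //; left.
  have [v [_ v2 v3]] := dyn_bump D (ha x ex); exists v; split => //; right => z.
  have [->|az] := eqVneq (a z) 0; first by rewrite mul0r.
  by rewrite v2 ?mulr0 //= => h; rewrite h eqxx in az.
have [v hv] := choice vex.
have [l hl] := compact_cover_seq cT (fun x => (hv x).2).
have main (t : seq T) (b : A) : (forall x, PV b (v x)) -> exists s : seq (A * A), forall (xi : T -> C) x,
    b x * (1 - \prod_(y <- t) (1 - v y x * v y x)) * xi x =
    \sum_(p <- s) p.1 x * tr fib e (fun z => p.2 z * xi z) (R x).
  elim: t b => [|y t ih] b hb; first by exists [::] => xi x; rewrite !big_nil subrr mulr0 mul0r.
  pose b' := b - cfM (cfM b (v y)) (v y).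
  have b'E x : b' x = b x * (1 - v y x * v y x).
    have -> : b' x = b x - b x * v y x * v y x by [].
    by rewrite mulrBr mulr1 mulrA.
  have [|s hs] := ih b'.
    move=> x; case: (hb x) => h; first by left.
    by right => z; rewrite b'E mulrAC h mul0r.
  have split1 xi x : b x * (1 - \prod_(z <- y :: t) (1 - v z x * v z x)) * xi x =
      b x * v y x * v y x * xi x + b' x * (1 - \prod_(z <- t) (1 - v z x * v z x)) * xi x.
    by rewrite big_cons b'E; ring.
  case: (hb y) => h; last by exists s => xi x; rewrite split1 h !mul0r add0r hs.
  exists ((cfM b (v y), v y) :: s) => xi x; rewrite split1 hs big_cons /=; congr (_ + _).
  transitivity (b x * (v y x * tr fib e (fun z => v y z * xi z) (R x))).
    by rewrite good_tr // !mulrA.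
  exact: mulrA.
have [s hs] := main l a (fun x => (hv x).1); exists s => xi x; rewrite -hs.
have [y yl /= vy] := hl x; congr (_ * _).
have -> : \prod_(y <- l) (1 - v y x * v y x) = 0.
  apply/eqP; rewrite prodf_seq_eq0; apply/hasP; exists y => //=.
  by rewrite vy mulr1 subrr.
by rewrite subr0 mulr1.
Qed.

End Decomposition.

(** * From the universal property to the covariance relations *)

Section Covrep.
Variables (K : realType) (P Q : {poly Cplx K}).
Local Notation C := (Cplx K).
Local Notation J := (julia_set P Q).
Local Notation G := (@julia_graph K P Q).
Local Notation A := (continuousType J C).
Local Notation X := (continuousType G C).
Variable D : dynamics K J.
Hypothesis hR : forall x : J, \val (dmap D x) = rat_map P Q (\val x).
Hypothesis hB : forall x : J, bri D x = branch_index P Q (\val x).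
Local Notation R := (dmap D).
Local Notation toJ := (toJ hR).
Hypothesis hinj : forall x : J, bri D x = 1%N -> exists2 U : set J, nbhs x U &
  forall z1 z2, U z1 -> U z2 -> R z1 = R z2 -> z1 = z2.
Variables (O : cstarAlgType C) (r : cuntz_pimsner_rep P Q O).
Hypothesis gen : generating r.
Hypothesis univ : forall (B : cstarAlgType C) (r' : cuntz_pimsner_rep P Q B),
  exists psi : {linear O -> B},
    [/\ forall x y, psi (cmul x y) = cmul (psi x) (psi y),
        forall x, psi (cstar x) = cstar (psi x),
        forall a, psi (rep_i r a) = rep_i r' a &
        forall f, psi (rep_S r f) = rep_S r' f].
Implicit Types (a b : A) (f g h : X).

Let one : X := toX (cf1 K J).
Let cS := rep_S r one.
Local Notation ci := (rep_i r).

Lemma lact_one a : lact a one = toX a.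
Proof. by apply: (@toX_eq _ _ _ D hR) => x; rewrite lactE !toXK cf1E mulr1. Qed.

Lemma rep_SE f : rep_S r f = ci (toJ f) ** cS.
Proof. by rewrite rep_lact lact_one toJK. Qed.

Fact ci1_S' : ci (cf1 K J) ** cS = cS.
Proof. by rewrite {1}/cS rep_lact lact_one. Qed.

Fact cS_ci' a : cS ** ci a = ci (al D a) ** cS.
Proof.
rewrite rep_ract rep_lact; congr (rep_S r _).
by apply: (@toX_eq _ _ _ D hR) => x; rewrite ractE lactE !toXK cf1E mul1r mulr1.
Qed.

Fact cS_tr' a : cS^s ** ci a ** cS = ci (trA D a).
Proof.
rewrite -cmulA rep_lact rep_inner lact_one; congr (ci _).
apply: A_ext => y; rewrite [LHS](innerE hR hB) !toXK; apply: tr_ext => x.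
by rewrite cf1E rmorph1 mul1r.
Qed.

Lemma rep_gen E : cstar_subalgebra E -> (forall a, E (ci a)) -> E cS -> E = setT.
Proof.
move=> sE hi hS; apply: gen => // f; rewrite rep_SE.
by case: sE => _ _ hM _; exact: hM.
Qed.

Lemma is_adjointD (T1 T1' T2 T2' : X -> X) : is_adjoint T1 T1' -> is_adjoint T2 T2' ->
  is_adjoint (fun h => T1 h + T2 h) (fun h => T1' h + T2' h).
Proof.
move=> h1 h2 f g; apply: A_ext => y.
transitivity (inner (T1 f) g y + inner (T2 f) g y).
  rewrite [LHS](innerE hR hB) [X in _ = X + _](innerE hR hB) [X in _ = _ + X](innerE hR hB).
  by rewrite -trD; apply: tr_ext => x; rewrite -mulrDl -rmorphD.
rewrite (h1 f g) (h2 f g).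
rewrite [RHS](innerE hR hB) [X in X + _ = _](innerE hR hB) [X in _ + X = _](innerE hR hB).
by rewrite -trD; apply: tr_ext => x; rewrite -mulrDr.
Qed.

Let TS (s : seq (A * A)) h := \sum_(p <- s) theta (toX p.1) (toX (cfconj p.2)) h.

Lemma TS_adjoint s : adjointable (TS s).
Proof.
exists (fun h => \sum_(p <- s) theta (toX (cfconj p.2)) (toX p.1) h).
elim: s => [|p s ih].
  have -> : TS [::] = fun=> 0 by apply/funext => h; rewrite /TS big_nil.
  have -> : (fun h => \sum_(p <- [::]) theta (toX (cfconj p.2)) (toX p.1) h) = fun=> 0 :> X.
    by apply/funext => h; rewrite big_nil.
  have z x : toJ 0 x = 0 by [].
  move=> f g; apply: A_ext => y; rewrite [LHS](innerE hR hB) [RHS](innerE hR hB).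
  by apply: tr_ext => x; rewrite !z conjC0 mul0r mulr0.
have -> : TS (p :: s) = fun h => theta (toX p.1) (toX (cfconj p.2)) h + TS s h.
  by apply/funext => h; rewrite /TS big_cons.
have -> : (fun h => \sum_(p <- p :: s) theta (toX (cfconj p.2)) (toX p.1) h) =
   fun h => theta (toX (cfconj p.2)) (toX p.1) h + \sum_(p <- s) theta (toX (cfconj p.2)) (toX p.1) h.
  by apply/funext => h; rewrite big_cons.
exact: is_adjointD (theta_adjoint hR hB (toX p.1) (toX (cfconj p.2))) ih.
Qed.

Lemma TS_compact s : compact_op (TS s).
Proof.
apply: (finite_rank_compact hR hB) (TS_adjoint s) _.
exists (size s), (fun=> 1), (fun k => toX (nth (0, 0) s k).1),
  (fun k => toX (cfconj (nth (0, 0) s k).2)).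
apply/funext => h; rewrite /TS (big_nth (0, 0)) big_mkord.
by apply: eq_bigr => k _; rewrite scale1r.
Qed.

Lemma iK_TS iK s : is_iK (rep_S r) iK ->
  iK (TS s) = \sum_(p <- s) ci p.1 ** cS ** cS^s ** ci p.2.
Proof.
move=> [lin _ _ rank]; elim: s => [|p s ih].
  (* The empty sum as [-1 * T + T], so that linearity of [iK] on compact operators gives the value
     0. *)
  have E : TS [::] = (fun f => -1 *: TS [::] f + TS [::] f).
    by apply/funext => h; rewrite /TS big_nil scaler0 addr0.
  by rewrite E lin ?big_nil; [rewrite scaleN1r addNr|exact: TS_compact..].
have -> : TS (p :: s) = fun h => 1 *: theta (toX p.1) (toX (cfconj p.2)) h + TS s h.
  by apply/funext => h; rewrite /TS big_cons scale1r.
rewrite lin; [|exact: theta_compact hR hB _ _|exact: TS_compact].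
rewrite scale1r ih rank big_cons !rep_SE !toXK; congr (_ + _).
rewrite cstarM -rep_iconj !cmulA; congr (_ ** ci _).
by apply: A_ext => x; rewrite !cfconjE conjCK.
Qed.

Fact ci_cov' a : (forall x : J, bri D x != 1%N -> \forall z \near x, a z = 0) ->
  exists s : seq (A * A), ci a = \sum_(p <- s) ci p.1 ** cS ** cS^s ** ci p.2 /\
    forall (xi : J -> C) x, a x * xi x =
      \sum_(p <- s) p.1 x * tr (fib D) (bri D) (fun z => p.2 z * xi z) (R x).
Proof.
move=> ha; have [s hs] := covariance_decomposition (@julia_compact K P Q) hinj ha.
exists s; split => //; have [iK hiK cov] := rep_covariant r.
have E : lact a = TS s.
  apply/funext => h; apply: (@toX_eq _ _ _ D hR) => x.
  rewrite lactE (hs (toJ h)) toJE /TS cf_sumE; apply: eq_bigr => p _.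
  rewrite -(toJE hR) thetaE toXK; congr (_ * _); rewrite [RHS](innerE hR hB).
  by apply: tr_ext => z; rewrite toXK cfconjE conjCK.
rewrite cov ?E; first exact: iK_TS.
by rewrite /covariance_ideal /= E; exact: TS_compact.
Qed.

Section Gauge.
Variables (w : C) (w1 : `|w| = 1).

Let ww : w^* * w = 1.
Proof. by rewrite -normCKC w1 expr1n. Qed.

Let wS : {linear X -> O} := w \*: rep_S r.

Let wSE f : wS f = w *: rep_S r f. Proof. by []. Qed.

Fact wS_lact a f : cmul (ci a) (wS f) = wS (lact a f).
Proof. by rewrite !wSE cmulZr rep_lact. Qed.

Fact wS_ract f a : cmul (wS f) (ci a) = wS (ract f a).
Proof. by rewrite !wSE cmulZl rep_ract. Qed.

Fact wS_inner f g : cmul (cstar (wS f)) (wS g) = ci (inner f g).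
Proof. by rewrite !wSE cstarZ cmulZl cmulZr scalerA ww scale1r rep_inner. Qed.

Fact wS_cov : exists2 iK, is_iK wS iK & forall a, covariance_ideal a -> ci a = iK (lact a).
Proof.
have [iK [h1 h2 h3 h4] cov] := rep_covariant r; exists iK => //; split=> // f g.
by rewrite h4 !wSE cstarZ cmulZl cmulZr scalerA mulrC ww scale1r.
Qed.

(** The same [iK] serves for [w S], because [w] cancels against its conjugate in [S f (S g)^*]. The
    universal property then returns the gauge automorphism. *)
Definition gauge_rep : cuntz_pimsner_rep P Q O :=
  @CuntzPimsnerRep K P Q O ci wS (rep_iM r) (rep_iconj r) wS_lact wS_ract wS_inner wS_cov.

End Gauge.

Fact ci_gauge' (w : C) : `|w| = 1 -> exists g : {linear O -> O},
  [/\ forall x y, g (x ** y) = g x ** g y, forall x, g x^s = (g x)^s,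
      forall a, g (ci a) = ci a & g cS = w *: cS].
Proof.
move=> w1; have [g [g1 g2 g3 g4]] := univ (gauge_rep w1).
by exists g; split => //; exact: g4.
Qed.

Fact ci_neq0' : exists x : O, x != 0.
Proof.
have [psi [_ _ hi _]] := univ (julia_rep hR hB).
exists (ci (cf1 K J)); apply: contra (julia_rep_cf1 hR hB) => /eqP h.
by rewrite -hi h raddf0.
Qed.

Definition julia_covrep : covrep D O :=
  @CovRep K J D O ci cS (rep_iM r) (rep_iconj r) ci1_S' cS_ci' cS_tr' ci_cov'
    rep_gen ci_gauge' ci_neq0'.

End Covrep.

Theorem theorem3p8 (K : realType) (P Q : {poly Cplx K})
  (hPQ : coprimep P Q) (hdeg : (2 <= rat_degree P Q)%N)
  (O : cstarAlgType (Cplx K)) (hO : is_cuntz_pimsner_algebra P Q O) :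
  simple_cstar O /\ purely_infinite O.
Proof.
have [r [gen univ]] := hO; have [D [dE _ bE]] := julia_dynamics hPQ hdeg.
have hR x : \val (dmap D x) = rat_map P Q (\val x) by rewrite dE.
have hB x : bri D x = branch_index P Q (\val x) by rewrite bE.
have hinj x : bri D x = 1%N -> exists2 U : set (julia_set P Q), nbhs x U &
    forall z1 z2, U z1 -> U z2 -> dmap D z1 = dmap D z2 -> z1 = z2.
  by rewrite dE bE; exact: jmap_local_inj.
have cr := julia_covrep hR hB hinj gen univ.
by split; [exact: simple_covrep cr|exact: purely_infinite_covrep cr].
Qed.
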